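(* Let $1\le d<n$ and let $M$ be a real analytic generic submanifold of $\mathbb{C}^n$ of codimension $d$ belonging to the family $\mathcal{T}_n^d$, defined in a neighborhood of the origin, in holomorphic coordinates $(z,w)=(x+iy,u+iv)\in\mathbb{C}^{n-d}\times\mathbb{C}^d$ centered at the origin, by the equations $$v_1=\varphi_1(y),\ \dots,\ v_d=\varphi_d(y),$$ where $\varphi_1,\dots,\varphi_d$ are real analytic functions vanishing at $0\in\mathbb{R}^{n-d}$; in particular $M$ is minimal and finitely nondegenerate at $0$. Let $\beta^1,\dots,\beta^{n-d}\in\mathbb{N}^{n-d}$ be multiindices of positive length and $1\le k_1,\dots,k_{n-d}\le d$ integers such that the real map $$\psi(y):=\left(\frac{\partial^{|\beta^1|}\varphi_{k_1}(y)}{\partial y^{\beta^1}},\ \dots,\ \frac{\partial^{|\beta^{n-d}|}\varphi_{k_{n-d}}(y)}{\partial y^{\beta^{n-d}}}\right)$$ has rank $n-d$ at the origin of $\mathbb{R}^{n-d}$ (such multiindices and integers exist by finite nondegeneracy), and let $y'\mapsto(\psi'_1(y'),\dots,\psi'_{n-d}(y'))$ denote the (local) inverse map of $\psi$. If $M$ is locally algebraizable at the origin, then all the partial derivatives $$\frac{\partial\psi'_j}{\partial y'_l},\qquad 1\le j,l\le n-d,$$ are real algebraic functions.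
   Context: Algebraicity. ''Algebraic'' is meant in the sense of Nash: a real (resp. complex) analytic function is algebraic if it satisfies a nontrivial polynomial equation with polynomial coefficients in its variables. A real analytic submanifold of $\mathbb{C}^n\cong\mathbb{R}^{2n}$ is algebraic if it is locally defined by the vanishing of real polynomials (in the Nash sense). It is locally algebraizable at one of its points $p$ if there is a system of local holomorphic coordinates centered at $p$ in which it is algebraic. Setting. Let $M$ be a local real analytic submanifold of codimension $d$ in $\mathbb{C}^n$ through the origin, defined by $r_k(t,\bar t)=0$, $k=1,\dots,d$, with $t=(t_1,\dots,t_n)\in\mathbb{C}^n$, where $r_k(t,\bar t)\in\mathbb{C}\{t,\bar t\}$ are convergent power series with $r_k(0,0)=0$, $r_k(t,\bar t)\equiv\overline{r_k(t,\bar t)}$ and $dr_1\wedge\cdots\wedge dr_d(0)\neq 0$. - $M$ is generic if $T_0M+iT_0M=T_0\mathbb{C}^n$. In that case $T^{(0,1)}M=(\mathbb{C}\otimes TM)\cap T^{(0,1)}\mathbb{C}^n$ is (near $0$) a complex vector bundle over $M$ of rank $n-d$; let $\overline{L}_1,\dots,\overline{L}_{n-d}$ be a basis (local frame) of it. - $M$ is minimal at $0$ if the orbit (in the sense of Sussmann) of the origin under the vector fields $\mathrm{Re}\,\overline{L}_1,\mathrm{Im}\,\overline{L}_1,\dots,\mathrm{Re}\,\overline{L}_{n-d},\mathrm{Im}\,\overline{L}_{n-d}$ contains a neighborhood of the origin in $M$. - $M$ is finitely nondegenerate at $p\in M$ if $\mathrm{Span}_{\mathbb{C}}\{\overline{L}^{\beta}\,\nabla_t(r_k)(p,\bar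 p):\beta\in\mathbb{N}^{n-d},\ k=1,\dots,d\}=\mathbb{C}^n$, where $\nabla_t(r_k)(t,\bar t)$ is the holomorphic gradient of $r_k$ and $\overline{L}^{\beta}=(\overline{L}_1)^{\beta_1}\cdots(\overline{L}_{n-d})^{\beta_{n-d}}$. For $M$ given by $v_k=\varphi_k(y)$, $k=1,\dots,d$, finite nondegeneracy at $0$ is equivalent to the existence of multiindices $\beta^1,\dots,\beta^{n-d}$ of positive length and integers $k_1,\dots,k_{n-d}\in\{1,\dots,d\}$ for which the map $\psi$ of the statement has rank $n-d$ at $0$. The family $\mathcal{T}_n^d$. It is the family of real analytic generic submanifolds $M$ of $\mathbb{C}^n$, defined in a neighborhood of the origin, of codimension $d$, minimal and finitely nondegenerate at $0$, whose local Lie (pseudo)group $G_M$ of local biholomorphisms of $\mathbb{C}^n$ (defined on a sufficiently small polydisc centered at $0$, close to the identity) stabilizing $M$ is commutative of real dimension $n$. At the Lie algebra level: the real Lie algebra of infinitesimal automorphisms of $M$, i.e. of holomorphic $(1,0)$ vector fields $X$ near $0$ whose real part is tangent to $M$, is commutative of dimension $n$. For $M$ in $\mathcal{T}_n^d$ given by $v_k=\varphi_k(y)$ as in the statement, this Lie algebra is generated over $\mathbb{R}$ by the $n$ coordinate fields $\partial/\partial z_j$ and $\partial/\partial w_k$. *)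

(* Defs.v *)
From HB Require Import structures.
From mathcomp Require Import all_boot all_order all_algebra.
From mathcomp Require Import all_classical all_reals all_analysis.
From mathcomp Require Import complex.
From mathcomp Require Import (canonicals) mpoly.

Set Implicit Arguments.
Unset Strict Implicit.
Unset Printing Implicit Defensive.

Import Order.TTheory GRing.Theory Num.Theory.
Import numFieldNormedType.Exports.

Local Open Scope classical_set_scope.
Local Open Scope ring_scope.

(* [R[i]] packed as a [numClosedFieldType], so that the topology which the
   library puts on every [numFieldType] is inferred on it. *)
Definition Cx (R : realType) : numClosedFieldType := R[i].

Definition re (R : realType) (z : Cx R) : R := complex.Re z.
Definition im (R : realType) (z : Cx R) : R := complex.Im z.
Definition cofr (R : realType) (x : R) : Cx R := real_complex R x.
Definition cplx (R : realType) (x y : R) : Cx R := Complex x y.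

(* Partial sum of \sum_alpha c_alpha (x - a)^alpha over the box alpha_i < k. *)
Definition power_sum (K : numFieldType) (n : nat)
    (c : {ffun 'I_n -> nat} -> K) (a x : 'rV[K]_n) (k : nat) : K :=
  \sum_(alpha : {ffun 'I_n -> 'I_k})
    c [ffun i => nat_of_ord (alpha i)] * \prod_i (x 0 i - a 0 i) ^+ alpha i.

Definition eval_at (K : numFieldType) (n : nat)
    (P : {poly (mpoly.mpoly n K)}) (x : 'rV[K]_n) : {poly K} :=
  map_poly (mpoly.meval (fun i => x 0 i)) P.

(* Analyticity at [a] over any [numFieldType]: real analyticity for K real,
   holomorphy for K = C.  The geometric bound on the coefficients makes the
   power series absolutely convergent near [a], so that the choice
   of partial sums is immaterial. *)
Definition analytic_at (K : numFieldType) (n : nat) (f : 'rV[K]_n -> K)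
    (a : 'rV[K]_n) : Prop :=
  exists (c : {ffun 'I_n -> nat} -> K) (e B : K),
    [/\ 0 < e,
        (forall alpha : {ffun 'I_n -> nat},
           `|c alpha| * e ^+ (\sum_i alpha i)%N <= B) &
        \forall x \near a,
          power_sum c a x @ \oo --> f x].

(* Nash functions: the polynomial P, in one variable over the ring of
   polynomials in x, is nontrivial and P(x, f(x)) = 0 near [a]. *)
Definition algebraic_at (K : numFieldType) (n : nat) (f : 'rV[K]_n -> K)
    (a : 'rV[K]_n) : Prop :=
  analytic_at f a /\
  exists P : {poly (mpoly.mpoly n K)},
    P != 0 /\
    \forall x \near a, (eval_at P x).[f x] = 0.

Definition pderiv (R : realType) (m : nat) (i : 'I_m) (f : 'rV[R]_m -> R) :
    'rV[R]_m -> R :=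
  fun y => 'D_(delta_mx 0 i) f y.

Definition pderiv_multi (R : realType) (m : nat) (beta : {ffun 'I_m -> nat})
    (f : 'rV[R]_m -> R) : 'rV[R]_m -> R :=
  foldr (fun i g => iter (beta i) (pderiv i) g) f (enum 'I_m).

(* C^N is identified with R^(2N) by t |-> (Re t, Im t). *)
Definition to_real (R : realType) (N : nat) (t : 'rV[Cx R]_N) : 'rV[R]_(N + N) :=
  row_mx (map_mx (@re R) t) (map_mx (@im R) t).

Definition of_real (R : realType) (N : nat) (u : 'rV[R]_(N + N)) : 'rV[Cx R]_N :=
  \row_j cplx (u 0 (lshift N j)) (u 0 (rshift N j)).

Definition real_analytic_at (R : realType) (N : nat) (f : 'rV[Cx R]_N -> R)
    (p : 'rV[Cx R]_N) : Prop :=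
  analytic_at (f \o @of_real R N) (to_real p).

Definition real_algebraic_at (R : realType) (N : nat) (f : 'rV[Cx R]_N -> R)
    (p : 'rV[Cx R]_N) : Prop :=
  algebraic_at (f \o @of_real R N) (to_real p).

Definition holomorphic_map_at (R : realType) (N : nat)
    (F : 'rV[Cx R]_N -> 'rV[Cx R]_N) (p : 'rV[Cx R]_N) : Prop :=
  forall j, analytic_at (fun t => F t 0 j) p.

(* Tangent vectors of R^(2N) are written as v in C^N, standing for
   \sum_j (v_j d/dt_j + conj v_j d/dconj t_j); [rdiff f t v] is df(t)(v). *)
Definition rdiff (R : realType) (N : nat) (f : 'rV[Cx R]_N -> R)
    (t v : 'rV[Cx R]_N) : R :=
  derive1 (fun s : R => f (t + cofr s *: v)) 0.

Definition rdiffC (R : realType) (N : nat) (f : 'rV[Cx R]_N -> Cx R)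
    (t v : 'rV[Cx R]_N) : Cx R :=
  cplx (rdiff (fun t => re (f t)) t v) (rdiff (fun t => im (f t)) t v).

(* d/dt_j = (d/dx_j - i d/dy_j)/2 and d/dconj t_j = (d/dx_j + i d/dy_j)/2. *)
Definition dt (R : realType) (N : nat) (j : 'I_N) (f : 'rV[Cx R]_N -> Cx R) :
    'rV[Cx R]_N -> Cx R :=
  fun t => (rdiffC f t (delta_mx 0 j) - 'i * rdiffC f t ('i *: delta_mx 0 j)) / 2.

Definition dtbar (R : realType) (N : nat) (j : 'I_N) (f : 'rV[Cx R]_N -> Cx R) :
    'rV[Cx R]_N -> Cx R :=
  fun t => (rdiffC f t (delta_mx 0 j) + 'i * rdiffC f t ('i *: delta_mx 0 j)) / 2.

Definition zeros (R : realType) (N d : nat) (r : 'I_d -> 'rV[Cx R]_N -> R) :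
    set 'rV[Cx R]_N :=
  [set t | forall k, r k t = 0].

(* [r] defines a real analytic submanifold of codimension d through 0; the last
   clause is dr_1 /\ ... /\ dr_d (0) <> 0. *)
Definition defining_functions (R : realType) (N d : nat)
    (r : 'I_d -> 'rV[Cx R]_N -> R) : Prop :=
  [/\ forall k, real_analytic_at (r k) 0,
      forall k, r k 0 = 0 &
      forall c : 'I_d -> R,
        (forall v, \sum_k c k * rdiff (r k) 0 v = 0) -> forall k, c k = 0].

Definition tangent_space (R : realType) (N d : nat)
    (r : 'I_d -> 'rV[Cx R]_N -> R) (p : 'rV[Cx R]_N) : set 'rV[Cx R]_N :=
  [set v | forall k, rdiff (r k) p v = 0].

Definition generic (R : realType) (N d : nat)
    (r : 'I_d -> 'rV[Cx R]_N -> R) : Prop :=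
  forall v : 'rV[Cx R]_N, exists a b,
    [/\ tangent_space r 0 a, tangent_space r 0 b & v = a + 'i *: b].

(* The rows of [A t] are the coefficients of Lbar_1, ..., Lbar_m on
   d/dconj t_1, ..., d/dconj t_(m+d).  The coefficients live on a neighborhood U
   of 0 in C^(m+d), but they are a basis of T^(0,1)M only at the points of M. *)
Definition CR_frame (R : realType) (m d : nat)
    (r : 'I_d -> 'rV[Cx R]_(m + d) -> R) (U : set 'rV[Cx R]_(m + d))
    (A : 'rV[Cx R]_(m + d) -> 'M[Cx R]_(m, m + d)) : Prop :=
  [/\ open_nbhs (0 : 'rV[Cx R]_(m + d)) U,
      (forall t, U t -> forall k, real_analytic_at (r k) t),
      (forall t, U t -> forall i j,
         real_analytic_at (fun t => re (A t i j)) t /\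
         real_analytic_at (fun t => im (A t i j)) t) &
      forall t, U t -> zeros r t ->
        row_free (A t) /\
        forall b : 'rV[Cx R]_(m + d),
          (b <= A t)%MS <->
          (forall k, \sum_j b 0 j * dtbar j (fun t => cofr (r k t)) t = 0)].

Definition Lbar (R : realType) (m d : nat)
    (A : 'rV[Cx R]_(m + d) -> 'M[Cx R]_(m, m + d)) (i : 'I_m)
    (f : 'rV[Cx R]_(m + d) -> Cx R) : 'rV[Cx R]_(m + d) -> Cx R :=
  fun t => \sum_j A t i j * dtbar j f t.

Definition Lbar_multi (R : realType) (m d : nat)
    (A : 'rV[Cx R]_(m + d) -> 'M[Cx R]_(m, m + d)) (beta : {ffun 'I_m -> nat})
    (f : 'rV[Cx R]_(m + d) -> Cx R) : 'rV[Cx R]_(m + d) -> Cx R :=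
  foldr (fun i g => iter (beta i) (Lbar A i) g) f (enum 'I_m).

(* Lbar^beta applied to the holomorphic gradient of r_k, at 0. *)
Definition Lbar_gradient (R : realType) (m d : nat)
    (r : 'I_d -> 'rV[Cx R]_(m + d) -> R)
    (A : 'rV[Cx R]_(m + d) -> 'M[Cx R]_(m, m + d))
    (beta : {ffun 'I_m -> nat}) (k : 'I_d) : 'rV[Cx R]_(m + d) :=
  \row_j Lbar_multi A beta (dt j (fun t => cofr (r k t))) 0.

Definition finitely_nondegenerate (R : realType) (m d : nat)
    (r : 'I_d -> 'rV[Cx R]_(m + d) -> R) : Prop :=
  exists U A, CR_frame r U A /\
    forall v : 'rV[Cx R]_(m + d),
      exists s : seq (Cx R * ({ffun 'I_m -> nat} * 'I_d)),
        v = \sum_(q <- s) q.1 *: Lbar_gradient r A q.2.1 q.2.2.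

(* Sussmann orbit of 0 in S under a family of vector fields.  Each step follows
   an integral curve contained in S; s1 and s2 are in arbitrary order, so
   the flow is used in both directions. *)
Inductive orbit (R : realType) (N : nat) (S : set 'rV[Cx R]_N)
    (V : set ('rV[Cx R]_N -> 'rV[Cx R]_N)) : 'rV[Cx R]_N -> Prop :=
| orbit_origin : orbit S V 0
| orbit_flow (X : 'rV[Cx R]_N -> 'rV[Cx R]_N) (gamma : R -> 'rV[Cx R]_N)
    (a b s1 s2 : R) :
    V X ->
    (forall s, a < s < b ->
       S (gamma s) /\
       forall j,
         is_derive s 1 (fun s => re (gamma s 0 j)) (re (X (gamma s) 0 j)) /\
         is_derive s 1 (fun s => im (gamma s 0 j)) (im (X (gamma s) 0 j))) ->
    a < s1 < b -> a < s2 < b ->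
    orbit S V (gamma s1) -> orbit S V (gamma s2).

(* For Lbar = \sum_j a_j d/dconj t_j, the real fields Re Lbar = (L + Lbar)/2 and
   Im Lbar = (Lbar - L)/(2i) are conj a / 2 and i conj a / 2 as vectors of C^N. *)
Definition Re_Lbar (R : realType) (m d : nat)
    (A : 'rV[Cx R]_(m + d) -> 'M[Cx R]_(m, m + d)) (i : 'I_m) :
    'rV[Cx R]_(m + d) -> 'rV[Cx R]_(m + d) :=
  fun t => \row_j ((A t i j)^* / 2).

Definition Im_Lbar (R : realType) (m d : nat)
    (A : 'rV[Cx R]_(m + d) -> 'M[Cx R]_(m, m + d)) (i : 'I_m) :
    'rV[Cx R]_(m + d) -> 'rV[Cx R]_(m + d) :=
  fun t => \row_j ('i * (A t i j)^* / 2).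

(* By analyticity (Nagano) the condition depends neither on the frame nor on
   the neighborhood U on which the orbit is taken. *)
Definition minimal (R : realType) (m d : nat)
    (r : 'I_d -> 'rV[Cx R]_(m + d) -> R) : Prop :=
  exists U A, CR_frame r U A /\
    \forall t \near (0 : 'rV[Cx R]_(m + d)), zeros r t ->
      orbit (U `&` zeros r)
        [set X | exists i, X = Re_Lbar A i \/ X = Im_Lbar A i] t.

(* X stands for the holomorphic field \sum_j X_j d/dt_j; its real part, as
   a vector of C^N, is X/2, and the factor 1/2 is irrelevant to tangency. *)
Definition inf_automorphism (R : realType) (N d : nat)
    (r : 'I_d -> 'rV[Cx R]_N -> R) (X : 'rV[Cx R]_N -> 'rV[Cx R]_N) : Prop :=
  holomorphic_map_at X 0 /\
  \forall t \near (0 : 'rV[Cx R]_N), zeros r t -> tangent_space r t (X t).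

Definition lie_bracket (R : realType) (N : nat)
    (X Y : 'rV[Cx R]_N -> 'rV[Cx R]_N) : 'rV[Cx R]_N -> 'rV[Cx R]_N :=
  fun t => 'D_(X t) Y t - 'D_(Y t) X t.

(* Vector fields are compared as germs at 0; the dimension is over the reals. *)
Definition hol_abelian_of_dim (R : realType) (N d : nat)
    (r : 'I_d -> 'rV[Cx R]_N -> R) (n : nat) : Prop :=
  (forall X Y, inf_automorphism r X -> inf_automorphism r Y ->
     \forall t \near (0 : 'rV[Cx R]_N), lie_bracket X Y t = 0) /\
  exists B : 'I_n -> 'rV[Cx R]_N -> 'rV[Cx R]_N,
    [/\ forall i, inf_automorphism r (B i),
        (forall c : 'I_n -> R,
           (\forall t \near (0 : 'rV[Cx R]_N), \sum_i cofr (c i) *: B i t = 0) ->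
           forall i, c i = 0) &
        forall X, inf_automorphism r X -> exists c : 'I_n -> R,
          \forall t \near (0 : 'rV[Cx R]_N), X t = \sum_i cofr (c i) *: B i t].

(* The family T_n^d, with n = m + d, for the submanifold {r = 0}. *)
Definition family_T (R : realType) (m d : nat)
    (r : 'I_d -> 'rV[Cx R]_(m + d) -> R) : Prop :=
  [/\ defining_functions r, generic r, minimal r, finitely_nondegenerate r &
      hol_abelian_of_dim r (m + d)].

Definition local_biholomorphism (R : realType) (N : nat)
    (Phi : 'rV[Cx R]_N -> 'rV[Cx R]_N) : Prop :=
  [/\ holomorphic_map_at Phi 0, Phi 0 = 0 &
      exists Psi : 'rV[Cx R]_N -> 'rV[Cx R]_N,
        [/\ holomorphic_map_at Psi 0,
            \forall t \near (0 : 'rV[Cx R]_N), Psi (Phi t) = t &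
            \forall t \near (0 : 'rV[Cx R]_N), Phi (Psi t) = t]].

(* In the coordinates t' = Phi(t) centered at 0, {r = 0} is defined near 0 by
   real algebraic functions with independent differentials. *)
Definition locally_algebraizable (R : realType) (N d : nat)
    (r : 'I_d -> 'rV[Cx R]_N -> R) : Prop :=
  exists (Phi : 'rV[Cx R]_N -> 'rV[Cx R]_N) (r' : 'I_d -> 'rV[Cx R]_N -> R),
    [/\ local_biholomorphism Phi, defining_functions r',
        forall k, real_algebraic_at (r' k) 0 &
        \forall t \near (0 : 'rV[Cx R]_N), zeros r t <-> zeros r' (Phi t)].

(* The equations v_k = phi_k(y), with t = (z, w), y = Im z, v = Im w. *)
Definition tube (R : realType) (m d : nat) (phi : 'I_d -> 'rV[R]_m -> R) :
    'I_d -> 'rV[Cx R]_(m + d) -> R :=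
  fun k t => im (t 0 (rshift m k)) - phi k (map_mx (@im R) (lsubmx t)).

Definition psi_map (R : realType) (m d : nat) (phi : 'I_d -> 'rV[R]_m -> R)
    (beta : 'I_m -> {ffun 'I_m -> nat}) (kappa : 'I_m -> 'I_d) :
    'rV[R]_m -> 'rV[R]_m :=
  fun y => \row_j pderiv_multi (beta j) (phi (kappa j)) y.

Definition local_inverse (R : realType) (m : nat)
    (f g : 'rV[R]_m -> 'rV[R]_m) (a : 'rV[R]_m) : Prop :=
  (\forall y \near a, g (f y) = y) /\ (\forall y' \near f a, f (g y') = y').

(* Main.v *)
(** Complexified, and after the rescaling [phi := 2i phi (./2i)], the tube reads
    [w - omega = phi (z - zeta)] in the variables [(z, w, zeta, omega)], and it is
    invariant under translations.  In the algebraizing coordinates [t' = Ph t],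
    [tau' = Pt tau] it is the zero set of a Nash map [rho], and the translations become
    the fields [X_a], [Y_a] with [d rho (X_a, Y_a) = 0] on [rho = 0]
    (here [X_a (t')] depends on [t'] only and [Y_a (tau')] on [tau'] only).
    Differentiating this identity along a Segre variety and using
    nondegeneracy, one sees that all the derivatives of [X_a] are Nash along a map
    [t' = g s] as soon as all those of [Y_a] are Nash along a map [tau' = h s] with
    [rho (g s, h s) = 0], and conversely.  Iterating along Segre varieties, one reaches
    such a [g] with invertible differential at [0], because minimality makes the vectors
    [(v, d phi_x v)] span; hence the [X_a] are Nash.  As [X = d Ph o Ps], the
    differential of [Ps] is Nash.  Restricting [Ps] to the Segre variety of [0], which is
    the graph of [phi], gives a map [eta] with Nash differential such that all
    derivatives of positive order of [phi] are Nash along [eta].  So [psi o eta] is Nash,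
    and [d psi' = d eta o (d (psi o eta))^-1] is Nash along [psi o eta], whose inverse is
    Nash. *)

From HB Require Import structures.
Require Import Defs.
From mathcomp Require Import all_boot all_order all_algebra.
From mathcomp Require Import all_classical all_reals all_analysis.
From mathcomp Require Import ring lra zify.
From mathcomp Require Import complex.
From mathcomp Require Import (canonicals, coercions) mpoly.
From mathcomp Require ssrcomplements.

Set Implicit Arguments.
Unset Strict Implicit.
Unset Printing Implicit Defensive.

Import Order.TTheory GRing.Theory Num.Theory.
Import numFieldNormedType.Exports.

Local Open Scope classical_set_scope.
Local Open Scope ring_scope.

(** * Analytic functions *)

(** The fields [X_a], [Y_a] are at first only analytic. What passes from one to the other is the
    property of having Nash derivatives along a given Nash map. It is asked for all orders at once,
    because every passage differentiates the identity [d rho (X_a, Y_a) = 0] and so consumes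
    derivatives. It holds along the constant map 0, where each derivative is a constant; each
    passage to [tau'] and back adds one vector [(v, d phi_x v)] to the differential of the map.

    The conjugation that ties [tau] to [t] is forgotten: [Pt] is any biholomorphism, so the exchange
    of [t] and [tau] is a symmetry and one direction of the passage gives the other.

    The map [eta] is known to be Nash only through its differential, which is why the conclusion
    concerns the derivatives of [psi'] and not [psi'] itself.

    Holomorphic functions are limits of polynomials for a weighted l^1 norm of the coefficients, for
    which Cauchy estimates hold term by term. *)

Section ComplexModulus.
Variable R : realType.
Local Notation C := (Cx R).

(** The norm of [Cx R] has values in [Cx R], whose order is partial; with values in [R] the
    estimates fall to [lra] and [nra]. *)
Definition cabs (z : C) : R := complex.Re `|z|.

Lemma normE (z : C) : `|z| = cofr (cabs z).
Proof. by rewrite /cofr /cabs RRe_real // realE normr_ge0. Qed.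

Lemma cofr_le (x y : R) : (cofr x <= cofr y) = (x <= y).
Proof. by rewrite /cofr lecR. Qed.

Lemma cofr_lt (x y : R) : (cofr x < cofr y) = (x < y).
Proof. by rewrite /cofr ltcR. Qed.

Lemma cofr_inj : injective (@cofr R).
Proof. by move=> x y []. Qed.

Lemma cofrM (x y : R) : cofr (x * y) = cofr x * cofr y.
Proof. by rewrite /cofr rmorphM. Qed.

Lemma cofrD (x y : R) : cofr (x + y) = cofr x + cofr y.
Proof. by rewrite /cofr rmorphD. Qed.

Lemma cofrN (x : R) : cofr (- x) = - cofr x.
Proof. by rewrite /cofr rmorphN. Qed.

Lemma cofrX (x : R) k : cofr (x ^+ k) = cofr x ^+ k.
Proof. by rewrite /cofr rmorphXn. Qed.

Lemma cofr0 : cofr (0 : R) = 0. Proof. by rewrite /cofr rmorph0. Qed.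
Lemma cofr1 : cofr (1 : R) = 1. Proof. by rewrite /cofr rmorph1. Qed.

Lemma cofrB (x y : R) : cofr (x - y) = cofr x - cofr y.
Proof. by rewrite cofrD cofrN. Qed.

Lemma cofrV (x : R) : cofr x^-1 = (cofr x)^-1.
Proof. by rewrite /cofr fmorphV. Qed.

Lemma cabs_ge0 (z : C) : 0 <= cabs z.
Proof. by rewrite -cofr_le cofr0 -normE. Qed.

Lemma cabs0 : cabs (0 : C) = 0.
Proof. by apply: cofr_inj; rewrite -normE normr0 cofr0. Qed.

Lemma cabs1 : cabs (1 : C) = 1.
Proof. by apply: cofr_inj; rewrite -normE normr1 cofr1. Qed.

Lemma cabsM (x y : C) : cabs (x * y) = cabs x * cabs y.
Proof. by apply: cofr_inj; rewrite cofrM -!normE normrM. Qed.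

Lemma cabsX (x : C) k : cabs (x ^+ k) = cabs x ^+ k.
Proof. by apply: cofr_inj; rewrite cofrX -!normE normrX. Qed.

Lemma cabsN (x : C) : cabs (- x) = cabs x.
Proof. by apply: cofr_inj; rewrite -!normE normrN. Qed.

Lemma cabsBC (x y : C) : cabs (x - y) = cabs (y - x).
Proof. by rewrite -opprB cabsN. Qed.

Lemma cabsV (x : C) : cabs x^-1 = (cabs x)^-1.
Proof. by apply: cofr_inj; rewrite cofrV -!normE normfV. Qed.

Lemma cabsD (x y : C) : cabs (x + y) <= cabs x + cabs y.
Proof. by rewrite -cofr_le cofrD -!normE ler_normD. Qed.

Lemma cabsB (x y : C) : cabs (x - y) <= cabs x + cabs y.
Proof. by rewrite (le_trans (cabsD _ _)) // cabsN. Qed.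

Lemma cabs_eq0 (x : C) : (cabs x == 0) = (x == 0).
Proof.
apply/eqP/eqP => [h|->]; last exact: cabs0.
by apply/eqP; rewrite -normr_eq0 normE h cofr0.
Qed.

Lemma cabs_gt0 (x : C) : (0 < cabs x) = (x != 0).
Proof. by rewrite lt_def cabs_ge0 andbT cabs_eq0. Qed.

Lemma cabs_sum (I : Type) (r : seq I) (P : pred I) (F : I -> C) :
  cabs (\sum_(i <- r | P i) F i) <= \sum_(i <- r | P i) cabs (F i).
Proof.
apply: (big_ind2 (fun x y => cabs x <= y)) => //; first by rewrite cabs0.
by move=> x1 x2 y1 y2 h1 h2; apply: (le_trans (cabsD _ _)); apply: lerD.
Qed.

Lemma cabs_prod (I : Type) (r : seq I) (P : pred I) (F : I -> C) :
  cabs (\prod_(i <- r | P i) F i) = \prod_(i <- r | P i) cabs (F i).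
Proof. by apply: (big_morph _ cabsM cabs1). Qed.

Lemma cabs_cofr (x : R) : cabs (cofr x) = `|x|.
Proof.
have h (y : R) : 0 <= y -> cabs (cofr y) = y.
  by move=> y0; rewrite /cabs ger0_norm // -cofr0 cofr_le.
have [x0|x0] := leP 0 x; first by rewrite h // ger0_norm.
by rewrite -[x in LHS]opprK cofrN cabsN h ?ltr0_norm // oppr_ge0 ltW.
Qed.

Lemma cabs_nat n : cabs (n%:R : C) = n%:R.
Proof.
have -> : (n%:R : C) = cofr n%:R by rewrite /cofr rmorph_nat.
by rewrite cabs_cofr normr_nat.
Qed.

Lemma re_cabs (z : C) : `|re z| <= cabs z.
Proof.
rewrite -cofr_le -normE; exact: normc_ge_Re.
Qed.

Lemma cE (z : C) : z = cofr (re z) + 'i * cofr (im z).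
Proof. by rewrite {1}(complexE z). Qed.

Lemma cabs_i : cabs ('i : C) = 1.
Proof. by apply: cofr_inj; rewrite -normE normCi cofr1. Qed.

Lemma im_re (z : C) : im z = - re ('i * z).
Proof. by rewrite /re /im mulrC ReiNIm opprK. Qed.

Lemma im_cabs (z : C) : `|im z| <= cabs z.
Proof.
rewrite im_re normrN; apply: (le_trans (re_cabs _)).
by rewrite cabsM cabs_i mul1r.
Qed.

Lemma cabs_le_reim (z : C) : cabs z <= `|re z| + `|im z|.
Proof.
by rewrite {1}(cE z) (le_trans (cabsD _ _)) // cabsM cabs_i mul1r !cabs_cofr.
Qed.

Lemma reD (x y : C) : re (x + y) = re x + re y.
Proof. by case: x y => a b [c d]. Qed.
Lemma reN (x : C) : re (- x) = - re x.
Proof. by case: x. Qed.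
Lemma reB (x y : C) : re (x - y) = re x - re y.
Proof. by rewrite reD reN. Qed.
Lemma imD (x y : C) : im (x + y) = im x + im y.
Proof. by case: x y => a b [c d]. Qed.
Lemma imN (x : C) : im (- x) = - im x.
Proof. by case: x. Qed.
Lemma imB (x y : C) : im (x - y) = im x - im y.
Proof. by rewrite imD imN. Qed.
Lemma re_cofr (x : R) : re (cofr x) = x. Proof. by []. Qed.
Lemma im_cofr (x : R) : im (cofr x) = 0. Proof. by []. Qed.

Definition disc n (a : 'rV[C]_n) (e : R) : set 'rV[C]_n :=
  [set x | forall i, cabs (x 0 i - a 0 i) < e].

(** The radius of a ball of the library is a positive element of [Cx R], hence real and equal to
    [cofr (re e)]. *)
Lemma nbhs_disc n (a : 'rV[C]_n) (P : set 'rV[C]_n) :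
  nbhs a P <-> exists2 e : R, 0 < e & disc a e `<=` P.
Proof.
split.
  move=> /nbhs_ballP[e e0 h].
  have er : e = cofr (re e).
    by rewrite /cofr RRe_real // realE ltW.
  exists (re e); first by rewrite -cofr_lt cofr0 -er.
  move=> x xe; apply: h; split=> // i j.
  by rewrite ord1 -ball_normE /= er normE cofr_lt -cabsN opprB xe.
move=> [e e0 h]; apply/nbhs_ballP; exists (cofr e); first by rewrite /= -cofr0 cofr_lt.
move=> x [_ xe]; apply: h => i; have := xe 0 i.
by rewrite -ball_normE /= normE cofr_lt -cabsN opprB.
Qed.

End ComplexModulus.

(** * A weighted l^1 norm on polynomials *)

Section WeightedNorm.
Variable R : realType.
Local Notation C := (Cx R).
Local Notation MP n := (mpoly.mpoly n (Cx R)).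
Local Notation mco := mpoly.mcoeff.
Local Notation msupp := mpoly.msupp.
Local Notation mX := (mpoly.mpolyX (Cx R)).
Local Notation mdeg := mpoly.mdeg.
Local Notation msz p := (mpoly.mmeasure mpoly.mdeg p).

(** Preferred to the supremum on the polydisc because it is read off the coefficients: [mco_le],
    [wn_mderiv] and [wn_tail] are Cauchy estimates proved term by term. *)
Definition wn n (e : R) (p : MP n) : R :=
  \sum_(m <- msupp p) cabs (mco m p) * e ^+ mdeg m.

Lemma wnE n e (p : MP n) : wn e p = \sum_(m <- msupp p) cabs (mco m p) * e ^+ mdeg m.
Proof. by []. Qed.

(** A common finite index type lets polynomials with different supports be compared term by term. *)
Lemma wnwE n e k (p : MP n) : (msz p <= k)%N ->
  wn e p = \sum_(m : mpoly.bmultinom n k) cabs (mco m p) * e ^+ mdeg m.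
Proof.
move=> lt_pk; rewrite /wn (ssrcomplements.big_mksub (mpoly.bmultinom n k)) //=; first last.
- by move=> x /mpoly.msize_mdeg_lt /leq_trans; apply.
- by rewrite mpoly.msupp_uniq.
rewrite big_rmcond //= => i /mpoly.memN_msupp_eq0 ->.
by rewrite cabs0 mul0r.
Qed.

Lemma wn_ge0 n e (p : MP n) : 0 <= e -> 0 <= wn e p.
Proof. by move=> e0; apply: sumr_ge0 => m _; rewrite mulr_ge0 ?cabs_ge0 ?exprn_ge0. Qed.

Lemma wn_partial n (e : R) (p : MP n) (s : seq (mpoly.multinom n)) : 0 <= e -> uniq s ->
  \sum_(m <- s) cabs (mco m p) * e ^+ mdeg m <= wn e p.
Proof.
move=> e0 us; rewrite /wn (bigID (mem (msupp p))) /= [X in _ + X <= _]big1 ?addr0; last first.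
  by move=> m hm; rewrite mpoly.memN_msupp_eq0 // cabs0 mul0r.
rewrite [leRHS](bigID (mem s)) /= -big_filter -[X in _ <= X + _]big_filter.
rewrite (perm_big [seq m <- msupp p | m \in s]) /=; last first.
  apply: uniq_perm => [||m]; [exact: filter_uniq| |by rewrite !mem_filter andbC].
  by apply: filter_uniq; exact: mpoly.msupp_uniq.
by rewrite lerDl; apply: sumr_ge0 => m _; rewrite mulr_ge0 ?cabs_ge0 // exprn_ge0.
Qed.

Lemma wn0 n e : wn e (0 : MP n) = 0.
Proof. by rewrite /wn (mpoly.msupp0 n C) big_nil. Qed.

Lemma wnD n e (p q : MP n) : 0 <= e -> wn e (p + q) <= wn e p + wn e q.
Proof.
move=> e0; set k := maxn (msz p) (msz q).
rewrite (@wnwE n e k); last exact: mpoly.msizeD_le.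
rewrite (@wnwE n e k p) ?leq_maxl // (@wnwE n e k q) ?leq_maxr // -big_split /=.
apply: ler_sum => m _; rewrite mpoly.mcoeffD -mulrDl ler_wpM2r ?exprn_ge0 //.
exact: cabsD.
Qed.

Lemma wnZ n e c (p : MP n) : wn e (c *: p) = cabs c * wn e p.
Proof.
rewrite (@wnwE n e (msz p)); last exact: mpoly.msizeZ_le.
rewrite (@wnwE n e (msz p) p) // mulr_sumr; apply: eq_bigr => m _.
by rewrite mpoly.mcoeffZ cabsM mulrA.
Qed.

Lemma wnN n e (p : MP n) : wn e (- p) = wn e p.
Proof. by rewrite -scaleN1r wnZ cabsN cabs1 mul1r. Qed.

Lemma wnB n e (p q : MP n) : 0 <= e -> wn e (p - q) <= wn e p + wn e q.
Proof. by move=> e0; rewrite (le_trans (wnD _ _ e0)) // wnN. Qed.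

Lemma wnBC n e (p q : MP n) : wn e (p - q) = wn e (q - p).
Proof. by rewrite -opprB wnN. Qed.

Lemma wnX n e m : wn e (mX m : MP n) = e ^+ mdeg m.
Proof. by rewrite /wn mpoly.msuppX big_seq1 mpoly.mcoeffX eqxx cabs1 mul1r. Qed.

Lemma wnC n e c : wn e (mpoly.mpolyC n c : MP n) = cabs c.
Proof.
rewrite -(mpoly.alg_mpolyC n c) wnZ -mpoly.mpolyX0 wnX mpoly.mdeg0.
by rewrite expr0 mulr1.
Qed.

Lemma wn1 n e : wn e (1 : MP n) = 1.
Proof. by rewrite -mpoly.mpolyX0 wnX mpoly.mdeg0. Qed.

Lemma wn_sum n e (I : Type) (r : seq I) (P : pred I) (F : I -> MP n) : 0 <= e ->
  wn e (\sum_(i <- r | P i) F i) <= \sum_(i <- r | P i) wn e (F i).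
Proof.
move=> e0; apply: (big_ind2 (fun x y => wn e x <= y)) => //; first by rewrite wn0.
by move=> x1 x2 y1 y2 h1 h2; apply: (le_trans (wnD _ _ e0)); apply: lerD.
Qed.

Lemma wnM n e (p q : MP n) : 0 <= e -> wn e (p * q) <= wn e p * wn e q.
Proof.
move=> e0.
have step m : wn e (mX m * q) <= e ^+ mdeg m * wn e q.
  rewrite {1}(mpoly.mpolyE q) mulr_sumr (le_trans (wn_sum _ _ _ e0)) //.
  rewrite mulr_sumr; apply: ler_sum => m' _.
  by rewrite -scalerAr -mpoly.mpolyXD wnZ wnX mpoly.mdegD exprD mulrCA.
rewrite {1}(mpoly.mpolyE p) mulr_suml (le_trans (wn_sum _ _ _ e0)) //.
rewrite mulr_suml; apply: ler_sum => m' _.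
rewrite -scalerAl wnZ -mulrA ler_wpM2l ?cabs_ge0 //.
Qed.

Lemma wn_prod n e (I : Type) (r : seq I) (P : pred I) (F : I -> MP n) : 0 <= e ->
  wn e (\prod_(i <- r | P i) F i) <= \prod_(i <- r | P i) wn e (F i).
Proof.
move=> e0; apply: (big_ind2 (fun x y => wn e x <= y)) => //; first by rewrite wn1.
move=> x1 x2 y1 y2 h1 h2; apply: (le_trans (wnM _ _ e0)).
by apply: ler_pM; rewrite ?wn_ge0.
Qed.

Lemma wnXn n e (p : MP n) k : 0 <= e -> wn e (p ^+ k) <= wn e p ^+ k.
Proof.
move=> e0; have h := @wn_prod n e _ (index_enum 'I_k) xpredT (fun _ : 'I_k => p) e0.
by move: h; rewrite !prodr_const card_ord.
Qed.

Lemma wn_mono n e e' (p : MP n) : 0 <= e -> e <= e' -> wn e p <= wn e' p.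
Proof.
move=> e0 ee'; apply: ler_sum => m _; rewrite ler_wpM2l ?cabs_ge0 //.
by apply: lerXn2r => //; rewrite nnegrE (le_trans e0).
Qed.

(** Locked, and opaque after this section, to keep [meval] from unfolding. *)
Definition peval n (p : MP n) (x : 'rV[C]_n) : C := locked (mpoly.meval (fun i => x 0 i) p).

Lemma pevalE n (p : MP n) x : peval p x = mpoly.meval (fun i => x 0 i) p.
Proof. by rewrite /peval -lock. Qed.

Lemma pevalD n (p q : MP n) x : peval (p + q) x = peval p x + peval q x.
Proof. rewrite !pevalE; exact: rmorphD. Qed.
Lemma pevalB n (p q : MP n) x : peval (p - q) x = peval p x - peval q x.
Proof. rewrite !pevalE; exact: rmorphB. Qed.
Lemma pevalM n (p q : MP n) x : peval (p * q) x = peval p x * peval q x.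
Proof. rewrite !pevalE; exact: rmorphM. Qed.
Lemma pevalZ n c (p : MP n) x : peval (c *: p) x = c * peval p x.
Proof. rewrite !pevalE; exact: mpoly.mevalZ. Qed.
Lemma pevalC n c x : peval (mpoly.mpolyC n c) x = c.
Proof. rewrite !pevalE; exact: mpoly.mevalC. Qed.
Lemma peval0 n x : peval (0 : MP n) x = 0.
Proof. rewrite !pevalE; exact: rmorph0. Qed.
Lemma peval1 n x : peval (1 : MP n) x = 1.
Proof. rewrite !pevalE; exact: rmorph1. Qed.
Lemma pevalX n m x : peval (mX m : MP n) x = \prod_(i < n) x 0 i ^+ m i.
Proof. rewrite !pevalE; exact: mpoly.mevalX. Qed.
Lemma pevalXU n i x : peval (mX (mpoly.mnm1 i) : MP n) x = x 0 i.
Proof. rewrite !pevalE; exact: mpoly.mevalXU. Qed.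
Lemma peval_sum n (I : Type) (r : seq I) (P : pred I) (F : I -> MP n) x :
  peval (\sum_(i <- r | P i) F i) x = \sum_(i <- r | P i) peval (F i) x.
Proof. by rewrite pevalE rmorph_sum /=; apply: eq_bigr => i _; rewrite pevalE. Qed.

Lemma peval_le n e (p : MP n) (x : 'rV[C]_n) :
  (forall i, cabs (x 0 i) <= e) -> cabs (peval p x) <= wn e p.
Proof.
move=> xe; rewrite pevalE mpoly.mevalE (le_trans (cabs_sum _ _ _)) //.
apply: ler_sum => m _; rewrite cabsM ler_wpM2l ?cabs_ge0 // cabs_prod.
rewrite mpoly.mdegE -prodrXr; apply: ler_prod => i _.
rewrite cabs_ge0 cabsX /=; apply: lerXn2r; rewrite ?nnegrE ?cabs_ge0 //.
exact: le_trans (cabs_ge0 _) (xe i).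
Qed.

Definition pcomp n k (q : 'I_n -> MP k) (p : MP n) : MP k :=
  locked (mpoly.comp_mpoly (mktuple q) p).

Lemma pcomp_unlock n k (q : 'I_n -> MP k) (p : MP n) :
  pcomp q p = mpoly.comp_mpoly (mktuple q) p.
Proof. by rewrite /pcomp -lock. Qed.

Lemma pcompE n k (q : 'I_n -> MP k) (p : MP n) :
  pcomp q p = \sum_(m <- msupp p) mco m p *: \prod_(i < n) q i ^+ m i.
Proof.
rewrite pcomp_unlock mpoly.comp_mpolyE; apply: eq_bigr => m _; congr (_ *: _).
by apply: eq_bigr => i _; rewrite tnth_mktuple.
Qed.

Lemma pcompB n k (q : 'I_n -> MP k) (p p' : MP n) :
  pcomp q (p - p') = pcomp q p - pcomp q p'.
Proof. by rewrite (pcomp_unlock q (p - p')) mpoly.comp_mpolyB -!pcomp_unlock. Qed.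
Lemma pcompD n k (q : 'I_n -> MP k) (p p' : MP n) :
  pcomp q (p + p') = pcomp q p + pcomp q p'.
Proof. by rewrite (pcomp_unlock q (p + p')) mpoly.comp_mpolyD -!pcomp_unlock. Qed.

Lemma peval_comp n k (q : 'I_n -> MP k) (p : MP n) x :
  peval (pcomp q p) x = peval p (\row_i peval (q i) x).
Proof.
rewrite !pevalE pcomp_unlock mpoly.comp_mpoly_meval; apply: mpoly.meval_eq => i.
by rewrite tnth_mktuple mxE pevalE.
Qed.

Lemma wn_comp n k e r (q : 'I_n -> MP k) (p : MP n) : 0 <= e ->
  (forall i, wn e (q i) <= r) -> wn e (pcomp q p) <= wn r p.
Proof.
move=> e0 qr; rewrite pcompE (le_trans (wn_sum _ _ _ e0)) //; apply: ler_sum => m _.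
rewrite wnZ ler_wpM2l ?cabs_ge0 // (le_trans (wn_prod _ _ _ e0)) //.
rewrite mpoly.mdegE -prodrXr; apply: ler_prod => i _.
rewrite wn_ge0 //=; apply: (le_trans (wnXn _ _ e0)).
by apply: lerXn2r; rewrite ?nnegrE ?wn_ge0 // (le_trans _ (qr i)) ?wn_ge0.
Qed.

(** The derivative of [r ^+ k]; at [k = 0] the truncated exponent does not matter, the factor [k%:R]
    being 0. *)
Definition dpow (r : R) k : R := k%:R * r ^+ k.-1.

Lemma dpowD r k1 k2 : dpow r (k1 + k2) = dpow r k1 * r ^+ k2 + r ^+ k1 * dpow r k2.
Proof.
rewrite /dpow; case: k1 => [|k1]; first by rewrite add0n mul0r mul0r expr0 add0r mul1r.
case: k2 => [|k2]; first by rewrite addn0 expr0 mul0r mulr0 addr0 mulr1.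
have -> : ((k1.+1 + k2.+1).-1 = (k1 + k2).+1)%N by lia.
by rewrite natrD /= !exprS exprD; ring.
Qed.

Lemma dpow_ge0 r k : 0 <= r -> 0 <= dpow r k.
Proof. by move=> r0; rewrite mulr_ge0 ?exprn_ge0. Qed.

(** By convexity the chord of [x ^+ k] from [r] to [E] is at least as steep as the tangent at [r].
    This is how a derivative is paid for with a larger radius. *)
Lemma dpow_le r E k : 0 <= r -> r < E -> dpow r k <= (E - r)^-1 * E ^+ k.
Proof.
move=> r0 rE; have Er : 0 < E - r by rewrite subr_gt0.
rewrite ler_pdivlMl //.
suff : (E - r) * dpow r k <= E ^+ k - r ^+ k.
  by move/le_trans; apply; rewrite gerBl exprn_ge0.
elim: k => [|k IH]; first by rewrite /dpow mul0r mulr0 !expr0 subrr.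
have rk : 0 <= r ^+ k by rewrite exprn_ge0.
have -> : dpow r k.+1 = r * dpow r k + r ^+ k.
  by rewrite -addn1 dpowD [dpow r 1]/dpow /= expr0 expr1 !mulr1 mulrC.
have -> : E ^+ k.+1 - r ^+ k.+1 = E * (E ^+ k - r ^+ k) + (E - r) * r ^+ k.
  by rewrite !exprS; ring.
rewrite [leLHS]mulrDr lerD2r mulrCA; apply: ler_pM => //; last exact: ltW.
by rewrite mulr_ge0 ?dpow_ge0 ?(ltW Er).
Qed.

(** Telescoping: the Leibniz rule [dpowD] makes the bounds of the factors add up to the bound of the
    product. *)
Lemma wn_prodB n e r d (I : Type) (s : seq I) (a b : I -> MP n) (k : I -> nat) :
  0 <= e -> 0 <= r -> 0 <= d ->
  (forall i, [/\ wn e (a i) <= r ^+ k i, wn e (b i) <= r ^+ k i &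
     wn e (a i - b i) <= dpow r (k i) * d]) ->
  wn e (\prod_(i <- s) a i - \prod_(i <- s) b i) <= dpow r (\sum_(i <- s) k i) * d.
Proof.
move=> e0 r0 d0 h; elim: s => [|i s IH].
  by rewrite !big_nil subrr wn0 mulr_ge0 ?dpow_ge0.
rewrite !big_cons dpowD.
have -> : a i * \prod_(j <- s) a j - b i * \prod_(j <- s) b j =
  (a i - b i) * \prod_(j <- s) b j + a i * (\prod_(j <- s) a j - \prod_(j <- s) b j) by ring.
have [ha hb hab] := h i.
have hB : wn e (\prod_(j <- s) b j) <= r ^+ (\sum_(j <- s) k j).
  rewrite (le_trans (wn_prod _ _ _ e0)) // -prodrXr; apply: ler_prod => j _.
  by rewrite wn_ge0 //=; case: (h j).
apply: (le_trans (wnD _ _ e0)); rewrite [leRHS]mulrDl; apply: lerD.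
  apply: (le_trans (wnM _ _ e0)); rewrite mulrAC; apply: ler_pM; rewrite ?wn_ge0 //.
apply: (le_trans (wnM _ _ e0)); rewrite -mulrA; apply: ler_pM; rewrite ?wn_ge0 //.
Qed.

(** A monomial of degree [k] is Lipschitz with constant [dpow r k] on the ball of radius [r];
    [dpow_le] replaces this by a multiple of [E ^+ k], so that the sum over the monomials is again a
    norm of [p]. *)
Lemma wn_compB n k e r E d (q q' : 'I_n -> MP k) (p : MP n) :
  0 <= e -> 0 <= r -> r < E -> 0 <= d ->
  (forall i, wn e (q i) <= r) -> (forall i, wn e (q' i) <= r) ->
  (forall i, wn e (q i - q' i) <= d) ->
  wn e (pcomp q p - pcomp q' p) <= (E - r)^-1 * wn E p * d.
Proof.
move=> e0 r0 rE d0 h1 h2 h3.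
have Er : 0 < E - r by rewrite subr_gt0.
rewrite !pcompE -sumrB (le_trans (wn_sum _ _ _ e0)) //.
rewrite [X in _ <= _ * X * _]/wn mulr_sumr mulr_suml; apply: ler_sum => m _.
rewrite -scalerBr wnZ mulrCA -!mulrA ler_wpM2l ?cabs_ge0 //.
apply: (@le_trans _ _ (dpow r (mdeg m) * d)); last first.
  rewrite mulrA ler_wpM2r //; exact: dpow_le.
rewrite mpoly.mdegE; apply: wn_prodB => // i.
have pw (x : MP k) : wn e x <= r -> wn e (x ^+ m i) <= r ^+ m i.
  move=> xr; apply: (le_trans (wnXn _ _ e0)).
  by apply: lerXn2r; rewrite ?nnegrE ?wn_ge0.
split; [exact: pw|exact: pw|].
(* A power is a product of [m i] factors of weight 1, and [dpow r 1 = 1]. *)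
have h := @wn_prodB k e r d _ (index_enum 'I_(m i)) (fun=> q i) (fun=> q' i) (fun=> 1%N) e0 r0 d0.
move: h; rewrite !prodr_const !card_ord sum1_card card_ord; apply=> j.
by rewrite expr1 /dpow /= expr0 mulr1 mul1r.
Qed.

Lemma wn_mderiv n r E (p : MP n) i : 0 <= r -> r < E ->
  wn r (mpoly.mderiv i p) <= (E - r)^-1 * wn E p.
Proof.
move=> r0 rE; have Er : 0 < E - r by rewrite subr_gt0.
rewrite {1}(mpoly.mpolyE p) raddf_sum (le_trans (wn_sum _ _ _ r0)) //.
rewrite [X in _ <= _ * X]/wn mulr_sumr; apply: ler_sum => m _.
rewrite /= mpoly.mderivZ mpoly.mderivX !wnZ wnX [leRHS]mulrCA ler_wpM2l ?cabs_ge0 //.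
apply: le_trans (dpow_le (mdeg m) r0 rE); rewrite cabs_nat /dpow.
case: (posnP (m i)) => [->|mi]; first by rewrite mul0r mulr_ge0 ?exprn_ge0.
have le1 : (mpoly.lem (mpoly.mnm1 i) m) by rewrite mpoly.lep1mP -lt0n.
have hd : mdeg m = (mdeg (mpoly.mnm_sub m (mpoly.mnm1 i))).+1.
  by rewrite -{1}(mpoly.submK le1) mpoly.mdegD mpoly.mdeg1 addn1.
rewrite [X in _ * _ ^+ X]/mdeg hd /= ler_wpM2r ?exprn_ge0 // ler_nat -hd mpoly.mdegE.
by rewrite (bigD1 i) //= leq_addr.
Qed.

Definition hpart n k (p : MP n) : MP n :=
  \sum_(m <- msupp p | mdeg m == k) mco m p *: mX m.
Definition tail n k (p : MP n) : MP n :=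
  \sum_(m <- msupp p | (k <= mdeg m)%N) mco m p *: mX m.

Lemma tail0 n (p : MP n) : tail 0 p = p.
Proof. by rewrite [RHS]mpoly.mpolyE; apply: eq_bigl. Qed.

Lemma tailS n k (p : MP n) : tail k p = hpart k p + tail k.+1 p.
Proof.
rewrite /tail (bigID (fun m => mdeg m == k)) /=; congr (_ + _).
  by apply: eq_bigl => m; case: eqP => [->|]; rewrite ?leqnn ?andbF.
by apply: eq_bigl => m; rewrite ltn_neqAle andbC eq_sym.
Qed.

Lemma hpart_sum n k (p : MP n) : p = \sum_(j < k) hpart j p + tail k p.
Proof.
elim: k => [|k IH]; first by rewrite big_ord0 add0r tail0.
by rewrite {1}IH big_ord_recr /= -addrA -tailS.
Qed.

Lemma mco_sumX n (p : MP n) (P : pred (mpoly.multinom n)) m :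
  mco m (\sum_(k <- msupp p | P k) mco k p *: mX k) = if P m then mco m p else 0.
Proof.
rewrite raddf_sum /=.
rewrite (eq_bigr (fun k => if k == m then mco m p else 0)); last first.
  move=> k _; rewrite mpoly.mcoeffZ mpoly.mcoeffX.
  by case: eqP => [->|]; rewrite ?mulr1 ?mulr0.
rewrite -big_mkcondr /=.
case: ifP => Pm; last first.
  by rewrite big1 // => k /andP[Pk /eqP km]; rewrite -km Pk in Pm.
have [ms|ms] := boolP (m \in msupp p).
  rewrite big_mkcond (bigD1_seq m) ?mpoly.msupp_uniq //= Pm eqxx big1 ?addr0 //.
  by move=> k /negPf ->; rewrite andbF.
rewrite mpoly.memN_msupp_eq0 // big1 //.
Qed.

Lemma mco_hpart n k (p : MP n) m : mco m (hpart k p) = if mdeg m == k then mco m p else 0.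
Proof. exact: (mco_sumX p (fun m => mdeg m == k)). Qed.
Lemma mco_tail n k (p : MP n) m : mco m (tail k p) = if (k <= mdeg m)%N then mco m p else 0.
Proof. exact: (mco_sumX p (fun m => (k <= mdeg m)%N)). Qed.

Lemma tailB n k (p q : MP n) : tail k (p - q) = tail k p - tail k q.
Proof.
apply/mpoly.mpolyP => m; rewrite mpoly.mcoeffB !mco_tail mpoly.mcoeffB.
by case: ifP; rewrite ?subr0.
Qed.

Lemma hpart0 n (p : MP n) : hpart 0 p = mpoly.mpolyC n (mco mpoly.mnm0 p).
Proof.
apply/mpoly.mpolyP => m; rewrite mco_hpart mpoly.mcoeffC mpoly.mdeg_eq0.
by case: eqP => [->|]; rewrite ?mulr1 ?mulr0.
Qed.

Lemma hpart1 n (p : MP n) :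
  hpart 1 p = \sum_(i < n) mco (mpoly.mnm1 i) p *: mX (mpoly.mnm1 i).
Proof.
apply/mpoly.mpolyP => m; rewrite mco_hpart raddf_sum /=.
have [/mpoly.mdeg1P[i /eqP->]|hm] := boolP (mdeg m == 1%N).
  rewrite (bigD1 i) //= mpoly.mcoeffZ mpoly.mcoeffX eqxx mulr1 big1 ?addr0 // => j ji.
  by rewrite mpoly.mcoeffZ mpoly.mcoeffX mpoly.eq_mnm1 (negPf ji) mulr0.
rewrite big1 // => i _; rewrite mpoly.mcoeffZ mpoly.mcoeffX.
by case: eqP => [e|_]; rewrite ?mulr0 //; rewrite -e mpoly.mdeg1 in hm.
Qed.

Lemma wn_hpart n k e (p : MP n) : 0 <= e -> wn e (hpart k p) <= wn e p.
Proof.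
move=> e0; rewrite (le_trans (wn_sum _ _ _ e0)) // [leRHS](bigID (fun m => mdeg m == k)) /=.
rewrite -[leLHS]addr0; apply: lerD.
  by apply: ler_sum => m _; rewrite wnZ wnX.
by apply: sumr_ge0 => m _; rewrite mulr_ge0 ?cabs_ge0 ?exprn_ge0.
Qed.

(** As in the Schwarz lemma, terms of degree at least [k] gain [(r / E) ^+ k] when the radius
    shrinks. *)
Lemma wn_tail n k r E (p : MP n) : 0 <= r -> r <= E -> 0 < E ->
  wn r (tail k p) <= (r / E) ^+ k * wn E p.
Proof.
move=> r0 rE E0; have rE0 : 0 <= r / E by rewrite divr_ge0 // ltW.
rewrite (le_trans (wn_sum _ _ _ r0)) // [X in _ <= _ * X]/wn mulr_sumr [leRHS](bigID (fun m => (k <= mdeg m)%N)) /=.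
rewrite -[leLHS]addr0; apply: lerD; last first.
  by apply: sumr_ge0 => m _; rewrite !mulr_ge0 ?cabs_ge0 ?exprn_ge0 // ltW.
apply: ler_sum => m km; rewrite wnZ wnX mulrCA ler_wpM2l ?cabs_ge0 //.
have -> : r = (r / E) * E by rewrite divfK // gt_eqF.
rewrite mulfK ?gt_eqF // exprMn ler_wpM2r ?exprn_ge0 ?(ltW E0) //.
rewrite -(subnKC km) exprD ler_piMr ?exprn_ge0 // exprn_ile1 //.
by rewrite ler_pdivrMr // mul1r.
Qed.

Lemma peval_hpart n k (p : MP n) (t : C) x :
  peval (hpart k p) (t *: x) = t ^+ k * peval (hpart k p) x.
Proof.
rewrite /hpart !peval_sum mulr_sumr; apply: eq_bigr => m /eqP <-.
rewrite !pevalZ !pevalX mulrCA; congr (_ * _).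
rewrite mpoly.mdegE -prodrXr -big_split /=; apply: eq_bigr => i _.
by rewrite mxE exprMn.
Qed.

Lemma mco_le n e (p : MP n) m : 0 <= e -> cabs (mco m p) * e ^+ mdeg m <= wn e p.
Proof.
move=> e0; have [ms|ms] := boolP (m \in msupp p).
  rewrite /wn (bigD1_seq m) ?mpoly.msupp_uniq //= lerDl.
  by apply: sumr_ge0 => m' _; rewrite mulr_ge0 ?cabs_ge0 ?exprn_ge0.
by rewrite mpoly.memN_msupp_eq0 // cabs0 mul0r wn_ge0.
Qed.

End WeightedNorm.
#[global] Opaque pcomp peval wn.

(** * Null sequences and limits with a rate *)

Section NullSequences.
Variable R : realType.
Implicit Types u v : nat -> R.

Definition null u := u @ \oo --> (0 : R).

Lemma null0 : null (fun=> 0).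
Proof. exact: cvg_cst. Qed.

Lemma nullD u v : null u -> null v -> null (fun k => u k + v k).
Proof. by move=> hu hv; rewrite /null -[0 : R]addr0; apply: cvgD. Qed.

Lemma nullZ c u : null u -> null (fun k => c * u k).
Proof. by move=> hu; rewrite /null -(mulr0 c); apply: cvgM => //; exact: cvg_cst. Qed.

Lemma null_sum (I : finType) (u : I -> nat -> R) :
  (forall i, null (u i)) -> null (fun k => \sum_i u i k).
Proof.
move=> hu; elim: (index_enum I) => [|i s IH].
  by under eq_fun do rewrite big_nil; exact: null0.
by under eq_fun do rewrite big_cons; exact: nullD.
Qed.

Lemma nullP u : null u <-> forall e : R, 0 < e -> exists N, forall k, (N <= k)%N -> `|u k| < e.
Proof.
split=> [hu e e0|h].
  have /cvgr0Pnorm_lt/(_ _ e0)[N _ hN] := hu.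
  by exists N => k Nk; apply: hN.
by apply/cvgr0Pnorm_lt => e e0; have [N hN] := h e e0; exists N.
Qed.

Lemma null_le u v : (forall k, `|u k| <= v k) -> null v -> null u.
Proof.
move=> uv /nullP hv; apply/nullP => e e0; have [N hN] := hv e e0.
exists N => k /hN; apply: le_lt_trans; apply: (le_trans (uv k)); exact: ler_norm.
Qed.

Lemma null_lt u e : null u -> 0 < e -> exists N, forall k, (N <= k)%N -> u k < e.
Proof.
move=> /nullP h e0; have [N hN] := h e e0; exists N => k /hN.
by apply: le_lt_trans; exact: ler_norm.
Qed.

Lemma le_null x y u : null u -> (forall k, x <= y + u k) -> x <= y.
Proof.
move=> hu h; apply/ler_addgt0Pr => e e0; have [N hN] := null_lt hu e0.
by apply: (le_trans (h N)); rewrite lerD2l; apply/ltW/hN.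
Qed.

Lemma null_geo (x : R) : 0 <= x -> x < 1 -> null (fun k => x ^+ k).
Proof. by move=> x0 x1; apply: cvg_expr; rewrite ger0_norm. Qed.

(** The intervals of centre [x k] and radius [u k] meet two by two, so the supremum of their left
    ends lies in all of them. The limit comes with its rate. *)
Lemma squeezed_limit (x u : nat -> R) :
  (forall j k, `|x j - x k| <= u j + u k) -> exists l, forall k, `|x k - l| <= u k.
Proof.
move=> h; pose E := [set x k - u k | k in [set: nat]].
have ub j : ubound E (x j + u j).
  by move=> _ [k _ <-]; have := h k j; rewrite ler_norml; lra.
have E0 : E !=set0 by exists (x 0%N - u 0%N), 0%N.
exists (sup E) => k; rewrite ler_norml; apply/andP; split.
  by have := ge_sup E0 (ub k); lra.
have : x k - u k <= sup E by apply: ub_le_sup; [exists (x 0%N + u 0%N)|exists k].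
by lra.
Qed.

Lemma squeezed_limitC (x : nat -> Cx R) (u : nat -> R) :
  (forall j k, cabs (x j - x k) <= u j + u k) ->
  exists l, forall k, cabs (x k - l) <= u k + u k.
Proof.
move=> h.
have [|a ha] := @squeezed_limit (fun k => re (x k)) u.
  by move=> j k; rewrite -reB; apply: le_trans (h j k); exact: re_cabs.
have [|b hb] := @squeezed_limit (fun k => im (x k)) u.
  by move=> j k; rewrite -imB; apply: le_trans (h j k); exact: im_cabs.
exists (cplx a b) => k; apply: (le_trans (cabs_le_reim _)).
by apply: lerD; rewrite ?reB ?imB; [exact: ha|exact: hb].
Qed.

End NullSequences.

(** * Holomorphic functions as limits of polynomials *)

Section Analytic.
Variable R : realType.
Local Notation C := (Cx R).
Local Notation MP n := (mpoly.mpoly n (Cx R)).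
Local Notation mco := mpoly.mcoeff.
Local Notation mX := (mpoly.mpolyX (Cx R)).
Local Notation mC n c := (mpoly.mpolyC n (c : Cx R)).
Local Notation U_ := mpoly.mnm1.

(* Holomorphic functions on a closed polydisc are handled as limits of polynomials in
   [x - a] for [wn e], the l^1 norm of the coefficients weighted by powers of [e]:
   limits for this norm exist without any rearrangement of power series. *)
Definition AnW n (e : R) (a : 'rV[C]_n) (f : 'rV[C]_n -> C)
    (p : nat -> MP n) (u : nat -> R) (B : R) : Prop :=
  [/\ null u, forall k, wn e (p k) <= B,
      forall j k, wn e (p j - p k) <= u j + u k &
      forall x : 'rV[C]_n, (forall i, cabs (x 0 i - a 0 i) <= e) ->
        forall k, cabs (f x - peval (p k) (x - a)) <= u k].

Definition AnE n (e : R) (a : 'rV[C]_n) (f : 'rV[C]_n -> C) : Prop :=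
  exists p u B, AnW e a f p u B.

Definition An n (f : 'rV[C]_n -> C) (a : 'rV[C]_n) := exists2 e, 0 < e & AnE e a f.

Lemma AnE_mono n e e' (a : 'rV[C]_n) f : 0 <= e' -> e' <= e -> AnE e a f -> AnE e' a f.
Proof.
move=> e0 ee' [p [u [B [hu hB hC hf]]]]; exists p, u, B; split=> //.
- by move=> k; apply: le_trans (hB k); exact: wn_mono.
- by move=> j k; apply: le_trans (hC j k); exact: wn_mono.
- by move=> x hx k; apply: hf => i; exact: le_trans (hx i) ee'.
Qed.

Lemma AnE_eq n e (a : 'rV[C]_n) f g :
  (forall x : 'rV[C]_n, (forall i, cabs (x 0 i - a 0 i) <= e) -> f x = g x) ->
  AnE e a f -> AnE e a g.
Proof.
move=> fg [p [u [B [hu hB hC hf]]]]; exists p, u, B; split=> //.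
by move=> x hx k; rewrite -fg //; apply: hf.
Qed.

Lemma An_near n (a : 'rV[C]_n) f g :
  (\forall x \near a, f x = g x) -> An f a -> An g a.
Proof.
move=> /nbhs_disc[e e0 fg] [e' e'0 h].
have m0 : 0 < Num.min (e / 2) e' by rewrite lt_min e'0 divr_gt0.
exists (Num.min (e / 2) e') => //.
apply: (@AnE_eq _ _ _ f); last by apply: AnE_mono h; [exact: ltW|rewrite ge_min lexx orbT].
move=> x hx; apply: fg => i; apply: (le_lt_trans (hx i)).
by rewrite gt_min; apply/orP; left; lra.
Qed.

Lemma AnE_ge0 n e (a : 'rV[C]_n) p (u : nat -> R) :
  0 <= e -> (forall j k, wn e (p j - p k : MP n) <= u j + u k) -> forall k, 0 <= u k.
Proof. by move=> e0 h k; have := h k k; rewrite subrr wn0; lra. Qed.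

Lemma An_cst n (a : 'rV[C]_n) c : An (fun=> c) a.
Proof.
exists 1 => //; exists (fun=> mC n c), (fun=> 0), (cabs c); split.
- exact: null0.
- by move=> k; rewrite wnC.
- by move=> j k; rewrite subrr wn0 addr0.
- by move=> x _ k; rewrite pevalC subrr cabs0.
Qed.

Lemma An_coord n (a : 'rV[C]_n) i : An (fun x => x 0 i) a.
Proof.
exists 1 => //; exists (fun=> mX (U_ i) + mC n (a 0 i)), (fun=> 0), (1 + cabs (a 0 i)); split.
- exact: null0.
- move=> k; apply: le_trans (wnD _ _ _) _ => //.
  by rewrite wnX wnC mpoly.mdeg1 expr1.
- by move=> j k; rewrite subrr wn0 addr0.
- by move=> x _ k; rewrite pevalD pevalC pevalXU !mxE subrK subrr cabs0.
Qed.

Lemma An_add n (a : 'rV[C]_n) f g : An f a -> An g a -> An (fun x => f x + g x) a.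
Proof.
move=> [e e0 hf] [e' e'0 hg]; pose d := Num.min e e'.
have d0 : 0 < d by rewrite lt_min e0.
have [p [u [B [hu hB hC {}hf]]]] : AnE d a f.
  by apply: AnE_mono hf; [exact: ltW|rewrite ge_min lexx].
have [q [v [B' [hv hB' hC' {}hg]]]] : AnE d a g.
  by apply: AnE_mono hg; [exact: ltW|rewrite ge_min lexx orbT].
exists d => //; exists (fun k => p k + q k), (fun k => u k + v k), (B + B'); split.
- exact: nullD.
- by move=> k; apply: le_trans (wnD _ _ (ltW d0)) _; apply: lerD.
- move=> j k; have -> : p j + q j - (p k + q k) = (p j - p k) + (q j - q k) by ring.
  by apply: le_trans (wnD _ _ (ltW d0)) _; have := hC j k; have := hC' j k; lra.
- move=> x hx k; rewrite pevalD.
  have -> : f x + g x - (peval (p k) (x - a) + peval (q k) (x - a)) =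
    (f x - peval (p k) (x - a)) + (g x - peval (q k) (x - a)) by ring.
  by apply: le_trans (cabsD _ _) _; apply: lerD; [exact: hf|exact: hg].
Qed.

Lemma An_common n (I : finType) (a : 'rV[C]_n) (g : I -> 'rV[C]_n -> C) (d : R) : 0 < d ->
  (forall i, An (g i) a) -> exists e, [/\ 0 < e, e <= d & forall i, AnE e a (g i)].
Proof.
move=> d0 h.
have /fin_all_exists[e he] : forall i, exists e, 0 < e /\ AnE e a (g i).
  by move=> i; have [e e0 ?] := h i; exists e.
pose m := \big[Num.min/d]_i e i.
have m0 : 0 < m.
  apply: (big_ind (fun x => 0 < x)) => // [x y x0 y0|i _]; first by rewrite lt_min x0.
  by have [] := he i.
have md : m <= d.
  exact: bigmin_le_id.
exists m; split=> // i; have [_ hi] := he i.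
apply: AnE_mono hi; [exact: ltW|exact: bigmin_le].
Qed.

(* Approximants without constant term, hence of small norm on small polydiscs. *)
Lemma AnE_small n e (a : 'rV[C]_n) f r : 0 < e -> 0 < r -> AnE e a f ->
  exists e' (p : nat -> MP n) (u : nat -> R), [/\ 0 < e' <= e, null u,
    forall k, wn e' (p k) <= r,
    forall j k, wn e' (p j - p k) <= u j + u k &
    forall x : 'rV[C]_n, (forall i, cabs (x 0 i - a 0 i) <= e') ->
        forall k, cabs (f x - f a - peval (p k) (x - a)) <= u k].
Proof.
move=> e0 r0 [p [u [B [hu hB hC hf]]]].
have B0 : 0 <= B by apply: le_trans (hB 0%N); apply: wn_ge0; exact: ltW.
pose e' := Num.min e (e * r / (B + 1)).
have B1 : 0 < B + 1 by lra.
have e'0 : 0 < e' by rewrite lt_min e0 divr_gt0 ?mulr_gt0.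
have e'e : e' <= e by rewrite ge_min lexx.
exists e', (fun k => tail 1 (p k)), (fun k => 2 * u k); split.
- by rewrite e'0.
- exact: nullZ.
- move=> k; apply: le_trans (wn_tail _ _ (ltW e'0) e'e e0) _; rewrite expr1.
  have h1 : e' / e <= r / (B + 1).
    rewrite ler_pdivrMr // mulrC mulrA.
    by rewrite ge_min lexx orbT.
  have h2 : e' / e * wn e (p k) <= r / (B + 1) * B.
    by apply: ler_pM => //; [rewrite divr_ge0 // ltW|rewrite wn_ge0 // ltW].
  apply: (le_trans h2); rewrite -mulrA [_ * B]mulrC mulrCA mulrC.
  by rewrite mulrAC ler_pdivrMr //; nra.
- move=> j k; rewrite -tailB; apply: (@le_trans _ _ (wn e (p j - p k))).
    apply: (le_trans (wn_tail 1 (p j - p k) (ltW e'0) e'e e0)); rewrite expr1.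
    by rewrite ler_piMl ?wn_ge0 ?(ltW e0) // ler_pdivrMr // mul1r.
  by have := hC j k; have := AnE_ge0 a (ltW e0) hC j; have := AnE_ge0 a (ltW e0) hC k; lra.
- move=> x hx k.
  have hx' i : cabs (x 0 i - a 0 i) <= e by exact: le_trans (hx i) e'e.
  have hc : p k = hpart 0 (p k) + tail 1 (p k) by rewrite -tailS tail0.
  have h1 := hf x hx' k; have h2 : cabs (f a - mco mpoly.mnm0 (p k)) <= u k.
    have := hf a _ k; rewrite subrr {1}hc hpart0 pevalD pevalC.
    have -> : peval (tail 1 (p k)) 0 = 0.
      rewrite /tail peval_sum big1 // => m m1; rewrite pevalZ pevalX.
      have [i mi] : exists i, (m i != 0)%N.
        apply: contrapT => h; have : mpoly.mdeg m = 0%N.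
          by rewrite mpoly.mdegE big1 // => i _; apply: contrapT => /eqP ?; apply: h; exists i.
        by move=> m0; rewrite m0 in m1.
      by rewrite (bigD1 i) //= mxE expr0n (negPf mi) mul0r mulr0.
    by rewrite addr0; apply => i; rewrite subrr cabs0 ltW.
  rewrite hc hpart0 pevalD pevalC in h1.
  have -> : f x - f a - peval (tail 1 (p k)) (x - a) =
    (f x - (mco mpoly.mnm0 (p k) + peval (tail 1 (p k)) (x - a))) - (f a - mco mpoly.mnm0 (p k)) by ring.
  by apply: le_trans (cabsB _ _) _; lra.
Qed.

Lemma peval_lip n r E d (p : MP n) (y y' : 'rV[C]_n) :
  0 <= r -> r < E -> 0 <= d ->
  (forall i, cabs (y 0 i) <= r) -> (forall i, cabs (y' 0 i) <= r) ->
  (forall i, cabs (y 0 i - y' 0 i) <= d) ->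
  cabs (peval p y - peval p y') <= (E - r)^-1 * wn E p * d.
Proof.
move=> r0 rE d0 h1 h2 h3.
(* Points become constant polynomials in 0 variables, for which [wn_compB] is a Lipschitz
   estimate. *)
pose A z : 'I_n -> MP 0 := fun i => mC 0 ((z : 'rV[C]_n) 0 i).
have e (z : 'rV[C]_n) : peval (pcomp (A z) p) 0 = peval p z.
  by rewrite peval_comp; congr peval; apply/rowP => i; rewrite mxE pevalC.
have h0 : forall i : 'I_0, cabs ((0 : 'rV[C]_0) 0 i) <= 1 by case.
have key : cabs (peval p y - peval p y') <= wn 1 (pcomp (A y) p - pcomp (A y') p).
  rewrite -(e y) -(e y') -pevalB; exact: peval_le.
apply: (le_trans key).
apply: wn_compB => // i; rewrite /A ?wnC //.
by rewrite -mpoly.mpolyCB wnC.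
Qed.

(** The composites of the approximants approximate the composite. Those of [G - G a] are kept below
    [E / 4], so that [G x - G a] stays below [E / 2], and the room up to [E] is what [wn_compB] and
    [peval_lip] consume. *)
Lemma An_comp n k (f : 'rV[C]_n -> C) (G : 'rV[C]_k -> 'rV[C]_n) (a : 'rV[C]_k) :
  An f (G a) -> (forall i, An (fun x => G x 0 i) a) -> An (fun x => f (G x)) a.
Proof.
move=> [E E0 [P [U [B [hU hB hC hf]]]]] hG.
have E4 : 0 < E / 4 by lra.
have B0 : 0 <= B by apply: le_trans (hB 0%N); apply: wn_ge0; exact: ltW.
have [e1 [e10 _ he1]] := An_common ltr01 hG.
have /fin_all_exists[e2 /fin_all_exists[q /fin_all_exists[u hqu]]] := fun i => AnE_small e10 E4 (he1 i).
pose e := \big[Num.min/e1]_i e2 i.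
have e0 : 0 < e.
  apply: (big_ind (fun x => 0 < x)) => // [x y x0 y0|i _]; first by rewrite lt_min x0.
  by have [/andP[]] := hqu i.
have ee2 i : e <= e2 i by exact: bigmin_le.
have hq i j : wn e (q i j) <= E / 4.
  by have [_ _ h _ _] := hqu i; apply: le_trans (h j); apply: wn_mono => //; exact: ltW.
have hqd i j l : wn e (q i j - q i l) <= u i j + u i l.
  by have [_ _ _ h _] := hqu i; apply: le_trans (h j l); apply: wn_mono => //; exact: ltW.
have u0 i j : 0 <= u i j by apply: (AnE_ge0 a (ltW e0) (hqd i)).
pose c := (E - E / 2)^-1 * B.
have c0 : 0 <= c by rewrite mulr_ge0 // invr_ge0; lra.
have lip j (y y' : nat -> R) : True by [].
exists e => //; exists (fun j => pcomp (fun i => q i j) (P j)),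
  (fun j => U j + c * \sum_i u i j), B; split.
- apply: nullD => //; apply: nullZ; apply: null_sum => i; by have [] := hqu i.
- move=> j; apply: le_trans (hB j); apply: le_trans (wn_comp _ (ltW e0) (hq^~ j)) _.
  by apply: wn_mono; lra.
- move=> j l.
  have -> : pcomp (q^~ j) (P j) - pcomp (q^~ l) (P l) =
    (pcomp (q^~ j) (P j) - pcomp (q^~ l) (P j)) + pcomp (q^~ l) (P j - P l).
    by rewrite pcompB addrA subrK.
  apply: le_trans (wnD _ _ (ltW e0)) _.
  have h1 : wn e (pcomp (q^~ l) (P j - P l)) <= U j + U l.
    apply: le_trans (wn_comp _ (ltW e0) (hq^~ l)) _.
    by apply: le_trans (hC j l); apply: wn_mono; lra.
  have h2 : wn e (pcomp (q^~ j) (P j) - pcomp (q^~ l) (P j)) <= c * (\sum_i u i j + \sum_i u i l).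
    have hs : 0 <= \sum_i u i j + \sum_i u i l by rewrite addr_ge0 ?sumr_ge0.
    apply: le_trans (@wn_compB R n k e (E / 2) E (\sum_i u i j + \sum_i u i l) (q^~ j) (q^~ l) (P j) (ltW e0) _ _ hs _ _ _) _.
    + by lra.
    + by lra.
    + by move=> i; apply: le_trans (hq i j) _; lra.
    + by move=> i; apply: le_trans (hq i l) _; lra.
    + move=> i; apply: le_trans (hqd i j l) _.
      by rewrite (bigD1 i) //= [X in _ <= _ + X](bigD1 i) //=; apply: lerD; rewrite lerDl sumr_ge0.
    + by rewrite ler_wpM2r // ler_wpM2l // invr_ge0; lra.
  by rewrite mulrDr in h2; lra.
- move=> x hx j; rewrite peval_comp.
  have hy i l : cabs (G x 0 i - G a 0 i - peval (q i l) (x - a)) <= u i l.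
    by have [_ _ _ _ h] := hqu i; apply: h => i'; exact: le_trans (hx i') (ee2 i).
  have hpe i l : cabs (peval (q i l) (x - a)) <= E / 4.
    apply: le_trans (hq i l); apply: peval_le => i'; by rewrite !mxE.
  have hy2 i : cabs (G x 0 i - G a 0 i) <= E / 2.
    have [_ hu _ _ _] := hqu i; have [N hN] := null_lt hu E4.
    have := hy i N; have := hN N (leqnn N); have := hpe i N.
    have := cabsD (G x 0 i - G a 0 i - peval (q i N) (x - a)) (peval (q i N) (x - a)).
    by rewrite subrK; lra.
  have h1 : cabs (f (G x) - peval (P j) (G x - G a)) <= U j.
    by apply: hf => i; apply: le_trans (hy2 i) _; lra.
  have hs : 0 <= \sum_i u i j by rewrite sumr_ge0.
  have h2 : cabs (peval (P j) (G x - G a) - peval (P j) (\row_i peval (q i j) (x - a))) <= c * \sum_i u i j.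
    apply: le_trans (@peval_lip n (E / 2) E (\sum_i u i j) (P j) _ _ _ _ hs _ _ _) _.
    + by lra.
    + by lra.
    + by move=> i; rewrite !mxE.
    + by move=> i; rewrite !mxE; apply: le_trans (hpe i j) _; lra.
    + by move=> i; rewrite !mxE; apply: le_trans (hy i j) _; rewrite (bigD1 i) //= lerDl sumr_ge0.
    + by rewrite ler_wpM2r // ler_wpM2l // invr_ge0; lra.
  have := cabsD (f (G x) - peval (P j) (G x - G a)) (peval (P j) (G x - G a) - peval (P j) (\row_i peval (q i j) (x - a))).
  by rewrite addrA subrK => h3; apply: le_trans h3 _; exact: lerD.
Qed.

(** Half of the radius is spent on moving the centre: the substituted polynomials
    [X_i + (b_i - a_i)] have norm at most [e] at radius [e / 2]. *)
Lemma AnW_recenter n e (a b : 'rV[C]_n) f p u B : 0 < e ->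
  (forall i, cabs (b 0 i - a 0 i) <= e / 2) -> AnW e a f p u B ->
  AnW (e / 2) b f (fun k => pcomp (fun i => mX (U_ i) + mC n (b 0 i - a 0 i)) (p k)) u B.
Proof.
move=> e0 ba [hu hB hC hf].
have e2 : 0 <= e / 2 by lra.
have hT i : wn (e / 2) (mX (U_ i) + mC n (b 0 i - a 0 i)) <= e.
  apply: le_trans (wnD _ _ e2) _; rewrite wnX wnC mpoly.mdeg1 expr1.
  by have := ba i; lra.
split=> //.
- by move=> k; apply: le_trans (hB k); exact: wn_comp.
- by move=> j k; rewrite -pcompB; apply: le_trans (hC j k); exact: wn_comp.
- move=> x hx k; rewrite peval_comp.
  have -> : \row_i peval (mX (U_ i) + mC n (b 0 i - a 0 i)) (x - b) = x - a.
    by apply/rowP => i; rewrite !mxE pevalD pevalXU pevalC !mxE; ring.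
  apply: hf => i; have -> : x 0 i - a 0 i = (x 0 i - b 0 i) + (b 0 i - a 0 i) by ring.
  by apply: le_trans (cabsD _ _) _; have := hx i; have := ba i; lra.
Qed.

Lemma AnE_shift n e (a b : 'rV[C]_n) f : 0 < e ->
  (forall i, cabs (b 0 i - a 0 i) <= e / 2) -> AnE e a f -> AnE (e / 2) b f.
Proof.
by move=> e0 ba [p [u [B /(AnW_recenter e0 ba)]]] h; do 3 eexists; exact: h.
Qed.

Lemma An_nbhs n (a : 'rV[C]_n) f : An f a -> \forall b \near a, An f b.
Proof.
move=> [e e0 h]; apply/nbhs_disc; exists (e / 2); first by lra.
move=> b hb; exists (e / 2); first by lra.
by apply: AnE_shift h => // i; exact/ltW/hb.
Qed.

Lemma peval_line n e J (p : MP n) (t : R) (v : 'rV[C]_n) r : 0 <= t -> t <= 1 ->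
  0 <= r -> r < e -> (forall i, cabs (v 0 i) <= r) ->
  cabs (peval p (cofr t *: v) - \sum_(j < J) cofr t ^+ j * peval (hpart j p) v)
    <= (t * r / e) ^+ J * wn e p.
Proof.
move=> t0 t1 r0 re hv; have e0 : 0 < e by lra.
rewrite {1}(hpart_sum J p) pevalD peval_sum.
under eq_bigr do rewrite peval_hpart.
rewrite addrC addKr.
have tr : t * r <= e by nra.
apply: le_trans (wn_tail _ _ _ tr e0); last by rewrite mulr_ge0.
apply: peval_le => i; rewrite mxE cabsM cabs_cofr ger0_norm //.
by rewrite ler_wpM2l.
Qed.

(** The degree [j] part [s j k] of [p k] at [v] approximates a Taylor coefficient of
    [t |-> f (a + t v)]. By induction on [j] it tends to 0 with [k], since [f] vanishes for small
    real [t > 0]; what is left of [f] is at most [(r / e) ^+ J * B] for every [J]. *)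
Lemma AnE_line_zero n e (a v : 'rV[C]_n) f r d : 0 <= r -> r < e ->
  (forall i, cabs (v 0 i) <= r) -> AnE e a f -> 0 < d ->
  (forall t : R, 0 < t -> t < d -> f (a + cofr t *: v) = 0) ->
  forall z : C, cabs z <= 1 -> f (a + z *: v) = 0.
Proof.
move=> r0 re hv [p [u [B [hu hB hC hf]]]] d0 hz.
have e0 : 0 < e by lra.
have B0 : 0 <= B by apply: le_trans (hB 0%N); apply: wn_ge0; exact: ltW.
pose s j k := peval (hpart j (p k)) v.
have bnd (t : R) k J : 0 <= t -> t <= 1 ->
    cabs (f (a + cofr t *: v) - \sum_(j < J) cofr t ^+ j * s j k) <= u k + (t * r / e) ^+ J * B.
  move=> t0 t1.
  have h1 : cabs (f (a + cofr t *: v) - peval (p k) (cofr t *: v)) <= u k.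
    have := hf (a + cofr t *: v) _ k; rewrite [a + _ - a]addrAC subrr add0r; apply => i.
    rewrite !mxE [a 0 i + _ - _]addrAC subrr add0r cabsM cabs_cofr ger0_norm //.
    by have := hv i; have := cabs_ge0 (v 0 i); nra.
  have h2 := peval_line J (p k) t0 t1 r0 re hv.
  have h3 : (t * r / e) ^+ J * wn e (p k) <= (t * r / e) ^+ J * B.
    by rewrite ler_wpM2l // exprn_ge0 // divr_ge0 ?mulr_ge0 // ltW.
  have := cabsD (f (a + cofr t *: v) - peval (p k) (cofr t *: v))
    (peval (p k) (cofr t *: v) - \sum_(j < J) cofr t ^+ j * s j k).
  by rewrite addrA subrK /s; lra.
have s0 j : null (fun k => cabs (s j k)).
  elim/ltn_ind: j => J IH.
  pose w k := \sum_(j < J) cabs (s j k) + u k.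
  have hw : null w by apply: nullD => //; apply: null_sum => j; exact: IH.
  apply/nullP => eps eps0.
  (* [t < d] makes [f] vanish; [t * B < eps] makes the remainder of order [J.+1] smaller than
     [t ^+ J * eps], with room left for the null sequence [w]. *)
  pose t := Num.min (Num.min 1 (d / 2)) (eps / (2 * (B + 1))).
  have B1 : 0 < B + 1 by lra.
  have t0 : 0 < t by rewrite !lt_min ltr01 /= !divr_gt0 ?mulr_gt0.
  have t1 : t <= 1 by rewrite !ge_min lexx.
  have td : t < d.
    apply: (@le_lt_trans _ _ (d / 2)); last by lra.
    by rewrite /t !ge_min lexx orbT.
  have tB : t * B < eps.
    have : t <= eps / (2 * (B + 1)) by rewrite ge_min lexx orbT.
    by rewrite ler_pdivlMr ?mulr_gt0 //; nra.
  have tJ : 0 < t ^+ J by rewrite exprn_gt0.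
  have hpos : 0 < t ^+ J * (eps - t * B) by rewrite mulr_gt0 // subr_gt0.
  have [N hN] := null_lt hw hpos; exists N => k Nk.
  rewrite ger0_norm ?cabs_ge0 //.
  have := bnd t k J.+1 (ltW t0) t1; rewrite hz // sub0r cabsN big_ord_recr /= => h1.
  have h2 : (t * r / e) ^+ J.+1 <= t ^+ J.+1.
    apply: lerXn2r; rewrite ?nnegrE ?divr_ge0 ?mulr_ge0 ?(ltW t0) ?(ltW e0) //.
    by rewrite -mulrA ler_piMr ?(ltW t0) // ler_pdivrMr // mul1r ltW.
  have h3 : cabs (\sum_(j < J) cofr t ^+ j * s j k) <= \sum_(j < J) cabs (s j k).
    apply: le_trans (cabs_sum _ _ _) _; apply: ler_sum => j _.
    rewrite cabsM cabsX cabs_cofr ger0_norm ?(ltW t0) // ler_piMl ?cabs_ge0 //.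
    by rewrite exprn_ile1 // ltW.
  have h4 : t ^+ J * cabs (s J k) <= cabs (\sum_(j < J) cofr t ^+ j * s j k + cofr t ^+ J * s J k)
      + cabs (\sum_(j < J) cofr t ^+ j * s j k).
    have := cabsB (\sum_(j < J) cofr t ^+ j * s j k + cofr t ^+ J * s J k) (\sum_(j < J) cofr t ^+ j * s j k).
    by rewrite addrAC subrr add0r cabsM cabsX cabs_cofr ger0_norm // ltW.
  have h5 : t ^+ J * cabs (s J k) < t ^+ J * eps.
    have h6 : (t * r / e) ^+ J.+1 * B <= t ^+ J * (t * B).
      by rewrite mulrA -exprSr ler_wpM2r.
    have := hN k Nk; rewrite /w mulrBr; lra.
  by rewrite ltr_pM2l in h5.
move=> z z1; apply/eqP; rewrite -cabs_eq0; apply/eqP/le_anti; rewrite cabs_ge0 andbT.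
have re1 : r / e < 1 by rewrite ltr_pdivrMr // mul1r.
have re0 : 0 <= r / e by rewrite divr_ge0 // ltW.
have hzv i : cabs ((z *: v) 0 i) <= r.
  by rewrite mxE cabsM; have := hv i; have := cabs_ge0 (v 0 i); have := cabs_ge0 z; nra.
have key J k : cabs (f (a + z *: v)) <= (r / e) ^+ J * B + (\sum_(j < J) cabs (s j k) + u k).
  have h1 : cabs (f (a + z *: v) - peval (p k) (z *: v)) <= u k.
    have := hf (a + z *: v) _ k; rewrite [a + _ - a]addrAC subrr add0r; apply => i.
    by rewrite mxE [a 0 i + _ - _]addrAC subrr add0r; apply: le_trans (hzv i) _; exact: ltW.
  have := peval_line J (p k) ler01 (lexx _) r0 re hzv; rewrite cofr1 scale1r mul1r => h2.
  have h3 : cabs (\sum_(j < J) 1 ^+ j * peval (hpart j (p k)) (z *: v)) <= \sum_(j < J) cabs (s j k).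
    apply: le_trans (cabs_sum _ _ _) _; apply: ler_sum => j _.
    rewrite expr1n mul1r peval_hpart cabsM cabsX ler_piMl ?cabs_ge0 //.
    by rewrite exprn_ile1 // cabs_ge0.
  have h4 : (r / e) ^+ J * wn e (p k) <= (r / e) ^+ J * B by rewrite ler_wpM2l // exprn_ge0.
  set X := \sum_(j < J) _ in h2 h3.
  have := cabsD (f (a + z *: v) - peval (p k) (z *: v) + (peval (p k) (z *: v) - X)) X.
  have := cabsD (f (a + z *: v) - peval (p k) (z *: v)) (peval (p k) (z *: v) - X).
  by rewrite addrA subrK subrK; lra.
have key2 J : cabs (f (a + z *: v)) <= (r / e) ^+ J * B.
  by apply: le_null (key J); apply: nullD => //; apply: null_sum => j; exact: s0.
apply: (@le_null _ _ _ (fun J => B * (r / e) ^+ J)).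
  by apply: nullZ; exact: null_geo.
by move=> J; rewrite add0r mulrC.
Qed.

(** A segment inside the polydisc joins any of its points to the centre, and [AnE_line_zero] applies
    on it. *)
Lemma AnE_identity n e (a : 'rV[C]_n) f : 0 < e -> AnE e a f ->
  (\forall x \near a, f x = 0) -> forall x, disc a e x -> f x = 0.
Proof.
move=> e0 h /nbhs_disc[d d0 hd] x hx.
pose r := \big[Num.max/0]_i cabs (x 0 i - a 0 i).
have r0 : 0 <= r by exact: bigmax_ge_id.
have re : r < e by apply/bigmax_ltP; split=> // i _; exact: hx.
have hr i : cabs ((x - a) 0 i) <= r by rewrite !mxE; exact: (le_bigmax _ (fun i => cabs (x 0 i - a 0 i))).
have := @AnE_line_zero n e a (x - a) f r (d / e) r0 re hr h _ _ 1.
rewrite scale1r subrKC cabs1; apply=> //; first by rewrite divr_gt0.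
move=> t t0 td; apply: hd => i; rewrite mxE [a 0 i + _ - _]addrAC subrr add0r.
rewrite mxE cabsM cabs_cofr ger0_norm ?(ltW t0) //.
rewrite ltr_pdivlMr // in td; apply: le_lt_trans td; rewrite ler_wpM2l ?(ltW t0) //.
exact: le_trans (hr i) (ltW re).
Qed.

(* One coordinate at a time, vanishing on a real segment extends to a complex disc. *)
Lemma An_real_zero n (a : 'rV[C]_n) f : An f a ->
  (exists2 d : R, 0 < d & forall v : 'rV[R]_n, (forall i, `|v 0 i| < d) ->
     f (a + map_mx (@cofr R) v) = 0) ->
  \forall x \near a, f x = 0.
Proof.
move=> [e e0 h] [d d0 hd].
pose m := Num.min (e / 4) d.
have m0 : 0 < m by rewrite lt_min d0 divr_gt0.
have me : m <= e / 4 by rewrite ge_min lexx.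
have md : m <= d by rewrite ge_min lexx orbT.
have main k : (k <= n)%N -> forall w : 'rV[C]_n, (forall i, cabs (w 0 i) < m) ->
    (forall i : 'I_n, (k <= i)%N -> w 0 i = cofr (re (w 0 i))) -> f (a + w) = 0.
  elim: k => [|k IH] kn w wm wr.
    have -> : w = map_mx (@cofr R) (\row_i re (w 0 i)).
      by apply/rowP => i; rewrite !mxE -wr.
    apply: hd => i; rewrite mxE; apply: le_lt_trans (re_cabs _) _.
    exact: lt_le_trans (wm i) md.
  pose i0 := Ordinal kn.
  pose c := \row_i (if i == i0 then 0 else w 0 i).
  pose v := (cofr m *: delta_mx 0 i0 : 'rV[C]_n).
  have -> : w = c + (w 0 i0 / cofr m) *: v.
    apply/rowP => i; rewrite !mxE eqxx /=; case: eqP => [->|_]; last by rewrite !mulr0 addr0.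
    by rewrite mulr1 add0r divfK // -(cofr0 R) (inj_eq (@cofr_inj R)) gt_eqF.
  rewrite addrA.
  have sh : AnE (e / 2) (a + c) f.
    apply: AnE_shift h => // i; rewrite !mxE [a 0 i + _]addrC addrK.
    case: eqP => _; first by rewrite cabs0; lra.
    by have := wm i; lra.
  have me2 : m < e / 2 by lra.
  have vm i : cabs (v 0 i) <= m.
    rewrite !mxE cabsM cabs_cofr gtr0_norm // ler_piMr ?(ltW m0) //.
    by case: (_ && _); rewrite ?cabs1 ?cabs0.
  apply: (@AnE_line_zero n (e / 2) (a + c) v f m 1 (ltW m0) me2 vm sh ltr01).
    move=> t t0 t1; rewrite -addrA.
    have E i : (c + cofr t *: v) 0 i = if i == i0 then cofr (t * m) else w 0 i.
      rewrite /c /v !mxE eqxx /=; case: eqP => _; last by rewrite !mulr0 addr0.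
      by rewrite add0r mulr1 -cofrM.
    apply: IH => [|i|i ki]; first exact: ltnW.
      rewrite E; case: eqP => // _; rewrite cabs_cofr gtr0_norm ?mulr_gt0 //.
      by rewrite gtr_pMl.
    rewrite E; case: eqP => // ne; apply: wr; rewrite ltn_neqAle ki andbT.
    by apply/eqP => kE; apply: ne; apply: val_inj.
  rewrite cabsM cabsV cabs_cofr gtr0_norm // ler_pdivrMr // mul1r.
  exact/ltW.
apply/nbhs_disc; exists m => // x hx.
rewrite -(subrKC a x); apply: (main n) => // i; first by rewrite !mxE; exact: hx.
by rewrite leqNgt ltn_ord.
Qed.

End Analytic.

(** * Derivatives and the domain of germs *)

Section Derivatives.
Variable R : realType.
Local Notation C := (Cx R).
Local Notation MP n := (mpoly.mpoly n (Cx R)).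
Local Notation mco := mpoly.mcoeff.
Local Notation mX := (mpoly.mpolyX (Cx R)).
Local Notation mC n c := (mpoly.mpolyC n (c : Cx R)).
Local Notation U_ := mpoly.mnm1.

Lemma mpoly_alg_ind n (P : MP n -> Prop) :
  (forall c, P (mC n c)) -> (forall i, P (mX (U_ i))) ->
  (forall p q, P p -> P q -> P (p + q)) -> (forall p q, P p -> P q -> P (p * q)) ->
  forall p, P p.
Proof.
move=> hc hX hD hM p; rewrite (mpoly.mpolyE p).
have P0 : P 0 by rewrite -(mpoly.mpolyC0 n C); exact: hc.
have P1 : P 1 by rewrite -(mpoly.mpolyC1 n C); exact: hc.
apply: big_ind => // m _; rewrite -mpoly.mul_mpolyC; apply: (hM _ _ (hc _)).
rewrite mpoly.mpolyXE_id; apply: big_ind => // i _.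
elim: (m i) => [|k IH]; first by rewrite expr0.
by rewrite exprS; apply: hM.
Qed.

Lemma pcompM n k (q : 'I_n -> MP k) (p p' : MP n) :
  pcomp q (p * p') = pcomp q p * pcomp q p'.
Proof.
rewrite (pcomp_unlock q (p * p')) (pcomp_unlock q p) (pcomp_unlock q p').
exact: rmorphM.
Qed.

Lemma pcompC n k (q : 'I_n -> MP k) c : pcomp q (mC n c) = mC k c.
Proof. by rewrite pcomp_unlock mpoly.comp_mpolyC. Qed.

Lemma pcompXU n k (q : 'I_n -> MP k) i : pcomp q (mX (U_ i)) = q i.
Proof. by rewrite pcomp_unlock mpoly.comp_mpolyXU -tnth_nth tnth_mktuple. Qed.

Lemma mderivXU n (i j : 'I_n) : mpoly.mderiv i (mX (U_ j)) = mC n (i == j)%:R.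
Proof.
rewrite mpoly.mderivX mpoly.mnm1E [j == i]eq_sym.
case: eqP => [->|_]; last by rewrite scale0r mpoly.mpolyC0.
have -> : mpoly.mnm_sub (U_ j) (U_ j) = mpoly.mnm0.
  by apply/mpoly.mnmP => l; rewrite mpoly.mnmBE subnn mpoly.mnm0E.
by rewrite mpoly.mpolyX0 scale1r mpoly.mpolyC1.
Qed.

Definition shiftp n (b : 'rV[C]_n) : 'I_n -> MP n := fun j => mX (U_ j) + mC n (b 0 j).

Lemma mderiv_shift n (b : 'rV[C]_n) i (p : MP n) :
  mpoly.mderiv i (pcomp (shiftp b) p) = pcomp (shiftp b) (mpoly.mderiv i p).
Proof.
elim/mpoly_alg_ind: p => [c|j|p q hp hq|p q hp hq].
- by rewrite pcompC mpoly.mderivC -(mpoly.mpolyC0 n C) pcompC.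
- by rewrite pcompXU mderivXU /shiftp pcompC mpoly.mderivD mderivXU mpoly.mderivC addr0.
- rewrite pcompD; etransitivity; first exact: mpoly.mderivD.
  etransitivity; first exact: (congr2 +%R hp hq).
  etransitivity; first exact: (esym (pcompD _ _ _)).
  exact: (congr1 (pcomp (shiftp b)) (esym (mpoly.mderivD i p q))).
- rewrite pcompM; etransitivity; first exact: mpoly.mderivM.
  etransitivity.
    exact: (congr2 (fun x y => x * pcomp (shiftp b) q + pcomp (shiftp b) p * y) hp hq).
  etransitivity.
    exact: (congr2 +%R (esym (pcompM _ _ _)) (esym (pcompM _ _ _))).
  etransitivity; first exact: (esym (pcompD _ _ _)).
  exact: (congr1 (pcomp (shiftp b)) (esym (mpoly.mderivM i p q))).
Qed.

Lemma peval_at0 n (p : MP n) : peval p 0 = mco mpoly.mnm0 p.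
Proof.
elim/mpoly_alg_ind: p => [c|j|p q hp hq|p q hp hq].
- by rewrite pevalC mpoly.mpolyCK.
- rewrite pevalXU mxE mpoly.mcoeffX; case: eqP => // e.
  by move: (mpoly.mdeg1 j); rewrite e mpoly.mdeg0.
- by rewrite pevalD mpoly.mcoeffD hp hq.
- by rewrite pevalM hp hq; rewrite [RHS]rmorphM.
Qed.

Lemma mco_U n (p : MP n) i : mco (U_ i) p = mco mpoly.mnm0 (mpoly.mderiv i p).
Proof. by rewrite mpoly.mcoeff_deriv mpoly.mnm0E mulr1n mpoly.add0m. Qed.

Lemma peval_shift n (b : 'rV[C]_n) (p : MP n) x : peval (pcomp (shiftp b) p) x = peval p (x + b).
Proof.
rewrite peval_comp; congr peval.
by apply/rowP => i; rewrite !mxE pevalD pevalXU pevalC.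
Qed.

Lemma mco_shift_U n (b : 'rV[C]_n) (p : MP n) i :
  mco (U_ i) (pcomp (shiftp b) p) = peval (mpoly.mderiv i p) b.
Proof. by rewrite mco_U mderiv_shift -peval_at0 peval_shift add0r. Qed.

(** Frechet differentiability, where any real bound [r] of the coordinates of [h] stands for its
    norm. *)
Definition isD n (f : 'rV[C]_n -> C) (a l : 'rV[C]_n) : Prop :=
  forall eps : R, 0 < eps -> exists2 d : R, 0 < d &
    forall (h : 'rV[C]_n) (r : R), (forall i, cabs (h 0 i) <= r) -> 0 <= r -> r <= d ->
      cabs (f (a + h) - f a - \sum_i l 0 i * h 0 i) <= eps * r.

Lemma isD_uniq n (f : 'rV[C]_n -> C) a l l' : isD f a l -> isD f a l' -> l = l'.
Proof.
move=> h h'; apply/rowP => i; apply/eqP; rewrite -subr_eq0 -cabs_eq0; apply/eqP/le_anti.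
rewrite cabs_ge0 andbT; apply/ler_addgt0Pr => eps eps0; rewrite add0r.
have e2 : 0 < eps / 2 by lra.
have [d d0 hd] := h _ e2; have [d' d'0 hd'] := h' _ e2.
pose r := Num.min d d'; have r0 : 0 < r by rewrite lt_min d0.
pose v : 'rV[C]_n := cofr r *: delta_mx 0 i.
have vr j : cabs (v 0 j) <= r.
  rewrite !mxE cabsM cabs_cofr gtr0_norm // ler_piMr ?(ltW r0) //.
  by case: (_ && _); rewrite ?cabs1 ?cabs0.
have vs (m : 'rV[C]_n) : \sum_j m 0 j * v 0 j = cofr r * m 0 i.
  rewrite (bigD1 i) //= big1 ?addr0 => [|j ji]; rewrite !mxE ?eqxx /= ?mulr1 1?mulrC //.
  by rewrite (negPf ji) /= mulr0 mul0r.
have := hd v r vr (ltW r0); rewrite ge_min lexx vs => /(_ isT) h1.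
have := hd' v r vr (ltW r0); rewrite ge_min lexx orbT vs => /(_ isT) h2.
have h3 : r * cabs (l 0 i - l' 0 i) <= r * eps.
  have := cabsB (f (a + v) - f a - cofr r * l' 0 i) (f (a + v) - f a - cofr r * l 0 i).
  have -> : f (a + v) - f a - cofr r * l' 0 i - (f (a + v) - f a - cofr r * l 0 i) =
    cofr r * (l 0 i - l' 0 i) by ring.
  by rewrite cabsM cabs_cofr gtr0_norm //; lra.
by rewrite ler_pM2l in h3.
Qed.

(** Total by choice: 0 where [f] is not differentiable. *)
Definition grad n (f : 'rV[C]_n -> C) a : 'rV[C]_n := xget 0 [set l | isD f a l].
Definition dC n (i : 'I_n) (f : 'rV[C]_n -> C) : 'rV[C]_n -> C := fun a => grad f a 0 i.

Lemma gradE n (f : 'rV[C]_n -> C) a l : isD f a l -> grad f a = l.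
Proof. by move=> h; apply: (@isD_uniq _ f a) => //; apply: (@xgetPex _ 0 [set l | isD f a l]); exists l. Qed.

Lemma dCE n (f : 'rV[C]_n -> C) a l i : isD f a l -> dC i f a = l 0 i.
Proof. by move=> h; rewrite /dC (gradE h). Qed.

Lemma isD_grad n (f : 'rV[C]_n -> C) a l : isD f a l -> isD f a (grad f a).
Proof. by move=> h; rewrite (gradE h). Qed.

Lemma isD_near n (f g : 'rV[C]_n -> C) a l :
  (\forall x \near a, f x = g x) -> isD f a l -> isD g a l.
Proof.
move=> /nbhs_disc[e e0 fg] h eps eps0; have [d d0 hd] := h _ eps0.
exists (Num.min d (e / 2)); first by rewrite lt_min d0 divr_gt0.
move=> v r vr r0; rewrite le_min => /andP[rd re].
rewrite -!fg; first exact: hd.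
  by move=> i; rewrite subrr cabs0.
move=> i; rewrite mxE [a 0 i + _ - _]addrAC subrr add0r; apply: (le_lt_trans (vr i)); lra.
Qed.

(** The gradient is the limit of the linear coefficients of the [p k], a Cauchy sequence by
    [mco_le]; the remainder is the tail of degree at least 2, bounded by [(r / e) ^+ 2 * B]. *)
Lemma AnW_isD n e (a : 'rV[C]_n) f p u B : 0 < e -> AnW e a f p u B ->
  exists2 l, isD f a l & forall i k, cabs (mco (U_ i) (p k) - l 0 i) <= 2 * u k / e.
Proof.
move=> e0 [hu hB hC hf].
have B0 : 0 <= B by apply: le_trans (hB 0%N); apply: wn_ge0; exact: ltW.
have /fin_all_exists[l hl] : forall i, exists l, forall k, cabs (mco (U_ i) (p k) - l) <= u k / e + u k / e.
  move=> i; apply: squeezed_limitC => j k.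
  have := mco_le (p j - p k) (U_ i) (ltW e0); rewrite mpoly.mdeg1 expr1 mpoly.mcoeffB => h.
  by rewrite -mulrDl ler_pdivlMr //; apply: le_trans h _; exact: hC.
exists (\row_i l i); last first.
  by move=> i k; rewrite mxE; apply: le_trans (hl i k) _; rewrite -mulrA; lra.
move=> eps eps0.
have B1 : 0 < B + 1 by lra.
(* Chosen so that [(r / e) ^+ 2 * B <= eps * r]. *)
exists (Num.min e (eps * e ^+ 2 / (B + 1))).
  by rewrite lt_min e0 divr_gt0 // mulr_gt0 // exprn_gt0.
move=> h r hr r0; rewrite le_min => /andP[re rd].
have key k : cabs (f (a + h) - f a - \sum_i (\row_i l i) 0 i * h 0 i) <=
    (r / e) ^+ 2 * B + (2 * u k + \sum_(i < n) (2 * u k / e) * r).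
  have h1 : cabs (f (a + h) - peval (p k) h) <= u k.
    have := hf (a + h) _ k; rewrite [a + _ - a]addrAC subrr add0r; apply => i.
    by rewrite mxE [a 0 i + _ - _]addrAC subrr add0r; apply: le_trans (hr i) re.
  have h2 : cabs (f a - peval (p k) 0) <= u k.
    by have := hf a _ k; rewrite subrr; apply => i; rewrite subrr cabs0 ltW.
  have h3 : cabs (peval (tail 2 (p k)) h) <= (r / e) ^+ 2 * B.
    apply: le_trans (peval_le _ hr) _; apply: le_trans (wn_tail _ _ r0 re e0) _.
    by rewrite ler_wpM2l // exprn_ge0 // divr_ge0 // ltW.
  have E : peval (p k) h = peval (p k) 0 + \sum_i mco (U_ i) (p k) * h 0 i + peval (tail 2 (p k)) h.
    rewrite {1}(hpart_sum 2 (p k)) !big_ord_recl big_ord0 addr0 hpart0 /= /bump /= hpart1.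
    rewrite !pevalD pevalC peval_at0 peval_sum; congr (_ + _ + _).
    by apply: eq_bigr => i _; rewrite pevalZ pevalXU.
  have h4 : cabs (\sum_i mco (U_ i) (p k) * h 0 i - \sum_i (\row_i l i) 0 i * h 0 i) <= \sum_(i < n) (2 * u k / e) * r.
    rewrite -sumrB; apply: le_trans (cabs_sum _ _ _) _; apply: ler_sum => i _.
    rewrite -mulrBl cabsM mxE; apply: ler_pM; rewrite ?cabs_ge0 //.
    by apply: le_trans (hl i k) _; rewrite -mulrA; lra.
  set S1 := \sum_i mco _ _ * _ in E h4; set S2 := \sum_i _ * h 0 i in h4 *.
  have -> : f (a + h) - f a - S2 = (f (a + h) - peval (p k) h) - (f a - peval (p k) 0)
     + (S1 - S2) + peval (tail 2 (p k)) h by rewrite E; ring.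
  apply: le_trans (cabsD _ _) _; rewrite addrC; apply: lerD => //.
  apply: le_trans (cabsD _ _) _; apply: lerD => //.
  by apply: le_trans (cabsB _ _) _; lra.
apply: (@le_trans _ _ ((r / e) ^+ 2 * B)).
  apply: le_null key; apply: nullD; first exact: nullZ.
  apply: null_sum => _; rewrite (_ : (fun k => _) = fun k => (2 / e * r) * u k); first exact: nullZ.
  by apply/funext => k; ring.
rewrite expr_div_n mulrAC ler_pdivrMr ?exprn_gt0 //.
have : r * (B + 1) <= eps * e ^+ 2 by rewrite -ler_pdivlMr.
move=> h5; apply: (@le_trans _ _ (r * (r * (B + 1)))).
  by rewrite expr2 -mulrA ler_wpM2l // ler_wpM2l // lerDl.
by rewrite [eps * r]mulrC -mulrA ler_wpM2l.
Qed.

Lemma An_isD n (a : 'rV[C]_n) f : An f a -> isD f a (grad f a).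
Proof. by move=> [e e0 [p [u [B h]]]]; have [l /isD_grad] := AnW_isD e0 h. Qed.

(** For each [x] of the half polydisc, recentering at [x] and [AnW_isD] identify the limit of the
    [mderiv i (p k)] at [x] with [dC i f x]; the factor [2 / (e / 2)] is the rate of [AnW_isD] at
    radius [e / 2]. *)
Lemma AnW_dC n (a : 'rV[C]_n) f i e p u B : 0 < e -> AnW e a f p u B ->
  AnW (e / 2) a (dC i f) (fun k => mpoly.mderiv i (p k)) (fun k => (2 / (e / 2)) * u k) ((e / 2)^-1 * B).
Proof.
move=> e0 h.
have e2 : 0 < e / 2 by lra.
have e2e : e / 2 < e by lra.
have hh : e - e / 2 = e / 2 by lra.
have [hu hB hC hf] := h.
have u0 := AnE_ge0 a (ltW e0) hC.
split.
- exact: nullZ.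
- move=> k; apply: le_trans (wn_mderiv _ _ (ltW e2) e2e) _; rewrite hh.
  by rewrite ler_wpM2l // invr_ge0 ltW.
- move=> j k; rewrite -mpoly.mderivB; apply: le_trans (wn_mderiv _ _ (ltW e2) e2e) _; rewrite hh.
  apply: (@le_trans _ _ ((e / 2)^-1 * (u j + u k))).
    by rewrite ler_wpM2l ?hC // invr_ge0 ltW.
  rewrite -mulrDr -mulrA ler_peMl ?ler1n //.
  by rewrite mulr_ge0 ?addr_ge0 // invr_ge0 ltW.
- move=> x hx k; have [l hl1 hl2] := AnW_isD e2 (AnW_recenter e0 hx h).
  rewrite (dCE i hl1) cabsBC; have := hl2 i k.
  have -> : (fun i : 'I_n => mX (U_ i) + mC n (x 0 i - a 0 i)) = shiftp (x - a).
    by apply/funext => j; rewrite /shiftp !mxE.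
  by rewrite mco_shift_U mulrAC.
Qed.

Lemma An_dC n (a : 'rV[C]_n) f i : An f a -> An (dC i f) a.
Proof.
move=> [e e0 [p [u [B h]]]].
exists (e / 2); first by rewrite divr_gt0.
by do 3 eexists; exact: AnW_dC h.
Qed.

Lemma An_peval n (p : MP n) a : An (peval p) a.
Proof.
exists 1 => //; exists (fun=> pcomp (shiftp a) p), (fun=> 0), (wn 1 (pcomp (shiftp a) p)); split=> //.
- exact: null0.
- by move=> j k; rewrite subrr wn0 addr0.
- by move=> x _ k; rewrite peval_shift subrK subrr cabs0.
Qed.

Lemma dC_peval n (p : MP n) i : dC i (peval p) = peval (mpoly.mderiv i p).
Proof.
apply/funext => a.
have h : AnW 1 a (peval p) (fun=> pcomp (shiftp a) p) (fun=> 0) (wn 1 (pcomp (shiftp a) p)).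
  split=> //; [exact: null0|by move=> j k; rewrite subrr wn0 addr0|].
  by move=> x _ k; rewrite peval_shift subrK subrr cabs0.
have [l hl1 hl2] := AnW_isD ltr01 h.
rewrite (dCE i hl1); have := hl2 i 0%N; rewrite mulr0 mul0r mco_shift_U => h2.
by apply/eqP; rewrite eq_sym -subr_eq0 -cabs_eq0 eq_le h2 cabs_ge0.
Qed.

Lemma dC_near n (f g : 'rV[C]_n -> C) a i :
  (\forall x \near a, f x = g x) -> dC i f a = dC i g a.
Proof.
move=> fg; have gf : \forall x \near a, g x = f x by apply: filterS fg.
have E : [set l | isD f a l] = [set l | isD g a l].
  by apply/seteqP; split=> l /=; exact: isD_near.
by rewrite /dC /grad E.
Qed.

Lemma near_near n (P : 'rV[C]_n -> Prop) (a : 'rV[C]_n) :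
  (\forall x \near a, P x) -> \forall x \near a, \forall y \near x, P y.
Proof. by move=> h; apply/near_join. Qed.

Lemma dC_near_near n (f g : 'rV[C]_n -> C) (a : 'rV[C]_n) i :
  (\forall x \near a, f x = g x) -> \forall x \near a, dC i f x = dC i g x.
Proof. by move=> /near_near; apply: filterS => x /dC_near. Qed.

Lemma An_cont n (f : 'rV[C]_n -> C) a (eps : R) : An f a -> 0 < eps ->
  \forall x \near a, cabs (f x - f a) < eps.
Proof.
move=> /An_isD h eps0; have [d d0 hd] := h _ ltr01.
pose M := \sum_i cabs (grad f a 0 i).
have M0 : 0 <= M by apply: sumr_ge0 => i _; exact: cabs_ge0.
pose r := Num.min d (eps / (2 * (M + 1))).
have M1 : 0 < 2 * (M + 1) by lra.
have r0 : 0 < r by rewrite lt_min d0 divr_gt0.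
apply/nbhs_disc; exists r => // x hx.
have hv i : cabs ((x - a) 0 i) <= r by rewrite !mxE; exact/ltW/hx.
have := hd (x - a) r hv (ltW r0); rewrite ge_min lexx subrKC mul1r => /(_ isT) h1.
have h2 : cabs (\sum_i grad f a 0 i * (x - a) 0 i) <= M * r.
  apply: le_trans (cabs_sum _ _ _) _; rewrite mulr_suml; apply: ler_sum => i _.
  by rewrite cabsM ler_wpM2l ?cabs_ge0.
have h3 : r * (2 * (M + 1)) <= eps by rewrite -ler_pdivlMr // ge_min lexx orbT.
have := cabsD (f x - f a - \sum_i grad f a 0 i * (x - a) 0 i) (\sum_i grad f a 0 i * (x - a) 0 i).
by rewrite subrK; nra.
Qed.

Lemma An_near_map n k (G : 'rV[C]_k -> 'rV[C]_n) a (P : 'rV[C]_n -> Prop) :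
  (forall i, An (fun x => G x 0 i) a) -> (\forall y \near G a, P y) ->
  \forall x \near a, P (G x).
Proof.
move=> hG /nbhs_disc[e e0 he].
have : \forall x \near a, forall i, cabs (G x 0 i - G a 0 i) < e.
  have h i : \forall x \near a, cabs (G x 0 i - G a 0 i) < e by exact: An_cont (hG i) e0.
  exact: filter_forall h.
by apply: filterS => x hx; apply: he.
Qed.

Lemma An_neq0 n (f : 'rV[C]_n -> C) a : An f a -> f a != 0 ->
  \forall x \near a, f x != 0.
Proof.
move=> hf fa; have h := An_cont hf _; have : 0 < cabs (f a) by rewrite cabs_gt0.
move=> /h; apply: filterS => x; apply: contraTneq => ->.
by rewrite sub0r cabsN ltxx.
Qed.

Lemma isD_comp n k (f : 'rV[C]_n -> C) (G : 'rV[C]_k -> 'rV[C]_n) a l (m : 'I_n -> 'rV[C]_k) :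
  isD f (G a) l -> (forall i, isD (fun x => G x 0 i) a (m i)) ->
  isD (fun x => f (G x)) a (\row_j \sum_i l 0 i * m i 0 j).
Proof.
move=> hf hG eps eps0.
(* [K] bounds the growth of [G] near [a], the summand 1 absorbing its error term because [e2 <= 1].
   Half of [eps] goes to [f], half to [G]. *)
pose L := \sum_i cabs (l 0 i); pose K := 1 + \sum_i \sum_j cabs (m i 0 j).
have L0 : 0 <= L by apply: sumr_ge0 => i _; exact: cabs_ge0.
have K1 : 1 <= K.
  by rewrite lerDl; apply: sumr_ge0 => i _; apply: sumr_ge0 => j _; exact: cabs_ge0.
have K0 : 0 < K by lra.
have L1 : 0 < L + 1 by lra.
have e1 : 0 < eps / 2 / K by rewrite !divr_gt0.
have [d1 d10 hd1] := hf _ e1.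
pose e2 := Num.min 1 (eps / 2 / (L + 1)).
have e20 : 0 < e2 by rewrite lt_min ltr01 !divr_gt0.
have e21 : e2 <= 1 by rewrite ge_min lexx.
have e2L : L * e2 <= eps / 2.
  apply: (@le_trans _ _ (L * (eps / 2 / (L + 1)))).
    by rewrite ler_wpM2l // ge_min lexx orbT.
  by rewrite mulrCA ler_piMr ?ler_pdivrMr //; lra.
have /fin_all_exists2[d2 d20 hd2] : forall i, exists2 d : R, 0 < d &
    forall (h : 'rV[C]_k) (r : R), (forall i, cabs (h 0 i) <= r) -> 0 <= r -> r <= d ->
      cabs (G (a + h) 0 i - G a 0 i - \sum_j m i 0 j * h 0 j) <= e2 * r.
  by move=> i; exact: hG.
pose d3 := \big[Num.min/1]_i d2 i.
have d30 : 0 < d3.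
  apply: (big_ind (fun x => 0 < x)) => // x y x0 y0; by rewrite lt_min x0.
exists (Num.min d3 (d1 / K)); first by rewrite lt_min d30 divr_gt0.
move=> h r hr r0; rewrite le_min => /andP[rd3 rd1].
have hk i : cabs (G (a + h) 0 i - G a 0 i - \sum_j m i 0 j * h 0 j) <= e2 * r.
  by apply: hd2 => //; apply: le_trans rd3 _; exact: bigmin_le.
have hm i : cabs (\sum_j m i 0 j * h 0 j) <= (\sum_j cabs (m i 0 j)) * r.
  apply: le_trans (cabs_sum _ _ _) _; rewrite mulr_suml; apply: ler_sum => j _.
  by rewrite cabsM ler_wpM2l ?cabs_ge0.
have hk2 i : cabs ((G (a + h) - G a) 0 i) <= K * r.
  have := cabsD (G (a + h) 0 i - G a 0 i - \sum_j m i 0 j * h 0 j) (\sum_j m i 0 j * h 0 j).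
  rewrite subrK !mxE => h1; apply: le_trans h1 _.
  have h2 : \sum_j cabs (m i 0 j) <= \sum_i \sum_j cabs (m i 0 j).
    by rewrite [leRHS](bigD1 i) //= lerDl; apply: sumr_ge0 => ? _; apply: sumr_ge0 => ? _; exact: cabs_ge0.
  by have := hk i; have := hm i; rewrite /K; nra.
have Kr0 : 0 <= K * r by rewrite mulr_ge0 // ltW.
have Kr : K * r <= d1 by rewrite mulrC -ler_pdivlMr.
have := hd1 (G (a + h) - G a) (K * r) hk2 Kr0 Kr; rewrite subrKC => h1.
have E1 : eps / 2 / K * (K * r) = eps / 2 * r by rewrite mulrA divfK // gt_eqF.
rewrite E1 in h1.
have h2 : cabs (\sum_i l 0 i * (G (a + h) - G a) 0 i - \sum_j (\row_j \sum_i l 0 i * m i 0 j) 0 j * h 0 j) <= eps / 2 * r.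
  have -> : \sum_j (\row_j \sum_i l 0 i * m i 0 j) 0 j * h 0 j = \sum_i l 0 i * \sum_j m i 0 j * h 0 j.
    under eq_bigr => j _ do rewrite mxE mulr_suml.
    rewrite exchange_big /=; apply: eq_bigr => i _; rewrite mulr_sumr.
    by apply: eq_bigr => j _; rewrite mulrA.
  rewrite -sumrB; apply: le_trans (cabs_sum _ _ _) _.
  apply: (@le_trans _ _ (L * (e2 * r))); last by rewrite mulrA ler_wpM2r.
  rewrite mulr_suml; apply: ler_sum => i _.
  by rewrite -mulrBr cabsM ler_wpM2l ?cabs_ge0 // !mxE.
set S1 := \sum_i l 0 i * _ in h1 h2; set S2 := \sum_j _ in h2 *.
have := cabsD (f (G (a + h)) - f (G a) - S1) (S1 - S2).
by rewrite addrA subrK; lra.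
Qed.

Lemma dC_comp n k (f : 'rV[C]_n -> C) (G : 'rV[C]_k -> 'rV[C]_n) a j :
  An f (G a) -> (forall i, An (fun x => G x 0 i) a) ->
  dC j (fun x => f (G x)) a = \sum_i dC i f (G a) * dC j (fun x => G x 0 i) a.
Proof.
move=> hf hG; rewrite (dCE j (isD_comp (An_isD hf) (fun i => An_isD (hG i)))) mxE.
by [].
Qed.

Lemma dC_cst n c (a : 'rV[C]_n) i : dC i (fun=> c) a = 0.
Proof.
have -> : (fun=> c) = peval (mC n c) by apply/funext => x; rewrite pevalC.
by rewrite dC_peval mpoly.mderivC peval0.
Qed.

Lemma dC_coord n (a : 'rV[C]_n) i j : dC i (fun x => x 0 j) a = (i == j)%:R.
Proof.
have -> : (fun x : 'rV[C]_n => x 0 j) = peval (mX (U_ j)) by apply/funext => x; rewrite pevalXU.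
by rewrite dC_peval mderivXU pevalC.
Qed.

(** Sums and products are polynomials in two functions, so their analyticity and their derivatives
    are instances of [An_comp] and [dC_comp]. *)
Definition pair2 n (f g : 'rV[C]_n -> C) (x : 'rV[C]_n) : 'rV[C]_2 :=
  \row_(i < 2) if i == ord0 then f x else g x.

Lemma An_pair2 n (f g : 'rV[C]_n -> C) a i : An f a -> An g a -> An (fun x => pair2 f g x 0 i) a.
Proof.
move=> hf hg; rewrite (_ : (fun x => _) = if i == ord0 then f else g); first by case: ifP.
by apply/funext => x; rewrite mxE; case: ifP.
Qed.

Lemma An_mul n (f g : 'rV[C]_n -> C) a : An f a -> An g a -> An (fun x => f x * g x) a.
Proof.
move=> hf hg; pose p : MP 2 := mX (U_ ord0) * mX (U_ (lift ord0 ord0)).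
have -> : (fun x => f x * g x) = (fun x => peval p (pair2 f g x)).
  by apply/funext => x; rewrite pevalM !pevalXU !mxE.
by apply: An_comp; [exact: An_peval|move=> i; exact: An_pair2].
Qed.

Lemma dC_mul n (f g : 'rV[C]_n -> C) a i : An f a -> An g a ->
  dC i (fun x => f x * g x) a = dC i f a * g a + f a * dC i g a.
Proof.
move=> hf hg; pose p : MP 2 := mX (U_ ord0) * mX (U_ (lift ord0 ord0)).
have -> : (fun x => f x * g x) = (fun x => peval p (pair2 f g x)).
  by apply/funext => x; rewrite pevalM !pevalXU !mxE.
rewrite dC_comp; [|exact: An_peval|by move=> j; exact: An_pair2].
rewrite !big_ord_recl big_ord0 !dC_peval !mpoly.mderivM !mderivXU !pevalD !pevalM !pevalXU !pevalC !mxE /=.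
have -> : (fun x => pair2 f g x 0 ord0) = f by apply/funext => x; rewrite mxE.
have -> : (fun x => pair2 f g x 0 (lift ord0 ord0)) = g by apply/funext => x; rewrite mxE.
ring.
Qed.

Lemma dC_add n (f g : 'rV[C]_n -> C) a i : An f a -> An g a ->
  dC i (fun x => f x + g x) a = dC i f a + dC i g a.
Proof.
move=> hf hg; pose p : MP 2 := mX (U_ ord0) + mX (U_ (lift ord0 ord0)).
have -> : (fun x => f x + g x) = (fun x => peval p (pair2 f g x)).
  by apply/funext => x; rewrite pevalD !pevalXU !mxE.
rewrite dC_comp; [|exact: An_peval|by move=> j; exact: An_pair2].
rewrite !big_ord_recl big_ord0 !dC_peval !mpoly.mderivD !mderivXU !pevalD !pevalC /=.
have -> : (fun x => pair2 f g x 0 ord0) = f by apply/funext => x; rewrite mxE.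
have -> : (fun x => pair2 f g x 0 (lift ord0 ord0)) = g by apply/funext => x; rewrite mxE.
ring.
Qed.

Lemma An_scale n (f : 'rV[C]_n -> C) a c : An f a -> An (fun x => c * f x) a.
Proof. by move=> hf; apply: An_mul => //; exact: An_cst. Qed.

Lemma dC_scale n (f : 'rV[C]_n -> C) a c i : An f a -> dC i (fun x => c * f x) a = c * dC i f a.
Proof. by move=> hf; rewrite dC_mul ?dC_cst ?mul0r ?add0r //; exact: An_cst. Qed.

Lemma An_opp n (f : 'rV[C]_n -> C) a : An f a -> An (fun x => - f x) a.
Proof.
by move=> hf; rewrite (_ : (fun x => _) = fun x => -1 * f x);
  [exact: An_scale|apply/funext => x; rewrite mulN1r].
Qed.

Lemma dC_opp n (f : 'rV[C]_n -> C) a i : An f a -> dC i (fun x => - f x) a = - dC i f a.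
Proof.
move=> hf; rewrite -mulN1r -dC_scale //; congr (dC i _ a).
by apply/funext => x; rewrite mulN1r.
Qed.

Lemma An_sub n (f g : 'rV[C]_n -> C) a : An f a -> An g a -> An (fun x => f x - g x) a.
Proof. by move=> hf hg; apply: An_add => //; exact: An_opp. Qed.

Lemma dC_sub n (f g : 'rV[C]_n -> C) a i : An f a -> An g a ->
  dC i (fun x => f x - g x) a = dC i f a - dC i g a.
Proof. by move=> hf hg; rewrite dC_add ?dC_opp //; exact: An_opp. Qed.

Lemma An_sum n (I : Type) (s : seq I) (P : pred I) (F : I -> 'rV[C]_n -> C) a :
  (forall i, An (F i) a) -> An (fun x => \sum_(i <- s | P i) F i x) a.
Proof.
move=> h; elim: s => [|i s IH].
  by under eq_fun do rewrite big_nil; exact: An_cst.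
under eq_fun do rewrite big_cons.
by case: (P i) => //; exact: An_add.
Qed.

Lemma dC_sum n (I : Type) (s : seq I) (P : pred I) (F : I -> 'rV[C]_n -> C) a j :
  (forall i, An (F i) a) ->
  dC j (fun x => \sum_(i <- s | P i) F i x) a = \sum_(i <- s | P i) dC j (F i) a.
Proof.
move=> h; elim: s => [|i s IH].
  by under eq_fun do rewrite big_nil; rewrite dC_cst big_nil.
under eq_fun do rewrite big_cons.
rewrite big_cons; case: (P i) => //; rewrite dC_add ?IH //; exact: An_sum.
Qed.

Lemma An_prod n (I : Type) (s : seq I) (P : pred I) (F : I -> 'rV[C]_n -> C) a :
  (forall i, An (F i) a) -> An (fun x => \prod_(i <- s | P i) F i x) a.
Proof.
move=> h; elim: s => [|i s IH].
  by under eq_fun do rewrite big_nil; exact: An_cst.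
under eq_fun do rewrite big_cons.
by case: (P i) => //; exact: An_mul.
Qed.

Lemma An_exp n (f : 'rV[C]_n -> C) a k : An f a -> An (fun x => f x ^+ k) a.
Proof.
move=> hf; elim: k => [|k IH].
  by under eq_fun do rewrite expr0; exact: An_cst.
by under eq_fun do rewrite exprS; exact: An_mul.
Qed.

(** If [f] is not the zero germ, it is nonzero at some [b] so close to [a] that [a] is inside a
    polydisc around [b] where [g] is analytic. There [g] vanishes near [b], hence near [a] by
    [AnE_identity]. *)
Lemma An_domain n (f g : 'rV[C]_n -> C) a : An f a -> An g a ->
  (\forall x \near a, f x * g x = 0) ->
  (\forall x \near a, f x = 0) \/ (\forall x \near a, g x = 0).
Proof.
move=> hf [e e0 hg] fg; have [h|nh] := pselect (\forall x \near a, f x = 0); [by left|right].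
have [b [ba [fb fgb hfb]]] : exists b : 'rV[C]_n, (forall i, cabs (b 0 i - a 0 i) <= e / 4) /\
    [/\ f b != 0, \forall x \near b, f x * g x = 0 & An f b].
  apply: contrapT => nb; apply: nh.
  have e4 : 0 < e / 4 by lra.
  have hd : \forall x \near a, disc a (e / 4) x by apply/nbhs_disc; exists (e / 4).
  have nfg := near_near fg; have nf := An_nbhs hf; near=> x.
  apply: contrapT => /eqP fx; apply: nb; exists x; split.
    have hx : disc a (e / 4) x by near: x.
    by move=> i; apply: ltW; exact: hx.
  split; [exact: fx|near: x; exact: nfg|near: x; exact: nf].
have gb : \forall x \near b, g x = 0.
  near=> x; have fx : f x != 0 by near: x; exact: An_neq0.
  have : f x * g x = 0 by near: x.
  by move/eqP; rewrite mulf_eq0 (negPf fx) => /eqP.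
have e2 : 0 < e / 2 by lra.
have hz := AnE_identity e2 (AnE_shift e0 _ hg) gb.
apply/nbhs_disc; exists (e / 4); first by lra.
move=> x hx; apply: hz => i; first by apply: le_trans (ba i) _; lra.
have := cabsB (x 0 i - a 0 i) (b 0 i - a 0 i); have := hx i; have := ba i.
have -> : x 0 i - a 0 i - (b 0 i - a 0 i) = x 0 i - b 0 i by ring.
by lra.
Unshelve. all: by end_near. Qed.

(** Induction on the degree of [m]: a derivative lowers it and multiplies the coefficient by an
    exponent that is nonzero in characteristic 0. *)
Lemma mpoly_zero n (p : MP n) : (forall x, peval p x = 0) -> p = 0.
Proof.
move=> hp; apply/mpoly.mpolyP => m; rewrite mpoly.mcoeff0.
move: {2}(mpoly.mdeg m) (erefl (mpoly.mdeg m)) => k.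
elim: k m p hp => [|k IH] m p hp hm.
  by move/eqP: hm; rewrite mpoly.mdeg_eq0 => /eqP ->; rewrite -peval_at0 hp.
have [i mi] : exists i, (m i != 0)%N.
  apply: contrapT => h; have : mpoly.mdeg m = 0%N.
    by rewrite mpoly.mdegE big1 // => i _; apply: contrapT => /eqP ?; apply: h; exists i.
  by rewrite hm.
have le1 : mpoly.lem (U_ i) m by rewrite mpoly.lep1mP.
have hm' : mpoly.mdeg (mpoly.mnm_sub m (U_ i)) = k.
  by have := mpoly.mdegD (mpoly.mnm_sub m (U_ i)) (U_ i); rewrite mpoly.submK // mpoly.mdeg1 hm addn1 => -[].
have hd : forall x, peval (mpoly.mderiv i p) x = 0.
  move=> x; rewrite -dC_peval; have -> : peval p = fun=> 0 by apply/funext.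
  by rewrite dC_cst.
have := IH _ _ hd hm'; rewrite mpoly.mcoeff_deriv mpoly.submK //.
by move/eqP; rewrite mulrn_eq0 /= => /eqP.
Qed.

(** A polynomial is an admissible limit on polydiscs of any radius, so [AnE_identity] reaches every
    [x]. *)
Lemma mpoly_zero_near n (p : MP n) (a : 'rV[C]_n) : (\forall x \near a, peval p x = 0) -> p = 0.
Proof.
move=> hp; apply: mpoly_zero => x.
pose e := 1 + \sum_i cabs (x 0 i - a 0 i).
have e0 : 0 < e by rewrite ltr_wpDr // sumr_ge0 // => i _; exact: cabs_ge0.
apply: (@AnE_identity R n e a _ e0 _ hp) => [|i].
  exists (fun=> pcomp (shiftp a) p), (fun=> 0), (wn e (pcomp (shiftp a) p)); split=> //.
  - exact: null0.
  - by move=> j k; rewrite subrr wn0 addr0.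
  - by move=> y _ k; rewrite peval_shift subrK subrr cabs0.
rewrite /e (bigD1 i) //= addrCA ltrDl ltr_wpDr // sumr_ge0 // => j _; exact: cabs_ge0.
Qed.

End Derivatives.

(** * The implicit function theorem *)

Section ImplicitFunction.
Variable R : realType.
Local Notation C := (Cx R).
Local Notation MP n := (mpoly.mpoly n (Cx R)).
Local Notation mco := mpoly.mcoeff.
Local Notation mX := (mpoly.mpolyX (Cx R)).
Local Notation mC n c := (mpoly.mpolyC n (c : Cx R)).
Local Notation U_ := mpoly.mnm1.

(** The error recursion for iterates of a contraction by 1/2 that is itself known up to [u k]. *)
Lemma null_rec (u v : nat -> R) : null u -> (forall k, v k.+1 = u k + 2^-1 * v k) -> null v.
Proof.
move=> hu hv; apply/nullP => eps eps0.
have e4 : 0 < eps / 4 by lra.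
have [N hN] := (nullP u).1 hu _ e4.
have h1 i : `|v (N + i)%N| <= 2^-1 ^+ i * `|v N| + eps / 2.
  elim: i => [|i IH]; first by rewrite addn0 expr0 mul1r; have := normr_ge0 (v N); lra.
  rewrite addnS hv exprS; apply: le_trans (ler_normD _ _) _.
  rewrite normrM (@ger0_norm _ 2^-1) ?invr_ge0 //.
  by have := hN (N + i)%N (leq_addr _ _); lra.
have g : null (fun i => `|v N| * (2^-1 : R) ^+ i).
  by apply: nullZ; apply: null_geo; rewrite ?invr_ge0 ?invf_lt1 //; lra.
have e2 : 0 < eps / 2 by lra.
have [N' hN'] := null_lt g e2.
exists (N + N')%N => k hk; have -> : k = (N + (k - N))%N by lia.
have := h1 (k - N)%N; have := hN' (k - N)%N; rewrite mulrC.
have -> : (N' <= k - N)%N by lia.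
by move=> /(_ isT); lra.
Qed.

Lemma null_bounded (u : nat -> R) : null u -> exists W, forall k, u k <= W.
Proof.
move=> hu; have [N hN] := null_lt hu ltr01.
exists (1 + \sum_(i < N) `|u i|) => k; have [/hN|kN] := leqP N k.
  move=> /ltW h; apply: le_trans h _; rewrite lerDl sumr_ge0 //.
rewrite (bigD1 (Ordinal kN)) //=; have := ler_norm (u k).
have : 0 <= \sum_(i < N | i != Ordinal kN) `|u i| by rewrite sumr_ge0.
by lra.
Qed.

Lemma sub_add_cancel (K : comNzRingType) (x y z : K) : (x + y) - (x + z) = y - z.
Proof. ring. Qed.

Lemma sub_sub_rearrange (K : comNzRingType) (x p1 z1 p2 z2 : K) :
  (x - p1 - z1) - (x - p2 - z2) = - (p1 - p2) - z1 + z2.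
Proof. ring. Qed.

(** * Picard iteration on polynomials *)

Section FixedPoint.
Variable q : nat.
Let iw : 'I_(q + 1) := rshift q ord0.

Definition mglue (t : MP q) (i : 'I_(q + 1)) : MP q :=
  match fintype.split i with inl j => mX (U_ j) | inr _ => t end.

Lemma glue_l t (j : 'I_q) : mglue t (lshift 1 j) = mX (U_ j).
Proof. by rewrite /mglue -[lshift 1 j]/(unsplit (inl j)) unsplitK. Qed.

Lemma glue_r t : mglue t iw = t.
Proof. by rewrite /mglue -[iw]/(unsplit (inr ord0)) unsplitK. Qed.

Lemma split1P (P : 'I_(q + 1) -> Prop) : (forall j, P (lshift 1 j)) -> P iw -> forall i, P i.
Proof.
move=> hl hr i; rewrite -(splitK i); case: (fintype.split i) => j /=; first exact: hl.
by rewrite (ord1 j).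
Qed.

Lemma pcompZ n k (g : 'I_n -> MP k) c (p : MP n) : pcomp g (c *: p) = c *: pcomp g p.
Proof. by rewrite -mpoly.mul_mpolyC pcompM pcompC mpoly.mul_mpolyC. Qed.

Lemma pcomp_sum n k (g : 'I_n -> MP k) (I : Type) (s : seq I) (F : I -> MP n) :
  pcomp g (\sum_(i <- s) F i) = \sum_(i <- s) pcomp g (F i).
Proof.
apply: (big_morph _ (pcompD g)).
by rewrite -(mpoly.mpolyC0 n C) pcompC mpoly.mpolyC0.
Qed.

(** Without a linear term in the last variable, [t] enters only through terms of degree at least 2,
    and these contract on a small ball. *)
Lemma pcomp_glue (t : MP q) (M : MP (q + 1)) :
  mco mpoly.mnm0 M = 0 -> mco (U_ iw) M = 0 ->
  pcomp (mglue t) M = pcomp (mglue 0) (hpart 1 M) + pcomp (mglue t) (tail 2 M).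
Proof.
move=> h0 h1; have E : M = hpart 1 M + tail 2 M.
  rewrite {1}(hpart_sum 2 M) !big_ord_recl big_ord0 addr0 /= hpart0 h0 mpoly.mpolyC0 add0r.
  by rewrite /bump.
have E1 : pcomp (mglue t) (hpart 1 M) = pcomp (mglue 0) (hpart 1 M).
  rewrite hpart1 (pcomp_sum (mglue t)) (pcomp_sum (mglue 0)).
  apply: eq_bigr => i _; rewrite (pcompZ (mglue t)) (pcompZ (mglue 0)) (pcompXU (mglue t)) (pcompXU (mglue 0)).
  by elim/split1P: i => [j|]; [rewrite (glue_l t) (glue_l 0)|rewrite h1 !scale0r].
by rewrite -E1 {1}E pcompD.
Qed.

Variables (M : nat -> MP (q + 1)) (u : nat -> R) (B E : R).
Hypothesis E0 : 0 < E.
Hypothesis hu : null u.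
Hypothesis hB : forall k, wn E (M k) <= B.
Hypothesis hC : forall j k, wn E (M j - M k) <= u j + u k.
Hypothesis M0 : forall k, mco mpoly.mnm0 (M k) = 0.
Hypothesis M1 : forall k, mco (U_ iw) (M k) = 0.

Let B0 : 0 <= B. Proof. by apply: le_trans (hB 0%N); apply: wn_ge0; exact: ltW. Qed.
(** The second bound gives [(2 * r / E) ^+ 2 * B <= r / 2], hence both size at most [r / 2] and
    Lipschitz constant 1/2 for the part of degree at least 2. *)
Let r := Num.min (E / 2) (E ^+ 2 / (8 * (B + 1))).
Let B8 : 0 < 8 * (B + 1). Proof. by have := B0; lra. Qed.
Let r0 : 0 < r. Proof. by rewrite lt_min !divr_gt0 // exprn_gt0. Qed.
Let rE : r <= E / 2. Proof. by rewrite ge_min lexx. Qed.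
Let rB : r * (8 * (B + 1)) <= E ^+ 2.
Proof. by rewrite -ler_pdivlMr // ge_min lexx orbT. Qed.
(** The second bound gives [e / E * B <= r / 2], which controls the linear part. *)
Let e := Num.min r (r * E / (2 * (B + 1))).
Let B2 : 0 < 2 * (B + 1). Proof. by have := B0; lra. Qed.
Let e0 : 0 < e. Proof. by rewrite lt_min r0 divr_gt0 // mulr_gt0. Qed.
Let er : e <= r. Proof. by rewrite ge_min lexx. Qed.
Let eB : e * (2 * (B + 1)) <= r * E.
Proof. by rewrite -ler_pdivlMr // ge_min lexx orbT. Qed.

Lemma wn_glue t i : wn e t <= r -> wn e (mglue t i) <= r.
Proof.
move=> ht; elim/split1P: i => [j|]; rewrite ?glue_r // glue_l wnX mpoly.mdeg1 expr1.
exact: er.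
Qed.

Lemma fp_self k t : wn e t <= r -> wn e (pcomp (mglue t) (M k)) <= r.
Proof.
move=> ht; rewrite pcomp_glue //; apply: le_trans (wnD _ _ (ltW e0)) _.
have eE : e <= E by have := er; have := rE; have := E0; lra.
have h1 : wn e (pcomp (mglue 0) (hpart 1 (M k))) <= r / 2.
  apply: (@le_trans _ _ (wn e (hpart 1 (M k)))).
    apply: wn_comp; first exact: ltW.
    move=> i; elim/split1P: i => [j|]; first by rewrite glue_l wnX mpoly.mdeg1 expr1.
    by rewrite glue_r wn0 ltW.
  have -> : hpart 1 (M k) = hpart 1 (tail 1 (M k)).
    by apply/mpoly.mpolyP => m; rewrite !mco_hpart mco_tail; case: eqP => // ->.
  apply: le_trans (wn_hpart _ _ (ltW e0)) _; apply: le_trans (wn_tail _ _ (ltW e0) eE E0) _.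
  rewrite expr1; apply: (@le_trans _ _ (e / E * B)).
    by rewrite ler_wpM2l ?hB // divr_ge0 // ltW.
  by rewrite mulrAC ler_pdivrMr //; have := eB; have := e0; have := B0; nra.
have h2 : wn e (pcomp (mglue t) (tail 2 (M k))) <= r / 2.
  apply: le_trans (wn_comp _ (ltW e0) (fun i => wn_glue i ht)) _.
  have rE' : r <= E by have := rE; have := E0; lra.
  apply: le_trans (wn_tail _ _ (ltW r0) rE' E0) _.
  apply: (@le_trans _ _ ((r / E) ^+ 2 * B)).
    by rewrite ler_wpM2l ?hB // exprn_ge0 // divr_ge0 // ltW.
  rewrite expr_div_n mulrAC ler_pdivrMr ?exprn_gt0 //.
  apply: (@le_trans _ _ (r / 2 * (r * (8 * (B + 1))))); last by rewrite ler_wpM2l ?rB // divr_ge0 // ltW.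
  have hb := B0; rewrite expr2.
  have : 0 <= r * r by apply: mulr_ge0; exact: ltW.
  by nra.
by apply: le_trans (lerD h1 h2) _; rewrite -splitr.
Qed.

Lemma fp_contract k t t' d : 0 <= d -> wn e t <= r -> wn e t' <= r -> wn e (t - t') <= d ->
  wn e (pcomp (mglue t) (M k) - pcomp (mglue t') (M k)) <= 2^-1 * d.
Proof.
move=> d0 ht ht' hd; rewrite (pcomp_glue t) // (pcomp_glue t') //.
rewrite sub_add_cancel.
have r2 : r < 2 * r by have := r0; lra.
have r2E : 2 * r <= E by have := rE; lra.
have r20 : 0 <= 2 * r by have := r0; lra.
apply: le_trans (@wn_compB R _ _ e r (2 * r) d (mglue t) (mglue t') (tail 2 (M k)) (ltW e0) (ltW r0) r2 d0 _ _ _) _.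
- by move=> i; exact: wn_glue.
- by move=> i; exact: wn_glue.
- by move=> i; elim/split1P: i => [j|]; rewrite ?glue_l ?glue_r ?subrr ?wn0.
rewrite ler_wpM2r //.
have -> : 2 * r - r = r by ring.
rewrite ler_pdivrMl ?r0 //; apply: le_trans (wn_tail _ _ r20 r2E E0) _.
apply: (@le_trans _ _ ((2 * r / E) ^+ 2 * B)).
  by rewrite ler_wpM2l ?hB // exprn_ge0 // divr_ge0 // ltW.
rewrite expr_div_n mulrAC ler_pdivrMr ?exprn_gt0 //.
apply: (@le_trans _ _ (r / 2 * (r * (8 * (B + 1))))); last by rewrite ler_wpM2l ?rB // divr_ge0 // ltW.
have h := r0; have hb := B0; rewrite exprMn !expr2.
have : 0 <= r * r by apply: mulr_ge0; exact: ltW.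
by nra.
Qed.

(** Step [k] applies the [k]-th approximant, so that the iterates are polynomials; [fpu] adds the
    errors of the approximants to those of the contraction. *)
Fixpoint fp k : MP q := if k is k'.+1 then pcomp (mglue (fp k')) (M k') else 0.
Fixpoint fpu k : R := if k is k'.+1 then u k' + 2^-1 * fpu k' else r.

Lemma wn_fp k : wn e (fp k) <= r.
Proof. by elim: k => [|k IH] /=; [rewrite wn0 ltW|exact: fp_self]. Qed.

Lemma u_ge0 k : 0 <= u k.
Proof. by have := hC k k; rewrite subrr wn0; lra. Qed.

Lemma fpu_ge0 k : 0 <= fpu k.
Proof. by elim: k => [|k IH] /=; [exact: ltW|have := u_ge0 k; lra]. Qed.

Lemma wn_fpB j k : wn e (fp j - fp k) <= fpu j + fpu k.
Proof.
elim: j k => [|j IH] k.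
  by rewrite sub0r wnN; apply: le_trans (wn_fp k) _; rewrite /= lerDl fpu_ge0.
case: k => [|k].
  by rewrite subr0; apply: le_trans (wn_fp _) _; rewrite [fpu 0]/= lerDr fpu_ge0.
have -> : fp j.+1 - fp k.+1 = pcomp (mglue (fp j)) (M j - M k) +
   (pcomp (mglue (fp j)) (M k) - pcomp (mglue (fp k)) (M k)).
  by rewrite pcompB addrA subrK.
apply: le_trans (wnD _ _ (ltW e0)) _.
have h1 : wn e (pcomp (mglue (fp j)) (M j - M k)) <= u j + u k.
  apply: le_trans (wn_comp _ (ltW e0) (fun i => wn_glue i (wn_fp j))) _.
  apply: le_trans (hC j k); apply: wn_mono; [exact: ltW|have := rE; have := E0; lra].
have d0 : 0 <= fpu j + fpu k by rewrite addr_ge0 ?fpu_ge0.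
have := fp_contract k d0 (wn_fp j) (wn_fp k) (IH k).
by rewrite /=; lra.
Qed.

Lemma fp_exists : exists (e r : R) (t : nat -> MP q) (v : nat -> R),
  [/\ 0 < e /\ e <= r, r <= E, null v &
  [/\ forall k, wn e (t k) <= r, forall j k, wn e (t j - t k) <= v j + v k,
      forall k, t k.+1 = pcomp (mglue (t k)) (M k), t 0%N = 0 &
      forall k s s', wn e s <= r -> wn e s' <= r ->
        wn e (pcomp (mglue s) (M k) - pcomp (mglue s') (M k)) <= 2^-1 * wn e (s - s')]].
Proof.
exists e, r, fp, fpu; split=> //.
- by have := rE; have := E0; lra.
- by apply: (null_rec hu).
split=> //; [exact: wn_fp|exact: wn_fpB|].
by move=> k s s' hs hs'; apply: fp_contract => //; apply: wn_ge0; exact: ltW.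
Qed.

End FixedPoint.

Definition jn q (x : 'rV[C]_q) (w : C) : 'rV[C]_(q + 1) := row_mx x (const_mx w : 'rV_1).

Lemma jnl q (x : 'rV[C]_q) w j : jn x w 0 (lshift 1 j) = x 0 j.
Proof. by rewrite /jn row_mxEl. Qed.

Lemma jnr q (x : 'rV[C]_q) w : jn x w 0 (rshift q ord0) = w.
Proof. by rewrite /jn row_mxEr mxE. Qed.

Lemma jnK q (v : 'rV[C]_(q + 1)) : jn (lsubmx v) (v 0 (rshift q ord0)) = v.
Proof.
rewrite -[RHS]hsubmxK /jn; congr row_mx.
by apply/rowP => i; rewrite !mxE (ord1 i).
Qed.

Lemma jnB q (x x' : 'rV[C]_q) w w' : jn x w - jn x' w' = jn (x - x') (w - w').
Proof.
rewrite /jn opp_row_mx add_row_mx; congr row_mx.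
by apply/rowP => i; rewrite !mxE.
Qed.

Lemma peval_glue q (t : MP q) (M : MP (q + 1)) x :
  peval (pcomp (mglue t) M) x = peval M (jn x (peval t x)).
Proof.
rewrite peval_comp; congr peval; apply/rowP => i; rewrite mxE.
by elim/split1P: i => [j|]; rewrite ?glue_l ?glue_r ?jnl ?jnr ?pevalXU.
Qed.

Lemma cabs_null_eq (x y : C) u : null u -> (forall k, cabs (x - y) <= u k) -> x = y.
Proof.
move=> hu h; apply/eqP; rewrite -subr_eq0 -cabs_eq0; apply/eqP/le_anti.
rewrite cabs_ge0 andbT; apply: (le_null hu) => k; rewrite add0r; exact: h.
Qed.

(** The Newton method with the derivative frozen at the base point. With [y] the last coordinate
    minus [b] and [N = y - G / c0], the equation [G = 0] is [N = y]; and [N] has neither a constant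
    term nor a linear term in [y], as the fixed point needs. *)
Theorem scalar_ift q (G : 'rV[C]_(q + 1) -> C) (a : 'rV[C]_q) (b : C) :
  An G (jn a b) -> G (jn a b) = 0 -> dC (rshift q ord0) G (jn a b) != 0 ->
  exists th : 'rV[C]_q -> C, [/\ An th a, th a = b,
    \forall x \near a, G (jn x (th x)) = 0 &
    \forall v \near jn a b, G v = 0 -> v 0 (rshift q ord0) = th (lsubmx v)].
Proof.
set iw := rshift q ord0; set pt := jn a b; set c0 := dC iw G pt.
move=> [E E0 [p [u [B hW]]]] G0 c00.
have [hu hB hC hf] := hW.
have [l hl hl2] := AnW_isD E0 hW.
have cl : c0 = l 0 iw by rewrite /c0 (dCE iw hl).
pose N (v : 'rV[C]_(q + 1)) := v 0 iw - b - c0^-1 * G v.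
pose T k : MP (q + 1) := mX (U_ iw) - c0^-1 *: p k.
(* These coefficients vanish only in the limit. Subtracting them makes the approximants satisfy [M0]
   and [M1] exactly, at the cost of a null sequence. *)
pose z k := mco mpoly.mnm0 (T k); pose s k := mco (U_ iw) (T k).
pose M k := T k - mC _ (z k) - s k *: mX (U_ iw).
have ic0 : 0 <= (cabs c0)^-1 by rewrite invr_ge0 cabs_ge0.
have hz k : cabs (z k) <= (cabs c0)^-1 * u k.
  rewrite /z mpoly.mcoeffB mpoly.mcoeffZ mpoly.mcoeffX.
  have -> : (U_ iw == mpoly.mnm0 :> mpoly.multinom (q + 1)) = false.
    by apply/eqP => h; have := mpoly.mdeg1 iw; rewrite h mpoly.mdeg0.
  rewrite sub0r cabsN cabsM cabsV ler_wpM2l // -peval_at0.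
  have := hf pt _ k; rewrite subrr G0 sub0r cabsN; apply => i.
  by rewrite subrr cabs0 ltW.
have hs k : cabs (s k) <= (cabs c0)^-1 * (2 * u k / E).
  rewrite /s mpoly.mcoeffB mpoly.mcoeffZ mpoly.mcoeffX eqxx.
  have -> : true%:R - c0^-1 * mco (U_ iw) (p k) = c0^-1 * (l 0 iw - mco (U_ iw) (p k)).
    by rewrite -cl mulrBr mulVf.
  by rewrite cabsM cabsV ler_wpM2l // cabsBC; exact: hl2.
pose w k := (cabs c0)^-1 * u k + (cabs c0)^-1 * u k + (cabs c0)^-1 * (2 * u k).
have u0 := AnE_ge0 pt (ltW E0) hC.
have hw : null w.
  apply: nullD; first by apply: nullD; exact: nullZ.
  by apply: nullZ; exact: nullZ.
have wnM' k : wn E (mC (q + 1) (z k) + s k *: mX (U_ iw)) <= (cabs c0)^-1 * u k + (cabs c0)^-1 * (2 * u k).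
  apply: le_trans (wnD _ _ (ltW E0)) _; apply: lerD; first by rewrite wnC.
  rewrite wnZ wnX mpoly.mdeg1 expr1; apply: (@le_trans _ _ ((cabs c0)^-1 * (2 * u k / E) * E)).
    by rewrite ler_wpM2r ?hs // ltW.
  by rewrite -mulrA divfK // gt_eqF.
have MT k : M k = T k - (mC (q + 1) (z k) + s k *: mX (U_ iw)) by rewrite /M opprD addrA.
have MC j k : wn E (M j - M k) <= w j + w k.
  have -> : M j - M k = - (c0^-1 *: (p j - p k)) - (mC (q + 1) (z j) + s j *: mX (U_ iw))
     + (mC (q + 1) (z k) + s k *: mX (U_ iw)).
    by rewrite !MT /T sub_sub_rearrange scalerBr.
  apply: le_trans (wnD _ _ (ltW E0)) _.
  have h1 := wnB (- (c0^-1 *: (p j - p k))) (mC (q + 1) (z j) + s j *: mX (U_ iw)) (ltW E0).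
  have h2 : wn E (- (c0^-1 *: (p j - p k))) <= (cabs c0)^-1 * u j + (cabs c0)^-1 * u k.
    by rewrite wnN wnZ cabsV -mulrDr ler_wpM2l.
  apply: le_trans (lerD (le_trans h1 (lerD h2 (wnM' j))) (wnM' k)) _.
  by rewrite le_eqVlt; apply/orP; left; apply/eqP; rewrite /w; ring.
have [W hW1] := null_bounded hw.
have MB k : wn E (M k) <= E + (cabs c0)^-1 * B + W.
  rewrite MT; apply: le_trans (wnB _ _ (ltW E0)) _.
  apply: lerD; last first.
    by apply: le_trans (hW1 k); apply: le_trans (wnM' k) _; rewrite /w; have := mulr_ge0 ic0 (u0 k); lra.
  apply: le_trans (wnB _ _ (ltW E0)) _; apply: lerD; first by rewrite wnX mpoly.mdeg1 expr1.
  by rewrite wnZ cabsV ler_wpM2l.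
have pt0 : mco mpoly.mnm0 (mX (U_ iw)) = 0.
  rewrite mpoly.mcoeffX; case: eqP => // h.
  by have := mpoly.mdeg1 iw; rewrite h mpoly.mdeg0.
have Mz k : mco mpoly.mnm0 (M k) = 0.
  rewrite /M 2!mpoly.mcoeffB mpoly.mcoeffZ pt0 mulr0 subr0 mpoly.mcoeffC eqxx mulr1.
  by rewrite subrr.
have Ms k : mco (U_ iw) (M k) = 0.
  rewrite /M 2!mpoly.mcoeffB mpoly.mcoeffZ mpoly.mcoeffX eqxx mulr1 mpoly.mcoeffC.
  by rewrite mpoly.mnm1_eq0 mulr0 subr0 subrr.
have NM (v : 'rV[C]_(q + 1)) : (forall i, cabs (v 0 i - pt 0 i) <= E) -> forall k, cabs (N v - peval (M k) (v - pt)) <= w k.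
  move=> hv k; rewrite MT /T !pevalB pevalD !pevalZ pevalXU pevalC /N.
  have -> : (v - pt) 0 iw = v 0 iw - b by rewrite mxE [X in _ + X]mxE /pt jnr.
  set y := v 0 iw - b; set P := peval _ _.
  have -> : y - c0^-1 * G v - (y - c0^-1 * P - (z k + s k * y)) =
    - (c0^-1 * (G v - P)) + (z k + s k * y) by ring.
  apply: le_trans (cabsD _ _) _; rewrite cabsN cabsM cabsV.
  have h1 : (cabs c0)^-1 * cabs (G v - P) <= (cabs c0)^-1 * u k by rewrite ler_wpM2l // hf.
  have h2 : cabs (s k * y) <= (cabs c0)^-1 * (2 * u k).
    rewrite cabsM; apply: (@le_trans _ _ ((cabs c0)^-1 * (2 * u k / E) * E)).
      apply: ler_pM; rewrite ?cabs_ge0 ?hs //.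
      by have := hv iw; rewrite /pt jnr.
    by rewrite -mulrA divfK // gt_eqF.
  by have := cabsD (z k) (s k * y); have := hz k; rewrite /w; lra.
have [e [r [t [v [[e0 er] rE hv [ht1 ht2 ht3 ht4 ht5]]]]]] := fp_exists E0 hw MB MC Mz Ms.
have r0 : 0 <= r by exact: le_trans (ltW e0) er.
(* [th] is the limit of the iterates on the polydisc and arbitrary elsewhere; [b] is added at the
   end. *)
have /choice[th hth] : forall x : 'rV[C]_q, exists l0 : C, (forall i, cabs (x 0 i - a 0 i) <= e) ->
    forall k, cabs (peval (t k) (x - a) - l0) <= v k + v k.
  move=> x; have [hx|nx] := pselect (forall i, cabs (x 0 i - a 0 i) <= e); last by exists 0.
  have [|l0 hl0] := @squeezed_limitC R (fun k => peval (t k) (x - a)) v; last by exists l0.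
  move=> j k; rewrite -pevalB; apply: le_trans (ht2 j k).
  by apply: peval_le => i; rewrite !mxE.
have v0 : forall k, 0 <= v k by move=> k; have := ht2 k k; rewrite subrr wn0; lra.
have nvv : null (fun k => v k + v k) by exact: nullD.
have thr (x : 'rV[C]_q) : (forall i, cabs (x 0 i - a 0 i) <= e) -> cabs (th x) <= r.
  move=> hx; apply: (le_null nvv) => k.
  have := cabsB (peval (t k) (x - a)) (peval (t k) (x - a) - th x).
  have -> : peval (t k) (x - a) - (peval (t k) (x - a) - th x) = th x by ring.
  have := hth x hx k; have : cabs (peval (t k) (x - a)) <= r.
    by apply: le_trans (ht1 k); apply: peval_le => i; rewrite !mxE.
  by lra.
have contr k (x : 'rV[C]_q) y y' : (forall i, cabs (x 0 i) <= e) -> cabs y <= r -> cabs y' <= r ->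
    cabs (peval (M k) (jn x y) - peval (M k) (jn x y')) <= 2^-1 * cabs (y - y').
  move=> hx hy hy'.
  have := ht5 k (mC q y) (mC q y'); rewrite !wnC => /(_ hy hy').
  rewrite -mpoly.mpolyCB wnC; apply: le_trans.
  have E1 := peval_glue (mC q y) (M k) x; rewrite (pevalC y x) in E1.
  have E2 := peval_glue (mC q y') (M k) x; rewrite (pevalC y' x) in E2.
  rewrite -E1 -E2 -pevalB; exact: peval_le.
have jE (x : 'rV[C]_q) y : (forall i, cabs (x 0 i - a 0 i) <= e) -> cabs y <= r ->
    forall i, cabs (jn x (b + y) 0 i - pt 0 i) <= E.
  move=> hx hy i; elim/split1P: i => [j|]; rewrite /pt ?jnl ?jnr.
    by apply: le_trans (hx j) _; exact: le_trans er rE.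
  by rewrite [b + y]addrC addrK; exact: le_trans hy rE.
have jsub (x : 'rV[C]_q) y : jn x (b + y) - pt = jn (x - a) y.
  by rewrite /pt jnB [b + y]addrC addrK.
have fixN (x : 'rV[C]_q) : (forall i, cabs (x 0 i - a 0 i) <= e) -> N (jn x (b + th x)) = th x.
  move=> hx; have hx' i : cabs ((x - a) 0 i) <= e by rewrite !mxE.
  have nu : null (fun k => (w k + 2^-1 * (v k + v k)) + (v k.+1 + v k.+1)).
    apply: nullD; first by apply: nullD => //; exact: nullZ.
    by have := nvv; rewrite /null -(cvg_shiftS (fun k => v k + v k)).
  apply: (cabs_null_eq nu) => k.
  have h1 := NM _ (jE x (th x) hx (thr x hx)) k; rewrite jsub in h1.
  have tr : cabs (peval (t k) (x - a)) <= r by apply: le_trans (ht1 k); exact: peval_le.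
  have h2 := contr k (x - a) (th x) (peval (t k) (x - a)) hx' (thr x hx) tr.
  have h3 : peval (M k) (jn (x - a) (peval (t k) (x - a))) = peval (t k.+1) (x - a).
    by rewrite ht3 peval_glue.
  have h4 := hth x hx k; have h5 := hth x hx k.+1; rewrite h3 in h2.
  rewrite cabsBC in h4.
  set A := N _ in h1 *; set B1 := peval (M k) _ in h1 h2; set D := peval (t k.+1) _ in h2 h5.
  have -> : A - th x = (A - B1) + (B1 - D) + (D - th x) by ring.
  have := cabsD (A - B1 + (B1 - D)) (D - th x); have := cabsD (A - B1) (B1 - D).
  by lra.
have Nz (x : 'rV[C]_(q + 1)) : N x = x 0 iw - b -> G x = 0.
  rewrite /N => /eqP; rewrite -subr_eq0 addrC addKr oppr_eq0 mulf_eq0 invr_eq0 (negPf c00).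
  by move=> /eqP.
have Nz' (x : 'rV[C]_(q + 1)) : G x = 0 -> N x = x 0 iw - b by rewrite /N => ->; rewrite mulr0 subr0.
have tha : th a = 0.
  apply: (cabs_null_eq nvv) => k; have ha i : cabs (a 0 i - a 0 i) <= e by rewrite subrr cabs0 ltW.
  have := hth a ha k; rewrite subrr.
  have -> : peval (t k) 0 = 0; last by rewrite sub0r subr0 cabsN.
  elim: k => [|k IH]; first by rewrite ht4 peval0.
  rewrite ht3 peval_glue IH.
  have -> : jn 0 0 = 0 :> 'rV[C]_(q + 1).
    by apply/rowP => i; elim/split1P: i => [j|]; rewrite ?jnl ?jnr !mxE.
  by rewrite peval_at0.
exists (fun x => b + th x); split.
- exists e => //; exists (fun k => mC q b + t k), (fun k => v k + v k), (cabs b + r); split=> //.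
  + by move=> k; apply: le_trans (wnD _ _ (ltW e0)) _; rewrite wnC lerD.
  + move=> j k; rewrite sub_add_cancel; apply: le_trans (ht2 j k) _.
    by have := v0 j; have := v0 k; lra.
  + move=> x hx k; rewrite pevalD pevalC opprD addrACA subrr add0r cabsBC; exact: hth.
- by rewrite tha addr0.
- apply/nbhs_disc; exists e => // x hx; apply: Nz; rewrite jnr fixN; last by move=> i; exact/ltW/hx.
  by rewrite [b + _]addrC addrK.
- apply/nbhs_disc; exists e => // y hy Gy; set x := lsubmx y.
  have hx i : cabs (x 0 i - a 0 i) <= e.
    by have := hy (lshift 1 i); rewrite /pt jnl /x !mxE => /ltW.
  have hx' i : cabs ((x - a) 0 i) <= e by rewrite mxE [X in _ + X]mxE; exact: hx.
  pose y1 := y 0 iw - b.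
  have y1r : cabs y1 <= r.
    by have := hy iw; rewrite /pt jnr => /ltW h; exact: le_trans h er.
  have yE : y = jn x (b + y1) by rewrite /y1 subrKC /x jnK.
  have fy : N (jn x (b + y1)) = y1 by rewrite -yE; exact: Nz'.
  (* Both are fixed points of a contraction by 1/2, up to the errors [w k]. *)
  have key : y1 = th x.
    apply/eqP; rewrite -subr_eq0 -cabs_eq0; apply/eqP/le_anti; rewrite cabs_ge0 andbT.
    suff : cabs (y1 - th x) <= 2^-1 * cabs (y1 - th x) by lra.
    have nww : null (fun k => w k + w k) by exact: nullD.
    apply: (le_null nww) => k.
    have h1 := NM _ (jE x y1 hx y1r) k; rewrite jsub fy in h1.
    have h2 := NM _ (jE x (th x) hx (thr x hx)) k; rewrite jsub fixN // in h2.
    have h3 := contr k (x - a) y1 (th x) hx' y1r (thr x hx).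
    set A := peval _ _ in h1 h3; set A' := peval _ (jn (x - a) (th x)) in h2 h3.
    have E1 : y1 - th x = (y1 - A) + (A - A') - (th x - A') by ring.
    rewrite {1}E1.
    have := cabsB (y1 - A + (A - A')) (th x - A'); have := cabsD (y1 - A) (A - A').
    by lra.
  by rewrite -key /y1 subrKC.
Qed.

End ImplicitFunction.

Lemma integral_root_sum (A K : comNzRingType) (f : {rmorphism A -> K}) (h : K) l (c : 'I_l -> K) :
  (forall i, integralOver f (c i)) -> h ^+ l + \sum_(i < l) c i * h ^+ i = 0 -> integralOver f h.
Proof.
move=> hc hh.
pose q : {poly K} := \poly_(i < l) (if insub i is Some j then c j else 0).
have sq : (size q <= l)%N by exact: size_poly.
have mp : 'X^l + q \is monic by rewrite monicE lead_coefDl ?lead_coefXn // size_polyXn ltnS.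
apply: (integral_root_monic mp).
  rewrite rootE hornerD hornerXn (horner_coef_wide _ sq) -[X in _ == X]hh; apply/eqP.
  congr (_ + _); apply: eq_bigr => i _; rewrite coef_poly ltn_ord insubT //= => il.
  by congr (c _ * _); exact: val_inj.
apply/integral_poly => i; rewrite coefD coefXn coef_poly.
apply: integral_add; first exact: integral_nat.
case: ifP => il; last exact: (integral_nat f 0).
by rewrite insubT.
Qed.

(** * Nash functions *)

Section EvalHom.
Variables (R : realType) (n : nat) (V : set 'rV[Cx R]_n) (a : 'rV[Cx R]_n).
Local Notation C := (Cx R).
Local Notation MP n := (mpoly.mpoly n (Cx R)).

(** Composed with it, functions that satisfy an identity on [V] satisfy it everywhere: the identity
    becomes an equation in the ring of all functions, and the theory of integral elements
    applies. *)
Definition retract (x : 'rV[C]_n) : 'rV[C]_n := if pselect (V x) is left _ then x else a.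

Lemma retractE x : V x -> retract x = x.
Proof. by rewrite /retract; case: pselect. Qed.

Lemma retract_in x : V a -> V (retract x).
Proof. by rewrite /retract; case: pselect. Qed.

(* Polynomials as elements of the ring of all functions, frozen outside V. *)
Definition evr (p : MP n) : 'rV[C]_n -> C := fun x => peval p (retract x).

Lemma evr_additive : additive evr.
Proof. by move=> p q; apply/funext => x; rewrite /evr pevalB. Qed.

Lemma evr_multiplicative : multiplicative evr.
Proof.
split; first by move=> p q; apply/funext => x; rewrite /evr pevalM.
by apply/funext => x; rewrite /evr peval1.
Qed.

HB.instance Definition _ := GRing.isAdditive.Build (MP n) ('rV[C]_n -> C) evr evr_additive.
HB.instance Definition _ := GRing.isMultiplicative.Build (MP n) ('rV[C]_n -> C) evr evr_multiplicative.

End EvalHom.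

Section Nash.
Variable R : realType.
Local Notation C := (Cx R).
Local Notation MP n := (mpoly.mpoly n (Cx R)).
Local Notation mX := (mpoly.mpolyX (Cx R)).
Local Notation mC n c := (mpoly.mpolyC n (c : Cx R)).
Local Notation U_ := mpoly.mnm1.

Definition ev n (P : {poly MP n}) (f : 'rV[C]_n -> C) (x : 'rV[C]_n) : C := (eval_at P x).[f x].

Lemma evE n k (P : {poly MP n}) f x : (size P <= k)%N ->
  ev P f x = \sum_(i < k) peval P`_i x * f x ^+ i.
Proof.
move=> hk; rewrite /ev /eval_at (@horner_coef_wide _ k).
  by apply: eq_bigr => i _; rewrite coef_map pevalE.
exact: leq_trans (size_poly _ _) hk.
Qed.

Lemma evD n (P Q : {poly MP n}) f x : ev (P + Q) f x = ev P f x + ev Q f x.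
Proof. by rewrite /ev /eval_at rmorphD /= hornerD. Qed.
Lemma evM n (P Q : {poly MP n}) f x : ev (P * Q) f x = ev P f x * ev Q f x.
Proof. by rewrite /ev /eval_at rmorphM /= hornerM. Qed.
Lemma evC n (p : MP n) f x : ev p%:P f x = peval p x.
Proof. by rewrite /ev /eval_at map_polyC /= hornerC pevalE. Qed.
Lemma evX n f (x : 'rV[C]_n) : ev 'X f x = f x.
Proof. by rewrite /ev /eval_at map_polyX hornerX. Qed.
Lemma ev0 n f (x : 'rV[C]_n) : ev 0 f x = 0.
Proof. by rewrite /ev /eval_at rmorph0 horner0. Qed.

Lemma evU n (P : {poly MP n}) f x : ev P f x = (eval_at P x).[f x].
Proof. by []. Qed.

Opaque ev.

Definition Alg n (f : 'rV[C]_n -> C) (a : 'rV[C]_n) : Prop :=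
  exists2 P : {poly MP n}, P != 0 & \forall x \near a, ev P f x = 0.

Definition Nash n (f : 'rV[C]_n -> C) (a : 'rV[C]_n) : Prop := An f a /\ Alg f a.

Definition Intg n (f : 'rV[C]_n -> C) (a : 'rV[C]_n) : Prop :=
  exists2 P : {poly MP n}, P \is monic & \forall x \near a, ev P f x = 0.

Lemma Intg_near n (f g : 'rV[C]_n -> C) (a : 'rV[C]_n) :
  (\forall x \near a, f x = g x) -> Intg f a -> Intg g a.
Proof.
move=> fg [P mP hP]; exists P => //; near=> x.
have fgx : f x = g x by near: x.
by rewrite evU -fgx -evU; near: x.
Unshelve. all: by end_near. Qed.

Lemma Alg_near n (f g : 'rV[C]_n -> C) (a : 'rV[C]_n) :
  (\forall x \near a, f x = g x) -> Alg f a -> Alg g a.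
Proof.
move=> fg [P mP hP]; exists P => //; near=> x.
have fgx : f x = g x by near: x.
by rewrite evU -fgx -evU; near: x.
Unshelve. all: by end_near. Qed.

Lemma Nash_near n (f g : 'rV[C]_n -> C) (a : 'rV[C]_n) :
  (\forall x \near a, f x = g x) -> Nash f a -> Nash g a.
Proof. by move=> fg [h1 h2]; split; [exact: An_near fg h1|exact: Alg_near fg h2]. Qed.

Lemma integral_ev n (V : set 'rV[C]_n) a f (P : {poly MP n}) : V a ->
  root (map_poly (evr V a) P) (f \o retract V a) <-> forall x, V x -> ev P f x = 0.
Proof.
move=> Va.
have key x : (map_poly (evr V a) P).[f \o retract V a] x = ev P f (retract V a x).
  rewrite (evE f (retract V a x) (leqnn (size P))) (@horner_coef_wide _ (size P)); last exact: size_poly.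
  rewrite fct_sumE; apply: eq_bigr => i _; rewrite coef_map /=.
  rewrite /GRing.mul /= /evr; congr (_ * _).
  by elim: (nat_of_ord i) => [|k IH]; rewrite ?expr0 // !exprS -IH.
split=> [/rootP h x Vx|h].
  by have := congr1 (fun g => g x) h; rewrite key retractE.
apply/rootP/funext => x; rewrite key; apply: h; exact: retract_in.
Qed.

Definition IntV n (V : set 'rV[C]_n) a f := integralOver (evr V a) (f \o retract V a).

Lemma IntVP n (V : set 'rV[C]_n) a f : V a ->
  IntV V a f <-> exists2 P : {poly MP n}, P \is monic & forall x, V x -> ev P f x = 0.
Proof. by move=> Va; split=> -[P mP hP]; exists P => //; apply/(integral_ev f P Va). Qed.

(** Finitely many germs share a neighborhood, hence one base morphism [evr V a]. *)
Lemma Intg_IntV n (I : finType) (f : I -> 'rV[C]_n -> C) (a : 'rV[C]_n) (W : set 'rV[C]_n) :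
  nbhs a W -> (forall i, Intg (f i) a) -> exists V, [/\ nbhs a V, V `<=` W & forall i, IntV V a (f i)].
Proof.
move=> hW /(_ _)/cid2 h; pose P i := s2val (h i).
pose V := [set x | W x /\ forall i, ev (P i) (f i) x = 0].
have hV : nbhs a V.
  have h2 : \forall x \near a, forall i, ev (P i) (f i) x = 0.
    have h1 i : \forall x \near a, ev (P i) (f i) x = 0 := s2valP' (h i).
    exact: filter_forall h1.
  by near=> x; split; near: x.
exists V; split=> //; first by move=> x [].
move=> i; apply/(IntVP _ (nbhs_singleton hV)); exists (P i); first exact: (s2valP (h i)).
by move=> x [_].
Unshelve. all: by end_near. Qed.

Lemma IntV_Intg n (V : set 'rV[C]_n) a f : nbhs a V -> IntV V a f -> Intg f a.
Proof.
move=> hV /(IntVP _ (nbhs_singleton hV))[P mP hP]; exists P => //.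
by apply: filterS hV => x; exact: hP.
Qed.

Lemma Intg_op2 n (op : C -> C -> C) (f g : 'rV[C]_n -> C) a :
  (forall V, IntV V a f -> IntV V a g -> IntV V a (fun x => op (f x) (g x))) ->
  Intg f a -> Intg g a -> Intg (fun x => op (f x) (g x)) a.
Proof.
move=> h hf hg.
have [|V [hV _ hVi]] := @Intg_IntV n bool (fun b => if b then f else g) a setT filterT.
  by case.
by apply: (IntV_Intg hV); apply: h; [exact: (hVi true)|exact: (hVi false)].
Qed.

Lemma Intg_add n (f g : 'rV[C]_n -> C) a : Intg f a -> Intg g a -> Intg (fun x => f x + g x) a.
Proof. by apply: Intg_op2 => V hf hg; apply: (integral_add hf hg). Qed.

Lemma Intg_mul n (f g : 'rV[C]_n -> C) a : Intg f a -> Intg g a -> Intg (fun x => f x * g x) a.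
Proof. by apply: Intg_op2 => V hf hg; apply: (integral_mul hf hg). Qed.

Lemma Intg_peval n (p : MP n) a : Intg (peval p) a.
Proof.
exists ('X - p%:P); first exact: monicXsubC.
by near=> x; rewrite evD evX -polyCN evC -[- p]add0r pevalB peval0 sub0r subrr.
Unshelve. all: by end_near. Qed.

Lemma Intg_cst n c (a : 'rV[C]_n) : Intg (fun=> c) a.
Proof.
have -> : (fun=> c) = peval (mC n c) by apply/funext => x; rewrite pevalC.
exact: Intg_peval.
Qed.

Lemma Intg_exp n (f : 'rV[C]_n -> C) a k : Intg f a -> Intg (fun x => f x ^+ k) a.
Proof.
move=> hf; elim: k => [|k IH].
  by under eq_fun do rewrite expr0; exact: Intg_cst.
by under eq_fun do rewrite exprS; exact: Intg_mul.
Qed.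

Lemma Intg_sum n (I : Type) (s : seq I) (P : pred I) (F : I -> 'rV[C]_n -> C) a :
  (forall i, Intg (F i) a) -> Intg (fun x => \sum_(i <- s | P i) F i x) a.
Proof.
move=> h; elim: s => [|i s IH].
  by under eq_fun do rewrite big_nil; exact: Intg_cst.
under eq_fun do rewrite big_cons.
by case: (P i) => //; exact: Intg_add.
Qed.

Lemma Intg_ev n (P : {poly MP n}) f a : Intg f a -> Intg (ev P f) a.
Proof.
move=> hf; have -> : ev P f = fun x => \sum_(i < size P) peval P`_i x * f x ^+ i.
  by apply/funext => x; rewrite -evE.
by apply: Intg_sum => i; apply: Intg_mul; [exact: Intg_peval|exact: Intg_exp].
Qed.

Lemma Intg_root n (h : 'rV[C]_n -> C) (a : 'rV[C]_n) l (c : 'I_l -> 'rV[C]_n -> C) :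
  (forall i, Intg (c i) a) ->
  (\forall x \near a, h x ^+ l + \sum_(i < l) c i x * h x ^+ i = 0) -> Intg h a.
Proof.
move=> hc hh; have [V [hV VW hVi]] := Intg_IntV hh hc.
have Va := nbhs_singleton hV; apply: (IntV_Intg hV).
have t1 := fun H => @integral_root_sum (MP n) _ (evr V a) (h \o retract V a) l (fun i => c i \o retract V a) hVi H.
refine (t1 _) => {t1}.
apply/funext => x; have := VW _ (retract_in x Va); rewrite /mkset.
have pw k (g : 'rV[C]_n -> C) : (g ^+ k) x = g x ^+ k.
  by elim: k => [|k IH]; rewrite ?expr0 // !exprS -IH.
move=> hx; transitivity (h (retract V a x) ^+ l + \sum_(i < l) c i (retract V a x) * h (retract V a x) ^+ i); last exact: hx.
have -> : ((h \o retract V a) ^+ l + \sum_(i < l) (c i \o retract V a) * (h \o retract V a) ^+ i) x =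
  ((h \o retract V a) ^+ l) x + (\sum_(i < l) (c i \o retract V a) * (h \o retract V a) ^+ i) x by [].
rewrite pw fct_sumE; congr (_ + _); apply: eq_bigr => i _.
by have -> : ((c i \o retract V a) * (h \o retract V a) ^+ i) x = (c i \o retract V a) x * ((h \o retract V a) ^+ i) x by []; rewrite pw.
Qed.

Lemma An_ev n (P : {poly MP n}) f a : An f a -> An (ev P f) a.
Proof.
move=> hf; have -> : ev P f = fun x => \sum_(i < size P) peval P`_i x * f x ^+ i.
  by apply/funext => x; rewrite -evE.
by apply: An_sum => i; apply: An_mul; [exact: An_peval|exact: An_exp].
Qed.

(** Multiplying the equation of [f] by a power of its leading coefficient [A] gives a monic equation
    for [A * f]. *)
Lemma Alg_lead n (f : 'rV[C]_n -> C) (a : 'rV[C]_n) : Alg f a ->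
  exists2 A : MP n, A != 0 & Intg (fun x => peval A x * f x) a.
Proof.
move=> [P P0 hP]; pose D := (size P).-1.
have sP : size P = D.+1 by rewrite prednK // size_poly_gt0.
exists (lead_coef P); first by rewrite lead_coef_eq0.
case E : D => [|D'].
  exfalso; have h0 : \forall x \near a, peval P`_0 x = 0.
    by apply: filterS hP => x; rewrite (@evE _ 1) ?sP ?E // big_ord1 expr0 mulr1.
  have := mpoly_zero_near h0; move/eqP; apply/negP.
  have -> : P`_0 = lead_coef P by rewrite lead_coefE sP E.
  by rewrite lead_coef_eq0.
set A := lead_coef P; have AE : A = P`_D'.+1 by rewrite /A lead_coefE sP E.
apply: (@Intg_root n _ a D'.+1 (fun i x => peval P`_i x * peval A x ^+ (D' - i))).
  by move=> i; apply: Intg_mul; [exact: Intg_peval|apply: Intg_exp; exact: Intg_peval].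
apply: filterS hP => x; rewrite (@evE _ D'.+2) ?sP ?E // big_ord_recr /= -AE => h.
transitivity (peval A x ^+ D' * (\sum_(i < D'.+1) peval P`_i x * f x ^+ i + peval A x * f x ^+ D'.+1)).
  rewrite mulrDr mulr_sumr addrC; congr (_ + _); last by rewrite exprMn exprS; ring.
  apply: eq_bigr => i _; have iD : (i <= D')%N by rewrite -ltnS ltn_ord.
  have -> : peval A x ^+ D' = peval A x ^+ (D' - i) * peval A x ^+ i by rewrite -exprD subnK.
  by rewrite exprMn; ring.
by rewrite h mulr0.
Qed.

Lemma Intg_Alg n (f : 'rV[C]_n -> C) (a : 'rV[C]_n) (A : MP n) : A != 0 ->
  Intg (fun x => peval A x * f x) a -> Alg f a.
Proof.
move=> A0 [Z mZ hZ]; exists (Z \Po (A%:P * 'X)).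
  by rewrite comp_poly_eq0 ?monic_neq0 // size_mulX ?polyC_eq0 // size_polyC A0.
apply: filterS hZ => x; rewrite !evU /eval_at map_comp_poly horner_comp rmorphM /= map_polyC /= map_polyX.
by rewrite hornerM hornerC hornerX pevalE.
Qed.

(** As long as the constant term is 0, an equation of [e] can be divided by its variable, germs
    forming a domain. In the end the constant term [c] is nonzero, and the equation displays [c] as
    a multiple of [e]. *)
Lemma Alg_cofactor n (e : 'rV[C]_n -> C) (a : 'rV[C]_n) : An e a -> ~ (\forall x \near a, e x = 0) ->
  Alg e a -> exists2 B : MP n, B != 0 & exists Q : {poly MP n},
    \forall x \near a, peval B x = e x * ev Q e x.
Proof.
move=> he e0 [P P0 hP]; move: {2}(size P) (leqnn (size P)) => k.
elim: k P P0 hP => [|k IH] P P0 hP; first by rewrite leqn0 size_poly_eq0 (negPf P0).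
move=> sP; have [Q [c PE]] : exists (Q : {poly MP n}) c, P = Q * 'X + c%:P.
  by elim/poly_ind: {IH} P P0 hP sP => [|Q c _] *; [exists 0, 0; rewrite mul0r addr0|exists Q, c].
have hx : \forall x \near a, ev Q e x * e x + peval c x = 0.
  by apply: filterS hP => x; rewrite PE evD evM evX evC.
have [c0|c0] := eqVneq c 0; last first.
  exists c => //; exists (- Q); apply: filterS hx => x.
  have -> : ev (- Q) e x = - ev Q e x by apply/eqP; rewrite -addr_eq0 -evD addNr ev0.
  by move=> h; apply/eqP; rewrite -subr_eq0 mulrN opprK addrC mulrC h.
have Q0 : Q != 0 by apply: contra_neq P0 => Q0; rewrite PE c0 Q0 mul0r addr0.
have hx2 : \forall x \near a, ev Q e x * e x = 0.
  by apply: filterS hx => x; rewrite c0 peval0 addr0.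
have [hQ|//] := An_domain (An_ev Q he) he hx2.
apply: (IH Q Q0 hQ); move: sP; rewrite PE c0 addr0 size_mulX //.
Qed.

(** Times a common denominator [AA], the coefficients are integral. With [e l] the highest one that
    is not the zero germ, [e l * h] is integral; a nonzero polynomial [B] is a multiple of [e l] by
    [Alg_cofactor], so [B * h] is integral too. *)
Theorem Alg_trans n k (c : 'I_k -> 'rV[C]_n -> C) (h : 'rV[C]_n -> C) (a : 'rV[C]_n) :
  (forall i, Nash (c i) a) ->
  (\forall x \near a, \sum_(i < k) c i x * h x ^+ i = 0) ->
  (exists i, ~ \forall x \near a, c i x = 0) -> Alg h a.
Proof.
move=> hc hh [i0 hi0].
pose nz i := `[< ~ \forall x \near a, c i x = 0 >].
have nzi0 : nz i0 by apply/asboolP.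
case: (arg_maxnP (fun i : 'I_k => i : nat) nzi0) => l /asboolP hl lmax.
have /fin_all_exists2[A A0 hA] := fun i => Alg_lead (hc i).2.
pose AA := \prod_i A i.
have AA0 : AA != 0 by apply/prodf_neq0 => i _.
pose e i x := peval AA x * c i x.
have eI i : Intg (e i) a.
  have -> : e i = fun x => peval (\prod_(j | j != i) A j) x * (peval (A i) x * c i x).
    by apply/funext => x; rewrite /e /AA (bigD1 i) //= pevalM; ring.
  by apply: Intg_mul => //; exact: Intg_peval.
have eA i : An (e i) a by apply: An_mul; [exact: An_peval|exact: (hc i).1].
have e0 : ~ \forall x \near a, e l x = 0.
  move=> h0; have [/mpoly_zero_near|//] := An_domain (An_peval AA a) (hc l).1 h0.
  by move/eqP; rewrite (negPf AA0).
have he : \forall x \near a, \sum_(i < k | (i < l)%N) e i x * h x ^+ i + e l x * h x ^+ l = 0.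
  have hz : \forall x \near a, forall i : 'I_k, (l < i)%N -> c i x = 0.
    suff H (i : 'I_k) : \forall x \near a, (l < i)%N -> c i x = 0 by exact: filter_forall H.
    have [li|li] := ltnP l i; last by near=> x.
    have : ~~ nz i by apply/negP => /lmax /=; rewrite leqNgt li.
    by move=> /asboolPn/contrapT; apply: filterS.
  near=> x; have hz' : forall i : 'I_k, (l < i)%N -> c i x = 0 by near: x.
  have : \sum_(i < k) c i x * h x ^+ i = 0 by near: x.
  rewrite (bigID (fun i : 'I_k => (i < l)%N)) /= [X in _ + X](bigD1 l) ?ltnn //= [X in _ + (_ + X)]big1; last first.
    move=> i /andP[il nil]; rewrite hz' ?mul0r // ltn_neqAle leqNgt il andbT.
    by apply: contra nil => /eqP/val_inj ->.
  rewrite addr0 => hs.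
  transitivity (peval AA x * (\sum_(i < k | (i < l)%N) c i x * h x ^+ i + c l x * h x ^+ l)).
    rewrite mulrDr mulr_sumr; congr (_ + _); last by rewrite /e mulrA.
    by apply: eq_bigr => i _; rewrite /e mulrA.
  by rewrite hs mulr0.
have l0 : (0 < l)%N.
  rewrite lt0n; apply/negP => /eqP l0; apply: e0; apply: filterS he => x.
  by rewrite l0 expr0 mulr1 big_pred0 ?add0r.
have yI : Intg (fun x => e l x * h x) a.
  apply: (@Intg_root n _ a l (fun i x => e (widen_ord (ltnW (ltn_ord l)) i) x * e l x ^+ (l.-1 - i))).
    by move=> i; apply: Intg_mul => //; exact: Intg_exp.
  apply: filterS he => x hx.
  transitivity (e l x ^+ l.-1 * (\sum_(i < k | (i < l)%N) e i x * h x ^+ i + e l x * h x ^+ l)); last by rewrite hx mulr0.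
  rewrite mulrDr addrC; congr (_ + _); last first.
    have -> : e l x ^+ l.-1 * (e l x * h x ^+ l) = e l x ^+ l.-1.+1 * h x ^+ l by rewrite exprS; ring.
    by rewrite prednK // exprMn.
  rewrite (big_ord_narrow (ltnW (ltn_ord l))) mulr_sumr; apply: eq_bigr => i _.
  have il : (i <= l.-1)%N by rewrite -ltnS prednK // ltn_ord.
  have -> : e l x ^+ l.-1 = e l x ^+ (l.-1 - i) * e l x ^+ i by rewrite -exprD subnK.
  move: (e l x) (h x) (e _ x) => el hx' ei; rewrite exprMn; ring.
have [B B0 [Q hQ]] : exists2 B : MP n, B != 0 & exists Q : {poly MP n},
    \forall x \near a, peval B x = e l x * ev Q (e l) x.
  apply: Alg_cofactor => //; have [P mP hP] := eI l.
  by exists P => //; exact: monic_neq0.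
apply: (Intg_Alg B0).
apply: (@Intg_near _ (fun x => ev Q (e l) x * (e l x * h x))).
  by apply: filterS hQ => x ->; ring.
by apply: Intg_mul => //; exact: Intg_ev.
Unshelve. all: by end_near. Qed.

Lemma Nash_peval n (p : MP n) a : Nash (peval p) a.
Proof.
split; first exact: An_peval.
have [P mP hP] := Intg_peval p a; exists P => //; exact: monic_neq0.
Qed.

Lemma Nash_cst n c (a : 'rV[C]_n) : Nash (fun=> c) a.
Proof.
have -> : (fun=> c) = peval (mC n c) by apply/funext => x; rewrite pevalC.
exact: Nash_peval.
Qed.

Lemma Nash_coord n (a : 'rV[C]_n) i : Nash (fun x => x 0 i) a.
Proof.
have -> : (fun x : 'rV[C]_n => x 0 i) = peval (mX (U_ i)) by apply/funext => x; rewrite pevalXU.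
exact: Nash_peval.
Qed.

Lemma Nash_add n (f g : 'rV[C]_n -> C) a : Nash f a -> Nash g a -> Nash (fun x => f x + g x) a.
Proof.
move=> [f1 /Alg_lead[A A0 hA]] [g1 /Alg_lead[B B0 hB]]; split; first exact: An_add.
apply: (@Intg_Alg _ _ _ (A * B)); first by rewrite mulf_neq0.
have -> : (fun x => peval (A * B) x * (f x + g x)) =
  fun x => peval B x * (peval A x * f x) + peval A x * (peval B x * g x).
  by apply/funext => x; rewrite pevalM; ring.
by apply: Intg_add; apply: Intg_mul => //; exact: Intg_peval.
Qed.

Lemma Nash_mul n (f g : 'rV[C]_n -> C) a : Nash f a -> Nash g a -> Nash (fun x => f x * g x) a.
Proof.
move=> [f1 /Alg_lead[A A0 hA]] [g1 /Alg_lead[B B0 hB]]; split; first exact: An_mul.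
apply: (@Intg_Alg _ _ _ (A * B)); first by rewrite mulf_neq0.
have -> : (fun x => peval (A * B) x * (f x * g x)) =
  fun x => (peval A x * f x) * (peval B x * g x).
  by apply/funext => x; rewrite pevalM; ring.
exact: Intg_mul.
Qed.

Lemma Nash_opp n (f : 'rV[C]_n -> C) a : Nash f a -> Nash (fun x => - f x) a.
Proof.
move=> hf; have -> : (fun x => - f x) = fun x => -1 * f x by apply/funext => x; rewrite mulN1r.
by apply: Nash_mul => //; exact: Nash_cst.
Qed.

Lemma Nash_sub n (f g : 'rV[C]_n -> C) a : Nash f a -> Nash g a -> Nash (fun x => f x - g x) a.
Proof. by move=> hf hg; apply: Nash_add => //; exact: Nash_opp. Qed.

Lemma Nash_sum n (I : Type) (s : seq I) (P : pred I) (F : I -> 'rV[C]_n -> C) a :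
  (forall i, Nash (F i) a) -> Nash (fun x => \sum_(i <- s | P i) F i x) a.
Proof.
move=> h; elim: s => [|i s IH].
  by under eq_fun do rewrite big_nil; exact: Nash_cst.
under eq_fun do rewrite big_cons.
by case: (P i) => //; exact: Nash_add.
Qed.

Lemma Nash_prod n (I : Type) (s : seq I) (P : pred I) (F : I -> 'rV[C]_n -> C) a :
  (forall i, Nash (F i) a) -> Nash (fun x => \prod_(i <- s | P i) F i x) a.
Proof.
move=> h; elim: s => [|i s IH].
  by under eq_fun do rewrite big_nil; exact: Nash_cst.
under eq_fun do rewrite big_cons.
by case: (P i) => //; exact: Nash_mul.
Qed.

Lemma Nash_exp n (f : 'rV[C]_n -> C) a k : Nash f a -> Nash (fun x => f x ^+ k) a.
Proof.
move=> hf; elim: k => [|k IH].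
  by under eq_fun do rewrite expr0; exact: Nash_cst.
by under eq_fun do rewrite exprS; exact: Nash_mul.
Qed.

Lemma Nash_ev n (P : {poly MP n}) f a : Nash f a -> Nash (ev P f) a.
Proof.
move=> hf; have -> : ev P f = fun x => \sum_(i < size P) peval P`_i x * f x ^+ i.
  by apply/funext => x; rewrite -evE.
by apply: Nash_sum => i; apply: Nash_mul; [exact: Nash_peval|exact: Nash_exp].
Qed.

Lemma Alg_div n (f g h : 'rV[C]_n -> C) (a : 'rV[C]_n) : Nash f a -> Nash g a ->
  ~ (\forall x \near a, g x = 0) -> (\forall x \near a, f x + g x * h x = 0) -> Alg h a.
Proof.
move=> hf hg g0 fgh.
apply: (@Alg_trans n 2 (fun i => if i == ord0 then f else g)).
- by move=> i; case: ifP.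
- by apply: filterS fgh => x; rewrite !big_ord_recl big_ord0 /= expr0 expr1 mulr1 addr0.
- by exists (lift ord0 ord0).
Qed.

Definition dpoly n (i : 'I_n) (P : {poly MP n}) : {poly MP n} := map_poly (mpoly.mderiv i) P.

Lemma dC_ev n (i : 'I_n) (P : {poly MP n}) f x : An f x ->
  dC i (ev P f) x = ev (dpoly i P) f x + ev P^`() f x * dC i f x.
Proof.
move=> hf; elim/poly_ind: P => [|P c IH].
  have -> : ev 0 f = fun=> 0 by apply/funext => y; rewrite ev0.
  by rewrite dC_cst /dpoly raddf0 deriv0 !ev0 mul0r addr0.
have -> : ev (P * 'X + c%:P) f = fun y => ev P f y * f y + peval c y.
  by apply/funext => y; rewrite evD evM evX evC.
rewrite dC_add; [|by apply: An_mul => //; exact: An_ev|exact: An_peval].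
rewrite (dC_mul i (An_ev P hf) hf).
rewrite IH dC_peval derivD derivM derivX derivC addr0 mulr1 evD evM evX.
have -> : dpoly i (P * 'X + c%:P) = dpoly i P * 'X + (mpoly.mderiv i c)%:P.
  rewrite /dpoly raddfD /= map_polyC /=; congr (_ + _).
  by apply/polyP => j; rewrite coefMX !coef_map_id0 ?raddf0 // coefMX; case: eqP => //; rewrite raddf0.
by rewrite evD evM evX evC; ring.
Qed.

(** The derivative of [P (f) = 0] is a linear equation for [dC i f], with leading coefficient
    [P' (f)]. If that is the zero germ, [P'] is an equation of [f] of smaller degree, and the
    induction continues with it. *)
Lemma Nash_dC n (i : 'I_n) (f : 'rV[C]_n -> C) a : Nash f a -> Nash (dC i f) a.
Proof.
move=> hf; split; first exact: An_dC hf.1.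
have [k] : exists k, exists P : {poly MP n}, [/\ P != 0, \forall x \near a, ev P f x = 0 & size P = k].
  by have [P P0 hP] := hf.2; exists (size P), P.
elim/ltn_ind: k => k IH [P [P0 hP sP]].
have [h|h] := pselect (\forall x \near a, ev P^`() f x = 0); last first.
  apply: (@Alg_div _ (ev (dpoly i P) f) (ev P^`() f)); [exact: Nash_ev|exact: Nash_ev|exact: h|].
  have hn := near_near hP; have hA := An_nbhs hf.1; near=> x.
  rewrite -dC_ev; last by near: x.
  have -> : dC i (ev P f) x = dC i (fun=> 0) x; last exact: dC_cst.
  by apply: dC_near; near: x.
have [sP1|sP1] := leqP (size P) 1.
  exfalso; have h0 : \forall x \near a, peval P`_0 x = 0.
    by apply: filterS hP => x; rewrite (@evE _ 1) // big_ord1 expr0 mulr1.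
  have /eqP := mpoly_zero_near h0.
  by move: P0; rewrite {1}(size1_polyC sP1) polyC_eq0 => /negPf ->.
have sd : (size P^`() < size P)%N by rewrite lt_size_deriv.
apply: (IH (size P^`())); first by rewrite -sP.
exists P^`(); split=> //.
apply/eqP => /(congr1 (fun Q : {poly MP n} => Q`_(size P).-2)); rewrite coef0 coef_deriv.
have -> : (size P).-2.+1 = (size P).-1 by rewrite prednK // -subn1 subn_gt0.
rewrite -lead_coefE => /eqP; rewrite -scaler_nat mpoly.mscalerI lead_coef_eq0 (negPf P0) orbF.
by rewrite pnatr_eq0 => /eqP h1; move: sP1; rewrite -subn_gt0 subn1 h1.
Unshelve. all: by end_near. Qed.

End Nash.
#[global] Opaque ev.

(** * Composition of Nash functions *)

Section NashComposition.
Variable R : realType.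
Local Notation C := (Cx R).
Local Notation MP n := (mpoly.mpoly n (Cx R)).
Local Notation mX := (mpoly.mpolyX (Cx R)).
Local Notation mC n c := (mpoly.mpolyC n (c : Cx R)).
Local Notation U_ := mpoly.mnm1.

Definition cpoly q (c : C) : {poly MP q} := (mC q c)%:P.

Lemma cpoly_additive q : additive (@cpoly q).
Proof. by move=> x y; rewrite /cpoly mpoly.mpolyCB polyCB. Qed.

Lemma cpoly_multiplicative q : multiplicative (@cpoly q).
Proof.
by split; [move=> x y; rewrite /cpoly mpoly.mpolyCM polyCM|rewrite /cpoly mpoly.mpolyC1].
Qed.

HB.instance Definition _ q := GRing.isAdditive.Build C {poly MP q} (@cpoly q) (@cpoly_additive q).
HB.instance Definition _ q :=
  GRing.isMultiplicative.Build C {poly MP q} (@cpoly q) (@cpoly_multiplicative q).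

Definition psub n q (h : 'I_n -> {poly MP q}) (p : MP n) : {poly MP q} := mpoly.mmap (@cpoly q) h p.

Lemma psubC n q (h : 'I_n -> {poly MP q}) c : psub h (mC n c) = (mC q c)%:P.
Proof. exact: mpoly.mmapC. Qed.
Lemma psubXU n q (h : 'I_n -> {poly MP q}) i : psub h (mX (U_ i)) = h i.
Proof. by rewrite /psub mpoly.mmapX mpoly.mmap1U. Qed.
Lemma psubD n q (h : 'I_n -> {poly MP q}) p p' : psub h (p + p') = psub h p + psub h p'.
Proof. exact: rmorphD. Qed.
Lemma psubM n q (h : 'I_n -> {poly MP q}) p p' : psub h (p * p') = psub h p * psub h p'.
Proof. exact: rmorphM. Qed.
Opaque psub.

Lemma ev_psub n q (h : 'I_n -> {poly MP q}) (p : MP n) (g : 'rV[C]_q -> C) x :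
  ev (psub h p) g x = peval p (\row_i ev (h i) g x).
Proof.
elim/mpoly_alg_ind: p => [c|i|p p' hp hp'|p p' hp hp'].
- by rewrite psubC evC !pevalC.
- by rewrite psubXU pevalXU mxE.
- rewrite psubD; etransitivity; first exact: evD.
  by etransitivity; [exact: (congr2 +%R hp hp')|exact: (esym (pevalD _ _ _))].
- rewrite psubM; etransitivity; first exact: evM.
  by etransitivity; [exact: (congr2 *%R hp hp')|exact: (esym (pevalM _ _ _))].
Qed.

Lemma Nash_pevalG n q (p : MP n) (G : 'rV[C]_q -> 'rV[C]_n) a :
  (forall i, Nash (fun x => G x 0 i) a) -> Nash (fun x => peval p (G x)) a.
Proof.
move=> hG; elim/mpoly_alg_ind: p => [c|i|p p' hp hp'|p p' hp hp'].
- by under eq_fun do rewrite pevalC; exact: Nash_cst.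
- by under eq_fun do rewrite pevalXU; exact: hG.
- by under eq_fun do rewrite pevalD; exact: Nash_add.
- by under eq_fun do rewrite pevalM; exact: Nash_mul.
Qed.

Definition pline n (v : 'rV[C]_n) (p : MP n) : {poly MP n} :=
  psub (fun i => (mX (U_ i))%:P + (mC n (v 0 i))%:P * 'X) p.

Lemma ev_pline n (v : 'rV[C]_n) (p : MP n) (t : C) x :
  ev (pline v p) (fun=> t) x = peval p (x + t *: v).
Proof.
rewrite /pline ev_psub; congr peval; apply/rowP => i.
by rewrite !mxE evD evM !evC evX pevalXU pevalC mulrC.
Qed.

(** Substituting [G] into the equation [P] of [f] may give 0 = 0, when the coefficients of [P]
    vanish on the image of [G]. So [P] is expanded at [G s + z v], with [v] a direction in which [P]
    is not zero, and divided by the largest possible power of [z] before setting [z = 0]. *)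
Lemma Alg_comp n q (f : 'rV[C]_n -> C) (G : 'rV[C]_q -> 'rV[C]_n) a :
  Nash f (G a) -> (forall i, Nash (fun x => G x 0 i) a) -> Alg (fun x => f (G x)) a.
Proof.
move=> [fA [P P0 hP]] hG; set b := G a in fA hP *.
have [i0 [y hy]] : exists i0 y, peval P`_i0 y != 0.
  apply: contrapT => h; move/eqP: P0; apply; apply/polyP => i; rewrite coef0.
  by apply: mpoly_zero => x; apply/eqP; apply: contrapT => hx; apply: h; exists i, x; apply/negP.
(* Some coefficient of [P] is nonzero at [y], so [P] is nonzero on the line through [b] and [y]. *)
pose v : 'rV[C]_n := y - b.
pose J := (\max_(i < size P) size (pline v (P`_i)%R))%N.
pose c j i s := peval (pline v (P`_i))`_j (G s).
pose nz j := `[< exists i : 'I_(size P), ~ \forall s \near a, c j i s = 0 >].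
have exnz : exists j, nz j.
  have hi0 : (i0 < size P)%N.
    by rewrite ltnNge; apply/negP => h; move: hy; rewrite nth_default // peval0 eqxx.
  have := ev_pline v (P`_i0) 1 b; rewrite scale1r /v subrKC (evE _ _ (leqnn _)) => hs.
  have [j hj] : exists j, peval (pline v (P`_i0))`_j b != 0.
    apply: contrapT => h; move: hy; rewrite -hs big1 ?eqxx // => i _.
    have -> : peval (pline (y - b) (P`_i0))`_i b = 0; last by rewrite mul0r.
    by apply/eqP; apply: contrapT => hx; apply: h; exists i; apply/negP.
  exists j; apply/asboolP; exists (Ordinal hi0) => /nbhs_singleton; rewrite /c /= => h.
  by move: hj; rewrite h eqxx.
(* The least order in [z] at which a coefficient of the expansion is not the zero germ in [s]. *)
have [j /asboolP[i1 hi1] jmin] := ex_minnP exnz.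
have GA i : An (fun x => G x 0 i) a by exact: (hG i).1.
apply: (@Alg_trans R q (size P) (fun i => c j i) (fun s => f (G s)) a).
- by move=> i; exact: Nash_pevalG.
- have hlow : \forall s \near a, forall i : 'I_(size P), forall j' : 'I_j, c j' i s = 0.
    suff H (i : 'I_(size P)) : \forall s \near a, forall j' : 'I_j, c j' i s = 0 by exact: filter_forall H.
    suff H (j' : 'I_j) : \forall s \near a, c j' i s = 0 by exact: filter_forall H.
    apply: contrapT => h; have : nz j' by apply/asboolP; exists i.
    by move=> /jmin; rewrite leqNgt ltn_ord.
  have hfA : \forall s \near a, An f (G s) by apply: (An_near_map GA); exact: An_nbhs.
  have hPs : \forall s \near a, \forall x \near G s, ev P f x = 0.
    by apply: (An_near_map GA (P := fun y => \forall x \near y, ev P f x = 0)); exact: near_near.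
  near=> s.
  have low : forall i : 'I_(size P), forall j' : 'I_j, c j' i s = 0 by near: s.
  have sA : An f (G s) by near: s.
  have sP : \forall x \near G s, ev P f x = 0 by near: s.
  pose L (z : 'rV[C]_1) := G s + z 0 0 *: v.
  have LA i : An (fun z => L z 0 i) 0.
    have -> : (fun z => L z 0 i) = fun z => G s 0 i + v 0 i * z 0 0.
      by apply/funext => z; rewrite !mxE [z 0 0 * _]mulrC.
    by apply: An_add; [exact: An_cst|apply: An_scale; exact: An_coord].
  have L0 : L 0 = G s by rewrite /L mxE scale0r addr0.
  have fLA : An (fun z => f (L z)) 0 by apply: An_comp => //; rewrite L0.
  (* The quotient of [ev P f (L z)] by [z ^+ j], which is the zero germ in [z] by [An_domain]. *)
  pose g (z : 'rV[C]_1) := \sum_(l < J) (if (l < j)%N then 0 else z 0 0 ^+ (l - j) *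
     \sum_(i < size P) c l i s * f (L z) ^+ i).
  have gA : An g 0.
    apply: An_sum => l; have [lj|lj] := boolP (l < j)%N; first exact: An_cst.
    apply: An_mul; first by apply: An_exp; exact: An_coord.
    by apply: An_sum => i; apply: An_scale; exact: An_exp.
  have zA : An (fun z : 'rV[C]_1 => z 0 0 ^+ j) 0 by apply: An_exp; exact: An_coord.
  have zg : \forall z \near (0 : 'rV[C]_1), (z : 'rV[C]_1) 0 0 ^+ j * g z = 0.
    have : \forall z \near (0 : 'rV[C]_1), ev P f (L z) = 0.
      by apply: (An_near_map LA (P := fun y => ev P f y = 0)); rewrite L0.
    apply: filterS => z; rewrite (evE _ _ (leqnn _)) => hz.
    have e1 (i : 'I_(size P)) : peval P`_i (L z) = \sum_(l < J) c l i s * z 0 0 ^+ l.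
      rewrite /L -ev_pline (@evE _ _ J) //.
      exact: (leq_bigmax (F := fun i : 'I_(size P) => size (pline v (P`_i)))).
    rewrite /g mulr_sumr -[RHS]hz.
    under [RHS]eq_bigr => i _ do rewrite e1 mulr_suml.
    rewrite exchange_big /=; apply: eq_bigr => l _; case: ltnP => lj.
      by rewrite mulr0 big1 // => i _; rewrite (low i (Ordinal lj)) !mul0r.
    rewrite mulrA -exprD subnKC // mulr_sumr; apply: eq_bigr => i _; ring.
  have [h|h] := An_domain zA gA zg.
    exfalso; move/nbhs_disc: h => [e e0 h].
    have := h (const_mx (cofr (e / 2))) _; rewrite mxE => H.
    have /eqP : cofr (e / 2) ^+ j = 0.
      by apply: H => i; rewrite !mxE subr0 cabs_cofr gtr0_norm ?divr_gt0 //; lra.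
    rewrite expf_eq0 => /andP[_ /eqP]; rewrite -(cofr0 R) => /cofr_inj.
    by move/eqP; rewrite gt_eqF // divr_gt0.
  have := nbhs_singleton h; rewrite /g.
  have [jJ|jJ] := ltnP j J; last first.
    move=> _; rewrite big1 // => i _; rewrite /c nth_default ?peval0 ?mul0r //.
    apply: leq_trans jJ; exact: (leq_bigmax (F := fun i : 'I_(size P) => size (pline v (P`_i)))).
  rewrite (bigD1 (Ordinal jJ)) //= ltnn subnn expr0 mul1r L0 [X in _ + X]big1 ?addr0 //.
  move=> l lj; have [lj1|jl] := ltnP l j; first by [].
  have jl' : (j < l)%N.
    by rewrite ltn_neqAle jl andbT; apply: contra lj => /eqP h1; apply/eqP/val_inj.
  by rewrite mxE expr0n subn_eq0 leqNgt jl' mul0r.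
- by exists i1.
Unshelve. all: by end_near. Qed.

Lemma Nash_comp n q (f : 'rV[C]_n -> C) (G : 'rV[C]_q -> 'rV[C]_n) a :
  Nash f (G a) -> (forall i, Nash (fun x => G x 0 i) a) -> Nash (fun x => f (G x)) a.
Proof.
move=> hf hG; split; last exact: Alg_comp.
by apply: An_comp; [exact: hf.1|move=> i; exact: (hG i).1].
Qed.

Lemma An_notzero n (f : 'rV[C]_n -> C) a i : An f a -> dC i f a != 0 ->
  ~ \forall x \near a, f x = 0.
Proof. by move=> _ hd h; move: hd; rewrite (dC_near i h) dC_cst eqxx. Qed.

(** A nonzero polynomial [B] is a multiple of [G] by [Alg_cofactor], so it vanishes on the graph of
    [th]; read as a polynomial in the last variable it is an equation of [th]. *)
Lemma Nash_ift q (G : 'rV[C]_(q + 1) -> C) (a : 'rV[C]_q) (b : C) (th : 'rV[C]_q -> C) :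
  Nash G (jn a b) -> dC (rshift q ord0) G (jn a b) != 0 -> An th a -> th a = b ->
  (\forall x \near a, G (jn x (th x)) = 0) -> Nash th a.
Proof.
move=> [GA Galg] hd thA tha hz; split=> //.
have [B B0 [Q hQ]] := Alg_cofactor GA (An_notzero GA hd) Galg.
have jA i : An (fun x => jn x (th x) 0 i) a.
  elim/split1P: i => [j|].
    by under eq_fun do rewrite jnl; exact: An_coord.
  by under eq_fun do rewrite jnr.
pose h (i : 'I_(q + 1)) : {poly MP q} :=
  match fintype.split i with inl j => (mX (U_ j))%:P | inr _ => 'X end.
have hE g x : \row_i ev (h i) g x = jn x (g x).
  apply/rowP => i; rewrite mxE; elim/split1P: i => [j|]; rewrite ?jnl ?jnr /h.
    by rewrite -[lshift 1 j]/(unsplit (inl j)) unsplitK evC pevalXU.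
  by rewrite -[rshift q ord0]/(unsplit (inr ord0)) unsplitK evX.
exists (psub h B).
  apply: contra_neq B0 => hB; apply: mpoly_zero => v.
  have := ev_psub h B (fun=> v 0 (rshift q ord0)) (lsubmx v).
  by rewrite hB ev0 hE jnK => <-.
have hn : \forall x \near a, peval B (jn x (th x)) = G (jn x (th x)) * ev Q G (jn x (th x)).
  apply: (An_near_map jA (P := fun y => peval B y = G y * ev Q G y)).
  by rewrite tha.
near=> x; rewrite ev_psub hE.
have -> : peval B (jn x (th x)) = G (jn x (th x)) * ev Q G (jn x (th x)) by near: x.
have -> : G (jn x (th x)) = 0 by near: x.
by rewrite mul0r.
Unshelve. all: by end_near. Qed.

End NashComposition.

(** * Directional derivatives *)

Section DirectionalDerivative.
Variable R : realType.
Local Notation C := (Cx R).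

Definition Dd n (f : 'rV[C]_n -> C) (a v : 'rV[C]_n) : C := \sum_i dC i f a * v 0 i.

Lemma dC_Dd n (f : 'rV[C]_n -> C) a i : dC i f a = Dd f a (delta_mx 0 i).
Proof.
rewrite /Dd (bigD1 i) //= mxE !eqxx mulr1 big1 ?addr0 // => j ji.
by rewrite mxE (negPf ji) andbF mulr0.
Qed.

Lemma Dd_comp n k (f : 'rV[C]_n -> C) (G : 'rV[C]_k -> 'rV[C]_n) a v :
  An f (G a) -> (forall i, An (fun x => G x 0 i) a) ->
  Dd (fun x => f (G x)) a v = Dd f (G a) (\row_i Dd (fun x => G x 0 i) a v).
Proof.
move=> hf hG; rewrite /Dd; under eq_bigr => j _ do rewrite dC_comp // mulr_suml.
rewrite exchange_big /=; apply: eq_bigr => i _; rewrite mxE mulr_sumr.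
by apply: eq_bigr => j _; rewrite mulrA.
Qed.

Lemma Dd_coord n i (a v : 'rV[C]_n) : Dd (fun x => x 0 i) a v = v 0 i.
Proof.
rewrite /Dd (bigD1 i) //= dC_coord eqxx mul1r big1 ?addr0 // => j ji.
by rewrite dC_coord (negPf ji) mul0r.
Qed.

Lemma Dd_cst n c (a v : 'rV[C]_n) : Dd (fun=> c) a v = 0.
Proof. by rewrite /Dd big1 // => i _; rewrite dC_cst mul0r. Qed.

Lemma Dd_near n (f g : 'rV[C]_n -> C) (a v : 'rV[C]_n) :
  (\forall x \near a, f x = g x) -> Dd f a v = Dd g a v.
Proof. by move=> h; apply: eq_bigr => i _; rewrite (dC_near i h). Qed.

Lemma Dd_near0 n (f : 'rV[C]_n -> C) (a v : 'rV[C]_n) :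
  (\forall x \near a, f x = 0) -> Dd f a v = 0.
Proof. by move=> /Dd_near ->; exact: Dd_cst. Qed.

Lemma DdD n (f : 'rV[C]_n -> C) a v w : Dd f a (v + w) = Dd f a v + Dd f a w.
Proof. by rewrite /Dd -big_split /=; apply: eq_bigr => i _; rewrite mxE mulrDr. Qed.

Lemma DdZ n (f : 'rV[C]_n -> C) a c v : Dd f a (c *: v) = c * Dd f a v.
Proof. by rewrite /Dd mulr_sumr; apply: eq_bigr => i _; rewrite mxE mulrCA. Qed.

Lemma Dd0 n (f : 'rV[C]_n -> C) a : Dd f a 0 = 0.
Proof. by rewrite /Dd big1 // => i _; rewrite mxE mulr0. Qed.

Lemma Dd_add n (f g : 'rV[C]_n -> C) a v : An f a -> An g a ->
  Dd (fun x => f x + g x) a v = Dd f a v + Dd g a v.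
Proof.
by move=> hf hg; rewrite /Dd -big_split /=; apply: eq_bigr => i _; rewrite dC_add // mulrDl.
Qed.

Lemma Dd_opp n (f : 'rV[C]_n -> C) a v : An f a -> Dd (fun x => - f x) a v = - Dd f a v.
Proof.
by move=> hf; rewrite /Dd -sumrN; apply: eq_bigr => i _; rewrite dC_opp // mulNr.
Qed.

Lemma Dd_sub n (f g : 'rV[C]_n -> C) a v : An f a -> An g a ->
  Dd (fun x => f x - g x) a v = Dd f a v - Dd g a v.
Proof. by move=> hf hg; rewrite Dd_add ?Dd_opp //; exact: An_opp. Qed.

Lemma Dd_mul n (f g : 'rV[C]_n -> C) a v : An f a -> An g a ->
  Dd (fun x => f x * g x) a v = Dd f a v * g a + f a * Dd g a v.
Proof.
move=> hf hg; rewrite /Dd mulr_suml mulr_sumr -big_split /=; apply: eq_bigr => i _.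
by rewrite (dC_mul i hf hg); ring.
Qed.

Lemma Dd_scale n (f : 'rV[C]_n -> C) a v c : An f a -> Dd (fun x => c * f x) a v = c * Dd f a v.
Proof. by move=> hf; rewrite (Dd_mul v (An_cst a c) hf) Dd_cst mul0r add0r. Qed.

Lemma Dd_sum n (I : Type) (s : seq I) (P : pred I) (F : I -> 'rV[C]_n -> C) a v :
  (forall i, An (F i) a) ->
  Dd (fun x => \sum_(i <- s | P i) F i x) a v = \sum_(i <- s | P i) Dd (F i) a v.
Proof.
move=> h; rewrite /Dd exchange_big /=; apply: eq_bigr => j _.
by rewrite dC_sum // mulr_suml.
Qed.

Definition consv d (w0 : C) (w : 'rV[C]_d) : 'rV[C]_d.+1 :=
  row_mx (const_mx w0 : 'rV_1) w.

Lemma consv0 d w0 (w : 'rV[C]_d) : consv w0 w 0 ord0 = w0.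
Proof.
rewrite /consv (_ : ord0 = lshift d (ord0 : 'I_1)); last exact: val_inj.
by etransitivity; [exact: (@row_mxEl _ 1 1 d)|rewrite mxE].
Qed.

Lemma consvS d w0 (w : 'rV[C]_d) j : consv w0 w 0 (lift ord0 j) = w 0 j.
Proof.
rewrite /consv (_ : lift ord0 j = rshift 1 j); last exact: val_inj.
exact: (@row_mxEr _ 1 1 d).
Qed.

Lemma consvK d (w : 'rV[C]_d.+1) : consv (w 0 ord0) (\row_j w 0 (lift ord0 j)) = w.
Proof.
apply/rowP => i; case: (unliftP ord0 i) => [j|] ->; first by rewrite consvS mxE.
by rewrite consv0.
Qed.

(** Puts back the first unknown, once it is solved as a function of the parameters and the other
    unknowns. *)
Definition insv q d (y : 'rV[C]_(q + d)) (w0 : C) : 'rV[C]_(q + d.+1) :=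
  row_mx (lsubmx y) (consv w0 (rsubmx y)).

Lemma ins_ind q d (P : 'I_(q + d.+1) -> Prop) :
  (forall j, P (lshift d.+1 j)) -> P (rshift q ord0) -> (forall j, P (rshift q (lift ord0 j))) ->
  forall i, P i.
Proof.
move=> h1 h2 h3 i; rewrite -(splitK i); case: (fintype.split i) => j /=; first exact: h1.
by case: (unliftP ord0 j) => [l|] ->.
Qed.

Lemma insv_l q d (y : 'rV[C]_(q + d)) w0 j : insv y w0 0 (lshift d.+1 j) = y 0 (lshift d j).
Proof. by rewrite /insv row_mxEl mxE. Qed.
Lemma insv_0 q d (y : 'rV[C]_(q + d)) w0 : insv y w0 0 (rshift q ord0) = w0.
Proof. by rewrite /insv row_mxEr consv0. Qed.
Lemma insv_S q d (y : 'rV[C]_(q + d)) w0 j : insv y w0 0 (rshift q (lift ord0 j)) = y 0 (rshift q j).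
Proof. by rewrite /insv row_mxEr consvS mxE. Qed.

Lemma An_insv q d k (Y : 'rV[C]_k -> 'rV[C]_(q + d)) (th : 'rV[C]_k -> C) a i :
  (forall i, An (fun x => Y x 0 i) a) -> An th a -> An (fun x => insv (Y x) (th x) 0 i) a.
Proof.
move=> hY hth; elim/ins_ind: i => [j||j].
- by under eq_fun do rewrite insv_l.
- by under eq_fun do rewrite insv_0.
- by under eq_fun do rewrite insv_S.
Qed.

Lemma Dd_insv q d k (f : 'rV[C]_(q + d.+1) -> C) (Y : 'rV[C]_k -> 'rV[C]_(q + d)) (th : 'rV[C]_k -> C) a v :
  An f (insv (Y a) (th a)) -> (forall i, An (fun x => Y x 0 i) a) -> An th a ->
  Dd (fun x => f (insv (Y x) (th x))) a v =
  Dd f (insv (Y a) (th a)) (insv (\row_i Dd (fun x => Y x 0 i) a v) (Dd th a v)).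
Proof.
move=> hf hY hth; rewrite (@Dd_comp _ _ f (fun x => insv (Y x) (th x))) //; last by move=> i; exact: An_insv.
congr Dd; apply/rowP => i; rewrite mxE; elim/ins_ind: i => [j||j].
- by under eq_fun do rewrite insv_l; rewrite insv_l mxE.
- by under eq_fun do rewrite insv_0; rewrite insv_0.
- by under eq_fun do rewrite insv_S; rewrite insv_S mxE.
Qed.

End DirectionalDerivative.

(** * Systems of implicit equations, analytic and Nash *)

Section VectorIFT.
Variable R : realType.
Local Notation C := (Cx R).
Variable Q : forall n, ('rV[C]_n -> C) -> 'rV[C]_n -> Prop.
Hypothesis QA : forall n (f : 'rV[C]_n -> C) a, Q f a -> An f a.
Hypothesis Qcoord : forall n i (a : 'rV[C]_n), Q (fun x => x 0 i) a.
Hypothesis Qcomp : forall n k (f : 'rV[C]_n -> C) (G : 'rV[C]_k -> 'rV[C]_n) a,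
  Q f (G a) -> (forall i, Q (fun x => G x 0 i) a) -> Q (fun x => f (G x)) a.
Hypothesis Qift : forall q (G : 'rV[C]_(q + 1) -> C) (a : 'rV[C]_q) (b : C) (th : 'rV[C]_q -> C),
  Q G (jn a b) -> dC (rshift q ord0) G (jn a b) != 0 -> An th a -> th a = b ->
  (\forall x \near a, G (jn x (th x)) = 0) -> Q th a.

Lemma Q_insv q d k (Y : 'rV[C]_k -> 'rV[C]_(q + d)) (th : 'rV[C]_k -> C) a i :
  (forall i, Q (fun x => Y x 0 i) a) -> Q th a -> Q (fun x => insv (Y x) (th x) 0 i) a.
Proof.
move=> hY hth; elim/ins_ind: i => [j||j].
- by under eq_fun do rewrite insv_l.
- by under eq_fun do rewrite insv_0.
- by under eq_fun do rewrite insv_S.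
Qed.

Lemma row_mxP q d (x : 'rV[C]_(q + d)) : row_mx (lsubmx x) (rsubmx x) = x.
Proof. exact: hsubmxK. Qed.

(** Induction on [d]: some [G k0] has a nonzero derivative in the first unknown and is solved for it
    as [t0]. The other equations with [t0] inserted are again nondegenerate, since a vector
    completed by the derivative of [t0] is killed by [G k0]. The class [Q] is later [An] and
    [Nash]. *)
Theorem vector_ift d q (G : 'I_d -> 'rV[C]_(q + d) -> C) (a : 'rV[C]_q) (b : 'rV[C]_d) :
  (forall k, Q (G k) (row_mx a b)) -> (forall k, G k (row_mx a b) = 0) ->
  (forall w, (forall k, Dd (G k) (row_mx a b) (row_mx 0 w) = 0) -> w = 0) ->
  exists th : 'rV[C]_q -> 'rV[C]_d,
    [/\ forall j, Q (fun x => th x 0 j) a, th a = b,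
        \forall x \near a, forall k, G k (row_mx x (th x)) = 0 &
        \forall v \near row_mx a b, (forall k, G k v = 0) -> rsubmx v = th (lsubmx v)].
Proof.
elim: d q G a b => [|d IH] q G a b hQ h0 hD.
  exists (fun=> b); split=> //; first by case.
    by near=> x => -[].
  by near=> v => _; apply/rowP => -[].
pose b0 := b 0 ord0; pose b' := \row_j b 0 (lift ord0 j); pose a1 := row_mx a b'.
have pE : insv a1 b0 = row_mx a b by rewrite /insv /a1 row_mxKl row_mxKr consvK.
have [k0 hk0] : exists k0, Dd (G k0) (row_mx a b) (row_mx 0 (consv 1 0)) != 0.
  apply: contrapT => h; have := hD (consv 1 0) _.
  have -> : (forall k, Dd (G k) (row_mx a b) (row_mx 0 (consv 1 0)) = 0) = true :> Prop.
    apply/propext; split=> // _ k; apply/eqP; apply: contrapT => hk.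
    by apply: h; exists k; apply/negP.
  move=> /(_ isT) /rowP/(_ ord0); rewrite consv0 mxE => /eqP; rewrite oner_eq0.
  by [].
pose G0 (u : 'rV[C]_((q + d) + 1)) := G k0 (insv (lsubmx u) (u 0 (rshift (q + d) ord0))).
have lsubA n m (u : 'rV[C]_(n + m)) i : Q (fun x : 'rV[C]_(n + m) => lsubmx x 0 i) u.
  by under eq_fun do rewrite mxE; exact: Qcoord.
have jE : insv (lsubmx (jn a1 b0)) (jn a1 b0 0 (rshift (q + d) ord0)) = row_mx a b.
  by rewrite jnr /jn row_mxKl pE.
have QG0 : Q G0 (jn a1 b0).
  apply: (@Qcomp _ _ (G k0) (fun u => insv (lsubmx u) (u 0 (rshift (q + d) ord0)))).
    by rewrite jE.
  by move=> i; apply: Q_insv; [move=> j; exact: lsubA|exact: Qcoord].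
have G00 : G0 (jn a1 b0) = 0 by rewrite /G0 jE.
have dG0 : dC (rshift (q + d) ord0) G0 (jn a1 b0) != 0.
  rewrite dC_Dd /G0 (@Dd_insv _ _ _ _ (G k0) (fun u => lsubmx u)); first last.
  - exact: An_coord.
  - by move=> j; apply: QA; exact: lsubA.
  - by rewrite jE; exact: QA.
  rewrite jE Dd_coord; apply: contra hk0 => /eqP <-; apply/eqP; congr Dd.
  rewrite mxE !eqxx /= /insv; congr row_mx; last congr consv.
    apply/rowP => i; rewrite !mxE; under eq_fun do rewrite mxE.
    by rewrite Dd_coord mxE eq_lrshift andbF.
  apply/rowP => i; rewrite !mxE; under eq_fun do rewrite mxE.
  by rewrite Dd_coord mxE eq_lrshift andbF.
have [t0 [t0A t0a t0z t0u]] := scalar_ift (QA QG0) G00 dG0.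
have t0Q : Q t0 a1 by exact: Qift dG0 t0A t0a t0z.
have WE : insv a1 (t0 a1) = row_mx a b by rewrite t0a pE.
pose G2 (k : 'I_d) (y : 'rV[C]_(q + d)) := G (lift k0 k) (insv y (t0 y)).
have t0z' : \forall y \near a1, G k0 (insv y (t0 y)) = 0.
  by apply: filterS t0z => y; rewrite /G0 jnr /jn row_mxKl.
have dW k (v : 'rV[C]_d) : Dd (fun y => G k (insv y (t0 y))) a1 (row_mx 0 v) =
    Dd (G k) (row_mx a b) (row_mx 0 (consv (Dd t0 a1 (row_mx 0 v)) v)).
  rewrite (@Dd_insv _ _ _ _ (G k) id) //; last by move=> i; exact: An_coord.
    rewrite WE; congr Dd; rewrite /insv; congr row_mx; last congr consv.
      by apply/rowP => i; rewrite !mxE Dd_coord row_mxEl mxE.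
    by apply/rowP => i; rewrite !mxE Dd_coord row_mxEr.
  by rewrite WE; exact: QA.
have [|||t [tQ ta tz tu]] := IH q G2 a b'.
- move=> k; apply: (@Qcomp _ _ (G (lift k0 k)) (fun y => insv y (t0 y))).
    by rewrite -/a1 WE.
  by move=> i; apply: Q_insv => // j; exact: Qcoord.
- by move=> k; rewrite /G2 -/a1 WE.
- move=> w hw; have := hD (consv (Dd t0 a1 (row_mx 0 w)) w) _.
  have H : forall k, Dd (G k) (row_mx a b) (row_mx 0 (consv (Dd t0 a1 (row_mx 0 w)) w)) = 0.
    move=> k; rewrite -dW; case: (unliftP k0 k) => [j|] ->; first exact: hw.
    exact: Dd_near0.
  by move=> /(_ H) /rowP e; apply/rowP => j; have := e (lift ord0 j); rewrite consvS !mxE.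
have tA i : An (fun x => t x 0 i) a by exact: QA.
have rowQ i : Q (fun x => row_mx x (t x) 0 i) a.
  rewrite -(splitK i); case: (fintype.split i) => j /=.
    by under eq_fun do rewrite row_mxEl; exact: Qcoord.
  by under eq_fun do rewrite row_mxEr; exact: tQ.
have rowA i : An (fun x => row_mx x (t x) 0 i) a by exact: QA.
have hra : row_mx a (t a) = a1 by rewrite ta.
have thQ : Q (fun x => t0 (row_mx x (t x))) a.
  by apply: (@Qcomp _ _ t0 (fun x => row_mx x (t x))) => //; rewrite hra.
have inE x : row_mx x (consv (t0 (row_mx x (t x))) (t x)) = insv (row_mx x (t x)) (t0 (row_mx x (t x))).
  by rewrite /insv row_mxKl row_mxKr.
exists (fun x => consv (t0 (row_mx x (t x))) (t x)); split.
- move=> j; case: (unliftP ord0 j) => [l|] ->.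
    by under eq_fun do rewrite consvS; exact: tQ.
  by under eq_fun do rewrite consv0.
- by rewrite hra t0a ta /b0 /b' consvK.
- have t0z2 : \forall x \near a, G k0 (insv (row_mx x (t x)) (t0 (row_mx x (t x)))) = 0.
    by apply: (An_near_map rowA (P := fun y => G k0 (insv y (t0 y)) = 0)); rewrite hra.
  near=> x => k; rewrite inE; case: (unliftP k0 k) => [j|] ->; last by near: x.
  have h : forall k, G2 k (row_mx x (t x)) = 0 by near: x.
  exact: h.
- pose Y (v : 'rV[C]_(q + d.+1)) : 'rV[C]_(q + d) := row_mx (lsubmx v) (\row_j rsubmx v 0 (lift ord0 j)).
  have YK v : insv (Y v) (rsubmx v 0 ord0) = v.
    by rewrite /insv /Y row_mxKl row_mxKr consvK hsubmxK.
  have YA i : An (fun v => Y v 0 i) (row_mx a b).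
    rewrite -(splitK i); case: (fintype.split i) => j /=.
      by under eq_fun do rewrite row_mxEl mxE; exact: An_coord.
    by under eq_fun do rewrite row_mxEr !mxE; exact: An_coord.
  have Yp : Y (row_mx a b) = a1 by rewrite /Y row_mxKl row_mxKr.
  pose J v := jn (Y v) (rsubmx v 0 ord0).
  have JA i : An (fun v => J v 0 i) (row_mx a b).
    elim/split1P: i => [j|].
      by under eq_fun do rewrite jnl; exact: YA.
    by under eq_fun do rewrite jnr mxE; exact: An_coord.
  have Jp : J (row_mx a b) = jn a1 b0 by rewrite /J Yp row_mxKr.
  have u1 : \forall v \near row_mx a b, G0 (J v) = 0 -> J v 0 (rshift (q + d) ord0) = t0 (lsubmx (J v)).
    apply: (An_near_map JA (P := fun u => G0 u = 0 -> u 0 (rshift (q + d) ord0) = t0 (lsubmx u))).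
    by rewrite Jp.
  have u2 : \forall v \near row_mx a b, (forall k, G2 k (Y v) = 0) -> rsubmx (Y v) = t (lsubmx (Y v)).
    apply: (An_near_map YA (P := fun y => (forall k, G2 k y = 0) -> rsubmx y = t (lsubmx y))).
    by rewrite Yp.
  near=> v => hv.
  have e1 : rsubmx v 0 ord0 = t0 (Y v).
    have h : G0 (J v) = 0 -> J v 0 (rshift (q + d) ord0) = t0 (lsubmx (J v)) by near: v.
    by move: h; rewrite /G0 /J jnr /jn row_mxKl YK; apply; exact: hv.
  have e2 : rsubmx (Y v) = t (lsubmx (Y v)).
    have h : (forall k, G2 k (Y v) = 0) -> rsubmx (Y v) = t (lsubmx (Y v)) by near: v.
    by apply: h => k; rewrite /G2 -e1 YK.
  have Yl : lsubmx (Y v) = lsubmx v by rewrite /Y row_mxKl.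
  rewrite -Yl -e2 row_mxP -e1 -[LHS]consvK; congr consv.
  by rewrite /Y row_mxKr.
Unshelve. all: by end_near. Qed.

End VectorIFT.

Section IFTInstances.
Variable R : realType.
Local Notation C := (Cx R).

Definition An_vector_ift d q (G : 'I_d -> 'rV[C]_(q + d) -> C) a b :=
  @vector_ift R (@An R) (fun n f a h => h) (fun n i a => An_coord a i)
    (fun n k f G a hf hG => An_comp hf hG) (fun q G a b th _ _ h _ _ => h) d q G a b.

Definition Nash_vector_ift d q (G : 'I_d -> 'rV[C]_(q + d) -> C) a b :=
  @vector_ift R (@Nash R) (fun n f a h => h.1) (fun n i a => Nash_coord a i)
    (fun n k f G a hf hG => Nash_comp hf hG) (@Nash_ift R) d q G a b.

(** The implicit function theorem for the equation [w * f x - 1 = 0] in [w]. *)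
Lemma An_inv n (f : 'rV[C]_n -> C) a : An f a -> f a != 0 -> An (fun x => (f x)^-1) a.
Proof.
move=> hf fa.
pose G (v : 'rV[C]_(n + 1)) := v 0 (rshift n ord0) * f (lsubmx v) - 1.
have lA i : An (fun v : 'rV[C]_(n + 1) => lsubmx v 0 i) (jn a (f a)^-1).
  by under eq_fun do rewrite mxE; exact: An_coord.
have jl : lsubmx (jn a (f a)^-1) = a by rewrite /jn row_mxKl.
have fA : An (fun v : 'rV[C]_(n + 1) => f (lsubmx v)) (jn a (f a)^-1).
  by apply: (@An_comp R _ _ f (fun v => lsubmx v)); rewrite ?jl.
have GA : An G (jn a (f a)^-1).
  apply: An_sub; last exact: An_cst.
  by apply: An_mul => //; exact: An_coord.
have [||th [thA tha thz thu]] := scalar_ift GA.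
- by rewrite /G jnr jl mulVf // subrr.
- rewrite /G dC_sub; [|by apply: An_mul => //; exact: An_coord|exact: An_cst].
  rewrite (dC_mul _ (An_coord _ _) fA) dC_coord eqxx dC_cst subr0 jl mul1r.
  rewrite (@dC_comp R _ _ f (fun v : 'rV[C]_(n + 1) => lsubmx v)) ?jl //.
  rewrite big1 ?mulr0 ?addr0 // => i _; under eq_fun do rewrite mxE.
  rewrite dC_coord; case: eqP => [h|]; last by rewrite mulr0.
  by have := ltn_ord i; have := congr1 val h; rewrite /= => <-; rewrite addn0 ltnn.
apply: An_near thA; have hn := An_neq0 hf fa; near=> x.
have fx : f x != 0 by near: x.
have : G (jn x (th x)) = 0 by near: x.
rewrite /G jnr /jn row_mxKl => /eqP; rewrite subr_eq0 => /eqP h.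
by apply: (mulIf fx); rewrite h mulVf.
Unshelve. all: by end_near. Qed.

Lemma Nash_inv n (f : 'rV[C]_n -> C) a : Nash f a -> f a != 0 -> Nash (fun x => (f x)^-1) a.
Proof.
move=> hf fa; split; first exact: An_inv hf.1 fa.
have hn := An_neq0 hf.1 fa.
apply: (@Alg_div R _ (fun=> -1) f _ a (Nash_cst _ _) hf).
  by move=> /nbhs_singleton h; rewrite h eqxx in fa.
by apply: filterS hn => x fx; rewrite divff // addNr.
Qed.

Lemma Nash_det n m (A : 'rV[C]_n -> 'M[C]_m) a :
  (forall i j, Nash (fun x => A x i j) a) -> Nash (fun x => \det (A x)) a.
Proof.
move=> hA; rewrite /determinant; apply: Nash_sum => s; apply: Nash_mul; first exact: Nash_cst.
by apply: Nash_prod => i.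
Qed.

Lemma An_det n m (A : 'rV[C]_n -> 'M[C]_m) a :
  (forall i j, An (fun x => A x i j) a) -> An (fun x => \det (A x)) a.
Proof.
move=> hA; rewrite /determinant; apply: An_sum => s; apply: An_mul; first exact: An_cst.
by apply: An_prod => i.
Qed.

(** Cramer's rule. *)
Lemma Nash_invmx n m (A : 'rV[C]_n -> 'M[C]_m) a i j :
  (forall i j, Nash (fun x => A x i j) a) -> A a \in unitmx ->
  Nash (fun x => invmx (A x) i j) a.
Proof.
move=> hA ua; have dA := Nash_det hA.
have da : \det (A a) != 0 by move: ua; rewrite unitmxE unitfE.
have hn := An_neq0 dA.1 da.
apply: (@Nash_near R _ (fun x => (\det (A x))^-1 * (\adj (A x)) i j)).
  apply: filterS hn => x dx.
  by rewrite /invmx unitmxE unitfE dx !mxE.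
apply: Nash_mul; first exact: Nash_inv.
rewrite (_ : (fun x => (\adj (A x)) i j) = fun x => (-1) ^+ (j + i) * \det (row' j (col' i (A x)))).
  apply: Nash_mul; first exact: Nash_cst.
  by apply: Nash_det => k l; under eq_fun do rewrite !mxE.
by apply/funext => x; rewrite mxE.
Qed.

Lemma unitmx_near n m (A : 'rV[C]_n -> 'M[C]_m) a :
  (forall i j, An (fun x => A x i j) a) -> A a \in unitmx ->
  \forall x \near a, A x \in unitmx.
Proof.
move=> hA; rewrite unitmxE unitfE => da; have := An_neq0 (An_det hA) da.
by apply: filterS => x; rewrite unitmxE unitfE.
Qed.

End IFTInstances.

(** * Taylor coefficients *)

Section Taylor.
Variable R : realType.
Local Notation C := (Cx R).
Local Notation MP n := (mpoly.mpoly n C).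
Local Notation mco := (mpoly.mcoeff).
Local Notation mdeg := mpoly.mdeg.

Definition dCs n (I : seq 'I_n) (f : 'rV[C]_n -> C) : 'rV[C]_n -> C := foldr (@dC R n) f I.

Lemma dCs_rcons n (I : seq 'I_n) i (f : 'rV[C]_n -> C) : dCs (rcons I i) f = dCs I (dC i f).
Proof. by rewrite /dCs foldr_rcons. Qed.

Lemma An_dCs n (I : seq 'I_n) (f : 'rV[C]_n -> C) a : An f a -> An (dCs I f) a.
Proof. by move=> h; elim: I => //= i I IH; exact: An_dC. Qed.

Lemma dCs_near n (I : seq 'I_n) (f g : 'rV[C]_n -> C) (a : 'rV[C]_n) :
  (\forall x \near a, f x = g x) -> \forall x \near a, dCs I f x = dCs I g x.
Proof. by move=> h; elim: I => //= i I IH; exact: dC_near_near. Qed.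

(** Induction on the degree: up to a positive integer, the coefficient of [m] in [p k] is one of
    lower degree in [mderiv i (p k)], and these approximate [dC i f] by [AnW_dC]. *)
Lemma null_mco n e (a : 'rV[C]_n) f (p : nat -> MP n) u B m : 0 < e -> AnW e a f p u B ->
  (forall I, dCs I f a = 0) -> null (fun k => cabs (mco m (p k))).
Proof.
have [N hm] := ubnP (mdeg m); elim: N m hm e f p u B => [//|N IH] m hm e f p u B e0 h h0.
case: (pselect (exists i, (0 < m i)%N)) => [[i hi]|nex]; last first.
  have -> : m = mpoly.mnm0.
    apply/mpoly.mnmP => i; rewrite mpoly.mnm0E; apply/eqP; rewrite -leqn0 leqNgt.
    by apply/negP => h'; apply: nex; exists i.
  have [hu hB hC hf] := h.
  apply: (null_le _ hu) => k; rewrite ger0_norm ?cabs_ge0 //.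
  have := hf a _ k; rewrite subrr peval_at0 (h0 [::] : f a = 0) sub0r cabsN; apply => i.
  by rewrite subrr cabs0 ltW.
pose m' := mpoly.mnm_sub m (mpoly.mnm1 i).
have mE : mpoly.mnm_add m' (mpoly.mnm1 i) = m.
  apply/mpoly.mnmP => j; rewrite mpoly.mnmDE mpoly.mnmBE mpoly.mnm1E subnK //.
  by case: eqP => // <-.
have dm : (mdeg m' < N)%N.
  by move: hm; rewrite -mE mpoly.mdegD mpoly.mdeg1 addn1 ltnS.
have := IH m' dm _ _ _ _ _ (divr_gt0 e0 (ltr0n _ 2)) (AnW_dC i e0 h) _.
move=> /(_ (fun I => etrans (congr1 (fun F => F a) (esym (dCs_rcons I i f))) (h0 _))).
apply: null_le => k; rewrite ger0_norm ?cabs_ge0 // mpoly.mcoeff_mderiv mE.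
rewrite -mulr_natr cabsM cabs_nat ler_peMr ?cabs_ge0 // ler1n.
by [].
Qed.

(** For fixed [k], the coefficients of [p j] on the finite support of [p k] tend to 0 with [j], so
    the estimate on [p k - p j] yields [wn e (p k) <= u k]. *)
Lemma An_taylor_zero n (f : 'rV[C]_n -> C) (a : 'rV[C]_n) : An f a -> (forall I, dCs I f a = 0) ->
  \forall x \near a, f x = 0.
Proof.
move=> [e e0 [p [u [B h]]]] h0.
have hm m : null (fun k => cabs (mco m (p k))) by exact: null_mco h h0.
have [hu hB hC hf] := h.
have wp k : wn e (p k) <= u k.
  apply: (@le_null _ _ _ (fun j => u j + \sum_(m <- mpoly.msupp (p k)) cabs (mco m (p j)) * e ^+ mdeg m)).
    apply: nullD => //.
    under eq_fun do rewrite (big_nth mpoly.mnm0) big_mkord.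
    by apply: null_sum => i; under eq_fun do rewrite mulrC; exact: nullZ.
  move=> j; rewrite addrA; apply: (@le_trans _ _ (wn e (p k - p j) + \sum_(m <- mpoly.msupp (p k)) cabs (mco m (p j)) * e ^+ mdeg m)); last first.
    by rewrite lerD2r.
  apply: (@le_trans _ _ (\sum_(m <- mpoly.msupp (p k)) cabs (mco m (p k - p j)) * e ^+ mdeg m +
     \sum_(m <- mpoly.msupp (p k)) cabs (mco m (p j)) * e ^+ mdeg m)); last first.
    by rewrite lerD2r; apply: wn_partial; rewrite ?mpoly.msupp_uniq // ltW.
  rewrite wnE -big_split /=; apply: ler_sum => m _; rewrite -mulrDl ler_wpM2r ?exprn_ge0 ?(ltW e0) //.
  have := cabsD (mco m (p k) - mco m (p j)) (mco m (p j)); rewrite subrK => h'.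
  apply: le_trans h' _; rewrite lerD2r le_eqVlt; apply/orP; left; apply/eqP; congr cabs.
  exact: esym (mpoly.mcoeffB _ _ _).
apply/nbhs_disc; exists e => // x hx.
have hx' i : cabs (x 0 i - a 0 i) <= e by exact: ltW.
apply: (@cabs_null_eq _ (f x) 0 (fun k => u k + u k)); first exact: nullD.
move=> k; rewrite subr0; have := cabsD (f x - peval (p k) (x - a)) (peval (p k) (x - a)).
rewrite subrK => h'; apply: le_trans h' _; apply: lerD; first exact: hf.
apply: le_trans (wp k); apply: peval_le => i.
by rewrite !mxE.
Qed.

Lemma dCs_lin n N (F : 'I_N -> 'rV[C]_n -> C) (a : 'rV[C]_n) (I : seq 'I_n) (c : 'I_N -> C) :
  (forall j, An (F j) a) ->
  \forall x \near a, dCs I (fun x => \sum_j F j x * c j) x = \sum_j dCs I (F j) x * c j.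
Proof.
move=> hF; elim: I => [|i I IH]; first by near=> x.
have h1 := dC_near_near i IH.
have h2 j : \forall x \near a, An (dCs I (F j)) x by apply: An_nbhs; exact: An_dCs.
have h3 : \forall x \near a, forall j, An (dCs I (F j)) x by exact: filter_forall h2.
near=> x; rewrite [LHS]/=; have -> : dC i (dCs I (fun x => \sum_j F j x * c j)) x =
  dC i (fun x => \sum_j dCs I (F j) x * c j) x by near: x.
have h4 : forall j, An (dCs I (F j)) x by near: x.
rewrite dC_sum; last by move=> j; apply: An_mul => //; exact: An_cst.
apply: eq_bigr => j _; rewrite dC_mul ?dC_cst ?mulr0 ?addr0 //.
exact: An_cst.
Unshelve. all: by end_near. Qed.

(** Take a free family of maximal size. If it had fewer than [N] rows, some column would be killed
    by them, and a row that does not kill this column could be added. *)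
Lemma rows_basis (T : Type) N (r : T -> 'rV[C]_N) :
  (forall c : 'cV[C]_N, (forall t, r t *m c = 0) -> c = 0) ->
  exists s : 'I_N -> T, \matrix_i r (s i) \in unitmx.
Proof.
move=> rc; pose P k := `[< exists s : 'I_k -> T, row_free (\matrix_i r (s i)) >].
have P0 : exists k, P k.
  by exists 0%N; apply/asboolP; exists (fun i : 'I_0 => match notF (ltn_ord i) with end); rewrite /row_free -leqn0 rank_leq_row.
have Pb k : P k -> (k <= N)%N.
  by move=> /asboolP[s]; rewrite /row_free => /eqP <-; exact: rank_leq_col.
have [k /asboolP[s hs] hk] := ex_maxnP P0 Pb.
case: (ltnP k N) => [kN|Nk]; last first.
  have kE : k = N by apply/eqP; rewrite eqn_leq Nk Pb //; apply/asboolP; exists s.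
  by subst k; exists s; rewrite -row_free_unit.
exfalso; pose M := \matrix_i r (s i).
have [c c0 Mc] : exists2 c : 'cV[C]_N, c != 0 & M *m c = 0.
  have : kermx M^T != 0.
    by rewrite kermx_eq0 /row_free mxrank_tr neq_ltn (leq_ltn_trans (rank_leq_row _) kN).
  move=> /rowV0Pn[v /sub_kermxP vM v0]; exists v^T; first by rewrite trmx_eq0.
  by apply: trmx_inj; rewrite trmx_mul trmxK vM trmx0.
have [t ht] : exists t, r t *m c != 0.
  apply: contrapT => h; move/eqP: c0; apply; apply: rc => t; apply/eqP.
  by apply: contrapT => /negP h'; apply: h; exists t.
have : (k + 1 <= k)%N; last by rewrite addn1 ltnn.
apply: hk; apply/asboolP.
exists (fun i => match fintype.split i with inl j => s j | inr _ => t end).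
have -> : \matrix_i r (match fintype.split i with inl j => s j | inr _ => t end) = col_mx M (r t).
  by apply/matrixP => i j; rewrite !mxE; case: (fintype.split i) => l; rewrite /M ?mxE ?ord1.
rewrite -kermx_eq0; apply/rowV0P => v /sub_kermxP.
rewrite -[v]hsubmxK mul_row_col => h.
have h2 : rsubmx v *m (r t *m c) = 0.
  have := congr1 (mulmx^~ c) h; rewrite mulmxDl -!mulmxA Mc mulmx0 add0r mul0mx.
  by [].
have rv : rsubmx v = 0.
  apply/matrixP => i j; have /matrixP/(_ i 0) := h2; rewrite [LHS]mxE big_ord1 !ord1 [RHS]mxE => /eqP.
  rewrite mulf_eq0 [X in _ || X](_ : _ = false) ?orbF; first by move/eqP => ->; rewrite mxE.
  apply/negP => /eqP h0; move/eqP: ht; apply; apply/matrixP => i' j'.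
  by rewrite !ord1 h0 mxE.
move: h; rewrite rv mul0mx addr0 => h.
have : (lsubmx v <= kermx M)%MS by apply/sub_kermxP.
move: hs; rewrite -kermx_eq0 => /eqP ->; rewrite submx0 => /eqP ->.
by rewrite row_mx0.
Qed.

(** A column killed at [a] by all derivatives of the rows is killed by the rows near [a], by
    [An_taylor_zero]; [rows_basis] then applies to these derivatives. *)
Lemma An_span n (N : nat) (K : finType) (A : 'rV[C]_n -> K -> 'rV[C]_N) (a : 'rV[C]_n) :
  (forall k j, An (fun x => A x k 0 j) a) ->
  (forall c : 'cV[C]_N, (forall k, \forall x \near a, A x k *m c = 0) -> c = 0) ->
  exists s : 'I_N -> seq 'I_n * K,
    \matrix_(i, j) dCs (s i).1 (fun x => A x (s i).2 0 j) a \in unitmx.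
Proof.
move=> hA hc.
pose r (t : seq 'I_n * K) : 'rV[C]_N := \row_j dCs t.1 (fun x => A x t.2 0 j) a.
have rc (c : 'cV[C]_N) : (forall t, r t *m c = 0) -> c = 0.
  move=> h; apply: hc => k.
  have e0 I : dCs I (fun x => (A x k *m c) 0 0) a = 0.
    rewrite (_ : (fun x => (A x k *m c) 0 0) = fun x => \sum_j A x k 0 j * c j 0); last first.
      by apply/funext => x; rewrite mxE.
    have /nbhs_singleton -> := dCs_lin I (fun j => c j 0) (fun j => hA k j).
    have /matrixP/(_ 0 0) := h (I, k).
    move=> h1; etransitivity; last (etransitivity; [exact: h1|by rewrite mxE]).
    by rewrite mxE; apply: eq_bigr => j _; rewrite mxE.
  have fA : An (fun x => (A x k *m c) 0 0) a.
    under eq_fun do rewrite mxE; apply: An_sum => j; apply: An_mul => //; exact: An_cst.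
  have := An_taylor_zero fA _.
  move=> /(_ e0); apply: filterS => x hx; apply/matrixP => i j.
  by rewrite !ord1 hx mxE.
have [s us] := rows_basis rc; exists s; move: us; apply: etrans; congr (_ \in unitmx).
by apply/matrixP => i j; rewrite !mxE.
Qed.

End Taylor.

(** * Differential calculus of maps *)

Section MapCalculus.
Variable R : realType.
Local Notation C := (Cx R).

Definition AnM n k (G : 'rV[C]_n -> 'rV[C]_k) a := forall i, An (fun x => G x 0 i) a.
Definition NashM n k (G : 'rV[C]_n -> 'rV[C]_k) a := forall i, Nash (fun x => G x 0 i) a.
Definition DM n k (G : 'rV[C]_n -> 'rV[C]_k) a v : 'rV[C]_k := \row_i Dd (fun x => G x 0 i) a v.

Lemma NashM_An n k (G : 'rV[C]_n -> 'rV[C]_k) a : NashM G a -> AnM G a.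
Proof. by move=> h i; exact: (h i).1. Qed.

Lemma AnM_comp n k l (F : 'rV[C]_k -> 'rV[C]_l) (G : 'rV[C]_n -> 'rV[C]_k) a :
  AnM F (G a) -> AnM G a -> AnM (fun x => F (G x)) a.
Proof. by move=> hF hG i; exact: (An_comp (hF i) hG). Qed.

Lemma NashM_comp n k l (F : 'rV[C]_k -> 'rV[C]_l) (G : 'rV[C]_n -> 'rV[C]_k) a :
  NashM F (G a) -> NashM G a -> NashM (fun x => F (G x)) a.
Proof. by move=> hF hG i; exact: (Nash_comp (hF i) hG). Qed.

Lemma NashM_id n (a : 'rV[C]_n) : NashM id a.
Proof. by move=> i; exact: Nash_coord. Qed.

Lemma NashM_cst n k (b : 'rV[C]_k) (a : 'rV[C]_n) : NashM (fun=> b) a.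
Proof. by move=> i; exact: Nash_cst. Qed.

Lemma NashM_row n k l (F : 'rV[C]_n -> 'rV[C]_k) (G : 'rV[C]_n -> 'rV[C]_l) a :
  NashM F a -> NashM G a -> NashM (fun x => row_mx (F x) (G x)) a.
Proof.
move=> hF hG i; rewrite -(splitK i); case: (fintype.split i) => j /=.
  by under eq_fun do rewrite row_mxEl; exact: hF.
by under eq_fun do rewrite row_mxEr; exact: hG.
Qed.

Lemma AnM_row n k l (F : 'rV[C]_n -> 'rV[C]_k) (G : 'rV[C]_n -> 'rV[C]_l) a :
  AnM F a -> AnM G a -> AnM (fun x => row_mx (F x) (G x)) a.
Proof.
move=> hF hG i; rewrite -(splitK i); case: (fintype.split i) => j /=.
  by under eq_fun do rewrite row_mxEl; exact: hF.
by under eq_fun do rewrite row_mxEr; exact: hG.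
Qed.

Lemma NashM_lsub n k l (F : 'rV[C]_n -> 'rV[C]_(k + l)) a :
  NashM F a -> NashM (fun x => lsubmx (F x)) a.
Proof. by move=> h i; under eq_fun do rewrite mxE; exact: h. Qed.
Lemma NashM_rsub n k l (F : 'rV[C]_n -> 'rV[C]_(k + l)) a :
  NashM F a -> NashM (fun x => rsubmx (F x)) a.
Proof. by move=> h i; under eq_fun do rewrite mxE; exact: h. Qed.
Lemma AnM_lsub n k l (F : 'rV[C]_n -> 'rV[C]_(k + l)) a :
  AnM F a -> AnM (fun x => lsubmx (F x)) a.
Proof. by move=> h i; under eq_fun do rewrite mxE; exact: h. Qed.
Lemma AnM_rsub n k l (F : 'rV[C]_n -> 'rV[C]_(k + l)) a :
  AnM F a -> AnM (fun x => rsubmx (F x)) a.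
Proof. by move=> h i; under eq_fun do rewrite mxE; exact: h. Qed.

Lemma NashM_add n k (F G : 'rV[C]_n -> 'rV[C]_k) a :
  NashM F a -> NashM G a -> NashM (fun x => F x + G x) a.
Proof. by move=> hF hG i; under eq_fun do rewrite mxE; exact: Nash_add. Qed.
Lemma AnM_add n k (F G : 'rV[C]_n -> 'rV[C]_k) a :
  AnM F a -> AnM G a -> AnM (fun x => F x + G x) a.
Proof. by move=> hF hG i; under eq_fun do rewrite mxE; exact: An_add. Qed.
Lemma NashM_opp n k (F : 'rV[C]_n -> 'rV[C]_k) a : NashM F a -> NashM (fun x => - F x) a.
Proof. by move=> hF i; under eq_fun do rewrite mxE; exact: Nash_opp. Qed.
Lemma AnM_opp n k (F : 'rV[C]_n -> 'rV[C]_k) a : AnM F a -> AnM (fun x => - F x) a.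
Proof. by move=> hF i; under eq_fun do rewrite mxE; exact: An_opp. Qed.
Lemma NashM_mulr n k (f : 'rV[C]_n -> C) (v : 'rV[C]_k) a :
  Nash f a -> NashM (fun x => f x *: v) a.
Proof.
by move=> hf i; under eq_fun do rewrite mxE; apply: Nash_mul => //; exact: Nash_cst.
Qed.

Lemma NashM_near n k (F G : 'rV[C]_n -> 'rV[C]_k) (a : 'rV[C]_n) :
  (\forall x \near a, F x = G x) -> NashM F a -> NashM G a.
Proof. by move=> h hF i; apply: (Nash_near _ (hF i)); apply: filterS h => x ->. Qed.

Lemma Nash_nbhs n (f : 'rV[C]_n -> C) (a : 'rV[C]_n) : Nash f a -> \forall x \near a, Nash f x.
Proof.
move=> [hf [P P0 hP]]; have h1 := An_nbhs hf; have h2 := near_near hP.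
by near=> x; split; [near: x|exists P; [exact: P0|near: x]].
Unshelve. all: by end_near. Qed.

Lemma NashM_nbhs n k (G : 'rV[C]_n -> 'rV[C]_k) (a : 'rV[C]_n) :
  NashM G a -> \forall x \near a, NashM G x.
Proof.
move=> h; have h1 i : \forall x \near a, Nash (fun x => G x 0 i) x by exact: Nash_nbhs.
exact: filter_forall h1.
Qed.

Lemma AnM_nbhs n k (G : 'rV[C]_n -> 'rV[C]_k) (a : 'rV[C]_n) :
  AnM G a -> \forall x \near a, AnM G x.
Proof.
move=> h; have h1 i : \forall x \near a, An (fun x => G x 0 i) x by exact: An_nbhs.
exact: filter_forall h1.
Qed.

Lemma Dd_compM n k (f : 'rV[C]_n -> C) (G : 'rV[C]_k -> 'rV[C]_n) a v :
  An f (G a) -> AnM G a -> Dd (fun x => f (G x)) a v = Dd f (G a) (DM G a v).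
Proof. exact: Dd_comp. Qed.

Lemma DM_comp n k l (F : 'rV[C]_k -> 'rV[C]_l) (G : 'rV[C]_n -> 'rV[C]_k) a v :
  AnM F (G a) -> AnM G a -> DM (fun x => F (G x)) a v = DM F (G a) (DM G a v).
Proof.
by move=> hF hG; apply/rowP => i; rewrite !mxE (Dd_compM (f := fun y => F y 0 i) v (hF i) hG).
Qed.

Lemma DM_id n (a v : 'rV[C]_n) : DM id a v = v.
Proof. by apply/rowP => i; rewrite mxE Dd_coord. Qed.
Lemma DM_cst n k (b : 'rV[C]_k) (a v : 'rV[C]_n) : DM (fun=> b) a v = 0.
Proof. by apply/rowP => i; rewrite !mxE Dd_cst. Qed.
Lemma DM_row n k l (F : 'rV[C]_n -> 'rV[C]_k) (G : 'rV[C]_n -> 'rV[C]_l) a v :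
  DM (fun x => row_mx (F x) (G x)) a v = row_mx (DM F a v) (DM G a v).
Proof.
apply/rowP => i; rewrite mxE -(splitK i); case: (fintype.split i) => j /=.
  by under eq_fun do rewrite row_mxEl; rewrite row_mxEl mxE.
by under eq_fun do rewrite row_mxEr; rewrite row_mxEr mxE.
Qed.
Lemma DM_lsub n k l (F : 'rV[C]_n -> 'rV[C]_(k + l)) a v :
  DM (fun x => lsubmx (F x)) a v = lsubmx (DM F a v).
Proof. by apply/rowP => i; rewrite !mxE; under eq_fun do rewrite mxE. Qed.
Lemma DM_rsub n k l (F : 'rV[C]_n -> 'rV[C]_(k + l)) a v :
  DM (fun x => rsubmx (F x)) a v = rsubmx (DM F a v).
Proof. by apply/rowP => i; rewrite !mxE; under eq_fun do rewrite mxE. Qed.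
Lemma DM_add n k (F G : 'rV[C]_n -> 'rV[C]_k) a v : AnM F a -> AnM G a ->
  DM (fun x => F x + G x) a v = DM F a v + DM G a v.
Proof.
by move=> hF hG; apply/rowP => i; rewrite !mxE; under eq_fun do rewrite mxE; exact: Dd_add.
Qed.
Lemma DM_opp n k (F : 'rV[C]_n -> 'rV[C]_k) a v : AnM F a ->
  DM (fun x => - F x) a v = - DM F a v.
Proof.
by move=> hF; apply/rowP => i; rewrite !mxE; under eq_fun do rewrite mxE; exact: Dd_opp.
Qed.
Lemma DM_sub n k (F G : 'rV[C]_n -> 'rV[C]_k) a v : AnM F a -> AnM G a ->
  DM (fun x => F x - G x) a v = DM F a v - DM G a v.
Proof. by move=> hF hG; rewrite DM_add ?DM_opp //; exact: AnM_opp. Qed.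
Lemma DM_mulr n k (f : 'rV[C]_n -> C) (w : 'rV[C]_k) a v : An f a ->
  DM (fun x => f x *: w) a v = Dd f a v *: w.
Proof.
move=> hf; apply/rowP => i; rewrite !mxE; under eq_fun do rewrite mxE.
by rewrite (Dd_mul v hf (An_cst a (w 0 i))) Dd_cst mulr0 addr0.
Qed.
Lemma DM_near n k (F G : 'rV[C]_n -> 'rV[C]_k) (a v : 'rV[C]_n) :
  (\forall x \near a, F x = G x) -> DM F a v = DM G a v.
Proof.
by move=> h; apply/rowP => i; rewrite !mxE; apply: Dd_near; apply: filterS h => x ->.
Qed.
Lemma DM_D n k (F : 'rV[C]_n -> 'rV[C]_k) a v w : DM F a (v + w) = DM F a v + DM F a w.
Proof. by apply/rowP => i; rewrite !mxE DdD. Qed.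
Lemma DM_Z n k (F : 'rV[C]_n -> 'rV[C]_k) a c v : DM F a (c *: v) = c *: DM F a v.
Proof. by apply/rowP => i; rewrite !mxE DdZ. Qed.
Lemma DM_N n k (F : 'rV[C]_n -> 'rV[C]_k) a v : DM F a (- v) = - DM F a v.
Proof. by rewrite -scaleN1r DM_Z scaleN1r. Qed.

Lemma Dd_sumv n (f : 'rV[C]_n -> C) a (I : Type) (s : seq I) (P : pred I) (v : I -> 'rV[C]_n) :
  Dd f a (\sum_(i <- s | P i) v i) = \sum_(i <- s | P i) Dd f a (v i).
Proof. by apply: (big_morph (Dd f a) (DdD f a)); exact: Dd0. Qed.

Lemma An_Dd n (f : 'rV[C]_n -> C) a v : An f a -> An (fun x => Dd f x v) a.
Proof.
by move=> hf; apply: An_sum => i; apply: An_mul; [exact: An_dC|exact: An_cst].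
Qed.
Lemma Nash_Dd n (f : 'rV[C]_n -> C) a v : Nash f a -> Nash (fun x => Dd f x v) a.
Proof.
by move=> hf; apply: Nash_sum => i; apply: Nash_mul; [exact: Nash_dC|exact: Nash_cst].
Qed.

Lemma AnM_DM n k (F : 'rV[C]_n -> 'rV[C]_k) a v : AnM F a -> AnM (fun x => DM F x v) a.
Proof. by move=> h i; under eq_fun do rewrite mxE; exact: An_Dd. Qed.
Lemma NashM_DM n k (F : 'rV[C]_n -> 'rV[C]_k) a v : NashM F a -> NashM (fun x => DM F x v) a.
Proof. by move=> h i; under eq_fun do rewrite mxE; exact: Nash_Dd. Qed.

End MapCalculus.

(** * Functions whose derivatives are Nash along a map *)

Section Jets.
Variable R : realType.
Local Notation C := (Cx R).

(** The derivatives are taken in the ambient space and only then restricted to [g], so that for [g]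
    of small rank this is much weaker than [Nash h]. *)
Fixpoint Jet k n q (h : 'rV[C]_n -> C) (g : 'rV[C]_q -> 'rV[C]_n) (a : 'rV[C]_q) : Prop :=
  [/\ An h (g a), Nash (fun s => h (g s)) a &
      if k is k'.+1 then forall i, Jet k' (dC i h) g a else True].

Definition Jets n q (h : 'rV[C]_n -> C) (g : 'rV[C]_q -> 'rV[C]_n) a := forall k, Jet k h g a.

Lemma Jet_Nash k n q h (g : 'rV[C]_q -> 'rV[C]_n) a : Jet k h g a -> Nash (fun s => h (g s)) a.
Proof. by case: k => [|k] []. Qed.

Lemma Jet_le k n q h (g : 'rV[C]_q -> 'rV[C]_n) a : Jet k.+1 h g a -> Jet k h g a.
Proof.
elim: k h => [|k IH] h [h1 h2 h3]; split => // i.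
by apply: IH; exact: h3.
Qed.

Lemma Jet_near k n q h h' (g : 'rV[C]_q -> 'rV[C]_n) (a : 'rV[C]_q) : AnM g a ->
  (\forall y \near g a, h y = h' y) -> Jet k h g a -> Jet k h' g a.
Proof.
move=> hg; elim: k h h' => [|k IH] h h' e [h1 h2 h3]; split => //.
- exact: An_near h1.
- by apply: Nash_near h2; exact: (An_near_map hg e).
- exact: An_near h1.
- by apply: Nash_near h2; exact: (An_near_map hg e).
- by move=> i; apply: IH (h3 i); exact: dC_near_near.
Qed.

Lemma Jet_curve k n q h (g g' : 'rV[C]_q -> 'rV[C]_n) (a : 'rV[C]_q) :
  (\forall s \near a, g s = g' s) -> Jet k h g a -> Jet k h g' a.
Proof.
move=> e; have e0 := nbhs_singleton e; elim: k h => [|k IH] h [h1 h2 h3]; split => //; rewrite -?e0 //.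
- by apply: Nash_near h2; apply: filterS e => s ->.
- by apply: Nash_near h2; apply: filterS e => s ->.
- by move=> i; exact: IH (h3 i).
Qed.

Lemma Jet_nash k n q h (g : 'rV[C]_q -> 'rV[C]_n) a : Nash h (g a) -> NashM g a -> Jet k h g a.
Proof.
move=> + hg; elim: k h => [|k IH] h hh; split=> //; try exact: hh.1.
- exact: Nash_comp hh hg.
- exact: Nash_comp hh hg.
- by move=> i; apply: IH; exact: Nash_dC.
Qed.

Lemma Jet_cst k n q h (b : 'rV[C]_n) (a : 'rV[C]_q) : An h b -> Jet k h (fun=> b) a.
Proof.
elim: k h => [|k IH] h hh; split=> //; try exact: Nash_cst.
by move=> i; apply: IH; exact: An_dC.
Qed.

Lemma Jet_add k n q h h' (g : 'rV[C]_q -> 'rV[C]_n) a : AnM g a ->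
  Jet k h g a -> Jet k h' g a -> Jet k (fun y => h y + h' y) g a.
Proof.
move=> hg; elim: k h h' => [|k IH] h h' [h1 h2 h3] [h1' h2' h3']; split => //.
- exact: An_add.
- exact: Nash_add.
- exact: An_add.
- exact: Nash_add.
- move=> i; apply: (@Jet_near _ _ _ (fun y => dC i h y + dC i h' y)) => //; last exact: IH (h3 i) (h3' i).
  have A1 := An_nbhs h1; have A2 := An_nbhs h1'.
  by near=> y; rewrite dC_add //; near: y.
Unshelve. all: by end_near. Qed.

Lemma Jet_mul k n q h h' (g : 'rV[C]_q -> 'rV[C]_n) a : AnM g a ->
  Jet k h g a -> Jet k h' g a -> Jet k (fun y => h y * h' y) g a.
Proof.
move=> hg; elim: k h h' => [|k IH] h h' H H'; have [h1 h2 h3] := H; have [h1' h2' h3'] := H'; split => //.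
- exact: An_mul.
- exact: Nash_mul.
- exact: An_mul.
- exact: Nash_mul.
- move=> i; apply: (@Jet_near _ _ _ (fun y => dC i h y * h' y + h y * dC i h' y)) => //.
    have A1 := An_nbhs h1; have A2 := An_nbhs h1'.
    near=> y; have a1 : An h y by near: y.
    have a2 : An h' y by near: y.
    exact: esym (dC_mul i a1 a2).
  apply: Jet_add => //; first exact: IH (h3 i) (Jet_le H').
  exact: IH (Jet_le H) (h3' i).
Unshelve. all: by end_near. Qed.

Lemma Jet_sum k n q (I : Type) (s : seq I) (P : pred I) (F : I -> 'rV[C]_n -> C) (g : 'rV[C]_q -> 'rV[C]_n) a : NashM g a ->
  (forall i, Jet k (F i) g a) -> Jet k (fun y => \sum_(i <- s | P i) F i y) g a.
Proof.
move=> hg h; elim: s => [|i s IH].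
  under eq_fun do rewrite big_nil.
  by apply: Jet_nash => //; exact: Nash_cst.
under eq_fun do rewrite big_cons; case: (P i) => //.
by apply: Jet_add => //; exact: NashM_An.
Qed.

Lemma Jet_comp k n l q h (G : 'rV[C]_n -> 'rV[C]_l) (g : 'rV[C]_q -> 'rV[C]_n) a :
  NashM G (g a) -> NashM g a -> Jet k h (fun s => G (g s)) a -> Jet k (fun y => h (G y)) g a.
Proof.
move=> hG hg; elim: k h => [|k IH] h H; have [h1 h2 h3] := H; split => //.
- exact: (An_comp h1 (NashM_An hG)).
- exact: (An_comp h1 (NashM_An hG)).
- move=> i; apply: (@Jet_near _ _ _ (fun y => \sum_j dC j h (G y) * dC i (fun y => G y 0 j) y)).
  + exact: NashM_An.
  + have A1 := An_nbhs h1; have A2 := AnM_nbhs (NashM_An hG).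
    have A3 : \forall y \near g a, An h (G y) by exact: (An_near_map (NashM_An hG) A1).
    near=> y; rewrite dC_comp //; first by near: y.
    have A4 : AnM G y by near: y.
    exact: A4.
  + apply: Jet_sum => // j; apply: Jet_mul; first exact: NashM_An.
      exact: IH (h3 j).
    by apply: Jet_nash => //; exact: Nash_dC.
Unshelve. all: by end_near. Qed.

(** The converse of [Jet_comp] for a projection: the derivatives of [h] are among those of [h] seen
    as a function of more variables. *)
Lemma Jet_rsub k m n q (h : 'rV[C]_n -> C) (g : 'rV[C]_q -> 'rV[C]_(m + n)) a : AnM g a ->
  An h (rsubmx (g a)) ->
  Jet k (fun y => h (rsubmx y)) g a -> Jet k h (fun s => rsubmx (g s)) a.
Proof.
move=> hg; elim: k h => [|k IH] h hh [h1 h2 h3]; split => // i.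
apply: IH; first exact: An_dC.
apply: (@Jet_near _ _ _ (dC (rshift m i) (fun y => h (rsubmx y)))) => //; last exact: h3.
have rA : AnM (fun y : 'rV[C]_(m + n) => rsubmx y) (g a) by apply: AnM_rsub; exact: An_coord.
have A1 := An_nbhs hh.
have A3 : \forall y \near g a, An h (rsubmx y) by exact: (An_near_map rA A1).
near=> y; have hy : An h (rsubmx y) by near: y.
have ry : AnM (fun y : 'rV[C]_(m + n) => rsubmx y) y by apply: AnM_rsub; exact: An_coord.
rewrite (dC_comp _ hy ry) (bigD1 i) //= big1 ?addr0.
  by under eq_fun do rewrite mxE; rewrite dC_coord eqxx mulr1.
move=> j ji; under eq_fun do rewrite mxE; rewrite dC_coord.
by rewrite (inj_eq (@rshift_inj m n)) eq_sym (negPf ji) mulr0.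
Unshelve. all: by end_near. Qed.

Lemma Jet_dCs k n q I h (g : 'rV[C]_q -> 'rV[C]_n) a : Jets h g a -> Jet k (dCs I h) g a.
Proof.
move=> H; elim: I k => [|i I IH] k //=.
by have [_ _] := IH k.+1; exact.
Qed.

End Jets.

Section LinearAlgebra.
Variable R : realType.
Local Notation C := (Cx R).

Lemma unitmx_injP (d : nat) (A : 'M[C]_d) :
  (forall c : 'cV[C]_d, A *m c = 0 -> c = 0) -> A \in unitmx.
Proof.
move=> h; rewrite -unitmx_tr -row_free_unit -kermx_eq0; apply/rowV0P => v /sub_kermxP vA.
apply: trmx_inj; rewrite trmx0; apply: h; apply: trmx_inj.
by rewrite trmx_mul trmxK vA trmx0.
Qed.

Definition Dmx n k (G : 'rV[C]_n -> 'rV[C]_k) a : 'M[C]_(n, k) :=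
  \matrix_(i, j) Dd (fun x => G x 0 j) a (delta_mx 0 i).

Lemma DM_mx n k (G : 'rV[C]_n -> 'rV[C]_k) a v : DM G a v = v *m Dmx G a.
Proof.
apply/rowP => j; rewrite !mxE [in LHS](row_sum_delta v) Dd_sumv; apply: eq_bigr => i _.
by rewrite DdZ mxE.
Qed.

Definition nondeg n k d (G : 'rV[C]_n -> 'rV[C]_d) (e : 'rV[C]_k -> 'rV[C]_n) u :=
  forall w, DM G u (e w) = 0 -> w = 0.

Lemma nondeg_near n d (G : 'rV[C]_n -> 'rV[C]_d) (E : 'M[C]_(d, n)) (u : 'rV[C]_n) :
  AnM G u -> nondeg G (fun w => w *m E) u ->
  \forall x \near u, nondeg G (fun w => w *m E) x.
Proof.
move=> hG hn.
have hA (i j : 'I_d) : An (fun x => (E *m Dmx G x) i j) u.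
  under eq_fun do rewrite mxE; apply: An_sum => k; apply: An_mul; first exact: An_cst.
  by under eq_fun do rewrite mxE; exact: An_Dd.
have uA : E *m Dmx G u \in unitmx.
  rewrite -row_free_unit -kermx_eq0; apply/rowV0P => v /sub_kermxP vA.
  by apply: hn; rewrite DM_mx -mulmxA.
have := unitmx_near hA uA; apply: filterS => x ux w; rewrite DM_mx -mulmxA => h.
by rewrite -[w](mulmxK ux) h mul0mx.
Qed.

End LinearAlgebra.

(** * Translations in algebraic coordinates *)

Section Setup.
Variable R : realType.
Local Notation C := (Cx R).
Variables m d : nat.
Local Notation N := (m + d)%N.

Implicit Types (phi : 'rV[C]_m -> 'rV[C]_d) (rho : 'rV[C]_(N + N) -> 'rV[C]_d).

(* [u = (t, tau)], [t = (z, w)], [tau = (zeta, omega)]: the equation [w - omega = phi (z - zeta)] of the complexified tube. *)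
Definition inM phi (u : 'rV[C]_(N + N)) : Prop :=
  rsubmx (lsubmx u) - rsubmx (rsubmx u) = phi (lsubmx (lsubmx u) - lsubmx (rsubmx u)).

(** Tangent to the identity at 0, so that vectors at 0 have the same components in both coordinate
    systems. *)
Record biholo (F G : 'rV[C]_N -> 'rV[C]_N) : Prop := Biholo {
  bih_An : AnM F 0;
  bih_An' : AnM G 0;
  bih0 : F 0 = 0;
  bih0' : G 0 = 0;
  bihD : forall v, DM F 0 v = v;
  bihK : \forall t \near (0 : 'rV[C]_N), G (F t) = t;
  bihK' : \forall t \near (0 : 'rV[C]_N), F (G t) = t }.

(** [Pt] is not tied to [Ph] by conjugation, which leaves the data symmetric in [t] and [tau]. Only
    one inclusion is asked in [szero]; the other is [pull_zero]. *)
Record setup phi Ph Ps Pt Pst rho : Prop := Setup {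
  sphi : AnM phi 0;
  sphi0 : phi 0 = 0;
  sPh : biholo Ph Ps;
  sPt : biholo Pt Pst;
  srho : NashM rho 0;
  szero : \forall u \near (0 : 'rV[C]_(N + N)), inM phi u -> rho (row_mx (Ph (lsubmx u)) (Pt (rsubmx u))) = 0;
  sind : forall c : 'cV[C]_d, (forall v, DM rho 0 v *m c = 0) -> c = 0 }.

Definition swap (u : 'rV[C]_(N + N)) : 'rV[C]_(N + N) := row_mx (rsubmx u) (lsubmx u).

Lemma swap0 : swap 0 = 0.
Proof. by rewrite /swap linear0 linear0 row_mx0. Qed.
Lemma swapK u : swap (swap u) = u.
Proof. by rewrite /swap row_mxKl row_mxKr hsubmxK. Qed.

Lemma NashM_swap u : NashM swap u.
Proof. by apply: NashM_row; [apply: NashM_rsub|apply: NashM_lsub]; exact: NashM_id. Qed.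

Lemma DM_swap u v : DM swap u v = swap v.
Proof. by rewrite DM_row DM_rsub DM_lsub DM_id. Qed.

(** Read from the side of [tau], the equation of the tube is [omega - w = - phi (- (zeta - z))].
    Results that lead from [Xf] to [Yf] thus also lead back. *)
Lemma setup_swap phi Ph Ps Pt Pst rho : setup phi Ph Ps Pt Pst rho ->
  setup (fun x => - phi (- x)) Pt Pst Ph Ps (fun u => rho (swap u)).
Proof.
case=> h1 h2 h3 h4 h5 h6 h7; split => //.
- apply: AnM_opp; apply: (@AnM_comp _ _ _ _ phi (fun x => - x)); first by rewrite oppr0.
  by apply: AnM_opp; exact: An_coord.
- by rewrite oppr0 h2 oppr0.
- by apply: NashM_comp; [rewrite swap0|exact: NashM_swap].
- have hs : \forall u \near (0 : 'rV[C]_(N + N)), inM phi (swap u) ->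
     rho (row_mx (Ph (lsubmx (swap u))) (Pt (rsubmx (swap u)))) = 0.
    apply: (An_near_map (G := swap) (P := fun v => inM phi v -> rho (row_mx (Ph (lsubmx v)) (Pt (rsubmx v))) = 0)).
      exact: NashM_An (NashM_swap 0).
    by rewrite swap0.
  apply: filterS hs => u; rewrite /inM /swap !row_mxKl !row_mxKr => h e; apply: h.
  by rewrite -[LHS]opprB e opprB opprK.
- move=> c hc; apply: h7 => v; have := hc (swap v).
  rewrite DM_comp.
  + by rewrite DM_swap swapK swap0.
  + by rewrite swap0; exact: NashM_An.
  + exact: NashM_An (NashM_swap 0).
Qed.

Section WithSetup.
Variables (phi : 'rV[C]_m -> 'rV[C]_d) (Ph Ps Pt Pst : 'rV[C]_N -> 'rV[C]_N).
Variable rho : 'rV[C]_(N + N) -> 'rV[C]_d.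
Hypothesis H : setup phi Ph Ps Pt Pst rho.

Let aphi := sphi H. Let phi0 := sphi0 H. Let bPh := sPh H. Let bPt := sPt H.
Let arho := NashM_An (srho H).

(** The complexified tube as a graph over [(z, tau)], with projection [unpar]. *)
Definition par (y : 'rV[C]_(m + N)) : 'rV[C]_(N + N) :=
  row_mx (row_mx (lsubmx y) (rsubmx (rsubmx y) + phi (lsubmx y - lsubmx (rsubmx y)))) (rsubmx y).

Definition unpar (u : 'rV[C]_(N + N)) : 'rV[C]_(m + N) := row_mx (lsubmx (lsubmx u)) (rsubmx u).

Lemma par_unpar u : inM phi u -> par (unpar u) = u.
Proof.
rewrite /inM /par /unpar !row_mxKl !row_mxKr => <-.
by rewrite addrC subrK !hsubmxK.
Qed.

Lemma NashM_unpar u : NashM unpar u.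
Proof.
apply: NashM_row; last by apply: NashM_rsub; exact: NashM_id.
by apply: NashM_lsub; apply: NashM_lsub; exact: NashM_id.
Qed.

Lemma unpar0 : unpar 0 = 0.
Proof. by rewrite /unpar !linear0 row_mx0. Qed.

Let dif (y : 'rV[C]_(m + N)) := lsubmx y - lsubmx (rsubmx y).

Lemma dif0 : lsubmx (0 : 'rV[C]_(m + N)) - lsubmx (rsubmx (0 : 'rV[C]_(m + N))) = 0.
Proof. by apply/rowP => i; rewrite !mxE subrr. Qed.

Lemma AnM_dif y : AnM dif y.
Proof.
apply: AnM_add; first by apply: AnM_lsub; exact: An_coord.
by apply: AnM_opp; apply: AnM_lsub; apply: AnM_rsub; exact: An_coord.
Qed.

Lemma AnM_par y : AnM phi (lsubmx y - lsubmx (rsubmx y)) -> AnM par y.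
Proof.
move=> h; apply: AnM_row; last by apply: AnM_rsub; exact: An_coord.
apply: AnM_row; first by apply: AnM_lsub; exact: An_coord.
apply: AnM_add; first by apply: AnM_rsub; apply: AnM_rsub; exact: An_coord.
exact: (@AnM_comp _ _ _ _ phi dif y h (@AnM_dif y)).
Qed.

Lemma DM_par y v : AnM phi (lsubmx y - lsubmx (rsubmx y)) -> DM par y v =
  row_mx (row_mx (lsubmx v) (rsubmx (rsubmx v) +
    DM phi (lsubmx y - lsubmx (rsubmx y)) (lsubmx v - lsubmx (rsubmx v)))) (rsubmx v).
Proof.
move=> h; have a1 : AnM (fun y : 'rV[C]_(m + N) => lsubmx y) y by apply: AnM_lsub; exact: An_coord.
have a2 : AnM (fun y : 'rV[C]_(m + N) => rsubmx y) y by apply: AnM_rsub; exact: An_coord.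
have a3 := AnM_lsub a2; have a4 := AnM_rsub a2.
rewrite !DM_row DM_lsub DM_rsub DM_id DM_add //; last first.
  exact: (@AnM_comp _ _ _ _ phi dif y h (@AnM_dif y)).
rewrite DM_rsub DM_rsub DM_id (@DM_comp _ _ _ _ phi dif) //; last exact: AnM_dif.
by rewrite DM_sub // !DM_lsub DM_rsub DM_id.
Qed.

Lemma par0 : par 0 = 0.
Proof. by rewrite /par dif0 phi0 addr0 !linear0 !row_mx0. Qed.

Lemma par_inM y : inM phi (par y).
Proof. by rewrite /inM /par !row_mxKl !row_mxKr addrC addKr. Qed.

Definition pull (u : 'rV[C]_(N + N)) : 'rV[C]_d := rho (row_mx (Ph (lsubmx u)) (Pt (rsubmx u))).
Definition pm (u : 'rV[C]_(N + N)) : 'rV[C]_(N + N) := row_mx (Ph (lsubmx u)) (Pt (rsubmx u)).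
Definition ps (u : 'rV[C]_(N + N)) : 'rV[C]_(N + N) := row_mx (Ps (lsubmx u)) (Pst (rsubmx u)).

Lemma bih2_An (F G : 'rV[C]_N -> 'rV[C]_N) (u : 'rV[C]_(N + N)) : AnM F (lsubmx u) -> AnM G (rsubmx u) ->
  AnM (fun u => row_mx (F (lsubmx u)) (G (rsubmx u))) u.
Proof.
move=> hF hG; apply: AnM_row.
  by apply: (@AnM_comp _ _ _ _ F (fun u => lsubmx u)) => //; apply: AnM_lsub; exact: An_coord.
by apply: (@AnM_comp _ _ _ _ G (fun u => rsubmx u)) => //; apply: AnM_rsub; exact: An_coord.
Qed.

Lemma bih2_DM (F G : 'rV[C]_N -> 'rV[C]_N) (u v : 'rV[C]_(N + N)) : AnM F (lsubmx u) -> AnM G (rsubmx u) ->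
  DM (fun u => row_mx (F (lsubmx u)) (G (rsubmx u))) u v =
  row_mx (DM F (lsubmx u) (lsubmx v)) (DM G (rsubmx u) (rsubmx v)).
Proof.
move=> hF hG; rewrite DM_row (@DM_comp _ _ _ _ F (fun u => lsubmx u)) //; last first.
  by apply: AnM_lsub; exact: An_coord.
rewrite (@DM_comp _ _ _ _ G (fun u => rsubmx u)) //; last by apply: AnM_rsub; exact: An_coord.
by rewrite DM_lsub DM_rsub DM_id.
Qed.

Lemma pm0 : pm 0 = 0.
Proof. by rewrite /pm !linear0 (bih0 bPh) (bih0 bPt) row_mx0. Qed.
Lemma ps0 : ps 0 = 0.
Proof. by rewrite /ps !linear0 (bih0' bPh) (bih0' bPt) row_mx0. Qed.
Lemma AnM_pm0 : AnM pm 0.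
Proof. by apply: bih2_An; rewrite linear0; [exact: bih_An bPh|exact: bih_An bPt]. Qed.
Lemma AnM_ps0 : AnM ps 0.
Proof. by apply: bih2_An; rewrite linear0; [exact: bih_An' bPh|exact: bih_An' bPt]. Qed.

Lemma near_lsub (P : 'rV[C]_N -> Prop) : (\forall t \near (0 : 'rV[C]_N), P t) ->
  \forall u \near (0 : 'rV[C]_(N + N)), P (lsubmx u).
Proof.
move=> h; apply: (An_near_map (G := fun u : 'rV[C]_(N + N) => lsubmx u) (P := P)).
  by apply: AnM_lsub; exact: An_coord.
by rewrite linear0.
Qed.
Lemma near_rsub (P : 'rV[C]_N -> Prop) : (\forall t \near (0 : 'rV[C]_N), P t) ->
  \forall u \near (0 : 'rV[C]_(N + N)), P (rsubmx u).
Proof.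
move=> h; apply: (An_near_map (G := fun u : 'rV[C]_(N + N) => rsubmx u) (P := P)).
  by apply: AnM_rsub; exact: An_coord.
by rewrite linear0.
Qed.

Lemma pullE u : pull u = rho (pm u). Proof. by []. Qed.

Lemma AnM_pull0 : AnM pull 0.
Proof. by apply: (@AnM_comp _ _ _ _ rho pm); [rewrite pm0|exact: AnM_pm0]. Qed.

Lemma DM_pull : \forall u \near (0 : 'rV[C]_(N + N)), forall v,
  DM pull u v = DM rho (pm u) (row_mx (DM Ph (lsubmx u) (lsubmx v)) (DM Pt (rsubmx u) (rsubmx v))).
Proof.
have h1 := near_lsub (AnM_nbhs (bih_An bPh)); have h2 := near_rsub (AnM_nbhs (bih_An bPt)).
have h3 : \forall u \near (0 : 'rV[C]_(N + N)), AnM rho (pm u).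
  by apply: (An_near_map AnM_pm0 (P := fun u => AnM rho u)); rewrite pm0; exact: AnM_nbhs.
near=> u => v.
have a1 : AnM Ph (lsubmx u) by near: u.
have a2 : AnM Pt (rsubmx u) by near: u.
have a3 : AnM rho (pm u) by near: u.
rewrite (@DM_comp _ _ _ _ rho pm) //; last exact: bih2_An.
by congr DM; exact: bih2_DM.
Unshelve. all: by end_near. Qed.

Definition tangent (u v : 'rV[C]_(N + N)) : Prop :=
  rsubmx (lsubmx v) - rsubmx (rsubmx v) =
  DM phi (lsubmx (lsubmx u) - lsubmx (rsubmx u)) (lsubmx (lsubmx v) - lsubmx (rsubmx v)).

(** The composite of [pull] and [par] is 0, and the differential of [par] at [unpar u] reaches every
    tangent vector at [u]. *)
Lemma DM_pull_tangent : \forall u \near (0 : 'rV[C]_(N + N)), inM phi u ->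
  forall v, tangent u v -> DM pull u v = 0.
Proof.
have ap : AnM par 0 by apply: AnM_par; rewrite dif0.
have h1 : \forall y \near (0 : 'rV[C]_(m + N)), pull (par y) = 0.
  have : \forall y \near (0 : 'rV[C]_(m + N)), inM phi (par y) -> pull (par y) = 0.
    apply: (An_near_map ap (P := fun u => inM phi u -> pull u = 0)).
    by rewrite par0; exact: szero H.
  by apply: filterS => y; apply; exact: par_inM.
have h2 : \forall u \near (0 : 'rV[C]_(N + N)), \forall y \near unpar u, pull (par y) = 0.
  apply: (An_near_map (NashM_An (NashM_unpar 0)) (P := fun y => \forall y' \near y, pull (par y') = 0)).
  by rewrite unpar0; exact: near_near.
have h3 : \forall u \near (0 : 'rV[C]_(N + N)), AnM phi (dif (unpar u)).
  apply: (An_near_map (G := fun u => dif (unpar u)) (P := fun y => AnM phi y)).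
    by apply: (@AnM_comp _ _ _ _ dif unpar); [exact: AnM_dif|exact: NashM_An (NashM_unpar 0)].
  by rewrite unpar0 /dif dif0; exact: AnM_nbhs.
have h4 := AnM_nbhs AnM_pull0.
near=> u => uM v tv.
have a1 : AnM phi (dif (unpar u)) by near: u.
have a2 : AnM pull u by near: u.
have a3 : \forall y \near unpar u, pull (par y) = 0 by near: u.
have e : DM (fun y => pull (par y)) (unpar u) (unpar v) = 0 by rewrite (DM_near _ a3) DM_cst.
rewrite -e (@DM_comp _ _ _ _ pull par) ?par_unpar //; last exact: AnM_par.
congr DM; rewrite DM_par // /unpar !row_mxKl !row_mxKr -tv.
by rewrite addrC subrK !hsubmxK.
Unshelve. all: by end_near. Qed.

End WithSetup.
End Setup.

(** * The equation [rho = 0] as a graph *)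

Section SegreGraph.
Variable R : realType.
Local Notation C := (Cx R).
Variables m d : nat.
Local Notation N := (m + d)%N.

Definition emb (w : 'rV[C]_d) : 'rV[C]_(N + N) := row_mx (row_mx 0 w) 0.

Lemma emb_mx : emb = fun w => w *m row_mx (row_mx 0 1%:M) 0.
Proof. by apply/funext => w; rewrite !mul_mx_row !mulmx0 mulmx1. Qed.

Lemma nondeg_emb_near (G : 'rV[C]_(N + N) -> 'rV[C]_d) (u : 'rV[C]_(N + N)) :
  AnM G u -> nondeg G emb u -> \forall x \near u, nondeg G emb x.
Proof. by rewrite emb_mx; exact: nondeg_near. Qed.

(* Reordering of the coordinates that puts the block [w] last. *)
Definition reo (v : 'rV[C]_((m + N) + d)) : 'rV[C]_(N + N) :=
  row_mx (row_mx (lsubmx (lsubmx v)) (rsubmx v)) (rsubmx (lsubmx v)).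
Definition oer (u : 'rV[C]_(N + N)) : 'rV[C]_((m + N) + d) :=
  row_mx (row_mx (lsubmx (lsubmx u)) (rsubmx u)) (rsubmx (lsubmx u)).

Lemma NashM_reo v : NashM reo v.
Proof.
apply: NashM_row; last by apply: NashM_rsub; apply: NashM_lsub; exact: NashM_id.
by apply: NashM_row; [do 2 apply: NashM_lsub|apply: NashM_rsub]; exact: NashM_id.
Qed.
Lemma NashM_oer v : NashM oer v.
Proof.
apply: NashM_row; last by apply: NashM_rsub; apply: NashM_lsub; exact: NashM_id.
by apply: NashM_row; [do 2 apply: NashM_lsub|apply: NashM_rsub]; exact: NashM_id.
Qed.
Lemma DM_reo v w : DM reo v w = reo w.
Proof. by rewrite !DM_row !DM_lsub !DM_rsub !DM_lsub DM_id. Qed.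
Lemma oerK u : reo (oer u) = u.
Proof. by rewrite /reo /oer !row_mxKl !row_mxKr !hsubmxK. Qed.
Lemma reo0 : reo 0 = 0.
Proof. by rewrite /reo !linear0 !row_mx0. Qed.
Lemma oer0 : oer 0 = 0.
Proof. by rewrite /oer !linear0 !row_mx0. Qed.
Lemma reo_emb w : reo (row_mx 0 w) = emb w.
Proof. by rewrite /reo /emb row_mxKl row_mxKr !linear0. Qed.

Section Graph.
Variable Q : forall n, ('rV[C]_n -> C) -> 'rV[C]_n -> Prop.
Hypothesis QA : forall n (f : 'rV[C]_n -> C) a, Q f a -> An f a.
Hypothesis Qcomp : forall n k (f : 'rV[C]_n -> C) (G : 'rV[C]_k -> 'rV[C]_n) a,
  Q f (G a) -> NashM G a -> Q (fun x => f (G x)) a.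
Hypothesis Qift : forall d q (G : 'I_d -> 'rV[C]_(q + d) -> C) (a : 'rV[C]_q) (b : 'rV[C]_d),
  (forall k, Q (G k) (row_mx a b)) -> (forall k, G k (row_mx a b) = 0) ->
  (forall w, (forall k, Dd (G k) (row_mx a b) (row_mx 0 w) = 0) -> w = 0) ->
  exists th : 'rV[C]_q -> 'rV[C]_d,
    [/\ forall j, Q (fun x => th x 0 j) a, th a = b,
        \forall x \near a, forall k, G k (row_mx x (th x)) = 0 &
        \forall v \near row_mx a b, (forall k, G k v = 0) -> rsubmx v = th (lsubmx v)].

Lemma graph_gen (G : 'rV[C]_(N + N) -> 'rV[C]_d) : (forall k, Q (fun u => G u 0 k) 0) ->
  G 0 = 0 -> nondeg G emb 0 ->
  exists th : 'rV[C]_(m + N) -> 'rV[C]_d,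
    [/\ forall j, Q (fun y => th y 0 j) 0, th 0 = 0,
        \forall y \near (0 : 'rV[C]_(m + N)), G (reo (row_mx y (th y))) = 0 &
        \forall u \near (0 : 'rV[C]_(N + N)), G u = 0 -> rsubmx (lsubmx u) = th (unpar u)].
Proof.
move=> hG G0 hn.
have z0 : row_mx (0 : 'rV[C]_(m + N)) (0 : 'rV[C]_d) = 0 by rewrite row_mx0.
have aG : AnM G 0 by move=> k; apply: QA; exact: hG.
have [|||th [t1 t2 t3 t4]] := @Qift d (m + N)%N (fun k v => G (reo v) 0 k) 0 0.
- by move=> k; rewrite z0; apply: (@Qcomp _ _ (fun u => G u 0 k) reo); rewrite ?reo0 //; exact: NashM_reo.
- by move=> k; rewrite z0 reo0 G0 mxE.
- move=> w hw; apply: hn.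
  have := @DM_comp R _ _ _ G reo 0 (row_mx 0 w); rewrite reo0 => /(_ aG (NashM_An (NashM_reo 0))).
  rewrite DM_reo reo_emb => <-; apply/rowP => k; rewrite !mxE -(hw k) z0 //.
exists th; split => //.
- by apply: filterS t3 => y hy; apply/rowP => k; rewrite hy mxE.
- have : \forall u \near (0 : 'rV[C]_(N + N)), (forall k, G (reo (oer u)) 0 k = 0) -> rsubmx (oer u) = th (lsubmx (oer u)).
    apply: (An_near_map (NashM_An (NashM_oer 0)) (P := fun v => (forall k, G (reo v) 0 k = 0) -> rsubmx v = th (lsubmx v))).
    by rewrite oer0 -z0.
  apply: filterS => u hu Gu; move: hu; rewrite oerK Gu /oer row_mxKr row_mxKl; apply => k.
  by rewrite mxE.
Qed.
End Graph.

Definition An_graph := @graph_gen (@An R) (fun n f a h => h)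
  (fun n k f G a hf hG => An_comp hf (NashM_An hG)) (@An_vector_ift R).
Definition Nash_graph := @graph_gen (@Nash R) (fun n f a h => h.1)
  (fun n k f G a hf hG => Nash_comp hf hG) (@Nash_vector_ift R).

Section WithSetup.
Variables (phi : 'rV[C]_m -> 'rV[C]_d) (Ph Ps Pt Pst : 'rV[C]_N -> 'rV[C]_N).
Variable rho : 'rV[C]_(N + N) -> 'rV[C]_d.
Hypothesis H : setup phi Ph Ps Pt Pst rho.

Let aphi := sphi H. Let phi0 := sphi0 H. Let bPh := sPh H. Let bPt := sPt H.
Let arho := NashM_An (srho H).
Local Notation pull := (pull Ph Pt rho).
Local Notation pm := (pm Ph Pt).
Local Notation ps := (ps Ps Pst).

Lemma inM0 : inM phi 0.
Proof.
rewrite /inM; have -> : lsubmx (lsubmx (0 : 'rV[C]_(N + N))) - lsubmx (rsubmx (0 : 'rV[C]_(N + N))) = 0.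
  by apply/rowP => i; rewrite !mxE subrr.
by rewrite phi0; apply/rowP => i; rewrite !mxE subrr.
Qed.

Lemma rho0 : rho 0 = 0.
Proof.
have := nbhs_singleton (szero H) inM0.
by rewrite !linear0 (bih0 bPh) (bih0 bPt) row_mx0.
Qed.

Lemma DM_pull0 v : DM pull 0 v = DM rho 0 v.
Proof.
have /nbhs_singleton -> := DM_pull H.
by rewrite (pm0 H) !linear0 (bihD bPh) (bihD bPt) hsubmxK.
Qed.

(** Every vector is the sum of a tangent one, killed by [d rho] at 0, and some [emb w]. So the
    vectors [emb w] already give the whole image of [d rho], which is everything by [sind]. *)
Lemma nondeg_rho0 : nondeg rho emb 0.
Proof.
have t0 v : tangent phi 0 v -> DM rho 0 v = 0.
  by rewrite -DM_pull0; exact: (nbhs_singleton (DM_pull_tangent H)) inM0 v.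
pose A : 'M[C]_d := row_mx (row_mx 0 1%:M) 0 *m Dmx rho 0.
have eA w : DM rho 0 (emb w) = w *m A by rewrite emb_mx DM_mx mulmxA.
have uA : A \in unitmx.
  apply: unitmx_injP => c Ac; apply: (sind H) => v.
  pose w := rsubmx (lsubmx v) - rsubmx (rsubmx v) -
    DM phi (lsubmx (lsubmx (0 : 'rV[C]_(N + N))) - lsubmx (rsubmx (0 : 'rV[C]_(N + N)))) (lsubmx (lsubmx v) - lsubmx (rsubmx v)).
  have -> : v = (v - emb w) + emb w by rewrite subrK.
  rewrite DM_D mulmxDl [X in X *m c]t0 ?mul0mx ?add0r.
    by rewrite eA -mulmxA Ac mulmx0.
  have p1 : lsubmx (lsubmx (v - emb w)) = lsubmx (lsubmx v).
    by rewrite !raddfB /= /emb !row_mxKl subr0.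
  have p2 : rsubmx (v - emb w) = rsubmx v by rewrite raddfB /= /emb row_mxKr subr0.
  have p3 : rsubmx (lsubmx (v - emb w)) = rsubmx (lsubmx v) - w.
    have e : rsubmx (lsubmx (emb w)) = w by rewrite /emb row_mxKl row_mxKr.
    by rewrite -[in RHS]e; apply/rowP => i; rewrite !mxE.
  rewrite /tangent p1 p2 p3 /w; set D := DM _ _ _; apply/rowP => i; rewrite !mxE.
  by ring.
by move=> w; rewrite eA => h; rewrite -[w](mulmxK uA) h mul0mx.
Qed.

(** The tube and [pull = 0] are both graphs of [w] over [(z, tau)] near 0, and one contains the
    other: they coincide by uniqueness in the implicit function theorem. *)
Lemma pull_zero : \forall u \near (0 : 'rV[C]_(N + N)), pull u = 0 -> inM phi u.
Proof.
have hn : nondeg pull emb 0 by move=> w; rewrite DM_pull0; exact: nondeg_rho0.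
have p0 : pull 0 = 0 by rewrite pullE (pm0 H) rho0.
have [th [_ _ _ t4]] := An_graph (AnM_pull0 H) p0 hn.
have ap : AnM (par phi) 0 by apply: AnM_par; rewrite dif0.
have au := NashM_An (@NashM_unpar R m d 0).
have t5 : \forall u \near (0 : 'rV[C]_(N + N)), pull (par phi (unpar u)) = 0 ->
     rsubmx (lsubmx (par phi (unpar u))) = th (unpar (par phi (unpar u))).
  apply: (An_near_map (G := fun u => par phi (unpar u)) (P := fun u => pull u = 0 -> rsubmx (lsubmx u) = th (unpar u))).
    by apply: (AnM_comp (F := par phi) (G := @unpar R m d)) => //; rewrite unpar0.
  by rewrite unpar0 (par0 H).
have z5 : \forall u \near (0 : 'rV[C]_(N + N)), inM phi (par phi (unpar u)) -> pull (par phi (unpar u)) = 0.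
  apply: (An_near_map (G := fun u => par phi (unpar u)) (P := fun u => inM phi u -> pull u = 0)).
    by apply: (AnM_comp (F := par phi) (G := @unpar R m d)) => //; rewrite unpar0.
  by rewrite unpar0 (par0 H); exact: szero H.
near=> u => pu.
have e1 : rsubmx (lsubmx u) = th (unpar u).
  have h : pull u = 0 -> rsubmx (lsubmx u) = th (unpar u) by near: u.
  exact: h.
have e2 : pull (par phi (unpar u)) = 0.
  have h : inM phi (par phi (unpar u)) -> pull (par phi (unpar u)) = 0 by near: u.
  by apply: h; exact: par_inM.
have e3 : rsubmx (lsubmx (par phi (unpar u))) = th (unpar u).
  have h : pull (par phi (unpar u)) = 0 ->
     rsubmx (lsubmx (par phi (unpar u))) = th (unpar (par phi (unpar u))) by near: u.
  by rewrite (h e2); congr th; rewrite /unpar /par !row_mxKl !row_mxKr.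
rewrite -e1 in e3; have := par_inM phi (unpar u).
by rewrite /inM e3 /par /unpar !row_mxKl !row_mxKr.
Unshelve. all: by end_near. Qed.

Definition Xf (a t : 'rV[C]_N) := DM Ph (Ps t) a.
Definition Yf (a t : 'rV[C]_N) := DM Pt (Pst t) a.

Lemma tangent_diag u a : tangent phi u (row_mx a a).
Proof.
by rewrite /tangent row_mxKl row_mxKr !subrr DM_mx mul0mx.
Qed.

(* Translations preserve the tube, so their push-forwards are tangent to [rho = 0]. *)
Lemma rho_XY : \forall u \near (0 : 'rV[C]_(N + N)), rho u = 0 ->
  forall a, DM rho u (row_mx (Xf a (lsubmx u)) (Yf a (rsubmx u))) = 0.
Proof.
have h1 := near_lsub (bihK' bPh); have h2 := near_rsub (bihK' bPt).
have h3 : \forall u \near (0 : 'rV[C]_(N + N)), pull (ps u) = 0 -> inM phi (ps u).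
  by apply: (An_near_map (AnM_ps0 H) (P := fun u => pull u = 0 -> inM phi u)); rewrite (ps0 H); exact: pull_zero.
have h4 : \forall u \near (0 : 'rV[C]_(N + N)), inM phi (ps u) -> forall v, tangent phi (ps u) v -> DM pull (ps u) v = 0.
  apply: (An_near_map (AnM_ps0 H) (P := fun u => inM phi u -> forall v, tangent phi u v -> DM pull u v = 0)).
  by rewrite (ps0 H); exact: (DM_pull_tangent H).
have h5 : \forall u \near (0 : 'rV[C]_(N + N)), forall v,
    DM pull (ps u) v = DM rho (pm (ps u)) (row_mx (DM Ph (lsubmx (ps u)) (lsubmx v)) (DM Pt (rsubmx (ps u)) (rsubmx v))).
  apply: (An_near_map (AnM_ps0 H) (P := fun u => forall v,
    DM pull u v = DM rho (pm u) (row_mx (DM Ph (lsubmx u) (lsubmx v)) (DM Pt (rsubmx u) (rsubmx v))))).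
  by rewrite (ps0 H); exact: (DM_pull H).
near=> u => ru a.
have e1 : Ph (Ps (lsubmx u)) = lsubmx u by near: u.
have e2 : Pt (Pst (rsubmx u)) = rsubmx u by near: u.
have pmps : pm (ps u) = u by rewrite /pm /ps row_mxKl row_mxKr e1 e2 hsubmxK.
have uM : inM phi (ps u).
  have h : pull (ps u) = 0 -> inM phi (ps u) by near: u.
  by apply: h; rewrite pullE pmps.
have h6 : inM phi (ps u) -> forall v, tangent phi (ps u) v -> DM pull (ps u) v = 0 by near: u.
have h7 : forall v, DM pull (ps u) v = DM rho (pm (ps u)) (row_mx (DM Ph (lsubmx (ps u)) (lsubmx v)) (DM Pt (rsubmx (ps u)) (rsubmx v))) by near: u.
have := h6 uM _ (tangent_diag (ps u) a).
by rewrite h7 pmps /ps !row_mxKl !row_mxKr.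
Unshelve. all: by end_near. Qed.

Lemma AnM_Xf a : AnM (Xf a) 0.
Proof.
apply: (@AnM_comp R _ _ _ (fun t => DM Ph t a) Ps); last exact: bih_An' bPh.
by rewrite (bih0' bPh); apply: AnM_DM; exact: bih_An bPh.
Qed.
Lemma AnM_Yf a : AnM (Yf a) 0.
Proof.
apply: (@AnM_comp R _ _ _ (fun t => DM Pt t a) Pst); last exact: bih_An' bPt.
by rewrite (bih0' bPt); apply: AnM_DM; exact: bih_An bPt.
Qed.

(** The counterpart of [par] in the new coordinates; it is Nash because [rho] is. *)
Lemma rho_graph : exists T : 'rV[C]_(m + N) -> 'rV[C]_(N + N),
  [/\ NashM T 0, T 0 = 0, forall y, unpar (T y) = y,
      \forall y \near (0 : 'rV[C]_(m + N)), rho (T y) = 0 &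
      \forall u \near (0 : 'rV[C]_(N + N)), rho u = 0 -> u = T (unpar u)].
Proof.
have [th [t1 t2 t3 t4]] := Nash_graph (srho H) rho0 nondeg_rho0.
exists (fun y => reo (row_mx y (th y))); split => //.
- apply: NashM_comp; first exact: NashM_reo.
  by apply: NashM_row => //; exact: NashM_id.
- by rewrite t2 row_mx0 reo0.
- by move=> y; rewrite /unpar /reo !row_mxKl !row_mxKr hsubmxK.
- apply: filterS t4 => u hu ru; rewrite -hu //.
  by rewrite -[LHS]oerK.
Qed.

End WithSetup.
End SegreGraph.

(** * Iterated derivatives in the first block of variables *)

Section PartialSums.
Variable R : realType.
Local Notation C := (Cx R).

Lemma DM_0 n k (F : 'rV[C]_n -> 'rV[C]_k) a : DM F a 0 = 0.
Proof. by rewrite DM_mx mul0mx. Qed.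

Lemma Nash_dCs n (I : seq 'I_n) (f : 'rV[C]_n -> C) a : Nash f a -> Nash (dCs I f) a.
Proof. by move=> h; elim: I => //= i I IH; exact: Nash_dC. Qed.

Lemma AnM_rsub_id m n (y : 'rV[C]_(m + n)) : AnM (fun y : 'rV[C]_(m + n) => rsubmx y) y.
Proof. by apply: AnM_rsub; exact: An_coord. Qed.

Lemma dC_rsub m n (Y : 'rV[C]_n -> C) (y : 'rV[C]_(m + n)) i : An Y (rsubmx y) ->
  dC (lshift n i) (fun x => Y (rsubmx x)) y = 0.
Proof.
move=> hY; rewrite (dC_comp _ hY (@AnM_rsub_id _ _ y)) big1 // => j _.
by under eq_fun do rewrite mxE; rewrite dC_coord eq_lrshift mulr0.
Qed.

(** Functions of the second block are constants for these derivatives, so a linear system can be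
    differentiated while its unknowns stay the same. *)
Lemma dCs_rsub m n N (I : seq 'I_m) (A : 'I_N -> 'rV[C]_(m + n) -> C) (Y : 'I_N -> 'rV[C]_n -> C)
    (y : 'rV[C]_(m + n)) :
  (forall j, An (A j) y) -> (forall j, An (Y j) (rsubmx y)) ->
  \forall x \near y, dCs (map (@lshift m n) I) (fun x => \sum_j A j x * Y j (rsubmx x)) x =
    \sum_j dCs (map (@lshift m n) I) (A j) x * Y j (rsubmx x).
Proof.
move=> hA hY; elim: I => [|i I IH]; first by near=> x.
have h1 := dC_near_near (lshift n i) IH.
have h2 j : \forall x \near y, An (dCs (map (@lshift m n) I) (A j)) x by apply: An_nbhs; exact: An_dCs.
have h3 : \forall x \near y, forall j, An (dCs (map (@lshift m n) I) (A j)) x by exact: filter_forall h2.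
have h4 j : \forall x \near y, An (Y j) (rsubmx x).
  by apply: (An_near_map (@AnM_rsub_id _ _ y)); exact: An_nbhs.
have h5 : \forall x \near y, forall j, An (Y j) (rsubmx x) by exact: filter_forall h4.
near=> x; rewrite [LHS]/=.
have -> : dC (lshift n i) (dCs (map (@lshift m n) I) (fun x => \sum_j A j x * Y j (rsubmx x))) x =
  dC (lshift n i) (fun x => \sum_j dCs (map (@lshift m n) I) (A j) x * Y j (rsubmx x)) x by near: x.
have a1 : forall j, An (dCs (map (@lshift m n) I) (A j)) x by near: x.
have a2 : forall j, An (Y j) (rsubmx x) by near: x.
have a3 j : An (fun x => Y j (rsubmx x)) x by exact: (An_comp (a2 j) (@AnM_rsub_id _ _ x)).
rewrite dC_sum; last by move=> j; exact: An_mul.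
by apply: eq_bigr => j _; rewrite dC_mul // dC_rsub // mulr0 addr0.
Unshelve. all: by end_near. Qed.

Lemma dCs_restrict m n (I : seq 'I_m) (f : 'rV[C]_(m + n) -> C) (a : 'rV[C]_m) (b : 'rV[C]_n) :
  An f (row_mx a b) ->
  \forall x \near a, dCs I (fun x => f (row_mx x b)) x = dCs (map (@lshift m n) I) f (row_mx x b).
Proof.
move=> hf; have rA x : AnM (fun x : 'rV[C]_m => row_mx x b) x.
  by apply: NashM_An; apply: NashM_row; [exact: NashM_id|exact: NashM_cst].
elim: I => [|i I IH]; first by near=> x.
have h1 := dC_near_near i IH.
have h2 : \forall x \near a, An (dCs (map (@lshift m n) I) f) (row_mx x b).
  by apply: (An_near_map (rA a)); apply: An_nbhs; exact: An_dCs.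
near=> x; rewrite [LHS]/=.
have -> : dC i (dCs I (fun x => f (row_mx x b))) x =
   dC i (fun x => dCs (map (@lshift m n) I) f (row_mx x b)) x by near: x.
have h3 : An (dCs (map (@lshift m n) I) f) (row_mx x b) by near: x.
rewrite (@dC_comp R _ _ _ (fun x => row_mx x b) x i h3 (rA x)) (bigD1 (lshift n i)) //= big1 ?addr0.
  by under [fun y => row_mx y b _ _]eq_fun do rewrite row_mxEl; rewrite dC_coord eqxx mulr1.
move=> j; rewrite -(splitK j); case: (fintype.split j) => l /= jl.
  under [fun y => row_mx y b _ _]eq_fun do rewrite row_mxEl; rewrite dC_coord.
  by rewrite (inj_eq (@lshift_inj m n)) in jl; rewrite eq_sym (negPf jl) mulr0.
by under [fun y => row_mx y b _ _]eq_fun do rewrite row_mxEr; rewrite dC_cst mulr0.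
Unshelve. all: by end_near. Qed.

End PartialSums.

(** * One passage along a Segre variety *)

Section Step.
Variable R : realType.
Local Notation C := (Cx R).
Variables m d : nat.
Local Notation N := (m + d)%N.
Variables (phi : 'rV[C]_m -> 'rV[C]_d) (Ph Ps Pt Pst : 'rV[C]_N -> 'rV[C]_N).
Variable rho : 'rV[C]_(N + N) -> 'rV[C]_d.
Hypothesis H : setup phi Ph Ps Pt Pst rho.

(** Holomorphic nondegeneracy: a nonzero [v] violating it would make the complexified tube
    invariant, near 0, under translations of [tau] along [v] with [t] fixed. *)
Definition levi_nondeg (f : 'rV[C]_m -> 'rV[C]_d) := forall v : 'rV[C]_N,
  (\forall x \near (0 : 'rV[C]_m), rsubmx v = DM f x (lsubmx v)) -> v = 0.

Hypothesis FN : levi_nondeg phi.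

Let aphi := sphi H. Let phi0 := sphi0 H. Let bPh := sPh H. Let bPt := sPt H.
Let arho := NashM_An (srho H).
Local Notation pull := (pull Ph Pt rho).
Local Notation pm := (pm Ph Pt).
Local Notation Xf := (Xf Ph Ps).
Local Notation Yf := (Yf Pt Pst).

Variable T : 'rV[C]_(m + N) -> 'rV[C]_(N + N).
Hypothesis TN : NashM T 0.
Hypothesis T0 : T 0 = 0.
Hypothesis TK : forall y, unpar (T y) = y.
Hypothesis Tz : \forall y \near (0 : 'rV[C]_(m + N)), rho (T y) = 0.
Hypothesis Tu : \forall u \near (0 : 'rV[C]_(N + N)), rho u = 0 -> u = T (unpar u).

(** The differential of [rho] in the [tau'] directions: the coefficients of the linear system for
    [Yf] in [Arow_Y]. *)
Definition Arow (y : 'rV[C]_(m + N)) (k : 'I_d) : 'rV[C]_N :=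
  \row_j DM rho (T y) (row_mx 0 (delta_mx 0 j)) 0 k.

Lemma DM_sumv n k (F : 'rV[C]_n -> 'rV[C]_k) a (I : Type) (s : seq I) (P : pred I) (v : I -> 'rV[C]_n) :
  DM F a (\sum_(i <- s | P i) v i) = \sum_(i <- s | P i) DM F a (v i).
Proof. by apply: (big_morph (DM F a) (DM_D F a)); rewrite DM_mx mul0mx. Qed.

Lemma DM_rrow n k l (F : 'rV[C]_(n + k) -> 'rV[C]_l) a (v : 'rV[C]_k) i :
  DM F a (row_mx 0 v) 0 i = \sum_j DM F a (row_mx 0 (delta_mx 0 j)) 0 i * v 0 j.
Proof.
have -> : row_mx 0 v = \sum_j v 0 j *: row_mx (0 : 'rV[C]_n) (delta_mx 0 j).
  rewrite {1}[v]row_sum_delta; elim/big_rec2: _ => [|j x y _ <-]; first by rewrite row_mx0.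
  by rewrite scale_row_mx scaler0 add_row_mx addr0.
rewrite DM_sumv summxE; apply: eq_bigr => j _.
by rewrite DM_Z mxE mulrC.
Qed.

Lemma ArowE y k (c : 'rV[C]_N) : \sum_j Arow y k 0 j * c 0 j = DM rho (T y) (row_mx 0 c) 0 k.
Proof. by rewrite DM_rrow; apply: eq_bigr => j _; rewrite mxE. Qed.

Lemma AnM_parz : AnM (fun z => par phi (row_mx z 0)) 0.
Proof.
apply: (AnM_comp (F := par phi) (G := fun z => row_mx z 0)); last first.
  by apply: NashM_An; apply: NashM_row; [exact: NashM_id|exact: NashM_cst].
by apply: AnM_par; rewrite row_mx0 dif0.
Qed.

Lemma parz0 : par phi (row_mx 0 0) = 0.
Proof. by rewrite row_mx0 (par0 H). Qed.

Lemma tangent_emb (z : 'rV[C]_m) (c : 'rV[C]_N) (u : 'rV[C]_(N + N)) :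
  rsubmx u = 0 -> lsubmx (lsubmx u) = z ->
  tangent phi u (row_mx (row_mx 0 (rsubmx c - DM phi z (lsubmx c))) c).
Proof.
move=> ru lu; rewrite /tangent !row_mxKl !row_mxKr ru lu linear0 subr0 sub0r DM_N.
by rewrite addrAC subrr sub0r.
Qed.

(** In the old coordinates, [(0, c)] is killed by the differential of [pull] at the points with
    [tau = 0]; the vector [c] does not change, [Pt] being tangent to the identity. Subtracting it
    from the tangent vector with the same [tau] part leaves [emb s], so [s = 0], which is the
    equation excluded by [FN] unless [c = 0]. *)
Lemma Arow_span (c : 'cV[C]_N) :
  (forall k, \forall z \near (0 : 'rV[C]_m), Arow (row_mx z 0) k *m c = 0) -> c = 0.
Proof.
move=> hc; have {}hc : \forall z \near (0 : 'rV[C]_m), forall k, Arow (row_mx z 0) k *m c = 0.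
  exact: filter_forall hc.
pose u z := par phi (row_mx z 0).
have uA := AnM_parz; have u0 := parz0.
have pA : AnM (fun z => pm (u z)) 0.
  by apply: (AnM_comp (F := pm) (G := u)) => //; rewrite /u u0; exact: (AnM_pm0 H).
have pu0 : pm (u 0) = 0 by rewrite /u u0 (pm0 H).
have h1 : \forall z \near (0 : 'rV[C]_m), forall k, Arow (row_mx (lsubmx (lsubmx (pm (u z)))) 0) k *m c = 0.
  apply: (An_near_map (G := fun z => lsubmx (lsubmx (pm (u z)))) (P := fun z => forall k, Arow (row_mx z 0) k *m c = 0)).
    by apply: AnM_lsub; apply: AnM_lsub.
  by rewrite pu0 !linear0.
have h2 : \forall z \near (0 : 'rV[C]_m), rho (pm (u z)) = 0 -> pm (u z) = T (unpar (pm (u z))).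
  by apply: (An_near_map pA (P := fun v => rho v = 0 -> v = T (unpar v))); rewrite pu0.
have h3 : \forall z \near (0 : 'rV[C]_m), inM phi (u z) -> rho (pm (u z)) = 0.
  by apply: (An_near_map uA (P := fun v => inM phi v -> rho (pm v) = 0)); rewrite u0; exact: (szero H).
have h4 : \forall z \near (0 : 'rV[C]_m), forall v,
    DM pull (u z) v = DM rho (pm (u z)) (row_mx (DM Ph (lsubmx (u z)) (lsubmx v)) (DM Pt (rsubmx (u z)) (rsubmx v))).
  apply: (An_near_map uA (P := fun u => forall v,
    DM pull u v = DM rho (pm u) (row_mx (DM Ph (lsubmx u) (lsubmx v)) (DM Pt (rsubmx u) (rsubmx v))))).
  by rewrite u0; exact: (DM_pull H).
have h5 : \forall z \near (0 : 'rV[C]_m), inM phi (u z) -> forall v, tangent phi (u z) v -> DM pull (u z) v = 0.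
  apply: (An_near_map uA (P := fun u => inM phi u -> forall v, tangent phi u v -> DM pull u v = 0)).
  by rewrite u0; exact: (DM_pull_tangent H).
have h6 : \forall z \near (0 : 'rV[C]_m), nondeg pull (@emb R m d) (u z).
  apply: (An_near_map uA (P := fun u => nondeg pull (@emb R m d) u)); rewrite u0.
  apply: nondeg_emb_near; first exact: (AnM_pull0 H).
  by move=> w; rewrite (DM_pull0 H); exact: (nondeg_rho0 H).
suff : c^T = 0 by move=> h; rewrite -[c]trmxK h trmx0.
apply: FN; near=> z.
have ru : rsubmx (u z) = 0 by rewrite /u /par !row_mxKr.
have lu : lsubmx (lsubmx (u z)) = z by rewrite /u /par !row_mxKl.
have uM : inM phi (u z) by exact: par_inM.
have r0 : rho (pm (u z)) = 0.
  have h : inM phi (u z) -> rho (pm (u z)) = 0 by near: z.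
  exact: h.
have pE : pm (u z) = T (row_mx (lsubmx (lsubmx (pm (u z)))) 0).
  have h : rho (pm (u z)) = 0 -> pm (u z) = T (unpar (pm (u z))) by near: z.
  rewrite {1}(h r0) /unpar {2}/pm row_mxKr ru (bih0 bPt).
  by [].
have d0 : DM pull (u z) (row_mx 0 c^T) = 0.
  have h : forall v, DM pull (u z) v = DM rho (pm (u z)) (row_mx (DM Ph (lsubmx (u z)) (lsubmx v)) (DM Pt (rsubmx (u z)) (rsubmx v))) by near: z.
  rewrite h (row_mxKl 0 c^T) (row_mxKr 0 c^T) ru (bihD bPt) DM_0.
  have h' : forall k, Arow (row_mx (lsubmx (lsubmx (pm (u z)))) 0) k *m c = 0 by near: z.
  apply/rowP => k; have e : (Arow (row_mx (lsubmx (lsubmx (pm (u z)))) 0) k *m c) 0 0 = 0.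
    by rewrite h' mxE.
  rewrite pE -ArowE [RHS]mxE -[RHS]e [RHS]mxE; apply: eq_bigr => j _.
  by rewrite [c^T 0 j]mxE.
pose s := rsubmx c^T - DM phi z (lsubmx c^T).
have tv : tangent phi (u z) (row_mx (row_mx 0 s) c^T).
  exact: tangent_emb ru lu.
have h7 : inM phi (u z) -> forall v, tangent phi (u z) v -> DM pull (u z) v = 0 by near: z.
have := h7 uM _ tv.
have -> : row_mx (row_mx 0 s) c^T = emb m s + row_mx 0 c^T by rewrite /emb add_row_mx addr0 add0r.
rewrite DM_D d0 addr0 => h8.
have h9 : nondeg pull (@emb R m d) (u z) by near: z.
by have /eqP := h9 s h8; rewrite subr_eq0 => /eqP.
Unshelve. all: by end_near. Qed.

Variable a : 'rV[C]_N.

Definition Bval (y : 'rV[C]_(m + N)) (k : 'I_d) : C :=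
  - DM rho (T y) (row_mx (Xf a (lsubmx (T y))) 0) 0 k.

Lemma rsub_T y : rsubmx (T y) = rsubmx y.
Proof. by rewrite -[in RHS](TK y) /unpar row_mxKr. Qed.

Lemma Arow_Y : \forall y \near (0 : 'rV[C]_(m + N)), forall k,
  \sum_j Arow y k 0 j * Yf a (rsubmx y) 0 j = Bval y k.
Proof.
have h1 : \forall y \near (0 : 'rV[C]_(m + N)), rho (T y) = 0 ->
    forall a, DM rho (T y) (row_mx (Xf a (lsubmx (T y))) (Yf a (rsubmx (T y)))) = 0.
  apply: (An_near_map (NashM_An TN) (P := fun u => rho u = 0 ->
    forall a, DM rho u (row_mx (Xf a (lsubmx u)) (Yf a (rsubmx u))) = 0)).
  by rewrite T0; exact: (rho_XY H).
near=> y; move=> k.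
have h2 : rho (T y) = 0 -> forall a, DM rho (T y) (row_mx (Xf a (lsubmx (T y))) (Yf a (rsubmx (T y)))) = 0 by near: y.
have h3 : rho (T y) = 0 by near: y.
have := h2 h3 a; rewrite ArowE rsub_T /Bval.
have -> : row_mx (Xf a (lsubmx (T y))) (Yf a (rsubmx y)) =
    row_mx (Xf a (lsubmx (T y))) 0 + row_mx 0 (Yf a (rsubmx y)).
  by rewrite add_row_mx addr0 add0r.
rewrite DM_D => /rowP/(_ k); rewrite mxE [RHS]mxE => /eqP.
by rewrite addrC addr_eq0 => /eqP.
Unshelve. all: by end_near. Qed.

Lemma Nash_Arow y k j : NashM T y -> NashM rho (T y) -> Nash (fun y => Arow y k 0 j) y.
Proof.
move=> hT hr; under eq_fun do rewrite mxE.
apply: (@Nash_comp R _ _ (fun u => DM rho u (row_mx 0 (delta_mx 0 j)) 0 k) T) => //.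
exact: NashM_DM.
Qed.

(** [Arow_Y] is a linear system for [Yf] with Nash coefficients. Differentiated in [z'] alone, it
    contains an invertible system by [An_span]; the solution expresses [Yf] through Nash functions
    and derivatives of [Xf] at [lsubmx (T y)]. All base points [u] near 0 are treated, since the
    iteration also starts from points other than 0. *)
Lemma Jets_step : \forall u \near (0 : 'rV[C]_(N + N)), forall q (a0 : 'rV[C]_q) (g h : 'rV[C]_q -> 'rV[C]_N),
  NashM g a0 -> NashM h a0 -> row_mx (g a0) (h a0) = u ->
  (\forall s \near a0, rho (row_mx (g s) (h s)) = 0) ->
  (forall j, Jets (fun t => Xf a t 0 j) g a0) -> forall j, Jets (fun t => Yf a t 0 j) h a0.
Proof.
have rN : \forall y \near (0 : 'rV[C]_(m + N)), NashM rho (T y).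
  by apply: (An_near_map (NashM_An TN) (P := fun u => NashM rho u)); rewrite T0; apply: NashM_nbhs; exact: srho H.
have NA k j : Nash (fun y => Arow y k 0 j) 0 by apply: Nash_Arow => //; rewrite T0; exact: srho H.
(* [s] selects [N] pairs of an iterated derivative and an equation of the system. *)
have [s us] : exists s : 'I_N -> seq 'I_m * 'I_d,
    \matrix_(i, j) dCs (map (@lshift m N) (s i).1) (fun y => Arow y (s i).2 0 j) 0 \in unitmx.
  have h1 k j : An (fun z => Arow (row_mx z 0) k 0 j) 0.
    apply: (@An_comp R _ _ (fun y => Arow y k 0 j) (fun z => row_mx z 0)).
      by rewrite row_mx0; exact: (NA k j).1.
    by apply: NashM_An; apply: NashM_row; [exact: NashM_id|exact: NashM_cst].
  have [s us] := An_span h1 Arow_span; exists s.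
  move: us; apply: etrans; congr (_ \in unitmx).
  apply/matrixP => i j; rewrite !mxE.
  have h2 : An (fun y => Arow y (s i).2 0 j) (row_mx 0 0) by rewrite row_mx0; exact: (NA _ j).1.
  by have := nbhs_singleton (dCs_restrict (s i).1 h2); rewrite row_mx0 => <-.
pose D (i : 'I_N) (f : 'rV[C]_(m + N) -> C) := dCs (map (@lshift m N) (s i).1) f.
pose Mx y : 'M[C]_N := \matrix_(i, j) D i (fun y => Arow y (s i).2 0 j) y.
have MN i j : Nash (fun y => Mx y i j) 0.
  by under eq_fun do rewrite mxE; apply: Nash_dCs.
have Mu := unitmx_near (fun i j => (MN i j).1) us.
have MN' : \forall y \near (0 : 'rV[C]_(m + N)), forall i j, Nash (fun y => Mx y i j) y.
  have h1 i j : \forall y \near (0 : 'rV[C]_(m + N)), Nash (fun y => Mx y i j) y by exact: Nash_nbhs.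
  have h2 i : \forall y \near (0 : 'rV[C]_(m + N)), forall j, Nash (fun y => Mx y i j) y by exact: filter_forall (h1 i).
  exact: filter_forall h2.
have eqY : \forall y \near (0 : 'rV[C]_(m + N)), forall i,
    \sum_j Mx y i j * Yf a (rsubmx y) 0 j = D i (fun y => Bval y (s i).2) y.
  have h1 i : \forall y \near (0 : 'rV[C]_(m + N)),
    \sum_j Mx y i j * Yf a (rsubmx y) 0 j = D i (fun y => Bval y (s i).2) y.
    have h2 : \forall y \near (0 : 'rV[C]_(m + N)), \sum_j Arow y (s i).2 0 j * Yf a (rsubmx y) 0 j = Bval y (s i).2.
      by apply: filterS Arow_Y => y; exact.
    have h3 := dCs_near (map (@lshift m N) (s i).1) h2.
    have h4 := @dCs_rsub R m N N (s i).1 (fun j y => Arow y (s i).2 0 j) (fun j t => Yf a t 0 j) 0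
      (fun j => (NA _ j).1) _.
    have h5 : forall j, An (fun t => Yf a t 0 j) (rsubmx (0 : 'rV[C]_(m + N))).
      by rewrite linear0; exact: (AnM_Yf H).
    have {}h4 := h4 h5.
    near=> y.
    have h6 : dCs (map (@lshift m N) (s i).1) (fun y => \sum_j Arow y (s i).2 0 j * Yf a (rsubmx y) 0 j) y =
      dCs (map (@lshift m N) (s i).1) (fun y => Bval y (s i).2) y by near: y.
    rewrite /D -h6.
    have -> : dCs (map (@lshift m N) (s i).1) (fun y => \sum_j Arow y (s i).2 0 j * Yf a (rsubmx y) 0 j) y =
      \sum_j dCs (map (@lshift m N) (s i).1) (fun y => Arow y (s i).2 0 j) y * Yf a (rsubmx y) 0 j by near: y.
    by apply: eq_bigr => j _; rewrite mxE.
  exact: filter_forall h1.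
have solY : \forall y \near (0 : 'rV[C]_(m + N)), forall j,
    Yf a (rsubmx y) 0 j = \sum_i invmx (Mx y) j i * D i (fun y => Bval y (s i).2) y.
  near=> y => j; have e : forall i, \sum_j Mx y i j * Yf a (rsubmx y) 0 j = D i (fun y => Bval y (s i).2) y by near: y.
  have uy : Mx y \in unitmx by near: y.
  have e2 : Mx y *m (Yf a (rsubmx y))^T = \col_i D i (fun y => Bval y (s i).2) y.
    by apply/matrixP => i l; rewrite [LHS]mxE [RHS]mxE -e; apply: eq_bigr => k _; rewrite [_^T _ _]mxE ord1.
  have e3 : (Yf a (rsubmx y))^T = invmx (Mx y) *m \col_i D i (fun y => Bval y (s i).2) y.
    by rewrite -e2 mulmxA mulVmx // mul1mx.
  have /matrixP/(_ j 0) := e3; rewrite [LHS]mxE => ->; rewrite mxE.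
  by apply: eq_bigr => i _; rewrite [X in _ * X]mxE.
have unA := NashM_An (@NashM_unpar R m d 0).
have n1 := near_near solY.
(* The local facts gathered at one point, to be transported together from near 0 to [unpar u]. *)
pose good (y : 'rV[C]_(m + N)) := [/\ \forall y \near y, forall j, Yf a (rsubmx y) 0 j =
       \sum_i invmx (Mx y) j i * D i (fun y => Bval y (s i).2) y,
     Mx y \in unitmx, forall i j, Nash (fun y => Mx y i j) y &
     [/\ NashM rho (T y), NashM T y & AnM (Yf a) (rsubmx y)]].
have good0 : \forall y \near (0 : 'rV[C]_(m + N)), good y.
  have n2 := NashM_nbhs TN.
  have n3 : \forall y \near (0 : 'rV[C]_(m + N)), AnM (Yf a) (rsubmx y).
    apply: (An_near_map (@AnM_rsub_id R m N 0)); rewrite linear0; apply: AnM_nbhs; exact: (AnM_Yf H).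
  by near=> y; split; [near: y|near: y|near: y|split; near: y].
have goodu : \forall u \near (0 : 'rV[C]_(N + N)), good (unpar u).
  by apply: (An_near_map unA (P := good)); rewrite unpar0.
have Tu2 := near_near Tu.
near=> u => q a0 g h gN hN gh rgh jX j k.
have Tuu : \forall v \near u, rho v = 0 -> v = T (unpar v) by near: u.
have ghN : NashM (fun s => row_mx (g s) (h s)) a0 by exact: NashM_row.
have gT : \forall s \near a0, g s = lsubmx (T (unpar (row_mx (g s) (h s)))).
  have h1 : \forall s \near a0, rho (row_mx (g s) (h s)) = 0 -> row_mx (g s) (h s) = T (unpar (row_mx (g s) (h s))).
    by apply: (An_near_map (NashM_An ghN) (P := fun v => rho v = 0 -> v = T (unpar v))); rewrite gh.
  near=> t.
  have h2 : rho (row_mx (g t) (h t)) = 0 -> row_mx (g t) (h t) = T (unpar (row_mx (g t) (h t))) by near: t.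
  have h3 : rho (row_mx (g t) (h t)) = 0 by near: t.
  by rewrite -(h2 h3) row_mxKl.
(* The pair [(g, h)] in the parameters [(z', tau')]; its left part is recovered by [T] ([gT]). *)
pose c t := unpar (row_mx (g t) (h t)).
have cN : NashM c a0 by apply: (NashM_comp (F := @unpar R m d)) => //; exact: NashM_unpar.
have c0 : c a0 = unpar u by rewrite /c gh.
have [e1 e2 e3 [e4 e5 e6]] : good (unpar u) by near: u.
have hE : (fun s => rsubmx (c s)) = h by apply/funext => t; rewrite /c /unpar !row_mxKr.
rewrite -hE; apply: (Jet_rsub (h := fun t => Yf a t 0 j)).
- exact: NashM_An.
- by rewrite c0; exact: e6.
apply: (@Jet_near R k _ _ (fun y => \sum_i invmx (Mx y) j i * D i (fun y => Bval y (s i).2) y)).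
- exact: NashM_An.
- by rewrite c0; apply: filterS e1 => y hy; rewrite hy.
apply: Jet_sum => // i; apply: Jet_mul; first exact: NashM_An.
  by apply: Jet_nash => //; rewrite c0; exact: Nash_invmx.
apply: Jet_dCs => {}k; rewrite /Bval.
have mN : Nash (fun=> -1 : C) (c a0) by exact: Nash_cst.
under eq_fun do rewrite mxE -mulN1r.
apply: Jet_mul; [exact: NashM_An|exact: Jet_nash|].
apply: Jet_sum => // l; apply: Jet_mul; first exact: NashM_An.
  apply: Jet_nash => //; rewrite c0.
  by apply: (@Nash_comp R _ _ (dC l (fun x => rho x 0 (s i).2)) T) => //; apply: Nash_dC; exact: e4.
rewrite -(splitK l); case: (fintype.split l) => l' /=; last first.
  by under eq_fun do rewrite row_mxEr mxE; apply: Jet_nash => //; exact: Nash_cst.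
under eq_fun do rewrite row_mxEl.
have lTN : NashM (fun y => lsubmx (T y)) (c a0) by rewrite c0; exact: NashM_lsub.
apply: (Jet_comp (h := fun t => Xf a t 0 l') (G := fun y => lsubmx (T y))) => //.
by apply: (Jet_curve gT); exact: jX.
Unshelve. all: by end_near. Qed.

End Step.

(** * Iteration along Segre varieties *)

Section Iterate.
Variable R : realType.
Local Notation C := (Cx R).
Variables m d : nat.
Local Notation N := (m + d)%N.
Variables (phi : 'rV[C]_m -> 'rV[C]_d) (Ph Ps Pt Pst : 'rV[C]_N -> 'rV[C]_N).
Variable rho : 'rV[C]_(N + N) -> 'rV[C]_d.
Hypothesis H : setup phi Ph Ps Pt Pst rho.
Hypothesis FN : levi_nondeg phi.

(** Dual to the spanning of the vectors [(v, d f_x v)]: a nonzero pair violating it would make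
    [x *m p + f x *m c] constant near 0. *)
Definition no_affine (f : 'rV[C]_m -> 'rV[C]_d) := forall (p : 'cV[C]_m) (c : 'cV[C]_d),
  (\forall x \near (0 : 'rV[C]_m), forall v, v *m p + DM f x v *m c = 0) -> p = 0 /\ c = 0.

Hypothesis MIN : no_affine phi.

Let aphi := sphi H. Let phi0 := sphi0 H. Let bPh := sPh H. Let bPt := sPt H.
Let arho := NashM_An (srho H).
Let Hs := setup_swap H.
Local Notation pull := (pull Ph Pt rho).
Local Notation pm := (pm Ph Pt).
Local Notation Xf := (Xf Ph Ps).
Local Notation Yf := (Yf Pt Pst).
Local Notation swap := (@swap R m d).
Local Notation unpar := (@unpar R m d).

Lemma AnM_oppv n (x : 'rV[C]_n) : AnM (fun x => - x) x.
Proof. by apply: AnM_opp; exact: An_coord. Qed.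

Lemma unpar_l u : lsubmx (unpar u) = lsubmx (lsubmx u).
Proof. by rewrite /unpar row_mxKl. Qed.
Lemma unpar_r u : rsubmx (unpar u) = rsubmx u.
Proof. by rewrite /unpar row_mxKr. Qed.

Lemma tangent_left u v : tangent phi u
  (row_mx (row_mx v (DM phi (lsubmx (lsubmx u) - lsubmx (rsubmx u)) v)) 0).
Proof.
have e1 : rsubmx (0 : 'rV[C]_N) = 0 :> 'rV[C]_d by exact: linear0.
have e2 : lsubmx (0 : 'rV[C]_N) = 0 :> 'rV[C]_m by exact: linear0.
by rewrite /tangent !row_mxKl !row_mxKr e1 e2 !subr0.
Qed.

Lemma DM_move (g : 'rV[C]_N -> 'rV[C]_N) (v : 'rV[C]_m) i e : AnM g 0 ->
  DM (fun s => lsubmx (g s) + s 0 i *: v) 0 e = lsubmx (DM g 0 e) + e 0 i *: v.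
Proof.
move=> gA; have gvA : AnM (fun s : 'rV[C]_N => s 0 i *: v) 0.
  by apply: NashM_An; apply: NashM_mulr; exact: Nash_coord.
rewrite (DM_add e (AnM_lsub gA) gvA) DM_lsub; congr (_ + _).
by rewrite (DM_mulr _ _ (An_coord _ _)) Dd_coord.
Qed.

Lemma levi_nondeg_swap : levi_nondeg (fun x => - phi (- x)).
Proof.
move=> v hv; apply: FN.
have h1 : \forall x \near (0 : 'rV[C]_m), AnM phi (- x).
  by apply: (An_near_map (@AnM_oppv m 0) (P := fun x => AnM phi x)); rewrite oppr0; exact: AnM_nbhs.
have h2 : \forall x \near (0 : 'rV[C]_m), rsubmx v = DM phi (- x) (lsubmx v).
  near=> x; have e : rsubmx v = DM (fun x => - phi (- x)) x (lsubmx v) by near: x.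
  have px : AnM phi (- x) by near: x.
  have cx : AnM (fun x => phi (- x)) x.
    by apply: (AnM_comp (F := phi) (G := fun x => - x)) => //; exact: AnM_oppv.
  rewrite e DM_opp // (@DM_comp R _ _ _ phi (fun x => - x)) //; last exact: AnM_oppv.
  by rewrite DM_opp ?DM_id ?DM_N ?opprK //; exact: An_coord.
have : \forall x \near (0 : 'rV[C]_m), rsubmx v = DM phi (- - x) (lsubmx v).
  by apply: (An_near_map (@AnM_oppv m 0) (P := fun x => rsubmx v = DM phi (- x) (lsubmx v))); rewrite oppr0.
by apply: filterS => x; rewrite opprK.
Unshelve. all: by end_near. Qed.

Variable a : 'rV[C]_N.

(** The source has dimension [N] from the start; each step makes the map depend on one more
    coordinate. *)
Definition reach (g : 'rV[C]_N -> 'rV[C]_N) :=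
  [/\ NashM g 0, g 0 = 0 & forall j, Jets (fun t => Xf a t 0 j) g 0].

(** The Segre variety of [tau x] passes through 0, and its tangent space there is the graph of
    [d phi_x]. [uu x] and [u0 x] are this pair of points in the old and the new coordinates. *)
Let tau (x : 'rV[C]_m) : 'rV[C]_N := row_mx (- x) (- phi x).
Let uu (x : 'rV[C]_m) : 'rV[C]_(N + N) := row_mx 0 (tau x).
Let u0 (x : 'rV[C]_m) : 'rV[C]_(N + N) := row_mx 0 (Pt (tau x)).

(* One more Segre variety: from [t'] to [tau'] with fixed [zeta'], and back with [z'] moving along [v]. *)
Lemma reach_step : \forall x \near (0 : 'rV[C]_m), forall (v : 'rV[C]_m) (i : 'I_N) g, reach g ->
  exists g', reach g' /\ forall e, DM g' 0 e = DM g 0 e + e 0 i *: row_mx v (DM phi x v).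
Proof.
have [T [TN T0 TK Tz Tu]] := rho_graph H.
have [S [SN S0 SK Sz Su]] := rho_graph Hs.
have st1 := @Jets_step R m d phi Ph Ps Pt Pst rho H FN T TN T0 TK Tz Tu a.
have st2 := @Jets_step R m d _ _ _ _ _ _ Hs levi_nondeg_swap S SN S0 SK Sz Su a.
have tauA : AnM tau 0.
  by apply: AnM_row; [exact: AnM_oppv|exact: AnM_opp].
have tau0 : tau 0 = 0 by rewrite /tau phi0 !oppr0 row_mx0.
have uuA : AnM uu 0 by apply: AnM_row => //; exact: NashM_An (NashM_cst 0 0).
have uu0 : uu 0 = 0 by rewrite /uu tau0 row_mx0.
have u0A : AnM u0 0.
  apply: AnM_row; first exact: NashM_An (NashM_cst 0 0).
  by apply: (AnM_comp (F := Pt)) => //; rewrite tau0; exact: bih_An bPt.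
have u00 : u0 0 = 0 by rewrite /u0 tau0 (bih0 bPt) row_mx0.
have unA : AnM (fun x => unpar (u0 x)) 0.
  by apply: (AnM_comp (F := unpar)) => //; exact: NashM_An (NashM_unpar _).
have swA : AnM (fun x => swap (u0 x)) 0.
  by apply: (AnM_comp (F := swap)) => //; exact: NashM_An (NashM_swap _).
have unsA : AnM (fun x => unpar (swap (u0 x))) 0.
  by apply: (AnM_comp (F := unpar)) => //; exact: NashM_An (NashM_unpar _).
have un00 : unpar (u0 0) = 0 by rewrite u00 unpar0.
have sw00 : swap (u0 0) = 0 by rewrite u00 swap0.
have uns00 : unpar (swap (u0 0)) = 0 by rewrite sw00 unpar0.
have k1 : \forall x \near (0 : 'rV[C]_m), inM phi (uu x) -> rho (row_mx (Ph (lsubmx (uu x))) (Pt (rsubmx (uu x)))) = 0.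
  apply: (An_near_map uuA (P := fun u => inM phi u -> rho (row_mx (Ph (lsubmx u)) (Pt (rsubmx u))) = 0)).
  by rewrite uu0; exact: szero H.
have k2 := An_near_map u0A; rewrite u00 in k2; have {}k2 := k2 _ st1.
have k3 := An_near_map swA; rewrite sw00 in k3; have {}k3 := k3 _ st2.
have k4 := An_near_map u0A; rewrite u00 in k4; have {}k4 := k4 _ Tu.
have k5 := An_near_map swA; rewrite sw00 in k5; have {}k5 := k5 _ Su.
have k6 := An_near_map unA; rewrite un00 in k6; have {}k6 := k6 _ (near_near Tz).
have k7 := An_near_map unsA; rewrite uns00 in k7; have {}k7 := k7 _ (near_near Sz).
have k8 := An_near_map unA; rewrite un00 in k8; have {}k8 := k8 _ (NashM_nbhs TN).
have k9 := An_near_map unsA; rewrite uns00 in k9; have {}k9 := k9 _ (NashM_nbhs SN).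
have k10 := An_near_map u0A; rewrite u00 in k10; have {}k10 := k10 _ (AnM_nbhs arho).
have k11 := An_near_map u0A; rewrite u00 in k11; have {}k11 := k11 _ (nondeg_emb_near arho (nondeg_rho0 H)).
have k12 := An_near_map uuA; rewrite uu0 in k12; have {}k12 := k12 _ (DM_pull H).
have k13 := An_near_map uuA; rewrite uu0 in k13; have {}k13 := k13 _ (DM_pull_tangent H).
near=> x => v i g [gN g0 gJ].
have uM : inM phi (uu x).
  by rewrite /inM /uu /tau !row_mxKl !row_mxKr !linear0 row_mxKl ?row_mxKr; rewrite !add0r !opprK.
have pmE : pm (uu x) = u0 x by rewrite /pm /uu row_mxKl row_mxKr (bih0 bPh).
have ru0 : rho (u0 x) = 0.
  have h : inM phi (uu x) -> rho (row_mx (Ph (lsubmx (uu x))) (Pt (rsubmx (uu x)))) = 0 by near: x.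
  by have := h uM; rewrite -/(pm (uu x)) pmE.
have Tu0 : T (unpar (u0 x)) = u0 x.
  have h : rho (u0 x) = 0 -> u0 x = T (unpar (u0 x)) by near: x.
  exact: esym (h ru0).
have Su0 : S (unpar (swap (u0 x))) = swap (u0 x).
  have h : rho (swap (swap (u0 x))) = 0 -> swap (u0 x) = S (unpar (swap (u0 x))) by near: x.
  by rewrite -h // swapK.
have q6 : \forall y \near unpar (u0 x), rho (T y) = 0 by near: x.
have q7 : \forall y \near unpar (swap (u0 x)), rho (swap (S y)) = 0 by near: x.
have q8 : NashM T (unpar (u0 x)) by near: x.
have q9 : NashM S (unpar (swap (u0 x))) by near: x.
pose tp := Pt (tau x).
have unE : unpar (u0 x) = row_mx 0 tp by rewrite /unpar /u0 row_mxKl row_mxKr linear0.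
have unsE : unpar (swap (u0 x)) = row_mx (lsubmx tp) 0.
  by rewrite /unpar /swap /u0 !row_mxKl !row_mxKr.
(* [S] solves the Segre relation for [omega'], with [zeta'] kept at its value at [tp]. *)
pose yh s := row_mx (lsubmx tp) (g s); pose h s := lsubmx (S (yh s)).
have yhN : NashM yh 0 by apply: NashM_row => //; exact: NashM_cst.
have yh0 : yh 0 = unpar (swap (u0 x)) by rewrite unsE /yh g0.
have hN : NashM h 0.
  have q9' : NashM S (yh 0) by rewrite yh0.
  exact: (NashM_lsub (NashM_comp q9' yhN)).
have h0 : h 0 = tp by rewrite /h yh0 Su0 /swap /u0 !row_mxKl row_mxKr.
have SE s : swap (S (yh s)) = row_mx (g s) (h s).
  by rewrite /swap -[rsubmx (S _)]unpar_r SK /yh row_mxKr.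
have rgh : \forall s \near (0 : 'rV[C]_N), rho (row_mx (g s) (h s)) = 0.
  have : \forall s \near (0 : 'rV[C]_N), rho (swap (S (yh s))) = 0.
    by apply: (An_near_map (NashM_An yhN) (P := fun y => rho (swap (S y)) = 0)); rewrite yh0.
  by apply: filterS => s; rewrite SE.
have hJ j : Jets (fun t => Yf a t 0 j) h 0.
  have q : forall q (a0 : 'rV[C]_q) (g h : 'rV[C]_q -> 'rV[C]_N),
    NashM g a0 -> NashM h a0 -> row_mx (g a0) (h a0) = u0 x ->
    (\forall s \near a0, rho (row_mx (g s) (h s)) = 0) ->
    (forall j, Jets (fun t => Xf a t 0 j) g a0) -> forall j, Jets (fun t => Yf a t 0 j) h a0 by near: x.
  by apply: (q _ 0 g h gN hN _ rgh gJ); rewrite g0 h0.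
(* [T] solves it back for [w'], while [z'] moves by the [i]-th coordinate of [s] times [v]. *)
pose yg s := row_mx (lsubmx (g s) + s 0 i *: v) (h s); pose g' s := lsubmx (T (yg s)).
have ygN : NashM yg 0.
  apply: NashM_row => //; apply: NashM_add; first exact: NashM_lsub.
  by apply: NashM_mulr; exact: Nash_coord.
have yg0 : yg 0 = unpar (u0 x) by rewrite unE /yg g0 h0 linear0 mxE scale0r addr0.
have gN' : NashM g' 0.
  have q8' : NashM T (yg 0) by rewrite yg0.
  exact: (NashM_lsub (NashM_comp q8' ygN)).
have g0' : g' 0 = 0 by rewrite /g' yg0 Tu0 /u0 row_mxKl.
have TE s : T (yg s) = row_mx (g' s) (h s).
  by rewrite -[LHS]hsubmxK -[rsubmx (T _)]unpar_r TK /yg row_mxKr.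
have lg' s : lsubmx (g' s) = lsubmx (g s) + s 0 i *: v.
  by rewrite /g' -unpar_l TK /yg row_mxKl.
have rgh' : \forall s \near (0 : 'rV[C]_N), rho (row_mx (g' s) (h s)) = 0.
  have : \forall s \near (0 : 'rV[C]_N), rho (T (yg s)) = 0.
    by apply: (An_near_map (NashM_An ygN) (P := fun y => rho (T y) = 0)); rewrite yg0.
  by apply: filterS => s; rewrite TE.
exists g'; split.
  split=> // j.
  have q : forall q (a0 : 'rV[C]_q) (g h : 'rV[C]_q -> 'rV[C]_N),
    NashM g a0 -> NashM h a0 -> row_mx (g a0) (h a0) = swap (u0 x) ->
    (\forall s \near a0, rho (swap (row_mx (g s) (h s))) = 0) ->
    (forall j, Jets (fun t => Yf a t 0 j) g a0) -> forall j, Jets (fun t => Xf a t 0 j) h a0 by near: x.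
  apply: (q _ 0 h g' hN gN' _ _ hJ); first by rewrite g0' h0 /swap /u0 row_mxKl row_mxKr.
  by apply: filterS rgh' => s; rewrite /swap row_mxKl row_mxKr.
move=> e.
have ar : AnM rho (u0 x) by near: x.
(* Applied to [g] and [g'], which are related to the same [h]: the difference of their
   differentials, completed by 0, is in the kernel of [d rho] at [u0 x]. *)
have D1 (f : 'rV[C]_N -> 'rV[C]_N) : NashM f 0 -> f 0 = 0 ->
    (\forall s \near (0 : 'rV[C]_N), rho (row_mx (f s) (h s)) = 0) ->
    DM rho (u0 x) (row_mx (DM f 0 e) (DM h 0 e)) = 0.
  move=> fN f0 rf; have fh : row_mx (f 0) (h 0) = u0 x by rewrite f0 h0.
  have := DM_near e rf; rewrite DM_cst (DM_comp (F := rho) (G := fun s => row_mx (f s) (h s))).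
  - by rewrite fh DM_row.
  - by rewrite fh.
  - by apply: AnM_row; exact: NashM_An.
have d1 := D1 g gN g0 rgh; have d2 := D1 g' gN' g0' rgh'.
have lD : lsubmx (DM g' 0 e) = lsubmx (DM g 0 e) + e 0 i *: v.
  rewrite -(DM_move v i e (NashM_An gN)) -DM_lsub.
  exact: (congr1 (fun F => DM F 0 e) (funext lg')).
have d3 : DM rho (u0 x) (row_mx (row_mx v (DM phi x v)) 0) = 0.
  have q12 : forall v, DM pull (uu x) v = DM rho (pm (uu x)) (row_mx (DM Ph (lsubmx (uu x)) (lsubmx v)) (DM Pt (rsubmx (uu x)) (rsubmx v))) by near: x.
  have q13 : inM phi (uu x) -> forall v, tangent phi (uu x) v -> DM pull (uu x) v = 0 by near: x.
  have := q13 uM (row_mx (row_mx v (DM phi x v)) 0); rewrite q12 pmE.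
  rewrite row_mxKl row_mxKr DM_0 /uu row_mxKl (bihD bPh); apply.
  have xE : lsubmx (lsubmx (uu x)) - lsubmx (rsubmx (uu x)) = x.
    by rewrite /uu /tau !row_mxKl row_mxKr row_mxKl linear0 opprK add0r.
  by rewrite -[X in DM phi X]xE; exact: tangent_left.
have q11 : nondeg rho (@emb R m d) (u0 x) by near: x.
(* The defect of the claimed formula: it has no [z'] part, and it lies in the kernel of [d rho], so
   nondegeneracy kills its [w'] part. *)
pose de := DM g' 0 e - DM g 0 e - e 0 i *: row_mx v (DM phi x v).
have lde : lsubmx de = 0.
  by rewrite /de !raddfB /= lD linearZ /= row_mxKl [lsubmx (DM g 0 e) + _]addrC addrK subrr.
have deE : row_mx de 0 = emb m (rsubmx de) by rewrite /emb -[X in row_mx X _]hsubmxK lde.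
have d4 : DM rho (u0 x) (row_mx de 0) = 0.
  have -> : row_mx de 0 = row_mx (DM g' 0 e) (DM h 0 e) - row_mx (DM g 0 e) (DM h 0 e)
      - e 0 i *: row_mx (row_mx v (DM phi x v)) 0.
    by rewrite scale_row_mx scaler0 !opp_row_mx !add_row_mx subrr subr0.
  by rewrite !DM_D !DM_N DM_Z d1 d2 d3 scaler0 !oppr0 !addr0.
rewrite deE in d4; have rde := q11 _ d4.
have : de = 0 by rewrite -[de]hsubmxK lde rde row_mx0.
by move=> /eqP; rewrite /de subr_eq0 subr_eq addrC => /eqP ->; rewrite addrC.
Unshelve. all: by end_near. Qed.

End Iterate.

(** * The inverse function theorem *)

Section Inverse.
Variable R : realType.
Local Notation C := (Cx R).

Section InverseGen.
Variable Q : forall n, ('rV[C]_n -> C) -> 'rV[C]_n -> Prop.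
Hypothesis QA : forall n (f : 'rV[C]_n -> C) a, Q f a -> An f a.
Hypothesis Qcomp : forall n k (f : 'rV[C]_n -> C) (G : 'rV[C]_k -> 'rV[C]_n) a,
  Q f (G a) -> NashM G a -> Q (fun x => f (G x)) a.
Hypothesis Qsub : forall n (f g : 'rV[C]_n -> C) a, Q f a -> Nash g a -> Q (fun x => f x - g x) a.
Hypothesis Qift : forall d q (G : 'I_d -> 'rV[C]_(q + d) -> C) (a : 'rV[C]_q) (b : 'rV[C]_d),
  (forall k, Q (G k) (row_mx a b)) -> (forall k, G k (row_mx a b) = 0) ->
  (forall w, (forall k, Dd (G k) (row_mx a b) (row_mx 0 w) = 0) -> w = 0) ->
  exists th : 'rV[C]_q -> 'rV[C]_d,
    [/\ forall j, Q (fun x => th x 0 j) a, th a = b,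
        \forall x \near a, forall k, G k (row_mx x (th x)) = 0 &
        \forall v \near row_mx a b, (forall k, G k v = 0) -> rsubmx v = th (lsubmx v)].

(** The implicit function theorem for [g x - y = 0], with parameter [y]. *)
Lemma inverse_gen n (g : 'rV[C]_n -> 'rV[C]_n) (a b : 'rV[C]_n) :
  (forall k, Q (fun x => g x 0 k) a) -> g a = b ->
  (forall e, DM g a e = 0 -> e = 0) ->
  exists s : 'rV[C]_n -> 'rV[C]_n, [/\ forall k, Q (fun x => s x 0 k) b, s b = a, \forall y \near b, g (s y) = y & \forall x \near a, s (g x) = x].
Proof.
move=> gQ ga gi; have gN : AnM g a by move=> k; exact: QA.
pose G (k : 'I_n) (v : 'rV[C]_(n + n)) := g (rsubmx v) 0 k - lsubmx v 0 k.
have rA v : AnM (fun v : 'rV[C]_(n + n) => rsubmx v) v by exact: AnM_rsub_id.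
have lA v : AnM (fun v : 'rV[C]_(n + n) => lsubmx v) v by apply: AnM_lsub; exact: An_coord.
have ar : rsubmx (row_mx b a) = a by rewrite row_mxKr.
have gN' k : Q (fun v : 'rV[C]_(n + n) => g (rsubmx v) 0 k) (row_mx b a).
  apply: (Qcomp (f := fun x => g x 0 k) (G := fun v : 'rV[C]_(n + n) => rsubmx v)); rewrite ?ar //.
  by apply: NashM_rsub; exact: NashM_id.
have gA' : AnM g (rsubmx (row_mx b a)) by rewrite ar.
have [|||s [s1 s2 s3 s4]] := @Qift n n G b a.
- move=> k; apply: Qsub; first exact: gN'.
  by apply: NashM_lsub; exact: NashM_id.
- by move=> k; rewrite /G ar row_mxKl ga subrr.
- move=> w hw; apply: gi; apply/rowP => k; rewrite [RHS]mxE -(hw k) /G.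
  rewrite Dd_sub; last first.
  + exact: (lA _ k).
  + exact: QA (gN' k).
  have e1 := @DM_comp R _ _ _ g (fun v : 'rV[C]_(n + n) => rsubmx v) (row_mx b a) (row_mx 0 w) gA' (rA _).
  have e2 : DM (fun v : 'rV[C]_(n + n) => lsubmx v) (row_mx b a) (row_mx 0 w) = 0.
    by rewrite DM_lsub DM_id row_mxKl.
  have /rowP/(_ k) := e2; rewrite mxE [RHS]mxE => ->; rewrite subr0.
  have /rowP/(_ k) := e1; rewrite mxE => ->.
  by rewrite DM_rsub DM_id !row_mxKr.
exists s; split => //.
- apply: filterS s3 => y hy; apply/rowP => k; have := hy k.
  by rewrite /G row_mxKl row_mxKr => /eqP; rewrite subr_eq0 => /eqP.
- have gr : AnM (fun x => row_mx (g x) x) a.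
    by apply: AnM_row => //; exact: An_coord.
  have : \forall x \near a, (forall k, G k (row_mx (g x) x) = 0) -> rsubmx (row_mx (g x) x) = s (lsubmx (row_mx (g x) x)).
    by apply: (An_near_map gr (P := fun v => (forall k, G k v = 0) -> rsubmx v = s (lsubmx v))); rewrite ga.
  apply: filterS => x hx; rewrite row_mxKl row_mxKr in hx; rewrite -hx // => k.
  by rewrite /G row_mxKl row_mxKr subrr.
Qed.

End InverseGen.

Definition NashM_inverse := @inverse_gen (@Nash R) (fun n f a h => h.1)
  (fun n k f G a hf hG => Nash_comp hf hG) (fun n f g a hf hg => Nash_sub hf hg) (@Nash_vector_ift R).
Definition AnM_inverse := @inverse_gen (@An R) (fun n f a h => h)
  (fun n k f G a hf hG => An_comp hf (NashM_An hG)) (fun n f g a hf hg => An_sub hf hg.1) (@An_vector_ift R).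

End Inverse.

(** * Algebraicity of the translations *)

Section Abstract.
Variable R : realType.
Local Notation C := (Cx R).
Variables m d : nat.
Local Notation N := (m + d)%N.
Variables (phi : 'rV[C]_m -> 'rV[C]_d) (Ph Ps Pt Pst : 'rV[C]_N -> 'rV[C]_N).
Variable rho : 'rV[C]_(N + N) -> 'rV[C]_d.
Hypothesis H : setup phi Ph Ps Pt Pst rho.
Hypothesis FN : levi_nondeg phi.
Hypothesis MIN : no_affine phi.

Local Notation Xf := (Xf Ph Ps).

Lemma segre_span (U : set 'rV[C]_m) : (\forall x \near (0 : 'rV[C]_m), U x) ->
  exists s : 'I_N -> 'rV[C]_m * 'rV[C]_m, (forall i, U (s i).1) /\
    \matrix_i row_mx (s i).2 (DM phi (s i).1 (s i).2) \in unitmx.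
Proof.
move=> hU; pose r (t : {t : 'rV[C]_m * 'rV[C]_m | U t.1}) : 'rV[C]_N :=
  row_mx (sval t).2 (DM phi (sval t).1 (sval t).2).
have rc (c : 'cV[C]_N) : (forall t, r t *m c = 0) -> c = 0.
  move=> hc; have [p0 c0] : usubmx c = 0 /\ dsubmx c = 0.
    apply: MIN; apply: filterS hU => x Ux v.
    have := hc (exist _ (x, v) Ux); rewrite /r /= => <-.
    by rewrite -[in RHS](vsubmxK c) mul_row_col.
  by rewrite -[c]vsubmxK p0 c0 col_mx0.
have [s us] := rows_basis rc; exists (fun i => sval (s i)); split => // i.
exact: (svalP (s i)).
Qed.

Lemma Nash_Xf a j : Nash (fun t => Xf a t 0 j) 0.
Proof.
have [s [sU us]] := segre_span (reach_step H FN a).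
pose b i : 'rV[C]_N := row_mx (s i).2 (DM phi (s i).1 (s i).2).
(* From the constant map 0, each step contributes one row [b i]; after [N] steps the differential at
   0 is an invertible matrix. *)
have step k : exists g, reach Ph Ps a g /\ forall e, DM g 0 e = \sum_(i < N | (i < k)%N) e 0 i *: b i.
  elim: k => [|k [g [rg Dg]]].
    exists (fun=> 0); split; last by move=> e; rewrite DM_cst big_pred0.
    split=> // [|l K]; first exact: NashM_cst.
    by apply: Jet_cst; exact: (AnM_Xf H a l).
  case: (ltnP k N) => [kN|Nk]; last first.
    exists g; split => // e; rewrite Dg; apply: eq_bigl => i.
    have iN := ltn_ord i; by rewrite !(leq_trans iN) // (leq_trans Nk).
  pose i0 := Ordinal kN; have [g' [rg' Dg']] := sU i0 (s i0).2 i0 g rg.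
  exists g'; split => // e; rewrite Dg' Dg [RHS](bigD1 i0) /= ?ltnS // addrC; congr (_ + _).
  apply: eq_bigl => i; rewrite ltnS ltn_neqAle andbC; congr (_ && _).
have [g [[gN g0 gJ] Dg]] := step N.
have Dg' e : DM g 0 e = e *m \matrix_i b i.
  rewrite Dg mulmx_sum_row; apply: eq_big => [i|i _]; first by rewrite ltn_ord.
  by rewrite rowK.
have [|u [uN u0 gu _]] := NashM_inverse gN g0.
  by move=> e; rewrite Dg' => h; rewrite -[e](mulmxK us) h mul0mx.
have gX := Jet_Nash (gJ j 0%N).
apply: (@Nash_near R _ (fun t => Xf a (g (u t)) 0 j)).
  by apply: filterS gu => t ->.
have gX' : Nash (fun s => Xf a (g s) 0 j) (u 0) by rewrite u0.
exact: (@Nash_comp R _ _ (fun s => Xf a (g s) 0 j) u _ gX' uN).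
Qed.

Let bPh := sPh H. Let bPt := sPt H.

(** [X t] is the matrix of [d Ph] at [Ps t], whose inverse is that of [d Ps] at [t]. *)
Lemma Nash_DPs v : NashM (fun t => DM Ps t v) 0.
Proof.
pose X t : 'M[C]_N := \matrix_(i, j) Xf (delta_mx 0 i) t 0 j.
have XE t : X t = Dmx Ph (Ps t) by apply/matrixP => i j; rewrite !mxE.
have XN i j : Nash (fun t => X t i j) 0.
  by under eq_fun do rewrite mxE; exact: Nash_Xf.
have X0 : X 0 = 1%:M.
  rewrite XE (bih0' bPh); apply/row_matrixP => i; rewrite rowE -DM_mx (bihD bPh).
  by rewrite row1.
have Xu : X 0 \in unitmx by rewrite X0 unitmx1.
have h1 : \forall t \near (0 : 'rV[C]_N), DM Ps t v = v *m invmx (X t).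
  have k1 : \forall t \near (0 : 'rV[C]_N), \forall s \near Ps t, Ps (Ph s) = s.
    apply: (An_near_map (bih_An' bPh) (P := fun t => \forall s \near t, Ps (Ph s) = s)).
    by rewrite (bih0' bPh); apply: near_near; exact: bihK bPh.
  have k2 := bihK' bPh.
  have k3 := AnM_nbhs (bih_An' bPh).
  have k4 : \forall t \near (0 : 'rV[C]_N), AnM Ph (Ps t).
    apply: (An_near_map (bih_An' bPh) (P := fun t => AnM Ph t)).
    by rewrite (bih0' bPh); apply: AnM_nbhs; exact: bih_An bPh.
  have k5 := unitmx_near (fun i j => (XN i j).1) Xu.
  near=> t.
  have e1 : \forall s \near Ps t, Ps (Ph s) = s by near: t.
  have e2 : Ph (Ps t) = t by near: t.
  have e3 : AnM Ps t by near: t.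
  have e4 : AnM Ph (Ps t) by near: t.
  have e5 : X t \in unitmx by near: t.
  have e6 w : DM Ps t (w *m X t) = w.
    have := DM_near w e1; rewrite DM_id (@DM_comp R _ _ _ Ps Ph) ?e2 //.
    by rewrite [DM Ph _ _]DM_mx -XE.
  by have := e6 (v *m invmx (X t)); rewrite mulmxKV.
have h2 : NashM (fun t => v *m invmx (X t)) 0.
  move=> j; under eq_fun do rewrite mxE; apply: Nash_sum => i; apply: Nash_mul; first exact: Nash_cst.
  exact: Nash_invmx.
by apply: NashM_near h2; apply: filterS h1 => t ->.
Unshelve. all: by end_near. Qed.

(** [B] is a Nash parametrization, by [z'], of the Segre variety [rho (t', 0) = 0], and [Ps] maps it
    into the graph of [phi]. The last clause is about the differential because only [d Ps] is known
    to be Nash. *)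
Theorem eta_exists : exists E : 'rV[C]_m -> 'rV[C]_N,
  [/\ AnM E 0, E 0 = 0, \forall z \near (0 : 'rV[C]_m), rsubmx (E z) = phi (lsubmx (E z)),
      forall v, lsubmx (DM E 0 v) = v & forall v, NashM (fun z => DM E z v) 0].
Proof.
have [T [TN T0 TK Tz _]] := rho_graph H.
pose y (z : 'rV[C]_m) : 'rV[C]_(m + N) := row_mx z 0.
have yN : NashM y 0 by apply: NashM_row; [exact: NashM_id|exact: NashM_cst].
have y0 : y 0 = 0 by rewrite /y row_mx0.
pose B z := lsubmx (T (y z)).
have BN : NashM B 0.
  have TN' : NashM T (y 0) by rewrite y0.
  exact: (NashM_lsub (NashM_comp TN' yN)).
have B0 : B 0 = 0 by rewrite /B y0 T0 linear0.
have lB z : lsubmx (B z) = z by rewrite /B -unpar_l TK /y row_mxKl.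
have rT z : rsubmx (T (y z)) = 0 by rewrite -unpar_r TK /y row_mxKr.
have PsB : AnM Ps (B 0) by rewrite B0; exact: bih_An' bPh.
exists (fun z => Ps (B z)); split.
- exact: AnM_comp PsB (NashM_An BN).
- by rewrite B0 (bih0' bPh).
- have psA : AnM (fun z => T (y z)) 0 by apply: (AnM_comp (F := T)); [rewrite y0; exact: NashM_An|exact: NashM_An].
  have h1 : \forall z \near (0 : 'rV[C]_m), rho (T (y z)) = 0.
    by apply: (An_near_map (NashM_An yN) (P := fun y => rho (T y) = 0)); rewrite y0.
  have h2 : \forall u \near (0 : 'rV[C]_(N + N)), rho u = 0 -> inM phi (ps Ps Pst u).
    have k1 := near_lsub (bihK' bPh); have k2 := near_rsub (bihK' bPt).
    have k3 : \forall u \near (0 : 'rV[C]_(N + N)), pull Ph Pt rho (ps Ps Pst u) = 0 -> inM phi (ps Ps Pst u).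
      apply: (An_near_map (AnM_ps0 H) (P := fun u => pull Ph Pt rho u = 0 -> inM phi u)).
      by rewrite (ps0 H); exact: (pull_zero H).
    near=> u => ru.
    have e1 : Ph (Ps (lsubmx u)) = lsubmx u by near: u.
    have e2 : Pt (Pst (rsubmx u)) = rsubmx u by near: u.
    have e3 : pull Ph Pt rho (ps Ps Pst u) = 0 -> inM phi (ps Ps Pst u) by near: u.
    by apply: e3; rewrite /pull /ps row_mxKl row_mxKr e1 e2 hsubmxK.
  have h3 : \forall z \near (0 : 'rV[C]_m), rho (T (y z)) = 0 -> inM phi (ps Ps Pst (T (y z))).
    by apply: (An_near_map psA (P := fun u => rho u = 0 -> inM phi (ps Ps Pst u))); rewrite y0 T0.
  near=> z.
  have e1 : rho (T (y z)) = 0 by near: z.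
  have e2 : rho (T (y z)) = 0 -> inM phi (ps Ps Pst (T (y z))) by near: z.
  have := e2 e1; rewrite /inM /ps !row_mxKl !row_mxKr rT (bih0' bPt) -/(B z).
  have l0 : lsubmx (0 : 'rV[C]_N) = 0 :> 'rV[C]_m by exact: linear0.
  have r0 : rsubmx (0 : 'rV[C]_N) = 0 :> 'rV[C]_d by exact: linear0.
  by rewrite l0 r0 !subr0.
- move=> v; rewrite DM_comp //; last exact: NashM_An.
  rewrite B0.
  have e : DM Ps 0 (DM Ph 0 (DM B 0 v)) = DM B 0 v.
    have := DM_near (DM B 0 v) (bihK bPh); rewrite DM_id (@DM_comp R _ _ _ Ps Ph) ?(bih0 bPh) //.
      exact: bih_An' bPh.
    exact: bih_An bPh.
  rewrite (bihD bPh) in e; rewrite e -DM_lsub.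
  by rewrite (_ : (fun z => lsubmx (B z)) = id) ?DM_id //; apply/funext.
- move=> v.
  have k1 : \forall z \near (0 : 'rV[C]_m), AnM Ps (B z).
    apply: (An_near_map (NashM_An BN) (P := fun t => AnM Ps t)).
    by rewrite B0; apply: AnM_nbhs; exact: bih_An' bPh.
  have k2 := AnM_nbhs (NashM_An BN).
  apply: (@NashM_near R _ _ (fun z => \sum_l DM B z v 0 l *: DM Ps (B z) (delta_mx 0 l))).
    near=> z; rewrite (@DM_comp R _ _ _ Ps B); [|near: z; exact: k1|near: z; exact: k2].
    rewrite [in RHS](row_sum_delta (DM B z v)) DM_sumv; apply: eq_bigr => l _.
    by rewrite DM_Z.
  move=> j; under eq_fun do rewrite summxE; apply: Nash_sum => l.
  under eq_fun do rewrite mxE; apply: Nash_mul; first exact: NashM_DM.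
  apply: (@Nash_comp R _ _ (fun t => DM Ps t (delta_mx 0 l) 0 j) B) => //.
  by rewrite B0; exact: Nash_DPs.
Unshelve. all: by end_near. Qed.

End Abstract.

(** * Power series and real analytic functions *)

Section Boxes.
Variable n : nat.

Definition nf k (alpha : {ffun 'I_n -> 'I_k}) : {ffun 'I_n -> nat} := [ffun i => nat_of_ord (alpha i)].
Definition mn (beta : {ffun 'I_n -> nat}) : mpoly.multinom n := mpoly.Multinom (mktuple beta).

Lemma mnE beta i : mn beta i = beta i. Proof. by rewrite /mn mpoly.mnmE. Qed.
Lemma mn_inj : injective mn.
Proof. by move=> b b' e; apply/ffunP => i; rewrite -!mnE e. Qed.
Lemma mdeg_mn beta : mpoly.mdeg (mn beta) = (\sum_i beta i)%N.
Proof. by rewrite mpoly.mdegE; apply: eq_bigr => i _; rewrite mnE. Qed.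
Lemma nf_inj k : injective (@nf k).
Proof.
by move=> a b e; apply/ffunP => i; apply: val_inj; have /ffunP/(_ i) := e; rewrite !ffunE.
Qed.

Lemma box_sum (V : nmodType) (G : {ffun 'I_n -> nat} -> V) k K : (k <= K)%N ->
  \sum_(alpha : {ffun 'I_n -> 'I_k}) G (nf alpha) =
  \sum_(alpha : {ffun 'I_n -> 'I_K} | [forall i, alpha i < k]%N) G (nf alpha).
Proof.
move=> kK; pose h (a : {ffun 'I_n -> 'I_k}) : {ffun 'I_n -> 'I_K} := [ffun i => widen_ord kK (a i)].
have hn a : nf (h a) = nf a by apply/ffunP => i; rewrite !ffunE.
have hi : {in predT &, injective h}.
  by move=> a b _ _ e; apply: nf_inj; rewrite -!hn e.
rewrite (eq_bigl (mem [set h x | x in predT]%SET)).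
  by rewrite (big_imset (fun a => G (nf a)) hi); apply: eq_bigr => a _; rewrite hn.
move=> b; apply/idP/imsetP => [/forallP hb|[a _ ->]].
  exists [ffun i => Ordinal (hb i)] => //; apply/ffunP => i; rewrite !ffunE.
  exact: val_inj.
by apply/forallP => i; rewrite ffunE /= ltn_ord.
Qed.

End Boxes.

Section PowerSeries.
Variable R : realType.
Local Notation C := (Cx R).
Local Notation MP n := (mpoly.mpoly n C).
Local Notation mco := mpoly.mcoeff.
Local Notation mdeg := mpoly.mdeg.
Local Notation mX := (mpoly.mpolyX C).

Lemma cvg_null (u : nat -> C) (l : C) : (u @ \oo --> l) <-> null (fun k => cabs (u k - l)).
Proof.
split=> [/cvgrPdist_lt h|/nullP h].
  apply/nullP => e e0; have [|N _ hN] := h (cofr e); first by rewrite -cofr0 cofr_lt.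
  exists N => k Nk; have := hN k Nk; rewrite normE cofr_lt cabsBC.
  by rewrite ger0_norm ?cabs_ge0.
apply/cvgrPdist_lt => e e0; have er : e = cofr (re e) by rewrite /cofr RRe_real // realE ltW.
have e1 : 0 < re e by rewrite -cofr_lt cofr0 -er.
have [N hN] := h _ e1; exists N => // k Nk; have := hN k Nk.
by rewrite ger0_norm ?cabs_ge0 // cabsBC /= normE er cofr_lt.
Qed.

Lemma cvg_nullR (u : nat -> R) (l : R) : (u @ \oo --> l) <-> null (fun k => u k - l).
Proof.
split=> [/cvgrPdist_lt h|/nullP h].
  apply/nullP => e e0; have [N _ hN] := h _ e0.
  by exists N => k Nk; rewrite distrC; exact: hN.
apply/cvgrPdist_lt => e e0; have [N hN] := h _ e0.
by exists N => // k Nk; rewrite /= distrC; exact: hN.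
Qed.

Definition bpoly n (c : {ffun 'I_n -> nat} -> C) k : MP n :=
  \sum_(alpha : {ffun 'I_n -> 'I_k}) c (nf alpha) *: mX (mn (nf alpha)).

Lemma peval_bpoly n (c : {ffun 'I_n -> nat} -> C) k (a x : 'rV[C]_n) :
  peval (bpoly c k) (x - a) = power_sum c a x k.
Proof.
rewrite peval_sum; apply: eq_bigr => al _; rewrite pevalZ pevalX; congr (_ * _).
by apply: eq_bigr => i _; rewrite mnE ffunE !mxE.
Qed.

Definition bsum n (q : R) k : R := \sum_(alpha : {ffun 'I_n -> 'I_k}) q ^+ (\sum_i nf alpha i)%N.

Lemma bsumE n q k : bsum n q k = (\sum_(i < k) q ^+ i) ^+ n.
Proof.
have := @bigA_distr_bigA R 0 1 *%R +%R 'I_n 'I_k (fun i j => q ^+ j).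
rewrite prodr_const card_ord => ->; apply: eq_bigr => al _.
rewrite -prodrXr; apply: eq_bigr => i _; by rewrite ffunE.
Qed.

Definition half : R := 2^-1.

Lemma bsum_half n k : bsum n half k = (2 * (1 - half ^+ k)) ^+ n.
Proof.
rewrite bsumE; congr (_ ^+ n); have := subrX1 half k.
rewrite -opprB => /eqP; rewrite eqr_oppLR => /eqP ->.
have h2 : half - 1 = - half by rewrite /half; lra.
by rewrite h2 mulNr opprK mulrA /half divff ?mul1r.
Qed.

Lemma half_pow k : 0 <= half ^+ k <= 1.
Proof.
by rewrite exprn_ge0 ?exprn_ile1 //= /half ?invr_ge0 ?invf_le1 // ler1n.
Qed.

Lemma bernoulli (x : R) n : 0 <= x -> x <= 1 -> 1 - n%:R * x <= (1 - x) ^+ n.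
Proof.
move=> x0 x1; elim: n => [|n IH]; first by rewrite mul0r subr0 expr0.
rewrite exprS -natr1; have h : 0 <= 1 - x by lra.
have := ler_wpM2l h IH; have : 0 <= n%:R * x * x by rewrite !mulr_ge0.
nra.
Qed.

(** What the full sum [2 ^+ n] leaves outside the box, bounded with Bernoulli's inequality. *)
Definition btail n k : R := 2 ^+ n * n%:R * half ^+ k.

Lemma btail_ge0 n k : 0 <= btail n k.
Proof. by have /andP[h _] := half_pow k; rewrite /btail; apply: mulr_ge0 => //; apply: mulr_ge0 => //; exact: exprn_ge0. Qed.

Lemma bsum_le n k : bsum n half k <= 2 ^+ n.
Proof.
have /andP[h1 h2] := half_pow k; rewrite bsum_half; apply: lerXn2r; rewrite ?nnegrE; lra.
Qed.

Lemma bsum_tail n k : 2 ^+ n - bsum n half k <= btail n k.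
Proof.
have /andP[h1 h2] := half_pow k; rewrite bsum_half exprMn /btail.
have := bernoulli n h1 h2; have : 0 < 2 ^+ n :> R by rewrite exprn_gt0.
move: ((1 - half ^+ k) ^+ n) => b p h; rewrite -mulrA.
rewrite -{1}[2 ^+ n]mulr1 -mulrBr ler_pM2l //; lra.
Qed.

Lemma null_btail n : null (btail n).
Proof.
apply: nullZ; apply: null_geo; rewrite /half ?invr_ge0 // invf_lt1 ?ltr1n //.
Qed.

Section Series.
Variables (n : nat) (c : {ffun 'I_n -> nat} -> C) (e B : R).
Hypotheses (e0 : 0 < e) (hc : forall al, cabs (c al) * e ^+ (\sum_i al i)%N <= B).

Lemma B_ge0 : 0 <= B.
Proof. by apply: le_trans (hc [ffun=> 0%N]); rewrite mulr_ge0 ?cabs_ge0 // exprn_ge0 // ltW. Qed.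

Let e' := half * e.
Let e'0 : 0 < e'. Proof. by rewrite mulr_gt0 // /half invr_gt0. Qed.

(** Halving the radius turns a bound on the coefficients into domination by a geometric series. *)
Lemma wn_term (al : {ffun 'I_n -> nat}) : wn e' (c al *: mX (mn al)) <= B * half ^+ (\sum_i al i)%N.
Proof.
rewrite wnZ wnX mdeg_mn exprMn [half ^+ _ * _]mulrC mulrA ler_wpM2r //.
by have /andP[] := half_pow (\sum_i al i)%N.
Qed.

Lemma wn_bpoly k : wn e' (bpoly c k) <= B * 2 ^+ n.
Proof.
apply: le_trans (wn_sum _ _ _ (ltW e'0)) _.
apply: (@le_trans _ _ (B * bsum n half k)); last by rewrite ler_wpM2l ?B_ge0 // bsum_le.
by rewrite mulr_sumr; apply: ler_sum => al _; exact: wn_term.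
Qed.

Lemma wn_bpolyB j k : (k <= j)%N -> wn e' (bpoly c j - bpoly c k) <= B * btail n k.
Proof.
move=> kj; rewrite /bpoly (@box_sum n _ (fun al => c al *: mX (mn al)) k j kj).
rewrite (bigID (fun al : {ffun 'I_n -> 'I_j} => [forall i, al i < k]%N)) /= addrAC subrr add0r.
apply: le_trans (wn_sum _ _ _ (ltW e'0)) _.
apply: (@le_trans _ _ (B * (bsum n half j - bsum n half k))); last first.
  apply: ler_wpM2l; first exact: B_ge0.
  by have := bsum_le n j; have := bsum_tail n k; lra.
rewrite /bsum (@box_sum n _ (fun al => half ^+ (\sum_i al i)%N) k j kj).
rewrite [X in B * (X - _)](bigID (fun al : {ffun 'I_n -> 'I_j} => [forall i, al i < k]%N)) /= addrAC subrr add0r.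
by rewrite mulr_sumr; apply: ler_sum => al _; exact: wn_term.
Qed.

Lemma series_AnW a : exists F, AnW e' a F (bpoly c) (fun k => 2 * (B * btail n k)) (B * 2 ^+ n).
Proof.
have B0 := B_ge0.
have t0 k : 0 <= B * btail n k by rewrite mulr_ge0 // btail_ge0.
have hC j k : wn e' (bpoly c j - bpoly c k) <= B * btail n j + B * btail n k.
  case: (leqP k j) => kj; first by apply: le_trans (wn_bpolyB kj) _; rewrite lerDr.
  by rewrite wnBC; apply: le_trans (wn_bpolyB (ltnW kj)) _; rewrite lerDl.
have lim (x : 'rV[C]_n) : (forall i, cabs (x 0 i - a 0 i) <= e') ->
    exists l, forall k, cabs (peval (bpoly c k) (x - a) - l) <= 2 * (B * btail n k).
  move=> hx; have [|l hl] := @squeezed_limitC R (fun k => peval (bpoly c k) (x - a)) (fun k => B * btail n k).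
    move=> j k; rewrite -pevalB; apply: le_trans (hC j k); apply: peval_le => i.
    by rewrite !mxE.
  by exists l => k; apply: le_trans (hl k) _; lra.
exists (fun x => xget 0 [set l | forall k, cabs (peval (bpoly c k) (x - a) - l) <= 2 * (B * btail n k)]).
split.
- by apply: nullZ; apply: nullZ; exact: null_btail.
- exact: wn_bpoly.
- move=> j k; apply: le_trans (hC j k) _; have := t0 j; have := t0 k; lra.
- move=> x /lim[l hl] k; rewrite cabsBC; case: xgetP => [y _ /= hy|/(_ l)] //.
Qed.

Lemma AnW_cvg n' (a x : 'rV[C]_n') E F (p : nat -> MP n') u b : AnW E a F p u b ->
  (forall i, cabs (x 0 i - a 0 i) <= E) -> peval (p k) (x - a) @[k --> \oo] --> F x.
Proof.
move=> [hu _ _ hF] hx; apply/cvg_null; apply: null_le hu => k.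
by rewrite ger0_norm ?cabs_ge0 // cabsBC; exact: hF.
Qed.

End Series.

Lemma cvg_uniqC (u : nat -> C) (l l' : C) : u @ \oo --> l -> u @ \oo --> l' -> l = l'.
Proof.
move=> /cvg_null h /cvg_null h'; apply: (@cabs_null_eq _ _ _ _ (nullD h h')) => k.
have := cabsD (l - u k) (u k - l'); rewrite addrA subrK => h1.
by apply: le_trans h1 _; rewrite [cabs (l - _)]cabsBC.
Qed.

Lemma near_disc n (a : 'rV[C]_n) (r : R) : 0 < r -> \forall x \near a, disc a r x.
Proof. by move=> r0; apply/nbhs_disc; exists r. Qed.

(** In [analytic_at] over [Cx R], the inequalities force [e] and [B] to be real, so both can be read
    in [R]. *)
Lemma analytic_An n (f : 'rV[C]_n -> C) (a : 'rV[C]_n) : analytic_at f a -> An f a.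
Proof.
move=> [c [e [B [e0 hc hf]]]].
have er : e = cofr (re e) by rewrite /cofr RRe_real // realE ltW.
have e1 : 0 < re e by rewrite -cofr_lt cofr0 -er.
have hc' al : cabs (c al) * re e ^+ (\sum_i al i)%N <= re B.
  have := hc al; rewrite normE {1}er -cofrX -cofrM => h.
  have Br : B = cofr (re B).
    rewrite /cofr RRe_real // ger0_real //; apply: le_trans h.
    by rewrite -(@cofr0 R) cofr_le mulr_ge0 ?cabs_ge0 // exprn_ge0 // ltW.
  by rewrite Br cofr_le in h.
have [F hF] := series_AnW e1 hc' a.
have h2 : 0 < half * re e by rewrite mulr_gt0 // /half invr_gt0.
apply: (@An_near _ _ _ F); last by exists (half * re e) => //; do 3 eexists; exact: hF.
have hd := near_disc a h2.
near=> x; apply: (@cvg_uniqC (fun k => power_sum c a x k)); last by near: x.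
have hx' : disc a (half * re e) x by near: x.
have hx i : cabs (x 0 i - a 0 i) <= half * re e by exact: ltW (hx' i).
by have := AnW_cvg hF hx; under eq_fun do rewrite peval_bpoly.
Unshelve. all: by end_near. Qed.

Definition cv n (v : 'rV[R]_n) : 'rV[C]_n := map_mx (@cofr R) v.

Lemma cvE n (v : 'rV[R]_n) i : cv v 0 i = cofr (v 0 i). Proof. by rewrite mxE. Qed.
Lemma cv0 n : cv (0 : 'rV[R]_n) = 0.
Proof. by apply/rowP => i; rewrite !mxE cofr0. Qed.
Lemma cvD n (v w : 'rV[R]_n) : cv (v + w) = cv v + cv w.
Proof. by apply/rowP => i; rewrite !mxE cofrD. Qed.
Lemma cvZ n c (v : 'rV[R]_n) : cv (c *: v) = cofr c *: cv v.
Proof. by apply/rowP => i; rewrite !mxE cofrM. Qed.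

Lemma near_cv n (a : 'rV[R]_n) (P : 'rV[C]_n -> Prop) :
  (\forall x \near cv a, P x) -> \forall y \near a, P (cv y).
Proof.
move=> /nbhs_disc[e e0 h]; apply/nbhs_ballP; exists e => //= y [_ hy]; apply: h => i.
have := hy 0 i; rewrite -ball_normE /= => h1.
by rewrite !cvE -cofrB cabs_cofr distrC.
Qed.

Lemma near_rdisc n (a : 'rV[R]_n) (r : R) : 0 < r -> nbhs a (fun y => forall i, `|y 0 i - a 0 i| < r).
Proof.
move=> r0; apply/nbhs_ballP; exists r => //= y [_ hy] i; have := hy 0 i.
by rewrite -ball_normE /= distrC.
Qed.

Lemma near_rdiscP n (a : 'rV[R]_n) (P : 'rV[R]_n -> Prop) : (\forall y \near a, P y) ->
  exists2 r : R, 0 < r & forall y : 'rV[R]_n, (forall i, `|y 0 i - a 0 i| < r) -> P y.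
Proof.
move=> /nbhs_ballP[e e0 h]; exists e => // y hy; apply: h; split=> // i j; rewrite ord1.
by rewrite -ball_normE /= distrC.
Qed.

(** [F] is a holomorphic extension of the germ of [f], through which the complex theory serves real
    functions. *)
Definition ext n (f : 'rV[R]_n -> R) (F : 'rV[C]_n -> C) (a : 'rV[R]_n) :=
  An F (cv a) /\ \forall y \near a, F (cv y) = cofr (f y).

Lemma power_sum_cofr n (c : {ffun 'I_n -> nat} -> R) (a x : 'rV[R]_n) k :
  power_sum (fun al => cofr (c al)) (cv a) (cv x) k = cofr (power_sum c a x k).
Proof.
rewrite /power_sum [RHS](rmorph_sum (real_complex R)); apply: eq_bigr => al _.
rewrite rmorphM rmorph_prod; congr (_ * _); apply: eq_bigr => i _.
by rewrite rmorphXn !cvE -cofrB.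
Qed.

Lemma analytic_ext n (f : 'rV[R]_n -> R) (a : 'rV[R]_n) : analytic_at f a -> exists F, ext f F a.
Proof.
move=> [c [e [B [e0 hc hf]]]].
have hc' al : cabs (cofr (c al)) * e ^+ (\sum_i al i)%N <= B by rewrite cabs_cofr.
have [F hF] := series_AnW e0 hc' (cv a).
have h2 : 0 < half * e by rewrite mulr_gt0 // /half invr_gt0.
exists F; split; first by exists (half * e) => //; do 3 eexists; exact: hF.
have hd := near_cv (near_disc (cv a) h2).
near=> y.
have hy' : disc (cv a) (half * e) (cv y) by near: y.
have hy i : cabs (cv y 0 i - cv a 0 i) <= half * e by exact: ltW (hy' i).
have fy : power_sum c a y k @[k --> \oo] --> f y by near: y.
apply: (@cvg_uniqC (fun k => cofr (power_sum c a y k))).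
  by have := AnW_cvg hF hy; under eq_fun do rewrite peval_bpoly power_sum_cofr.
apply/cvg_null; move/cvg_nullR: fy => h; apply/nullP => d d0.
have [M hM] := (nullP _).1 h _ d0; exists M => k Mk.
by rewrite -cofrB cabs_cofr normr_id; exact: hM.
Unshelve. all: by end_near. Qed.

End PowerSeries.

(** * From holomorphic extensions back to real power series *)

Section Converse.
Variable R : realType.
Local Notation C := (Cx R).
Local Notation MP n := (mpoly.mpoly n C).
Local Notation mco := mpoly.mcoeff.
Local Notation mdeg := mpoly.mdeg.
Local Notation mX := (mpoly.mpolyX C).
Local Notation half := (half R).

Lemma peval_box n (p : MP n) (X : 'rV[C]_n) K : (mpoly.mmeasure mdeg p <= K)%N ->
  peval p X = \sum_(al : {ffun 'I_n -> 'I_K}) mco (mn (nf al)) p * \prod_i X 0 i ^+ al i.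
Proof.
move=> pK; rewrite pevalE mpoly.mevalE.
pose G (m : mpoly.multinom n) := mco m p * \prod_i X 0 i ^+ m i.
pose s := [seq mn (nf al) | al <- enum {ffun 'I_n -> 'I_K}].
have us : uniq s by rewrite map_inj_uniq ?enum_uniq // => x y /mn_inj /nf_inj.
have ss m : m \in mpoly.msupp p -> m \in s.
  move=> mp; have mK : (mdeg m < K)%N by apply: leq_trans pK; exact: mpoly.msize_mdeg_lt.
  have mi i : (m i < K)%N.
    by apply: leq_ltn_trans mK; rewrite mpoly.mdegE (bigD1 i) //= leq_addr.
  apply/mapP; exists [ffun i => Ordinal (mi i)]; first by rewrite mem_enum.
  by apply/mpoly.mnmP => i; rewrite mnE !ffunE.
have -> : \sum_(al : {ffun 'I_n -> 'I_K}) mco (mn (nf al)) p * \prod_i X 0 i ^+ al i =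
    \sum_(m <- s) G m.
  rewrite big_map big_enum /=; apply: eq_bigr => al _; congr (_ * _).
  by apply: eq_bigr => i _; rewrite mnE ffunE.
rewrite [RHS](bigID (mem (mpoly.msupp p))) /= [X in _ = _ + X]big1 ?addr0; last first.
  by move=> m hm; rewrite /G mpoly.memN_msupp_eq0 // mul0r.
rewrite -[RHS]big_filter; apply: perm_big; apply: uniq_perm => [||m].
- exact: mpoly.msupp_uniq.
- exact: filter_uniq.
- by rewrite mem_filter; apply/idP/andP => [h|[]//]; split => //; exact: ss.
Qed.

Lemma reM (z : C) (r : R) : re (z * cofr r) = re z * r.
Proof. by case: z => x y; rewrite /re /= mulr0 subr0. Qed.
Lemma re_sum (I : Type) (s : seq I) (P : pred I) (F : I -> C) :
  re (\sum_(i <- s | P i) F i) = \sum_(i <- s | P i) re (F i).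
Proof. by apply: (big_morph (@re R) (@reD R)). Qed.

Lemma power_sum_re n (c : {ffun 'I_n -> nat} -> C) (a x : 'rV[R]_n) k :
  re (power_sum c (cv a) (cv x) k) = power_sum (fun al => re (c al)) a x k.
Proof.
rewrite /power_sum re_sum; apply: eq_bigr => al _; rewrite -reM; congr (re (_ * _)).
rewrite [RHS](rmorph_prod (real_complex R)); apply: eq_bigr => i _.
by rewrite rmorphXn !cvE -cofrB.
Qed.

(** The coefficients [c] are limits of those of the [p k], with an error at most [2 * u k] after
    weighting. As [f] is real, the series of their real parts also sums to [f]. *)
Lemma ext_analytic n (f : 'rV[R]_n -> R) F (a : 'rV[R]_n) : ext f F a -> analytic_at f a.
Proof.
move=> [[e e0 [p [u [B hAn]]]] hf]; have [hu hB hC hF] := hAn.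
have u0 k : 0 <= u k by exact: (AnE_ge0 (cv a) (ltW e0) hC).
have hl (al : {ffun 'I_n -> nat}) : exists l : C, forall k,
    cabs (mco (mn al) (p k) - l) * e ^+ (\sum_i al i)%N <= 2 * u k.
  pose E := e ^+ (\sum_i al i)%N; have E0 : 0 < E by rewrite exprn_gt0.
  have [|l hl] := @squeezed_limitC R (fun k => mco (mn al) (p k) * cofr E) u.
    move=> j k; rewrite -mulrBl cabsM cabs_cofr gtr0_norm //.
    have := mco_le (p j - p k) (mn al) (ltW e0); rewrite mdeg_mn.
    have -> : mco (mn al) (p j - p k) = mco (mn al) (p j) - mco (mn al) (p k) by exact: mpoly.mcoeffB.
    by move=> h; apply: le_trans h _; exact: hC.
  exists (l / cofr E) => k; have := hl k.
  have -> : mco (mn al) (p k) * cofr E - l = (mco (mn al) (p k) - l / cofr E) * cofr E.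
    by rewrite mulrBl divfK // -cofr0 (inj_eq (@cofr_inj R)) gt_eqF.
  rewrite cabsM cabs_cofr gtr0_norm // => h; apply: le_trans h _; lra.
have /choice[c hc] := hl.
exists (fun al => re (c al)), e, (B + 2 * u 0%N); split => //.
  move=> al; apply: (@le_trans _ _ (cabs (c al) * e ^+ (\sum_i al i)%N)).
    by rewrite ler_wpM2r ?re_cabs // exprn_ge0 // ltW.
  have h1 := hc al 0%N; have h2 := mco_le (p 0%N) (mn al) (ltW e0); rewrite mdeg_mn in h2.
  have h3 := hB 0%N.
  have h4 : cabs (c al) <= cabs (mco (mn al) (p 0%N) - c al) + cabs (mco (mn al) (p 0%N)).
    by have := cabsD (c al - mco (mn al) (p 0%N)) (mco (mn al) (p 0%N)); rewrite subrK cabsBC.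
  have E0 : 0 <= e ^+ (\sum_i al i)%N by rewrite exprn_ge0 // ltW.
  have := ler_wpM2r E0 h4; rewrite mulrDl; lra.
have h2 : 0 < half * e by rewrite mulr_gt0 // /half invr_gt0.
have hd := near_cv (near_disc (cv a) h2).
near=> y.
have hy' : disc (cv a) (half * e) (cv y) by near: y.
have fy : F (cv y) = cofr (f y) by near: y.
have hye i : cabs (cv y 0 i - cv a 0 i) <= e.
  apply: le_trans (ltW (hy' i)) _; rewrite ler_piMl ?(ltW e0) // /half invf_le1 ?ler1n //.
(* Once the box contains the support of [p k], the partial sum differs from [p k] by at most
   [2 * u k] times the geometric sum over the box. *)
have key k K : (mpoly.mmeasure mdeg (p k) <= K)%N ->
    cabs (F (cv y) - power_sum c (cv a) (cv y) K) <= u k * (1 + 2 * 2 ^+ n).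
  move=> pK; have h1 := hF _ hye k.
  have h3 : cabs (peval (p k) (cv y - cv a) - power_sum c (cv a) (cv y) K) <= 2 * u k * 2 ^+ n.
    rewrite (peval_box _ pK) /power_sum -sumrB; apply: le_trans (cabs_sum _ _ _) _.
    apply: (@le_trans _ _ (2 * u k * @bsum R n half K)); last first.
      by apply: ler_wpM2l; [rewrite mulr_ge0|exact: bsum_le].
    rewrite /bsum mulr_sumr; apply: ler_sum => al _.
    have -> : \prod_i (cv y - cv a) 0 i ^+ al i = \prod_i (cv y 0 i - cv a 0 i) ^+ al i.
      by apply: eq_bigr => i _; rewrite !mxE.
    rewrite -mulrBl cabsM cabs_prod.
    apply: (@le_trans _ _ (cabs (mco (mn (nf al)) (p k) - c (nf al)) * (half * e) ^+ (\sum_i nf al i)%N)).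
      rewrite ler_wpM2l ?cabs_ge0 // -prodrXr; apply: ler_prod => i _.
      rewrite cabs_ge0 cabsX ffunE /=; apply: lerXn2r; rewrite ?nnegrE ?cabs_ge0 ?(ltW h2) //.
      exact: ltW (hy' i).
    have := hc (nf al) k; rewrite exprMn mulrCA => h.
    rewrite [leRHS]mulrC ler_wpM2l //.
    by have /andP[] := @half_pow R (\sum_i nf al i)%N.
  have := cabsD (F (cv y) - peval (p k) (cv y - cv a)) (peval (p k) (cv y - cv a) - power_sum c (cv a) (cv y) K).
  by rewrite addrA subrK => h; apply: le_trans h _; apply: le_trans (lerD h1 h3) _; lra.
apply/cvg_nullR/nullP => d d0.
have D0 : 0 < 1 + 2 * 2 ^+ n :> R by rewrite addr_gt0 // mulr_gt0 // exprn_gt0.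
have [k0 hk0] := null_lt hu (divr_gt0 d0 D0).
exists (mpoly.mmeasure mdeg (p k0)) => K hK.
have h1 := key k0 K hK; rewrite fy in h1.
rewrite -power_sum_re -[f y]re_cofr -reB; apply: le_lt_trans (re_cabs _) _; rewrite cabsBC.
apply: le_lt_trans h1 _; by rewrite -ltr_pdivlMr //; exact: hk0.
Unshelve. all: by end_near. Qed.

Lemma ext_unique n (f : 'rV[R]_n -> R) F G (a : 'rV[R]_n) : ext f F a -> ext f G a ->
  \forall x \near cv a, F x = G x.
Proof.
move=> [FA Ff] [GA Gf].
have h : \forall y \near a, F (cv y) - G (cv y) = 0.
  by near=> y; apply/eqP; rewrite subr_eq0; apply/eqP; transitivity (cofr (f y)); [|symmetry]; near: y.
have [r r0 hr] := near_rdiscP h.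
have := An_real_zero (An_sub FA GA) _.
have k : exists2 d : R, 0 < d & forall v : 'rV[R]_n, (forall i, `|v 0 i| < d) ->
    F (cv a + map_mx (@cofr R) v) - G (cv a + map_mx (@cofr R) v) = 0.
  exists r => // v hv; rewrite -/(cv v) -cvD; apply: hr => i.
  by rewrite mxE addrAC subrr add0r.
by move=> /(_ k); apply: filterS => x /eqP; rewrite subr_eq0 => /eqP.
Unshelve. all: by end_near. Qed.

Lemma ext_zero n F (a : 'rV[R]_n) : An F (cv a) -> (\forall y \near a, F (cv y) = 0) ->
  \forall x \near cv a, F x = 0.
Proof.
move=> FA h; apply: (@ext_unique n (fun=> 0) F (fun=> 0) a).
  by split => //; apply: filterS h => y ->; rewrite cofr0.
by split; [exact: An_cst|apply: filterE => y; rewrite cofr0].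
Qed.

Lemma ext_nbhs n (f : 'rV[R]_n -> R) F (a : 'rV[R]_n) : ext f F a -> \forall b \near a, ext f F b.
Proof.
move=> [FA Ff]; have h1 := near_cv (An_nbhs FA).
have h2 : \forall b \near a, \forall y \near b, F (cv y) = cofr (f y).
  have [r r0 hr] := near_rdiscP Ff.
  have h3 := near_rdisc a (divr_gt0 r0 (ltr0n R 2)).
  apply: filterS h3 => b hb.
  have := near_rdisc b (divr_gt0 r0 (ltr0n R 2)); apply: filterS => y hy; apply: hr => i.
  have := ler_normD (y 0 i - b 0 i) (b 0 i - a 0 i); rewrite addrA subrK => h.
  apply: le_lt_trans h _; have := hb i; have := hy i; lra.
by near=> b; split; near: b.
Unshelve. all: by end_near. Qed.

End Converse.

(** * Real derivatives through holomorphic extensions *)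

Section RealDerivatives.
Variable R : realType.
Local Notation C := (Cx R).

Lemma row_norm_ge n (h : 'rV[R]_n) i : `|h 0 i| <= `|h|.
Proof.
by rewrite [leRHS]/Num.norm /= mx_normrE; exact: (le_bigmax _ (fun ij : 'I_1 * 'I_n => `|h ij.1 ij.2|) (0, i)).
Qed.

Lemma row_norm_le n (h : 'rV[R]_n) c : 0 <= c -> (forall i, `|h 0 i| <= c) -> `|h| <= c.
Proof.
move=> c0 hc; rewrite [leLHS]/Num.norm /= mx_normrE; apply/bigmax_leP; split => // -[i j] _ /=.
by rewrite ord1.
Qed.

Definition rD n (F : 'rV[C]_n -> C) (a v : 'rV[R]_n) : R := re (Dd F (cv a) (cv v)).

Lemma ext_isD n (f : 'rV[R]_n -> R) F (a : 'rV[R]_n) : ext f F a -> forall eps : R, 0 < eps ->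
  exists2 d : R, 0 < d & forall h : 'rV[R]_n, `|h| <= d ->
    cabs (cofr (f (a + h) - f a) - Dd F (cv a) (cv h)) <= eps * `|h|.
Proof.
move=> [FA Ff] eps e0; have [d d0 hd] := An_isD FA e0.
have [r r0 hr] := near_rdiscP Ff.
have fa : F (cv a) = cofr (f a) by exact: nbhs_singleton Ff.
exists (Num.min d (r / 2)); first by rewrite lt_min d0 divr_gt0.
move=> h hh; have h1 : `|h| <= d by apply: le_trans hh _; rewrite ge_min lexx.
have h2 : `|h| < r.
  apply: le_lt_trans hh _; apply: (@le_lt_trans _ _ (r / 2)); last lra.
  by rewrite ge_min lexx orbT.
have := hd (cv h) `|h| _ (normr_ge0 _) h1; rewrite -cvD hr; last first.
  by move=> i; rewrite mxE addrAC subrr add0r; apply: le_lt_trans h2; exact: row_norm_ge.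
rewrite fa -cofrB; apply => i.
by rewrite cvE cabs_cofr row_norm_ge.
Qed.

(** The difference quotients of [f] are real, so the imaginary part is below every [eps]. *)
Lemma ext_Dd_real n (f : 'rV[R]_n -> R) F (a v : 'rV[R]_n) : ext f F a ->
  Dd F (cv a) (cv v) = cofr (rD F a v).
Proof.
move=> hF; have h0 : im (Dd F (cv a) (cv v)) = 0.
  apply/eqP; rewrite -normr_eq0; apply/eqP/le_anti; rewrite normr_ge0 andbT.
  apply/ler_addgt0Pl => eps e0; rewrite addr0.
  have V0 : 0 < `|v| + 1 by apply: ltr_wpDl.
  have [d d0 hd] := ext_isD hF (divr_gt0 e0 V0).
  pose s := d / (`|v| + 1); have s0 : 0 < s by rewrite divr_gt0.
  have sv : `|s *: v| <= d.
    rewrite normrZ gtr0_norm // /s mulrAC ler_pdivrMr // ler_pM2l //; lra.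
  have := hd _ sv; rewrite cvZ DdZ normrZ gtr0_norm // => h.
  have h1 := le_trans (im_cabs _) h; move: h1.
  rewrite imB im_cofr sub0r normrN.
  have -> : im (cofr s * Dd F (cv a) (cv v)) = s * im (Dd F (cv a) (cv v)).
    by case: (Dd _ _ _) => x y; rewrite /im /= mul0r addr0.
  rewrite normrM gtr0_norm // mulrCA ler_pM2l // => h1; apply: le_trans h1 _.
  by rewrite mulrAC ler_pdivrMr // ler_pM2l //; lra.
by rewrite {1}[Dd _ _ _]cE h0 cofr0 mulr0 addr0.
Qed.

Lemma ext_lim n (f : 'rV[R]_n -> R) F (a v : 'rV[R]_n) : ext f F a ->
  (fun h : R => h^-1 * (f (a + h *: v) - f a)) @ 0^' --> rD F a v.
Proof.
move=> hF; apply/cvgrPdist_le => eps e0.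
have V0 : 0 < `|v| + 1 by apply: ltr_wpDl.
have [d d0 hd] := ext_isD hF (divr_gt0 e0 V0).
have s0 : 0 < d / (`|v| + 1) by rewrite divr_gt0.
near=> s.
have sn0 : s != 0 by near: s; exact: nbhs_dnbhs_neq.
have sd : `|s| < d / (`|v| + 1) by near: s; apply: dnbhs0_lt.
have sv : `|s *: v| <= d.
  rewrite normrZ; move: sd; rewrite ltr_pdivlMr // mulrDr => h.
  by apply: le_trans (ltW h); rewrite lerDl mulr1.
have := hd _ sv; rewrite cvZ DdZ (ext_Dd_real v hF) -cofrM -cofrB cabs_cofr normrZ => h.
have -> : rD F a v - s^-1 * (f (a + s *: v) - f a) = - s^-1 * ((f (a + s *: v) - f a) - s * rD F a v).
  by field.
rewrite normrM normrN normfV ler_pdivrMl ?normr_gt0 //; apply: le_trans h _.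
by rewrite mulrCA ler_pM2l ?normr_gt0 // mulrAC ler_pdivrMr // ler_pM2l //; lra.
Unshelve. all: by end_near. Qed.

Lemma ext_derive n (f : 'rV[R]_n -> R) F (a v : 'rV[R]_n) : ext f F a -> 'D_v f a = rD F a v.
Proof.
move=> hF; apply: cvg_lim => //; have := ext_lim (v := v) hF.
have -> // : (fun h : R => h^-1 * (f (a + h *: v) - f a)) = fun h => h^-1 *: ((f \o shift a) (h *: v) - f a).
by apply/funext => h /=; rewrite [h *: v + a]addrC.
Qed.

Lemma ext_derive1 n (f : 'rV[R]_n -> R) F (a v : 'rV[R]_n) : ext f F a ->
  derive1 (fun s : R => f (a + s *: v)) 0 = rD F a v.
Proof.
move=> hF; apply: cvg_lim => //; have := ext_lim (v := v) hF.
have -> // : (fun h : R => h^-1 * (f (a + h *: v) - f a)) =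
  fun h => h^-1 *: (f (a + (h + 0) *: v) - f (a + 0 *: v)).
by apply/funext => h; rewrite addr0 scale0r addr0.
Qed.

Lemma cv_delta n i : cv (delta_mx 0 i : 'rV[R]_n) = delta_mx 0 i.
Proof.
by apply/rowP => j; rewrite !mxE; case: (_ && _); rewrite /= ?cofr1 ?cofr0.
Qed.

Lemma ext_pderiv n (f : 'rV[R]_n -> R) F (a : 'rV[R]_n) i : ext f F a ->
  ext (pderiv i f) (dC i F) a.
Proof.
move=> hF; split; first exact: An_dC hF.1.
apply: filterS (ext_nbhs hF) => b hb.
by rewrite /pderiv (ext_derive _ hb) -(ext_Dd_real _ hb) cv_delta -dC_Dd.
Qed.

Definition mlist n (beta : {ffun 'I_n -> nat}) : seq 'I_n :=
  flatten [seq nseq (beta i) i | i <- enum 'I_n].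

Lemma ext_pderiv_multi n (f : 'rV[R]_n -> R) F (a : 'rV[R]_n) beta : ext f F a ->
  ext (pderiv_multi beta f) (dCs (mlist beta) F) a.
Proof.
move=> hF; rewrite /pderiv_multi /mlist; elim: (enum 'I_n) => [|i s IH] //=.
rewrite /dCs foldr_cat -/(dCs _ _); elim: (beta i) => [|k IHk] //=.
exact: ext_pderiv.
Qed.

Lemma size_mlist n (beta : {ffun 'I_n -> nat}) : size (mlist beta) = (\sum_i beta i)%N.
Proof.
rewrite size_flatten /shape -map_comp sumnE big_map big_enum /=.
by apply: eq_bigr => i _; rewrite size_nseq.
Qed.

(** ['J] is taken from the differential of the library, identified by [diff_unique] once the
    candidate is continuous and the remainder negligible. *)
Lemma ext_jacobian n k (f : 'rV[R]_n -> 'rV[R]_k) (F : 'I_k -> 'rV[C]_n -> C) (a : 'rV[R]_n) :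
  (forall j, ext (fun y => f y 0 j) (F j) a) ->
  'J f a = \matrix_(i, j) rD (F j) a (delta_mx 0 i).
Proof.
move=> hF; pose A : 'M[R]_(n, k) := \matrix_(i, j) rD (F j) a (delta_mx 0 i).
have AE h j : (h *m A) 0 j = rD (F j) a h.
  rewrite mxE; apply: cofr_inj; rewrite -(ext_Dd_real h (hF j)).
  rewrite [cofr _](rmorph_sum (real_complex R)) [in RHS](row_sum_delta (cv h)) Dd_sumv; apply: eq_bigr => i _.
  by rewrite DdZ cvE -cv_delta (ext_Dd_real _ (hF j)) -cofrM mxE.
have cA : continuous (mulmxr A : 'rV[R]_n -> 'rV[R]_k).
  apply/linear_bounded_continuous/linear_boundedP.
  exists (\sum_i \sum_j `|A i j|); split; first by rewrite realE sumr_ge0 // => i _; rewrite sumr_ge0.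
  move=> r hr x; have r0 : 0 <= r.
    by apply: le_trans (ltW hr); rewrite sumr_ge0 // => i _; rewrite sumr_ge0.
  apply: row_norm_le; first by rewrite mulr_ge0.
  move=> j; rewrite mxE; apply: le_trans (ler_norm_sum _ _ _) _.
  apply: (@le_trans _ _ ((\sum_i \sum_j `|A i j|) * `|x|)); last by rewrite ler_wpM2r // ltW.
  rewrite mulr_suml; apply: ler_sum => i _; rewrite normrM mulrC; apply: ler_pM => //; last exact: row_norm_ge.
  by rewrite (bigD1 j) //= lerDl sumr_ge0.
have := @diff_unique R _ _ f (mulmxr A) a cA.
have hd : f \o shift a = cst (f a) + mulmxr A +o_ (0 : 'rV[R]_n) id.
  apply/eqaddoP => eps e0.
  have hj j : \forall h \near (0 : 'rV[R]_n), `|f (a + h) 0 j - f a 0 j - rD (F j) a h| <= eps * `|h|.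
    have [d d0 hd] := ext_isD (hF j) e0.
    have : \forall h \near (0 : 'rV[R]_n), `|h| < d by apply: nbhs0_lt.
    apply: filterS => h hh; have := hd h (ltW hh).
    by rewrite (ext_Dd_real h (hF j)) -cofrB cabs_cofr.
  have hjj : \forall h \near (0 : 'rV[R]_n), forall j, `|f (a + h) 0 j - f a 0 j - rD (F j) a h| <= eps * `|h| by exact: filter_forall hj.
  apply: filterS hjj => h hh; apply: row_norm_le; first by rewrite mulr_ge0 // ltW.
  have e : (f \o shift a - (cst (f a) + mulmxr A)) h = f (a + h) - f a - h *m A.
    by rewrite -[LHS]/(f (h + a) - (f a + h *m A)) [h + a]addrC opprD addrA.
  have subE (x y z : 'rV[R]_k) j : (x - y - z) 0 j = x 0 j - y 0 j - z 0 j by rewrite !mxE.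
  by move=> j; rewrite e subE AE; exact: hh.
move=> /(_ hd) dE; rewrite /jacobian dE; apply/matrixP => i j.
by rewrite mxE /= AE mxE.
Qed.

End RealDerivatives.

(** * Real algebraic functions and Nash extensions *)

Section RealAlgebraic.
Variable R : realType.
Local Notation C := (Cx R).
Local Notation MP n := (mpoly.mpoly n C).
Local Notation MR n := (mpoly.mpoly n R).
Local Notation mco := mpoly.mcoeff.

Lemma evalR_sum n (P : {poly MR n}) (y : 'rV[R]_n) (t : R) k : (size P <= k)%N ->
  (eval_at P y).[t] = \sum_(i < k) mpoly.meval (fun j => y 0 j) P`_i * t ^+ i.
Proof.
move=> sP; rewrite /eval_at (@horner_coef_wide _ k); last by apply: leq_trans (size_poly _ _) sP.
by apply: eq_bigr => i _; rewrite coef_map_id0 ?raddf0.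
Qed.

Lemma meval_real n (p : MR n) (y : 'rV[R]_n) :
  peval (mpoly.map_mpoly (real_complex R) p) (cv y) = cofr (mpoly.meval (fun j => y 0 j) p).
Proof.
rewrite pevalE !mpoly.mevalE (perm_big _ (mpoly.msupp_map_mpoly p (@cofr_inj R))) /=.
rewrite [RHS](rmorph_sum (real_complex R)); apply: eq_bigr => m _.
rewrite rmorphM rmorph_prod mpoly.mcoeff_map_mpoly; congr (_ * _).
by apply: eq_bigr => i _; rewrite rmorphXn cvE.
Qed.

Lemma algebraic_ext n (f : 'rV[R]_n -> R) (a : 'rV[R]_n) : algebraic_at f a ->
  exists F, ext f F a /\ Nash F (cv a).
Proof.
move=> [/analytic_ext[F hF] [P [P0 hP]]]; exists F; split => //; split; first exact: hF.1.
pose Pc : {poly MP n} := map_poly (mpoly.map_mpoly (real_complex R)) P.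
have cE i : Pc`_i = mpoly.map_mpoly (real_complex R) P`_i by rewrite coef_map_id0 ?raddf0.
exists Pc.
  apply/eqP => Pc0; move/eqP: P0; apply; apply/polyP => i; rewrite coef0.
  apply/mpoly.mpolyP => m; rewrite mpoly.mcoeff0; apply: (@cofr_inj R).
  have := congr1 (mco m) (cE i); rewrite Pc0 coef0 mpoly.mcoeff0 mpoly.mcoeff_map_mpoly => e.
  by etransitivity; [symmetry; exact: e|rewrite cofr0].
apply: (@ext_zero R n (ev Pc F) a); first exact: An_ev hF.1.
have Ff := hF.2; near=> y.
have e1 : F (cv y) = cofr (f y) by near: y.
have e2 : (eval_at P y).[f y] = 0 by near: y.
rewrite (evE F (cv y) (size_poly _ _ : (size Pc <= size P)%N)) e1.
transitivity (cofr ((eval_at P y).[f y])); last by rewrite e2 cofr0.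
rewrite (evalR_sum y (f y) (leqnn _)) [RHS](rmorph_sum (real_complex R)).
apply: eq_bigr => i _; rewrite cE meval_real.
by rewrite [RHS]cofrM cofrX.
Unshelve. all: by end_near. Qed.

Lemma imM (z : C) (r : R) : im (z * cofr r) = im z * r.
Proof. by case: z => x y; rewrite /im /= mulr0 add0r. Qed.

Section Parts.
Variable h : C -> R.
Hypotheses (hD : forall x y, h (x + y) = h x + h y) (h0 : h 0 = 0).
Hypothesis hM : forall z r, h (z * cofr r) = h z * r.

(** [h] is the real or the imaginary part, an additive map linear over real scalars. *)
Definition part n (p : MP n) : MR n := \sum_(m <- mpoly.msupp p) h (mco m p) *: mpoly.mpolyX R m.

Lemma part_mco n (p : MP n) m : mco m (part p) = h (mco m p).
Proof.
rewrite /part raddf_sum /=; under eq_bigr => k _ do rewrite mpoly.mcoeffZ mpoly.mcoeffX.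
case: (boolP (m \in mpoly.msupp p)) => [mp|mp].
  rewrite (bigD1_seq m) ?mpoly.msupp_uniq //= eqxx mulr1 big1 ?addr0 // => k km.
  by rewrite (negPf km) mulr0.
rewrite big_seq big1 => [|k kp]; first by rewrite mpoly.memN_msupp_eq0 ?h0.
by case: eqP => [e|]; rewrite ?mulr0 //; move: mp; rewrite -e kp.
Qed.

Lemma part_eval n (p : MP n) (y : 'rV[R]_n) :
  mpoly.meval (fun j => y 0 j) (part p) = h (peval p (cv y)).
Proof.
rewrite pevalE [in RHS]mpoly.mevalE (big_morph h hD h0) /part raddf_sum /=; apply: eq_bigr => m _.
rewrite mpoly.mevalZ mpoly.mevalX -hM; congr (h (_ * _)).
rewrite [LHS](rmorph_prod (real_complex R)); apply: eq_bigr => i _.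
by rewrite rmorphXn cvE.
Qed.

Definition partP n (P : {poly MP n}) : {poly MR n} := \poly_(i < size P) part P`_i.

Lemma partP_eval n (P : {poly MP n}) (y : 'rV[R]_n) F t : F (cv y) = cofr t ->
  (eval_at (partP P) y).[t] = h (ev P F (cv y)).
Proof.
move=> e; rewrite (evalR_sum y t (size_poly _ _)) (evE F (cv y) (leqnn _)) e (big_morph h hD h0).
apply: eq_bigr => i _; rewrite coef_poly ltn_ord part_eval -hM.
by congr (h (_ * _)); rewrite cofrX.
Qed.

Lemma partP_coef n (P : {poly MP n}) i m : partP P = 0 -> h (mco m P`_i) = 0.
Proof.
move=> P0; case: (ltnP i (size P)) => iP; last by rewrite nth_default // mpoly.mcoeff0.
by rewrite -part_mco; have := congr1 (fun Q : {poly MR n} => mco m Q`_i) P0; rewrite coef_poly iP coef0 mpoly.mcoeff0.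
Qed.

End Parts.

(** At real points the real and the imaginary part of a complex equation both hold, and at least one
    of them is a nonzero polynomial. *)
Lemma Nash_algebraic n (f : 'rV[R]_n -> R) F (a : 'rV[R]_n) : ext f F a -> Nash F (cv a) -> algebraic_at f a.
Proof.
move=> hF [_ [P P0 hP]]; split; first exact: ext_analytic hF.
have hP' := near_cv hP; have Ff := hF.2.
have re0 : @re R 0 = 0 by [].
have im0 : @im R 0 = 0 by [].
case: (eqVneq (partP (@re R) P) 0) => [r0|rn0]; last first.
  exists (partP (@re R) P); split => //; near=> y.
  have e1 : F (cv y) = cofr (f y) by near: y.
  have e2 : ev P F (cv y) = 0 by near: y.
  by rewrite (partP_eval (@reD R) re0 (@reM R) P e1) e2.
exists (partP (@im R) P); split; last first.
  near=> y.
  have e1 : F (cv y) = cofr (f y) by near: y.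
  have e2 : ev P F (cv y) = 0 by near: y.
  by rewrite (partP_eval (@imD R) im0 imM P e1) e2.
apply: contraNneq P0 => i0; apply/eqP/polyP => i; rewrite coef0; apply/mpoly.mpolyP => m.
rewrite mpoly.mcoeff0 [LHS]cE (partP_coef re0 i m r0) (partP_coef im0 i m i0).
by rewrite cofr0 mulr0 addr0.
Unshelve. all: by end_near. Qed.

End RealAlgebraic.

(** * Complex conjugation *)

Section Conjugation.
Variable R : realType.
Local Notation C := (Cx R).
Local Notation MP n := (mpoly.mpoly n C).
Local Notation mco := mpoly.mcoeff.

Lemma conD (x y : C) : (x + y)^* = x^* + y^*. Proof. exact: rmorphD. Qed.
Lemma conB (x y : C) : (x - y)^* = x^* - y^*. Proof. exact: rmorphB. Qed.
Lemma conM (x y : C) : (x * y)^* = x^* * y^*. Proof. exact: rmorphM. Qed.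
Lemma con0 : (0 : C)^* = 0. Proof. exact: rmorph0. Qed.
Lemma conX (x : C) k : (x ^+ k)^* = x^* ^+ k. Proof. exact: rmorphXn. Qed.
Lemma con_sum (I : Type) (s : seq I) (P : pred I) (F : I -> C) :
  (\sum_(i <- s | P i) F i)^* = \sum_(i <- s | P i) (F i)^*.
Proof. exact: rmorph_sum. Qed.
Lemma con_prod (I : Type) (s : seq I) (P : pred I) (F : I -> C) :
  (\prod_(i <- s | P i) F i)^* = \prod_(i <- s | P i) (F i)^*.
Proof. exact: rmorph_prod. Qed.
Lemma con_inj : injective (Num.conj : C -> C). Proof. exact: can_inj (@conjCK C). Qed.

Lemma conj_cofr (x : R) : (cofr x)^* = cofr x.
Proof. by apply: conj_Creal; rewrite realE -(cofr0 R) !cofr_le -realE num_real. Qed.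

Lemma conjE (z : C) : z^* = cofr (re z) - 'i * cofr (im z).
Proof. by rewrite {1}[z]cE conD conM conjCi !conj_cofr mulNr. Qed.

Lemma re_i (x : R) : re ('i * cofr x : C) = 0.
Proof. by rewrite -[re _]opprK -im_re im_cofr oppr0. Qed.

Lemma im_conj (z : C) : im z^* = - im z.
Proof. by rewrite conjE imB im_cofr sub0r {2}[z]cE imD im_cofr add0r. Qed.

Lemma cabs_conj (z : C) : cabs z^* = cabs z.
Proof. by apply: (@cofr_inj R); rewrite -!normE norm_conjC. Qed.

Definition cj n (v : 'rV[C]_n) : 'rV[C]_n := map_mx (fun z : C => z^*) v.

Lemma cjE n (v : 'rV[C]_n) i : cj v 0 i = (v 0 i)^*. Proof. by rewrite mxE. Qed.
Lemma cjK n : involutive (@cj n).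
Proof. by move=> v; apply/rowP => i; rewrite !cjE conjCK. Qed.
Lemma cj0 n : cj (0 : 'rV[C]_n) = 0.
Proof. by apply/rowP => i; rewrite cjE mxE con0. Qed.
Lemma cjB n (v w : 'rV[C]_n) : cj (v - w) = cj v - cj w.
Proof. by apply/rowP => i; rewrite cjE !mxE conB. Qed.
Lemma cjD n (v w : 'rV[C]_n) : cj (v + w) = cj v + cj w.
Proof. by apply/rowP => i; rewrite cjE !mxE conD. Qed.

Lemma near_cj n (a : 'rV[C]_n) (P : 'rV[C]_n -> Prop) :
  (\forall x \near a, P x) -> \forall x \near cj a, P (cj x).
Proof.
move=> /nbhs_disc[e e0 h]; apply/nbhs_disc; exists e => // x hx; apply: h => i.
by have := hx i; rewrite !cjE -{1}[x 0 i]conjCK -conB cabs_conj.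
Qed.

Definition pcj n (p : MP n) : MP n := mpoly.map_mpoly (Num.conj : {rmorphism C -> C}) p.

Lemma pcj_eval n (p : MP n) x : peval (pcj p) (cj x) = (peval p x)^*.
Proof.
rewrite !pevalE !mpoly.mevalE (perm_big _ (mpoly.msupp_map_mpoly p (con_inj))) /=.
rewrite con_sum; apply: eq_bigr => m _.
rewrite conM con_prod /pcj mpoly.mcoeff_map_mpoly; congr (_ * _).
by apply: eq_bigr => i _; rewrite cjE conX.
Qed.

Lemma wn_pcj n e (p : MP n) : wn e (pcj p) = wn e p.
Proof.
rewrite !wnE (perm_big _ (mpoly.msupp_map_mpoly p (con_inj))) /=.
by apply: eq_bigr => m _; rewrite /pcj mpoly.mcoeff_map_mpoly cabs_conj.
Qed.

Lemma pcjB n (p q : MP n) : pcj (p - q) = pcj p - pcj q.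
Proof. exact: raddfB. Qed.

Lemma An_conj n (f : 'rV[C]_n -> C) a : An f a -> An (fun x => (f (cj x))^*) (cj a).
Proof.
move=> [e e0 [p [u [B [hu hB hC hf]]]]]; exists e => //; exists (fun k => pcj (p k)), u, B; split => //.
- by move=> k; rewrite wn_pcj.
- by move=> j k; rewrite -pcjB wn_pcj.
- move=> x hx k; rewrite -[x - cj a]cjK pcj_eval -conB cabs_conj cjB cjK; apply: hf => i.
  by have := hx i; rewrite !cjE -{1}[x 0 i]conjCK -conB cabs_conj.
Qed.

Lemma isD_conj n (f : 'rV[C]_n -> C) a l : isD f a l -> isD (fun x => (f (cj x))^*) (cj a) (cj l).
Proof.
move=> h eps e0; have [d d0 hd] := h eps e0; exists d => // v r hv r0 rd.
have := hd (cj v) r _ r0 rd; rewrite cjD cjK.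
have -> : (f (a + cj v))^* - (f a)^* - \sum_i cj l 0 i * v 0 i =
    (f (a + cj v) - f a - \sum_i l 0 i * cj v 0 i)^*.
  rewrite !conB con_sum; congr (_ - _); apply: eq_bigr => i _.
  by rewrite conM !cjE conjCK.
by rewrite cabs_conj; apply => i; rewrite cjE cabs_conj.
Qed.

Lemma Dd_conj n (f : 'rV[C]_n -> C) a v : An f a ->
  Dd (fun x => (f (cj x))^*) (cj a) (cj v) = (Dd f a v)^*.
Proof.
move=> hf; rewrite /Dd con_sum; apply: eq_bigr => i _.
by rewrite (dCE i (isD_conj (An_isD hf))) conM !cjE.
Qed.

Lemma AnM_conj n k (F : 'rV[C]_n -> 'rV[C]_k) a : AnM F a -> AnM (fun x => cj (F (cj x))) (cj a).
Proof. by move=> h i; under eq_fun do rewrite cjE; exact: (An_conj (h i)). Qed.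

Lemma DM_conj n k (F : 'rV[C]_n -> 'rV[C]_k) a v : AnM F a ->
  DM (fun x => cj (F (cj x))) (cj a) (cj v) = cj (DM F a v).
Proof.
move=> h; apply/rowP => i; rewrite cjE !mxE -Dd_conj //.
by congr Dd; apply/funext => x; rewrite cjE.
Qed.

Lemma biholo_conj m d (F G : 'rV[C]_(m + d) -> 'rV[C]_(m + d)) : biholo F G ->
  biholo (fun x => cj (F (cj x))) (fun x => cj (G (cj x))).
Proof.
case=> h1 h2 h3 h4 h5 h6 h7; split.
- by rewrite -[X in AnM _ X]cj0; exact: AnM_conj.
- by rewrite -[X in AnM _ X]cj0; exact: AnM_conj.
- by rewrite cj0 h3 cj0.
- by rewrite cj0 h4 cj0.
- by move=> v; rewrite -[X in DM _ X](@cj0 (m + d)) -[X in DM _ _ X]cjK DM_conj // h5 cjK.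
- by have := near_cj h6; rewrite cj0; apply: filterS => t ht; rewrite cjK ht cjK.
- by have := near_cj h7; rewrite cj0; apply: filterS => t ht; rewrite cjK ht cjK.
Qed.

End Conjugation.

(** * The complexified tube *)

Section Linear.
Variable R : realType.
Local Notation C := (Cx R).

Lemma NashM_mulmx n k l (F : 'rV[C]_n -> 'rV[C]_k) (A : 'M[C]_(k, l)) a :
  NashM F a -> NashM (fun x => F x *m A) a.
Proof.
move=> h j; under eq_fun do rewrite mxE; apply: Nash_sum => i; apply: Nash_mul => //.
exact: Nash_cst.
Qed.
Lemma AnM_mulmx n k l (F : 'rV[C]_n -> 'rV[C]_k) (A : 'M[C]_(k, l)) a :
  AnM F a -> AnM (fun x => F x *m A) a.
Proof.
move=> h j; under eq_fun do rewrite mxE; apply: An_sum => i; apply: An_mul => //.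
exact: An_cst.
Qed.
Lemma DM_mulmx n k l (F : 'rV[C]_n -> 'rV[C]_k) (A : 'M[C]_(k, l)) a v :
  AnM F a -> DM (fun x => F x *m A) a v = DM F a v *m A.
Proof.
move=> h; apply/rowP => j; rewrite mxE; under eq_fun do rewrite mxE.
rewrite Dd_sum; last by move=> i; apply: An_mul => //; exact: An_cst.
rewrite [RHS]mxE; apply: eq_bigr => i _.
by rewrite (Dd_mul v (h i) (An_cst a (A i j))) Dd_cst mulr0 addr0 mxE.
Qed.
Lemma NashM_scale n k c (F : 'rV[C]_n -> 'rV[C]_k) a : NashM F a -> NashM (fun x => c *: F x) a.
Proof.
by move=> h j; under eq_fun do rewrite mxE; apply: Nash_mul => //; exact: Nash_cst.
Qed.
Lemma AnM_scale n k c (F : 'rV[C]_n -> 'rV[C]_k) a : AnM F a -> AnM (fun x => c *: F x) a.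
Proof.
by move=> h j; under eq_fun do rewrite mxE; apply: An_mul => //; exact: An_cst.
Qed.
Lemma DM_scale n k c (F : 'rV[C]_n -> 'rV[C]_k) a v : AnM F a ->
  DM (fun x => c *: F x) a v = c *: DM F a v.
Proof.
move=> h; apply/rowP => j; rewrite !mxE; under eq_fun do rewrite mxE.
by rewrite Dd_scale.
Qed.

Lemma near_real n (a : 'rV[R]_n) (P : 'rV[R]_n -> Prop) : (\forall y \near a, P y) ->
  \forall x \near cv a, forall y, x = cv y -> P y.
Proof.
move=> /near_rdiscP[r r0 h]; apply/nbhs_disc; exists r => // x hx y xy; apply: h => i.
by have := hx i; rewrite xy !cvE -cofrB cabs_cofr.
Qed.

Lemma to_real0 N : to_real (0 : 'rV[C]_N) = 0.
Proof. by rewrite /to_real; apply/rowP => i; rewrite !mxE; case: (fintype.split i) => j; rewrite !mxE. Qed.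

Lemma of_realK N (t : 'rV[C]_N) : of_real (to_real t) = t.
Proof.
apply/rowP => j; rewrite mxE /to_real row_mxEl row_mxEr !mxE.
by case: (t 0 j).
Qed.

Lemma near_to_real N (P : 'rV[R]_(N + N) -> Prop) : (\forall y \near (0 : 'rV[R]_(N + N)), P y) ->
  \forall t \near (0 : 'rV[C]_N), P (to_real t).
Proof.
move=> /near_rdiscP[r r0 h]; apply/nbhs_disc; exists r => // t ht; apply: h => i.
rewrite [X in _ - X]mxE subr0 /to_real -(splitK i); case: (fintype.split i) => j /=.
  rewrite row_mxEl mxE; apply: le_lt_trans (re_cabs _) _.
  by have := ht j; rewrite mxE subr0.
rewrite row_mxEr mxE; apply: le_lt_trans (im_cabs _) _.
by have := ht j; rewrite mxE subr0.
Qed.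

Definition i2 : C := 2 * 'i.
Lemma i2_neq0 : i2 != 0.
Proof. by rewrite /i2 mulf_neq0 // ?pnatr_eq0 // neq0Ci. Qed.

(** The real and imaginary parts of [t], written with [t] and its conjugate, with the conjugate
    replaced by an independent variable. *)
Definition Lin N (u : 'rV[C]_(N + N)) : 'rV[C]_(N + N) :=
  row_mx (2^-1 *: (lsubmx u + rsubmx u)) (i2^-1 *: (lsubmx u - rsubmx u)).

Lemma Lin_real N (t : 'rV[C]_N) : Lin (row_mx t (cj t)) = cv (to_real t).
Proof.
have h2 : (2 : C) != 0 by rewrite pnatr_eq0.
have hi : ('i : C) != 0 by exact: neq0Ci.
rewrite /Lin row_mxKl row_mxKr /to_real; apply/rowP => j; rewrite cvE -(splitK j).
case: (fintype.split j) => l /=.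
  rewrite !row_mxEl !mxE {1}[t 0 l]cE conjE.
  by field.
rewrite !row_mxEr !mxE {1}[t 0 l]cE conjE /i2.
by field; rewrite ?h2 ?hi.
Qed.

Lemma NashM_Lin N (u : 'rV[C]_(N + N)) : NashM (@Lin N) u.
Proof.
by apply: NashM_row; apply: NashM_scale; apply: NashM_add; try apply: NashM_opp;
  (apply: NashM_lsub || apply: NashM_rsub); exact: NashM_id.
Qed.

Lemma Lin0 N : Lin (0 : 'rV[C]_(N + N)) = 0.
Proof.
have e1 : lsubmx (0 : 'rV[C]_(N + N)) = 0 :> 'rV[C]_N by exact: linear0.
have e2 : rsubmx (0 : 'rV[C]_(N + N)) = 0 :> 'rV[C]_N by exact: linear0.
by rewrite /Lin e1 e2 addr0 subr0 !scaler0 row_mx0.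
Qed.

Lemma DM_Lin N (u v : 'rV[C]_(N + N)) : DM (@Lin N) u v = Lin v.
Proof.
have a1 : AnM (fun u : 'rV[C]_(N + N) => lsubmx u) u by apply: AnM_lsub; exact: An_coord.
have a2 : AnM (fun u : 'rV[C]_(N + N) => rsubmx u) u by apply: AnM_rsub; exact: An_coord.
rewrite DM_row; congr row_mx.
  by rewrite (DM_scale _ _ (AnM_add a1 a2)) (DM_add _ a1 a2) DM_lsub DM_rsub DM_id.
rewrite (DM_scale _ _ (AnM_add a1 (AnM_opp a2))) (DM_add _ a1 (AnM_opp a2)) (DM_opp _ a2).
by rewrite DM_lsub DM_rsub DM_id.
Qed.

(* [Lin] is invertible: the variables [t', tau'] are recovered from its two blocks. *)
Lemma Lin_surj N (w : 'rV[C]_(N + N)) : Lin (row_mx (lsubmx w + 'i *: rsubmx w) (lsubmx w - 'i *: rsubmx w)) = w.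
Proof.
have h2 : (2 : C) != 0 by rewrite pnatr_eq0.
have hi : ('i : C) != 0 by exact: neq0Ci.
rewrite /Lin row_mxKl row_mxKr -[RHS]hsubmxK; congr row_mx; apply/rowP => j.
  by rewrite !mxE; field.
by rewrite !mxE /i2; field; rewrite ?h2 ?hi.
Qed.

End Linear.

(** * A tube in algebraic coordinates *)

Section TubeSetup.
Variable R : realType.
Local Notation C := (Cx R).
Variables m d : nat.
Local Notation N := (m + d)%N.
Variables (phi : 'I_d -> 'rV[R]_m -> R) (Fp : 'I_d -> 'rV[C]_m -> C).
Hypothesis hphi : forall k, ext (phi k) (Fp k) 0.
Hypothesis hphi0 : forall k, phi k 0 = 0.

Definition phC (x : 'rV[C]_m) : 'rV[C]_d := \row_k Fp k x.
(** With conjugates as independent variables, [v = phi y] reads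
    [(w - omega) / 2i = phi ((z - zeta) / 2i)]. *)
Definition phH (x : 'rV[C]_m) : 'rV[C]_d := i2 R *: phC ((i2 R)^-1 *: x).

Lemma AnM_phC : AnM phC 0.
Proof. by move=> k; under eq_fun do rewrite mxE; rewrite -(cv0 R m); exact: (hphi k).1. Qed.
Lemma phC0 : phC 0 = 0.
Proof.
apply/rowP => k; rewrite !mxE; have := nbhs_singleton (hphi k).2.
by rewrite cv0 hphi0 cofr0.
Qed.

Lemma AnM_scl c (x : 'rV[C]_m) : AnM (fun x => c *: x) x.
Proof. by apply: AnM_scale; exact: An_coord. Qed.

Lemma AnM_phH : AnM phH 0.
Proof.
apply: AnM_scale; apply: (AnM_comp (F := phC) (G := fun x => (i2 R)^-1 *: x)); last exact: AnM_scl.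
by rewrite scaler0; exact: AnM_phC.
Qed.
Lemma phH0 : phH 0 = 0.
Proof. by rewrite /phH scaler0 phC0 scaler0. Qed.

Lemma DM_phH : \forall x \near (0 : 'rV[C]_m), forall v, DM phH x v = DM phC ((i2 R)^-1 *: x) v.
Proof.
have h1 : \forall x \near (0 : 'rV[C]_m), AnM phC ((i2 R)^-1 *: x).
  apply: (An_near_map (@AnM_scl (i2 R)^-1 0) (P := fun x => AnM phC x)).
  by rewrite scaler0; apply: AnM_nbhs; exact: AnM_phC.
apply: filterS h1 => x hx v.
have hc : AnM (fun x => phC ((i2 R)^-1 *: x)) x.
  by apply: (AnM_comp (F := phC) (G := fun x => (i2 R)^-1 *: x)) => //; exact: AnM_scl.
rewrite DM_scale // (@DM_comp R _ _ _ phC (fun x => (i2 R)^-1 *: x)) //; last exact: AnM_scl.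
rewrite DM_scale; last exact: An_coord.
by rewrite DM_id DM_Z scalerA divff ?i2_neq0 // scale1r.
Qed.

Local Notation Q := ((m + m) + d)%N.
Let X1 (x : 'rV[C]_Q) : 'rV[C]_m := lsubmx (lsubmx x).
Let X2 (x : 'rV[C]_Q) : 'rV[C]_m := rsubmx (lsubmx x).
Let X3 (x : 'rV[C]_Q) : 'rV[C]_d := rsubmx x.

(* The complexified parametrization [(x, y, s) |-> (x + iy, s + i phi y, x - iy, s - i phi y)]. *)
Definition Wp (x : 'rV[C]_Q) : 'rV[C]_(N + N) :=
  row_mx (row_mx (X1 x + 'i *: X2 x) (X3 x + 'i *: phC (X2 x)))
         (row_mx (X1 x - 'i *: X2 x) (X3 x - 'i *: phC (X2 x))).

(** A right inverse of [Wp] on the complexified tube, defined for all [u]. *)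
Definition Ep (u : 'rV[C]_(N + N)) : 'rV[C]_Q :=
  row_mx (row_mx (2^-1 *: (lsubmx (lsubmx u) + lsubmx (rsubmx u)))
                 ((i2 R)^-1 *: (lsubmx (lsubmx u) - lsubmx (rsubmx u))))
         (rsubmx (rsubmx u) + 'i *: phC ((i2 R)^-1 *: (lsubmx (lsubmx u) - lsubmx (rsubmx u)))).

Lemma Wp_Ep u : inM phH u -> Wp (Ep u) = u.
Proof.
have h2 : (2 : C) != 0 by rewrite pnatr_eq0.
have hi : ('i : C) != 0 by exact: neq0Ci.
rewrite /inM /phH => hu; rewrite /Wp /X1 /X2 /X3 /Ep !row_mxKl !row_mxKr.
set z := lsubmx (lsubmx u) in hu *; set zt := lsubmx (rsubmx u) in hu *.
set p := phC _ in hu *.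
rewrite -[RHS]hsubmxK -[lsubmx u in RHS]hsubmxK -[rsubmx u in RHS]hsubmxK -/z -/zt.
congr (row_mx (row_mx _ _) (row_mx _ _)).
- by apply/rowP => i; rewrite !mxE /i2; field; rewrite ?h2 ?hi.
- move/eqP: hu; rewrite subr_eq => /eqP ->; apply/rowP => i; rewrite !mxE /i2; ring.
- by apply/rowP => i; rewrite !mxE /i2; field; rewrite ?h2 ?hi.
- by rewrite addrK.
Qed.

Lemma AnM_X1 x : AnM X1 x.
Proof. by apply: AnM_lsub; apply: AnM_lsub; exact: An_coord. Qed.
Lemma AnM_X2 x : AnM X2 x.
Proof. by apply: AnM_rsub; apply: AnM_lsub; exact: An_coord. Qed.
Lemma AnM_X3 x : AnM X3 x.
Proof. by apply: AnM_rsub; exact: An_coord. Qed.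

Lemma X20 : X2 0 = 0.
Proof. by apply/rowP => i; rewrite !mxE. Qed.

Lemma AnM_Wp : AnM Wp 0.
Proof.
have h : AnM (fun x => 'i *: phC (X2 x)) 0.
  apply: AnM_scale; apply: (AnM_comp (F := phC)); last exact: AnM_X2.
  by rewrite X20; exact: AnM_phC.
have a1 := @AnM_X1 0; have a2 := AnM_scale 'i (@AnM_X2 0); have a3 := @AnM_X3 0.
apply: AnM_row; apply: AnM_row; apply: AnM_add => //; exact: AnM_opp.
Qed.

Lemma Wp0 : Wp 0 = 0.
Proof.
have e1 : X1 0 = 0 by apply/rowP => i; rewrite !mxE.
have e3 : X3 0 = 0 by apply/rowP => i; rewrite !mxE.
by rewrite /Wp e1 X20 e3 phC0 !scaler0 !oppr0 !addr0 !row_mx0.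
Qed.

Let dz (u : 'rV[C]_(N + N)) : 'rV[C]_m := (i2 R)^-1 *: (lsubmx (lsubmx u) - lsubmx (rsubmx u)).

Lemma AnM_dz u : AnM dz u.
Proof.
apply: AnM_scale; apply: AnM_add; last apply: AnM_opp.
  by apply: AnM_lsub; apply: AnM_lsub; exact: An_coord.
by apply: AnM_lsub; apply: AnM_rsub; exact: An_coord.
Qed.

Lemma dz0 : dz 0 = 0.
Proof. by apply/rowP => i; rewrite !mxE subrr mulr0. Qed.

Lemma AnM_Ep : AnM Ep 0.
Proof.
have h : AnM (fun u => 'i *: phC (dz u)) 0.
  apply: AnM_scale; apply: (AnM_comp (F := phC)); last exact: AnM_dz.
  by rewrite dz0; exact: AnM_phC.
apply: AnM_row.
  apply: AnM_row; last exact: AnM_dz.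
  apply: AnM_scale; apply: AnM_add.
    by apply: AnM_lsub; apply: AnM_lsub; exact: An_coord.
  by apply: AnM_lsub; apply: AnM_rsub; exact: An_coord.
by apply: AnM_add => //; apply: AnM_rsub; apply: AnM_rsub; exact: An_coord.
Qed.

Lemma Ep0 : Ep 0 = 0.
Proof.
have e1 : 2^-1 *: (lsubmx (lsubmx (0 : 'rV[C]_(N + N))) + lsubmx (rsubmx (0 : 'rV[C]_(N + N)))) = 0.
  by apply/rowP => i; rewrite !mxE addr0 mulr0.
have e2 : rsubmx (rsubmx (0 : 'rV[C]_(N + N))) = 0 :> 'rV[C]_d by apply/rowP => i; rewrite !mxE.
by rewrite /Ep -/(dz 0) dz0 phC0 e1 e2 scaler0 addr0 !row_mx0.
Qed.

Definition tpt (v : 'rV[R]_Q) : 'rV[C]_N :=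
  row_mx (cv (lsubmx (lsubmx v)) + 'i *: cv (rsubmx (lsubmx v)))
         (cv (rsubmx v) + 'i *: cv (\row_k phi k (rsubmx (lsubmx v)))).

Lemma Wp_real (v : 'rV[R]_Q) : (forall k, Fp k (cv (rsubmx (lsubmx v))) = cofr (phi k (rsubmx (lsubmx v)))) ->
  Wp (cv v) = row_mx (tpt v) (cj (tpt v)).
Proof.
move=> hv; have e1 : X1 (cv v) = cv (lsubmx (lsubmx v)) by apply/rowP => i; rewrite !mxE.
have e2 : X2 (cv v) = cv (rsubmx (lsubmx v)) by apply/rowP => i; rewrite !mxE.
have e3 : X3 (cv v) = cv (rsubmx v) by apply/rowP => i; rewrite !mxE.
have e4 : phC (X2 (cv v)) = cv (\row_k phi k (rsubmx (lsubmx v))).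
  by apply/rowP => k; rewrite e2 cvE !mxE hv.
have cjr n (x y : 'rV[R]_n) : cj (cv x + 'i *: cv y) = cv x - 'i *: cv y.
  by apply/rowP => i; rewrite cjE !mxE conD conM conjCi !conj_cofr mulNr.
rewrite /Wp e4 e1 e2 e3; congr row_mx; rewrite /tpt.
apply/rowP => i; rewrite cjE -(splitK i); case: (fintype.split i) => j /=.
  by rewrite !row_mxEl -cjr cjE.
by rewrite !row_mxEr -cjr cjE.
Qed.

Lemma im_pt (x y : R) : im (cofr x + 'i * cofr y : C) = y.
Proof.
rewrite imD im_cofr add0r; apply: (@cofr_inj R).
have := cE ('i * cofr y : C); rewrite re_i cofr0 add0r => e.
by symmetry; exact: (mulfI (neq0Ci _) e).
Qed.

Lemma tpt_tube v k : tube phi k (tpt v) = 0.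
Proof.
rewrite /tube /tpt row_mxEr row_mxKl !mxE im_pt.
have -> : map_mx (@im R) (cv (lsubmx (lsubmx v)) + 'i *: cv (rsubmx (lsubmx v))) = rsubmx (lsubmx v).
  by apply/rowP => i; rewrite !mxE im_pt.
by rewrite subrr.
Qed.

Section Algebraized.
Variables (Phi Psi : 'rV[C]_N -> 'rV[C]_N) (r' : 'I_d -> 'rV[C]_N -> R) (Rp : 'I_d -> 'rV[C]_(N + N) -> C).
Hypotheses (PhiA : AnM Phi 0) (PsiA : AnM Psi 0) (Phi0 : Phi 0 = 0).
Hypotheses (PhiK : \forall t \near (0 : 'rV[C]_N), Psi (Phi t) = t)
           (PsiK : \forall t \near (0 : 'rV[C]_N), Phi (Psi t) = t).
Hypothesis Rext : forall k, ext (r' k \o @of_real R N) (Rp k) 0.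
Hypothesis RN : forall k, Nash (Rp k) 0.
Hypothesis Rind : forall c : 'I_d -> R,
  (forall v, \sum_k c k * rdiff (r' k) 0 v = 0) -> forall k, c k = 0.
Hypothesis Rzero : \forall t \near (0 : 'rV[C]_N), zeros (tube phi) t <-> zeros r' (Phi t).

Let A : 'M[C]_N := Dmx Phi 0.
Let Ac : 'M[C]_N := map_mx (fun z : C => z^*) A.

Lemma A_unit : A \in unitmx.
Proof.
have e (v : 'rV[C]_N) : v *m A *m Dmx Psi 0 = v.
  have := DM_near v PhiK; rewrite DM_id (@DM_comp R _ _ _ Psi Phi) // ?Phi0 //.
  by rewrite !DM_mx.
have e' : A *m Dmx Psi 0 = 1%:M.
  by apply/row_matrixP => i; rewrite !rowE mulmxA e mulmx1.
by case: (mulmx1_unit e').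
Qed.

Lemma cj_mulmx (v : 'rV[C]_N) : cj (v *m A) = cj v *m Ac.
Proof.
apply/rowP => j; rewrite cjE !mxE con_sum; apply: eq_bigr => i _.
by rewrite conM cjE [Ac _ _]mxE.
Qed.

Lemma Ac_unit : Ac \in unitmx.
Proof.
have e : Ac *m map_mx (fun z : C => z^*) (invmx A) = 1%:M.
  apply/matrixP => i j; rewrite mxE; have /matrixP/(_ i j) := mulmxV A_unit.
  rewrite !mxE => h; transitivity ((\sum_k A i k * invmx A k j)^*).
    by rewrite con_sum; apply: eq_bigr => k _; rewrite conM !mxE.
  by rewrite h; case: (_ == _); rewrite /= ?con0 // rmorph1.
by case: (mulmx1_unit e).
Qed.

(** Made tangent to the identity, as [biholo] requires; [L] undoes this with [A] on [t'] and its
    conjugate on [tau']. *)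
Let Ph t := Phi t *m invmx A.
Let Ps t := Psi (t *m A).

Lemma Psi0 : Psi 0 = 0.
Proof. by have := nbhs_singleton PhiK; rewrite Phi0. Qed.

Lemma biholo_norm : biholo Ph Ps.
Proof.
have mA (B : 'M[C]_N) : AnM (fun t : 'rV[C]_N => t *m B) 0.
  by apply: NashM_An; apply: NashM_mulmx; exact: NashM_id.
split.
- exact: AnM_mulmx.
- by apply: (AnM_comp (F := Psi)); rewrite ?mul0mx.
- by rewrite /Ph Phi0 mul0mx.
- by rewrite /Ps mul0mx Psi0.
- by move=> v; rewrite DM_mulmx // DM_mx mulmxK // A_unit.
- by apply: filterS PhiK => t ht; rewrite /Ps /Ph mulmxKV // A_unit.
- have h0 : \forall y \near (0 : 'rV[C]_N) *m A, Phi (Psi y) = y by rewrite mul0mx.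
  have h := An_near_map (G := fun t : 'rV[C]_N => t *m A) (mA A) (P := fun y => Phi (Psi y) = y) h0.
  near=> t; have e : Phi (Psi (t *m A)) = t *m A by near: t.
  by rewrite /Ps /Ph e mulmxK // A_unit.
Unshelve. all: by end_near. Qed.

Let Pt t := cj (Ph (cj t)).
Let Pst t := cj (Ps (cj t)).

Let L (u : 'rV[C]_(N + N)) : 'rV[C]_(N + N) := Lin (row_mx (lsubmx u *m A) (rsubmx u *m Ac)).
Definition rhoA (u : 'rV[C]_(N + N)) : 'rV[C]_d := \row_k Rp k (L u).

Let L1 (u : 'rV[C]_(N + N)) : 'rV[C]_(N + N) := row_mx (lsubmx u *m A) (rsubmx u *m Ac).

Lemma NashM_L1 u : NashM L1 u.
Proof.
by apply: NashM_row; apply: NashM_mulmx; [apply: NashM_lsub|apply: NashM_rsub]; exact: NashM_id.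
Qed.
Lemma NashM_L u : NashM L u.
Proof. by apply: (NashM_comp (F := @Lin R N) (G := L1)); [exact: NashM_Lin|exact: NashM_L1]. Qed.

Lemma L0 : L 0 = 0.
Proof.
have e1 : lsubmx (0 : 'rV[C]_(N + N)) = 0 :> 'rV[C]_N by exact: linear0.
have e2 : rsubmx (0 : 'rV[C]_(N + N)) = 0 :> 'rV[C]_N by exact: linear0.
by rewrite /L e1 e2 !mul0mx row_mx0 Lin0.
Qed.

Lemma DM_L u v : DM L u v = L v.
Proof.
have a1 : AnM (fun u : 'rV[C]_(N + N) => lsubmx u) u by apply: AnM_lsub; exact: An_coord.
have a2 : AnM (fun u : 'rV[C]_(N + N) => rsubmx u) u by apply: AnM_rsub; exact: An_coord.
rewrite (@DM_comp R _ _ _ (@Lin R N) L1); first last.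
- exact: NashM_An (NashM_L1 u).
- exact: NashM_An (NashM_Lin _).
by rewrite DM_Lin DM_row (DM_mulmx _ _ a1) (DM_mulmx _ _ a2) DM_lsub DM_rsub DM_id.
Qed.

Lemma L_surj w : exists v, L v = w.
Proof.
exists (row_mx ((lsubmx w + 'i *: rsubmx w) *m invmx A) ((lsubmx w - 'i *: rsubmx w) *m invmx Ac)).
by rewrite /L row_mxKl row_mxKr mulmxKV ?A_unit // mulmxKV ?Ac_unit // Lin_surj.
Qed.

Lemma NashM_rhoA : NashM rhoA 0.
Proof.
move=> k; under eq_fun do rewrite mxE.
by apply: (@Nash_comp R _ _ (Rp k) L); [rewrite L0|exact: NashM_L].
Qed.

Lemma rdiff_ext k v : rdiff (r' k) 0 v = rD (Rp k) 0 (to_real v).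
Proof.
rewrite -(ext_derive1 (to_real v) (Rext k)) /rdiff; congr derive1.
apply/funext => s /=; congr (r' k); rewrite !add0r.
have tl j : to_real v 0 (lshift N j) = re (v 0 j) by rewrite /to_real row_mxEl mxE.
have tr j : to_real v 0 (rshift N j) = im (v 0 j) by rewrite /to_real row_mxEr mxE.
apply/rowP => j; rewrite [LHS]mxE [RHS]mxE [X in cplx X _]mxE [X in cplx _ X]mxE tl tr.
case: (v 0 j) => x y; rewrite /cplx /re /im /cofr /real_complex_def /=.
by apply/eqP; rewrite eq_complex /= !mul0r subr0 addr0 !eqxx.
Qed.

(** [L] is onto, so a complex relation holds on all real vectors, where it splits into two real
    relations that [Rind] excludes. *)
Lemma rhoA_ind (c : 'cV[C]_d) : (forall v, DM rhoA 0 v *m c = 0) -> c = 0.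
Proof.
move=> hc.
have h1 (w : 'rV[R]_(N + N)) : \sum_k c k 0 * cofr (rD (Rp k) 0 w) = 0.
  have [v Lv] := L_surj (cv w); have /matrixP/(_ 0 0) := hc v; rewrite mxE [RHS]mxE => h.
  rewrite -[RHS]h; apply: eq_bigr => k _; rewrite mulrC; congr (_ * _); rewrite mxE.
  under eq_fun do rewrite mxE.
  rewrite (Dd_compM (f := Rp k) (G := L)).
  - by rewrite L0 DM_L Lv -(ext_Dd_real w (Rext k)) cv0.
  - by rewrite L0; exact: (RN k).1.
  - exact: NashM_An (NashM_L 0).
have cr (h : C -> R) : (forall x y, h (x + y) = h x + h y) -> h 0 = 0 ->
    (forall z r, h (z * cofr r) = h z * r) -> forall k, h (c k 0) = 0.
  move=> hD h0 hM; apply: Rind => v.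
  have := congr1 h (h1 (to_real v)); rewrite (big_morph h hD h0) h0 => e.
  by rewrite -[RHS]e; apply: eq_bigr => k _; rewrite hM rdiff_ext.
apply/matrixP => k j; rewrite ord1 [RHS]mxE [LHS]cE.
by rewrite (cr _ (@reD R) erefl (@reM R)) (cr _ (@imD R) erefl (@imM R)) cofr0 mulr0 addr0.
Qed.

(** At the points [Wp (cv v)], which come from the real tube, this is [Rzero]. By [ext_zero] it
    extends to [Wp x] for complex [x], and [Ep] brings it to every [u] of the complexified tube. *)
Lemma rhoA_zero : \forall u \near (0 : 'rV[C]_(N + N)), inM phH u ->
  rhoA (row_mx (Ph (lsubmx u)) (Pt (rsubmx u))) = 0.
Proof.
pose pl u : 'rV[C]_d := rhoA (row_mx (Ph (lsubmx u)) (Pt (rsubmx u))).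
have PtA : AnM Pt 0 by exact: (bih_An (biholo_conj biholo_norm)).
have PhA : AnM Ph 0 by exact: (bih_An biholo_norm).
have pmA : AnM (fun u => row_mx (Ph (lsubmx u)) (Pt (rsubmx u))) 0.
  by apply: bih2_An; rewrite linear0.
have pm00 : row_mx (Ph (lsubmx (0 : 'rV[C]_(N + N)))) (Pt (rsubmx (0 : 'rV[C]_(N + N)))) = 0.
  have Pt0 : Pt 0 = 0 by exact: (bih0 (biholo_conj biholo_norm)).
  by rewrite !linear0 (bih0 biholo_norm) Pt0 row_mx0.
have plA : AnM pl 0.
  by apply: (AnM_comp (F := rhoA)) => //; rewrite pm00; exact: NashM_An NashM_rhoA.
have plW : AnM (fun x => pl (Wp x)) 0.
  by apply: (AnM_comp (F := pl)); [rewrite Wp0|exact: AnM_Wp].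
have lWA : AnM (fun x => lsubmx (Wp x)) 0 by apply: AnM_lsub; exact: AnM_Wp.
have lW0 : lsubmx (Wp 0) = 0 by rewrite Wp0 linear0.
have n1 : \forall v \near (0 : 'rV[R]_Q), zeros (tube phi) (lsubmx (Wp (cv v))) <-> zeros r' (Phi (lsubmx (Wp (cv v)))).
  apply: (near_cv (P := fun x => zeros (tube phi) (lsubmx (Wp x)) <-> zeros r' (Phi (lsubmx (Wp x))))).
  rewrite cv0; apply: (An_near_map lWA (P := fun t => zeros (tube phi) t <-> zeros r' (Phi t))).
  by rewrite lW0.
have n2 : \forall v \near (0 : 'rV[R]_Q), forall k, forall y, X2 (cv v) = cv y -> Fp k (cv y) = cofr (phi k y).
  have h k : \forall v \near (0 : 'rV[R]_Q), forall y, X2 (cv v) = cv y -> Fp k (cv y) = cofr (phi k y).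
    apply: (near_cv (P := fun x => forall y, X2 x = cv y -> Fp k (cv y) = cofr (phi k y))); rewrite cv0.
    apply: (An_near_map (@AnM_X2 0) (P := fun x => forall y, x = cv y -> Fp k (cv y) = cofr (phi k y))).
    by rewrite X20 -(cv0 R m); apply: near_real; exact: (hphi k).2.
  exact: filter_forall h.
have n3 : \forall v \near (0 : 'rV[R]_Q), forall k,
    Rp k (cv (to_real (Phi (lsubmx (Wp (cv v)))))) = cofr (r' k (of_real (to_real (Phi (lsubmx (Wp (cv v))))))).
  have h k : \forall v \near (0 : 'rV[R]_Q),
    Rp k (cv (to_real (Phi (lsubmx (Wp (cv v)))))) = cofr (r' k (of_real (to_real (Phi (lsubmx (Wp (cv v))))))).
    apply: (near_cv (P := fun x => Rp k (cv (to_real (Phi (lsubmx (Wp x))))) = cofr (r' k (of_real (to_real (Phi (lsubmx (Wp x)))))))).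
    rewrite cv0; apply: (An_near_map (G := fun x => Phi (lsubmx (Wp x))) (P := fun t => Rp k (cv (to_real t)) = cofr (r' k (of_real (to_real t))))).
      by apply: (AnM_comp (F := Phi)) => //; rewrite lW0.
    rewrite lW0 Phi0; apply: (near_to_real (P := fun y => Rp k (cv y) = cofr (r' k (of_real y)))).
    exact: (Rext k).2.
  exact: filter_forall h.
have z1 : \forall v \near (0 : 'rV[R]_Q), forall k, pl (Wp (cv v)) 0 k = 0.
  near=> v; move=> k.
  have e1 : zeros (tube phi) (lsubmx (Wp (cv v))) <-> zeros r' (Phi (lsubmx (Wp (cv v)))) by near: v.
  have e2 : forall k, forall y, X2 (cv v) = cv y -> Fp k (cv y) = cofr (phi k y) by near: v.
  have e3 : forall k,
    Rp k (cv (to_real (Phi (lsubmx (Wp (cv v)))))) = cofr (r' k (of_real (to_real (Phi (lsubmx (Wp (cv v))))))) by near: v.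
  have eW : Wp (cv v) = row_mx (tpt v) (cj (tpt v)).
    by apply: Wp_real => l; apply: e2; apply/rowP => i; rewrite !mxE.
  rewrite eW row_mxKl in e1 e3; rewrite /pl eW row_mxKl row_mxKr /rhoA mxE /L row_mxKl row_mxKr.
  have -> : Ph (tpt v) *m A = Phi (tpt v) by rewrite /Ph mulmxKV // A_unit.
  have -> : Pt (cj (tpt v)) *m Ac = cj (Phi (tpt v)).
    by rewrite /Pt cjK -cj_mulmx /Ph mulmxKV // A_unit.
  rewrite Lin_real e3 of_realK; have /e1 h : zeros (tube phi) (tpt v) by move=> l; exact: tpt_tube.
  by rewrite h cofr0.
have z2 : \forall x \near (0 : 'rV[C]_Q), forall k, pl (Wp x) 0 k = 0.
  have h k : \forall x \near (0 : 'rV[C]_Q), pl (Wp x) 0 k = 0.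
    have := @ext_zero R Q (fun x => pl (Wp x) 0 k) 0; rewrite cv0 => /(_ (plW k)); apply.
    by apply: filterS z1 => v; apply.
  exact: filter_forall h.
have z3 : \forall u \near (0 : 'rV[C]_(N + N)), forall k, pl (Wp (Ep u)) 0 k = 0.
  by apply: (An_near_map AnM_Ep (P := fun x => forall k, pl (Wp x) 0 k = 0)); rewrite Ep0.
apply: filterS z3 => u hu uM; apply/rowP => k; have := hu k; rewrite (Wp_Ep uM) => h.
by rewrite -[LHS]/(pl u 0 k) h mxE.
Unshelve. all: by end_near. Qed.

Lemma setup_tube : setup phH Ph Ps Pt Pst rhoA.
Proof.
split.
- exact: AnM_phH.
- exact: phH0.
- exact: biholo_norm.
- exact: biholo_conj biholo_norm.
- exact: NashM_rhoA.
- exact: rhoA_zero.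
- exact: rhoA_ind.
Qed.

End Algebraized.
End TubeSetup.

(** * Minimality *)

Section Minimality.
Variable R : realType.
Local Notation C := (Cx R).

Lemma zero_deriv_const (h : R -> R) (a b s1 s2 : R) :
  (forall s, a < s < b -> is_derive s (1 : R) h 0) -> a < s1 < b -> a < s2 < b -> h s1 = h s2.
Proof.
move=> hd; wlog s12 : s1 s2 / s1 <= s2.
  by move=> W; case: (leP s1 s2) => [|/ltW] s12 h1 h2; [exact: W|symmetry; exact: W].
move=> /andP[h1 h2] /andP[h3 h4].
have hin x : s1 <= x -> x <= s2 -> is_derive x (1 : R) h 0.
  by move=> x1 x2; apply: hd; rewrite (lt_le_trans h1 x1) (le_lt_trans x2 h4).
have [||c _] := @MVT_segment R h (fun=> 0) s1 s2 s12.
- by move=> x; rewrite in_itv /= => /andP[x1 x2]; apply: hin; exact: ltW.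
- apply: derivable_within_continuous => x; rewrite in_itv /= => /andP[x1 x2].
  by have := hin x x1 x2; case.
- by rewrite mul0r => /eqP; rewrite subr_eq0 => /eqP.
Qed.

Lemma quotient_affine (h a b p q : R) : h != 0 ->
  h^-1 * ((a + h * b - p) - (a - q)) = b - h^-1 * (p - q).
Proof. by move=> h0; field. Qed.

Variables m d : nat.
Local Notation N := (m + d)%N.
Variable phi : 'I_d -> 'rV[R]_m -> R.
Local Notation r := (tube phi).

Definition yv (t : 'rV[C]_N) : 'rV[R]_m := map_mx (@im R) (lsubmx t).

Lemma yvE t i : yv t 0 i = im (t 0 (lshift d i)).
Proof. by rewrite !mxE. Qed.

(** The orbit may run far from 0 inside [U]. There the analyticity of [phi] is recovered from that
    of the defining function, by fixing all real variables but [y]. *)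
Lemma phi_ext_at k (t : 'rV[C]_N) : real_analytic_at (r k) t -> exists F, ext (phi k) F (yv t).
Proof.
move=> /analytic_ext[F hF].
pose E (y : 'rV[R]_m) : 'rV[R]_(N + N) :=
  row_mx (map_mx (@re R) t) (row_mx y (map_mx (@im R) (rsubmx t))).
pose EC (y : 'rV[C]_m) : 'rV[C]_(N + N) :=
  row_mx (cv (map_mx (@re R) t)) (row_mx y (cv (map_mx (@im R) (rsubmx t)))).
have cvr n k' (x : 'rV[R]_n) (y : 'rV[R]_k') : cv (row_mx x y) = row_mx (cv x) (cv y).
  apply/rowP => i; rewrite cvE -(splitK i); case: (fintype.split i) => j /=.
    by rewrite !row_mxEl cvE.
  by rewrite !row_mxEr cvE.
have EE y : EC (cv y) = cv (E y) by rewrite /EC /E !cvr.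
have E0 : E (yv t) = to_real t.
  rewrite /E /to_real; congr row_mx; rewrite -[RHS]hsubmxK; congr row_mx; apply/rowP => i; rewrite !mxE //.
have ECA : AnM EC (cv (yv t)).
  apply: NashM_An; apply: NashM_row; first exact: NashM_cst.
  by apply: NashM_row; [exact: NashM_id|exact: NashM_cst].
exists (fun y => cofr (im (t 0 (rshift m k))) - F (EC y)); split.
  apply: An_sub; first exact: An_cst.
  by apply: (An_comp (G := EC)) => //; rewrite EE E0; exact: hF.1.
have h : \forall x \near cv (to_real t), forall u, x = cv u -> F (cv u) = cofr ((r k \o @of_real R N) u).
  by apply: (near_real (P := fun u => F (cv u) = cofr ((r k \o @of_real R N) u))); exact: hF.2.
have h2 : \forall y \near yv t, forall u, EC (cv y) = cv u -> F (cv u) = cofr ((r k \o @of_real R N) u).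
  apply: (near_cv (P := fun y => forall u, EC y = cv u -> F (cv u) = cofr ((r k \o @of_real R N) u))).
  apply: (An_near_map ECA (P := fun y => forall u, y = cv u -> F (cv u) = cofr ((r k \o @of_real R N) u))).
  by rewrite EE E0.
apply: filterS h2 => y hy; rewrite EE (hy (E y)) // -cofrB; congr cofr.
rewrite /= /tube.
have oE j : im (of_real (E y) 0 j) = E y 0 (rshift N j) by rewrite mxE.
have -> : map_mx (@im R) (lsubmx (of_real (E y))) = y.
  by rewrite -/(yv _); apply/rowP => i; rewrite yvE oE /E row_mxEr row_mxEl.
by rewrite oE /E row_mxEr row_mxEr !mxE opprB addrC subrK.
Qed.

Lemma rdiff_tube k F t v : ext (phi k) F (yv t) ->
  rdiff (r k) t v = im (v 0 (rshift m k)) - rD F (yv t) (yv v).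
Proof.
move=> hF; apply: cvg_lim => //.
have hl := ext_lim (v := yv v) hF.
have h1 : (fun h : R => im (v 0 (rshift m k)) - h^-1 * (phi k (yv t + h *: yv v) - phi k (yv t))) @ 0^'
    --> im (v 0 (rshift m k)) - rD F (yv t) (yv v).
  by apply: cvgB => //; exact: cvg_cst.
apply: cvg_trans h1; apply: near_eq_cvg; near=> h.
have h0 : h != 0 by near: h; exact: nbhs_dnbhs_neq.
have imZ (x : R) (z : C) : im (cofr x * z) = x * im z.
  by rewrite mulrC imM mulrC.
have e1 x : yv (t + cofr x *: v) = yv t + x *: yv v.
  by apply/rowP => i; rewrite yvE 2!mxE imD imZ [RHS]mxE yvE [X in _ = _ + X]mxE yvE.
have e2 x : r k (t + cofr x *: v) = im (t 0 (rshift m k)) + x * im (v 0 (rshift m k)) - phi k (yv t + x *: yv v).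
  by rewrite /tube -e1; congr (_ - _); rewrite 2!mxE imD imZ.
have y0 : yv t + 0 *: yv v = yv t by rewrite scale0r; exact: addr0.
have e20 : r k (t + cofr 0 *: v) = im (t 0 (rshift m k)) - phi k (yv t).
  by rewrite (e2 0) y0 (mul0r (im (v 0 (rshift m k)))) (addr0 (im (t 0 (rshift m k)))).
have e3 : h^-1 * (r k (t + cofr (h + 0) *: v) - r k (t + cofr 0 *: v)) =
    im (v 0 (rshift m k)) - h^-1 * (phi k (yv t + h *: yv v) - phi k (yv t)).
  have eh : r k (t + cofr (h + 0) *: v) = im (t 0 (rshift m k)) + h * im (v 0 (rshift m k)) - phi k (yv t + h *: yv v).
    by rewrite (addr0 h); exact: e2.
  exact: (etrans (congr2 (fun A B => h^-1 * (A - B)) eh e20) (quotient_affine _ _ _ _ h0)).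
exact: esym e3.
Unshelve. all: by end_near. Qed.

Lemma dtbar_tube k t j : dtbar j (fun t => cofr (r k t)) t =
  (cofr (rdiff (r k) t (delta_mx 0 j)) + 'i * cofr (rdiff (r k) t ('i *: delta_mx 0 j))) / 2.
Proof.
have e v : rdiffC (fun t => cofr (r k t)) t v = cofr (rdiff (r k) t v).
  rewrite /rdiffC; have -> : rdiff (fun t => im (cofr (r k t))) t v = 0.
    by rewrite /rdiff; have := derive1_cst (0 : R) (0 : R).
  by [].
by rewrite /dtbar !e.
Qed.

Lemma yv_delta_l i : yv (delta_mx 0 (lshift d i)) = 0.
Proof. by apply/rowP => j; rewrite yvE !mxE; case: (_ && _). Qed.
Lemma yv_delta_r k : yv (delta_mx 0 (rshift m k)) = 0.
Proof. by apply/rowP => j; rewrite yvE !mxE eq_lrshift andbF. Qed.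
Lemma im_i : im ('i : C) = 1.
Proof. by have := im_pt 0 (1 : R); rewrite cofr0 add0r cofr1 mulr1. Qed.
Lemma yv_idelta_l i : yv ('i *: delta_mx 0 (lshift d i)) = delta_mx 0 i.
Proof.
apply/rowP => j; rewrite yvE !mxE (inj_eq (@lshift_inj m d)) /=.
by case: (j == i); rewrite ?mulr1 ?mulr0 // im_i.
Qed.
Lemma yv_idelta_r k : yv ('i *: delta_mx 0 (rshift m k)) = 0.
Proof. by apply/rowP => j; rewrite yvE !mxE eq_lrshift andbF mulr0. Qed.

Lemma rD0 n (F : 'rV[C]_n -> C) a : rD F a 0 = 0.
Proof. by rewrite /rD cv0 Dd0. Qed.

(** The derivatives of the equations in the conjugates of [w] form ['i / 2] times the identity, so
    the equations are solved for the [w] components. *)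
Lemma CR_coef (F : 'I_d -> 'rV[C]_m -> C) t (b : 'rV[C]_N) : (forall k, ext (phi k) (F k) (yv t)) ->
  (forall k, \sum_j b 0 j * dtbar j (fun t => cofr (r k t)) t = 0) ->
  forall k, b 0 (rshift m k) = \sum_i b 0 (lshift d i) * cofr (rD (F k) (yv t) (delta_mx 0 i)).
Proof.
move=> hF hb k; have := hb k; rewrite big_split_ord /=.
have hi : ('i : C) != 0 by exact: neq0Ci.
have h2 : (2 : C) != 0 by rewrite pnatr_eq0.
have e1 i : dtbar (lshift d i) (fun t => cofr (r k t)) t = - ('i / 2) * cofr (rD (F k) (yv t) (delta_mx 0 i)).
  rewrite dtbar_tube !(rdiff_tube _ (hF k)) yv_delta_l yv_idelta_l rD0 !mxE eq_rlshift andbF mulr0.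
  by rewrite im_cofr subrr cofr0 add0r sub0r cofrN; field.
have e2 l : dtbar (rshift m l) (fun t => cofr (r k t)) t = 'i / 2 * (k == l)%:R.
  rewrite dtbar_tube !(rdiff_tube _ (hF k)) yv_delta_r yv_idelta_r rD0 !mxE (inj_eq (@rshift_inj m d)) !subr0 /=.
  by case: (k == l); rewrite ?mulr1 ?mulr0 ?im_i ?im_cofr ?cofr1 ?cofr0 ?add0r ?mulr0 ?mulr1 ?mul0r.
under eq_bigr => i _ do rewrite e1; under [X in _ + X]eq_bigr => l _ do rewrite e2.
rewrite [X in _ + X](bigD1 k) //= eqxx mulr1 [X in _ + (_ + X)]big1 ?addr0; last first.
  by move=> l lk; rewrite eq_sym (negPf lk) !mulr0.
move=> h; apply: (mulfI (_ : 'i / 2 != 0 :> C)); first by rewrite mulf_neq0 // invr_eq0.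
rewrite mulrC; have : b 0 (rshift m k) * ('i / 2) = - \sum_(i < m) b 0 (lshift d i) * (- ('i / 2) * cofr (rD (F k) (yv t) (delta_mx 0 i))).
  by apply/eqP; rewrite -addr_eq0 addrC h.
move=> ->; rewrite -sumrN mulr_sumr; apply: eq_bigr => i _; ring.
Qed.

Section Invariant.
Variables (p : 'I_m -> R) (c : 'I_d -> R).

(** On the tube, [gfun] is the imaginary part of the holomorphic function [p z + c w]. Where it
    vanishes identically, the real part [rform] is constant along the CR directions. *)
Definition gfun (y : 'rV[R]_m) : R := \sum_i p i * y 0 i + \sum_k c k * phi k y.
Definition rform (t : 'rV[C]_N) : R :=
  \sum_i p i * re (t 0 (lshift d i)) + \sum_k c k * re (t 0 (rshift m k)).
Definition flat (y : 'rV[R]_m) := \forall y' \near y, gfun y' = 0.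

Definition GC (F : 'I_d -> 'rV[C]_m -> C) (x : 'rV[C]_m) : C :=
  \sum_i cofr (p i) * x 0 i + \sum_k cofr (c k) * F k x.

Lemma ext_g (F : 'I_d -> 'rV[C]_m -> C) y : (forall k, ext (phi k) (F k) y) -> ext gfun (GC F) y.
Proof.
move=> hF; split.
  apply: An_add; apply: An_sum => i; apply: An_mul; try exact: An_cst; first exact: An_coord.
  exact: (hF i).1.
have h k : \forall y' \near y, F k (cv y') = cofr (phi k y') by exact: (hF k).2.
have h' : \forall y' \near y, forall k, F k (cv y') = cofr (phi k y') by exact: filter_forall h.
apply: filterS h' => y' hy; rewrite /GC /gfun cofrD.
rewrite [in RHS]/cofr (rmorph_sum (real_complex R)) (rmorph_sum (real_complex R)) -/(cofr _); congr (_ + _).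
  by apply: eq_bigr => i _; rewrite cvE -cofrM.
by apply: eq_bigr => k _; rewrite hy -cofrM.
Qed.

Lemma rD_g (F : 'I_d -> 'rV[C]_m -> C) (y v : 'rV[R]_m) : (forall k, ext (phi k) (F k) y) ->
  rD (GC F) y v = \sum_i p i * v 0 i + \sum_k c k * rD (F k) y v.
Proof.
move=> hF; apply: (@cofr_inj R); rewrite -(ext_Dd_real v (ext_g hF)) /GC.
have A1 i : An (fun x : 'rV[C]_m => cofr (p i) * x 0 i) (cv y) by apply: An_scale; exact: An_coord.
have A2 k : An (fun x : 'rV[C]_m => cofr (c k) * F k x) (cv y) by apply: An_scale; exact: (hF k).1.
rewrite Dd_add; [|exact: An_sum|exact: An_sum].
rewrite !Dd_sum // cofrD [in RHS]/cofr (rmorph_sum (real_complex R)) (rmorph_sum (real_complex R)) -/(cofr _); congr (_ + _).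
  by apply: eq_bigr => i _; rewrite Dd_scale ?Dd_coord ?cvE -?cofrM //; exact: An_coord.
by apply: eq_bigr => k _; rewrite Dd_scale ?(ext_Dd_real v (hF k)) -?cofrM //; exact: (hF k).1.
Qed.

Lemma flat_rD (F : 'I_d -> 'rV[C]_m -> C) (y v : 'rV[R]_m) : (forall k, ext (phi k) (F k) y) -> flat y ->
  \sum_i p i * v 0 i + \sum_k c k * rD (F k) y v = 0.
Proof.
move=> hF fy; rewrite -rD_g // /rD (@Dd_near _ _ (GC F) (fun=> 0)) ?Dd_cst //.
apply: ext_zero; first exact: (ext_g hF).1.
have h := (ext_g hF).2; near=> y'.
have e1 : GC F (cv y') = cofr (gfun y') by near: y'.
have e2 : gfun y' = 0 by near: y'.
by rewrite e1 e2 cofr0.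
Unshelve. all: by end_near. Qed.

(** The identity theorem on one polydisc around [y], used in both directions: flatness is open and
    closed. *)
Lemma flat_local (F : 'I_d -> 'rV[C]_m -> C) y : (forall k, ext (phi k) (F k) y) ->
  exists2 e : R, 0 < e & forall y1 : 'rV[R]_m, (forall i, `|y1 0 i - y 0 i| < e) -> (flat y <-> flat y1).
Proof.
move=> hF; have [[e e0 GA] hG] := ext_g hF; have [r1 r0 hr] := near_rdiscP hG.
pose s := Num.min (e / 4) (r1 / 2).
have s0 : 0 < s by rewrite lt_min !divr_gt0.
have se : s <= e / 4 by rewrite ge_min lexx.
have sr : s <= r1 / 2 by rewrite ge_min lexx orbT.
have bd (x x1 : 'rV[R]_m) : (forall i, `|x 0 i - x1 0 i| < s) -> (forall i, `|x1 0 i - y 0 i| < s) -> forall i, `|x 0 i - y 0 i| < r1.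
  move=> h1 h2 i; have := ler_normD (x 0 i - x1 0 i) (x1 0 i - y 0 i); rewrite addrA subrK => h.
  by apply: le_lt_trans h _; have := h1 i; have := h2 i; lra.
exists s => // y1 hy1; split=> fy.
  have z : \forall x \near cv y, GC F x = 0.
    apply: ext_zero; first by exists e.
    near=> y'; have e1 : GC F (cv y') = cofr (gfun y') by near: y'.
    have e2 : gfun y' = 0 by near: y'.
    by rewrite e1 e2 cofr0.
  have z2 := AnE_identity e0 GA z.
  apply: filterS (near_rdisc y1 s0) => y' hy'.
  apply: (@cofr_inj R); rewrite cofr0 -hr; last exact: bd hy' hy1.
  apply: z2 => i; rewrite !cvE -cofrB cabs_cofr.
  have := ler_normD (y' 0 i - y1 0 i) (y1 0 i - y 0 i); rewrite addrA subrK => h.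
  by apply: le_lt_trans h _; have := hy' i; have := hy1 i; lra.
have sh : AnE (e / 2) (cv y1) (GC F).
  apply: AnE_shift GA => // i; rewrite !cvE -cofrB cabs_cofr.
  by have := hy1 i; lra.
have e2 : 0 < e / 2 by rewrite divr_gt0.
have z : \forall x \near cv y1, GC F x = 0.
  apply: ext_zero; first by exists (e / 2).
  have h3 := near_rdisc y1 s0; near=> y'.
  have h4 : forall i, `|y' 0 i - y1 0 i| < s by near: y'.
  have e3 : gfun y' = 0 by near: y'.
  by rewrite hr ?e3 ?cofr0 //; exact: bd h4 hy1.
have z2 := AnE_identity e2 sh z.
apply: filterS (near_rdisc y s0) => y' hy'.
apply: (@cofr_inj R); rewrite cofr0 -hr; last by move=> i; apply: lt_le_trans (hy' i) _; lra.
apply: z2 => i; rewrite !cvE -cofrB cabs_cofr.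
have := ler_normD (y' 0 i - y 0 i) (y 0 i - y1 0 i); rewrite addrA subrK [`|y 0 i - _|]distrC => h.
by apply: le_lt_trans h _; have := hy' i; have := hy1 i; lra.
Unshelve. all: by end_near. Qed.

Lemma rD_lin n (F : 'rV[C]_n -> C) (y v : 'rV[R]_n) : rD F y v = \sum_i v 0 i * rD F y (delta_mx 0 i).
Proof.
rewrite {1}/rD [cv v]row_sum_delta Dd_sumv re_sum; apply: eq_bigr => i _.
by rewrite DdZ cvE mulrC reM mulrC /rD cv_delta.
Qed.

Lemma is_derive_near (f g : R -> R) (s l : R) : (\forall x \near s, f x = g x) ->
  is_derive s (1 : R) f l -> is_derive s (1 : R) g l.
Proof.
move=> e [d1 d2]; apply: DeriveDef; first exact: near_eq_derivable e d1.
by rewrite -(near_eq_derive _ e).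
Qed.

Lemma is_derive_rform (gamma : R -> 'rV[C]_N) (s : R) (X : 'rV[C]_N) :
  (forall j, is_derive s (1 : R) (fun s => re (gamma s 0 j)) (re (X 0 j))) ->
  is_derive s (1 : R) (fun s => rform (gamma s)) (rform X).
Proof.
move=> h; rewrite (_ : (fun s => rform (gamma s)) =
  (\sum_(i < m) (p i \*: (fun s => re (gamma s 0 (lshift d i))))) +
  (\sum_(k < d) (c k \*: (fun s => re (gamma s 0 (rshift m k)))))); last first.
  by apply/funext => x; rewrite /rform !fctE !fct_sumE.
exact: is_deriveD.
Qed.

(** By [CR_coef] the real part of the [w] components is [d phi] of the real part of the [z]
    components, so [rform X] is a directional derivative of [gfun]. *)
Lemma rform_CR (F : 'I_d -> 'rV[C]_m -> C) (t b X : 'rV[C]_N) (u : C) :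
  (forall k, ext (phi k) (F k) (yv t)) -> flat (yv t) ->
  (forall k, \sum_j b 0 j * dtbar j (fun t => cofr (r k t)) t = 0) ->
  (forall j, X 0 j = u * (b 0 j)^*) -> rform X = 0.
Proof.
move=> hF fl hb hX; have hc := CR_coef hF hb.
have e k : re (X 0 (rshift m k)) = rD (F k) (yv t) (\row_i re (X 0 (lshift d i))).
  rewrite rD_lin hX hc con_sum mulr_sumr re_sum; apply: eq_bigr => i _.
  by rewrite conM conj_cofr mulrA reM -hX mxE.
have h := flat_rD (\row_i re (X 0 (lshift d i))) hF fl.
transitivity (\sum_i p i * (\row_i re (X 0 (lshift d i))) 0 i +
    \sum_k c k * rD (F k) (yv t) (\row_i re (X 0 (lshift d i)))); last exact: h.
rewrite /rform; congr (_ + _); apply: eq_bigr => i _; first by rewrite mxE.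
by rewrite e.
Qed.

Lemma orbit_flat (U : set 'rV[C]_N) (A : 'rV[C]_N -> 'M[C]_(m, N)) t : CR_frame r U A -> flat 0 ->
  Defs.orbit (U `&` zeros r) [set X | exists i, X = Re_Lbar A i \/ X = Im_Lbar A i] t ->
  flat (yv t) /\ rform t = 0.
Proof.
move=> [_ Ur _ UA] fl0; elim=> [|X gamma a b s1 s2 [i hX] hg h1 h2 _ [f1 z1]].
  split; last by rewrite /rform !big1 ?addr0 // => i _; rewrite mxE mulr0.
  by rewrite (_ : yv 0 = 0) //; apply/rowP => i; rewrite yvE !mxE.
(* Flatness is propagated together with [rform = 0]: the value 1 marks its failure. By [flat_local]
   and [rform_CR], [h] has derivative 0, so it stays at its initial value 0. *)
pose h s := if `[< flat (yv (gamma s)) >] then rform (gamma s) else 1.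
have h_T s : flat (yv (gamma s)) -> h s = rform (gamma s) by move=> fs; rewrite /h asboolT.
have h_F s : ~ flat (yv (gamma s)) -> h s = 1 by move=> fs; rewrite /h asboolF.
have hd s : a < s < b -> is_derive s (1 : R) h 0.
  move=> sab; have [[Us zs] gd] := hg s sab.
  have [F hF] : exists F : 'I_d -> 'rV[C]_m -> C, forall k, ext (phi k) (F k) (yv (gamma s)).
    have q k : exists F, ext (phi k) F (yv (gamma s)) by apply: phi_ext_at; exact: Ur.
    by have [F hF] := choice q; exists F.
  have [e e0 he] := flat_local hF.
  have cn : \forall x \near s, forall i, `|yv (gamma x) 0 i - yv (gamma s) 0 i| < e.
    have c1 i' : \forall x \near s, `|yv (gamma x) 0 i' - yv (gamma s) 0 i'| < e.
      have [_ [dj _]] := gd (lshift d i').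
      have /cvgrPdist_lt/(_ _ e0) := differentiable_continuous ((derivable1_diffP _ _).1 dj).
      by apply: filterS => x; rewrite !yvE distrC.
    exact: filter_forall c1.
  case: (pselect (flat (yv (gamma s)))) => fs; last first.
    apply: (@is_derive_near (fun=> 1)).
    apply: filterS cn => x hx; symmetry; apply: h_F => fx.
    exact: fs ((he _ hx).2 fx).
  have dX : rform (X (gamma s)) = 0.
    have hb := (UA _ Us zs).2 (row i (A (gamma s))).
    have hb' := hb.1 (row_sub _ _).
    case: hX => ->.
      by apply: (rform_CR (u := 2^-1) hF fs hb') => j; rewrite !mxE mulrC.
    by apply: (rform_CR (u := 'i / 2) hF fs hb') => j; rewrite !mxE mulrAC.
  rewrite -dX; apply: (@is_derive_near (fun s => rform (gamma s))).
    apply: filterS cn => x hx; symmetry; apply: h_T; exact: (he _ hx).1 fs.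
  by apply: is_derive_rform => j; have [] := gd j.
have e := zero_deriv_const hd h1 h2; rewrite (h_T _ f1) z1 in e.
case: (pselect (flat (yv (gamma s2)))) => f2; first by rewrite -(h_T _ f2) -e.
by move: e; rewrite (h_F _ f2) => /esym/eqP; rewrite oner_eq0.
Qed.

(** Small real multiples of the basis vectors lie in the tube, hence in the orbit, and [rform] reads
    [p] and [c] off them. *)
Lemma minimal_indep : minimal r -> (forall k, phi k 0 = 0) -> flat 0 ->
  (forall i, p i = 0) /\ (forall k, c k = 0).
Proof.
move=> [U [A [UA hO]]] phi0 fl0.
have [e e0 he] := (nbhs_disc _ _).1 hO.
pose x := e / 2; have x0 : 0 < x by rewrite divr_gt0.
have key (j : 'I_N) : rform (cofr x *: delta_mx 0 j) = 0.
  have y0 : yv (cofr x *: delta_mx 0 j) = 0.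
    by apply/rowP => i; rewrite yvE !mxE; case: (_ && _); rewrite ?mulr1 ?mulr0 // im_cofr.
  apply: (orbit_flat UA fl0 _).2; apply: he => [i|k].
    rewrite !mxE subr0 cabsM cabs_cofr gtr0_norm // /x; case: (_ && _); rewrite /= ?cabs1 ?cabs0; lra.
  rewrite /tube -/(yv _) y0 phi0 subr0 !mxE.
  by case: (_ && _); rewrite ?mulr1 ?mulr0 // im_cofr.
have xx : x != 0 by rewrite gt_eqF.
have reZ (z : bool) : re (cofr x * z%:R) = x * z%:R :> R.
  by case: z; rewrite ?mulr1 ?mulr0.
split=> [i|k].
  have := key (lshift d i); rewrite /rform [X in _ + X]big1 ?addr0; last first.
    by move=> l _; rewrite !mxE eq_rlshift andbF mulr0 mulr0.
  rewrite (bigD1 i) //= big1 ?addr0; last first.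
    by move=> l li; rewrite !mxE (inj_eq (@lshift_inj m d)) (negPf li) andbF mulr0 mulr0.
  by rewrite !mxE !eqxx reZ mulr1 => /eqP; rewrite mulf_eq0 (negPf xx) orbF => /eqP.
have := key (rshift m k); rewrite /rform [X in X + _]big1 ?add0r; last first.
  by move=> l _; rewrite !mxE eq_lrshift andbF mulr0 mulr0.
rewrite (bigD1 k) //= big1 ?addr0; last first.
  by move=> l li; rewrite !mxE (inj_eq (@rshift_inj m d)) (negPf li) andbF mulr0 mulr0.
by rewrite !mxE !eqxx reZ mulr1 => /eqP; rewrite mulf_eq0 (negPf xx) orbF => /eqP.
Qed.

End Invariant.

Lemma gfun_re_im (p : 'I_m -> C) (c : 'I_d -> C) :
  (\forall y \near (0 : 'rV[R]_m), \sum_k c k * cofr (phi k y) + \sum_i p i * cofr (y 0 i) = 0) ->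
  minimal r -> (forall k, phi k 0 = 0) -> (forall i, p i = 0) /\ (forall k, c k = 0).
Proof.
move=> h hmin phi0.
have part (g : C -> R) : (forall x y, g (x + y) = g x + g y) -> g 0 = 0 ->
    (forall z x, g (z * cofr x) = g z * x) -> (forall i, g (p i) = 0) /\ (forall k, g (c k) = 0).
  move=> gD g0 gM; apply: minimal_indep => //; apply: filterS h => y hy.
  rewrite /gfun addrC -[RHS]g0 -hy gD !(big_morph g gD g0); congr (_ + _); apply: eq_bigr => i _;
    by rewrite gM.
have [p1 c1] := part _ (@reD R) erefl (@reM R); have [p2 c2] := part _ (@imD R) erefl (@imM R).
by split=> i; rewrite [LHS]cE ?p1 ?p2 ?c1 ?c2 cofr0 mulr0 addr0.
Qed.

End Minimality.

(** * The inverse of the partial derivatives *)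

Section Commute.
Variable R : realType.
Local Notation C := (Cx R).

(** Both sides are limits of the second derivatives of the same polynomials, which commute. *)
Lemma dC_comm n (f : 'rV[C]_n -> C) a i j : An f a -> dC i (dC j f) a = dC j (dC i f) a.
Proof.
move=> [e e0 [p [u [B h]]]].
have e2 : 0 < e / 2 by lra.
have e4 : 0 < e / 2 / 2 by lra.
have [uL _ _ hL] := AnW_dC i e2 (AnW_dC j e0 h).
have [uR _ _ hR] := AnW_dC j e2 (AnW_dC i e0 h).
have h0 : forall l, cabs (a 0 l - a 0 l) <= e / 2 / 2 by move=> l; rewrite subrr cabs0 ltW.
apply: (@cabs_null_eq _ _ _ _ (nullD uL uR)) => k.
have hl := hL a h0 k; have hr := hR a h0 k; rewrite (mpoly.mderiv_comm i j) in hr.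
move: hl hr; set q := peval _ _; move=> hl hr.
have := cabsD (dC i (dC j f) a - q) (q - dC j (dC i f) a); rewrite addrA subrK => h1.
by apply: le_trans h1 _; rewrite [cabs (q - _)]cabsBC lerD.
Qed.

Lemma dCs_dC n (I : seq 'I_n) l (f : 'rV[C]_n -> C) (a : 'rV[C]_n) : An f a ->
  \forall x \near a, dCs I (dC l f) x = dC l (dCs I f) x.
Proof.
move=> hf; elim: I => [|i I IH]; first by near=> x.
have h1 := dC_near_near i IH; have h2 := An_nbhs (An_dCs I hf).
near=> x; have e1 : dC i (dCs I (dC l f)) x = dC i (dC l (dCs I f)) x by near: x.
have e2 : An (dCs I f) x by near: x.
by rewrite [LHS]e1 [LHS](dC_comm _ _ e2).
Unshelve. all: by end_near. Qed.

Lemma dCs_Dd n (I : seq 'I_n) (f : 'rV[C]_n -> C) (a w : 'rV[C]_n) : An f a ->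
  \forall x \near a, dCs I (fun x => Dd f x w) x = Dd (dCs I f) x w.
Proof.
move=> hf; have h1 := dCs_lin I (F := fun j => dC j f) (fun j => w 0 j) (fun j => An_dC j hf).
have h2 l : \forall x \near a, dCs I (dC l f) x = dC l (dCs I f) x by exact: dCs_dC.
have h3 : \forall x \near a, forall l, dCs I (dC l f) x = dC l (dCs I f) x by exact: filter_forall h2.
apply: filterS2 h1 h3 => x e1 e2; rewrite /Dd [LHS]e1.
by apply: eq_bigr => j _; rewrite e2.
Qed.

Lemma dCs_cst n (I : seq 'I_n) (b : C) : (0 < size I)%N -> dCs I (fun=> b) = fun=> 0 :> C.
Proof.
case/lastP: I => // I i _; rewrite dCs_rcons.
have e0 c : dC i (fun=> c) = fun=> 0 :> C by apply/funext => x; exact: dC_cst.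
rewrite e0; elim: I => [//|j I IH]; rewrite /= IH; apply/funext => x; exact: dC_cst.
Qed.

(** The chain rule for [f o eta], solved for the gradient of [f] along [eta]. Only differentials are
    assumed to be Nash. *)
Lemma Nash_pull_dC m (f : 'rV[C]_m -> C) (eta : 'rV[C]_m -> 'rV[C]_m) :
  An f 0 -> AnM eta 0 -> eta 0 = 0 -> Dmx eta 0 \in unitmx ->
  (forall v, NashM (fun z => DM eta z v) 0) ->
  (forall v, Nash (fun z => Dd (fun z => f (eta z)) z v) 0) ->
  forall i, Nash (fun z => dC i f (eta z)) 0.
Proof.
move=> fA eA e0 eu eN hN i.
have DN j l : Nash (fun z => Dmx eta z j l) 0.
  by under eq_fun do rewrite mxE; have := eN (delta_mx 0 j) l; under eq_fun do rewrite mxE.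
have k1 := unitmx_near (fun j l => (DN j l).1) eu.
have k2 := AnM_nbhs eA.
have k3 : \forall z \near (0 : 'rV[C]_m), An f (eta z).
  by apply: (An_near_map eA (P := fun x => An f x)); rewrite e0; exact: An_nbhs.
apply: (@Nash_near R _ (fun z => \sum_j invmx (Dmx eta z) i j * Dd (fun z => f (eta z)) z (delta_mx 0 j))).
  near=> z.
  have e1 : Dmx eta z \in unitmx by near: z.
  have e2 : AnM eta z by near: z.
  have e3 : An f (eta z) by near: z.
  pose c : 'cV[C]_m := \col_l dC l f (eta z).
  have cE : Dmx eta z *m c = \col_j Dd (fun z => f (eta z)) z (delta_mx 0 j).
    apply/colP => j; rewrite !mxE (Dd_compM _ e3 e2) /Dd; apply: eq_bigr => l _.
    by rewrite !mxE mulrC.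
  have : c = invmx (Dmx eta z) *m \col_j Dd (fun z => f (eta z)) z (delta_mx 0 j).
    by rewrite -cE mulKmx.
  move/colP/(_ i); rewrite !mxE => ->.
  by apply: eq_bigr => j _; rewrite mxE.
apply: Nash_sum => j; apply: Nash_mul => //.
by apply: Nash_invmx.
Unshelve. all: by end_near. Qed.

Lemma Nash_pull_dCs m (f : 'rV[C]_m -> C) (eta : 'rV[C]_m -> 'rV[C]_m) :
  An f 0 -> AnM eta 0 -> eta 0 = 0 -> Dmx eta 0 \in unitmx ->
  (forall v, NashM (fun z => DM eta z v) 0) ->
  (forall v, Nash (fun z => Dd (fun z => f (eta z)) z v) 0) ->
  forall I, (0 < size I)%N -> Nash (fun z => dCs I f (eta z)) 0.
Proof.
move=> fA eA e0 eu eN hN; elim=> // i [|j I] IH _; first exact: Nash_pull_dC.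
apply: (Nash_pull_dC (f := dCs (j :: I) f)) => //; first exact: An_dCs.
by move=> v; apply: Nash_Dd; exact: IH.
Qed.

(** With [s] the Nash inverse of [P o eta], one has [s0 = eta o s]; since only the differential of
    [eta] is Nash, the same is obtained for [s0]. *)
Lemma Nash_inverse_dC m (P eta s0 : 'rV[C]_m -> 'rV[C]_m) (b : 'rV[C]_m) :
  AnM eta 0 -> eta 0 = 0 -> AnM P 0 -> P 0 = b ->
  (forall w, DM P 0 w = 0 -> w = 0) -> (forall w, DM eta 0 w = 0 -> w = 0) ->
  (forall v, NashM (fun z => DM eta z v) 0) -> NashM (fun z => P (eta z)) 0 ->
  AnM s0 b -> (\forall x \near (0 : 'rV[C]_m), s0 (P x) = x) ->
  forall l j, Nash (dC l (fun y => s0 y 0 j)) b.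
Proof.
move=> eA e0 PA P0 Pi ei eN HN sA sK l j.
have [||s [sN sb HK _]] := @NashM_inverse R m (fun z => P (eta z)) 0 b HN.
- by rewrite e0.
- move=> w; rewrite (@DM_comp R _ _ _ P eta) ?e0 // => h; apply: ei; exact: Pi.
have sN' : NashM s b := sN.
have sA' := NashM_An sN'.
have eA' : AnM eta (s b) by rewrite sb.
have h1 : \forall y \near b, s0 (P (eta (s y))) = eta (s y).
  apply: (An_near_map (AnM_comp eA' sA') (P := fun x => s0 (P x) = x)).
  by rewrite sb e0.
have h2 : \forall y \near b, s0 y = eta (s y) by apply: filterS2 h1 HK => y e1 e2; rewrite -[in LHS]e2 e1.
have h3 : \forall y \near b, \forall x \near y, s0 x = eta (s x) by exact: near_near.
have h4 := AnM_nbhs sA'.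
have h5 : \forall y \near b, AnM eta (s y).
  by apply: (An_near_map sA' (P := fun x => AnM eta x)); exact: AnM_nbhs.
apply: (@Nash_near R _ (fun y => \sum_i DM s y (delta_mx 0 l) 0 i * DM eta (s y) (delta_mx 0 i) 0 j)).
  near=> y.
  have k3 : \forall x \near y, s0 x = eta (s x) by near: y.
  have k4 : AnM s y by near: y.
  have k5 : AnM eta (s y) by near: y.
  have : DM s0 y (delta_mx 0 l) = DM eta (s y) (DM s y (delta_mx 0 l)).
    by rewrite (DM_near _ k3) (@DM_comp R _ _ _ eta s).
  move/rowP/(_ j); rewrite [LHS]mxE -dC_Dd => ->.
  rewrite [in RHS](row_sum_delta (DM s y (delta_mx 0 l))) DM_sumv summxE.
  by apply: eq_bigr => i _; rewrite DM_Z [RHS]mxE.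
apply: Nash_sum => i; apply: Nash_mul; first exact: NashM_DM.
apply: (@Nash_comp R _ _ (fun t => DM eta t (delta_mx 0 i) 0 j) s) => //.
by rewrite sb; exact: eN.
Unshelve. all: by end_near. Qed.

End Commute.

(** * Nondegeneracy and minimality of the tube *)

Section TubeConditions.
Variable R : realType.
Local Notation C := (Cx R).
Variables m d : nat.
Variables (phi : 'I_d -> 'rV[R]_m -> R) (Fp : 'I_d -> 'rV[C]_m -> C).
Hypothesis FE : forall k, ext (phi k) (Fp k) 0.

Lemma Fp_An k : An (Fp k) 0.
Proof. by have := (FE k).1; rewrite cv0. Qed.

(** Undoes the rescaling: [d phH] at [2i y] is [d phC] at [y]. *)
Lemma near_DM_phH (Q : 'rV[C]_m -> ('rV[C]_m -> 'rV[C]_d) -> Prop) :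
  (\forall x \near (0 : 'rV[C]_m), Q x (DM (phH Fp) x)) ->
  \forall y \near (0 : 'rV[C]_m), Q (i2 R *: y) (DM (phC Fp) y).
Proof.
move=> h; have h1 := DM_phH FE.
have h2 : \forall x \near (0 : 'rV[C]_m), Q x (DM (phC Fp) ((i2 R)^-1 *: x)).
  apply: filterS2 h h1 => x h e.
  by have <- : DM (phH Fp) x = DM (phC Fp) ((i2 R)^-1 *: x) by apply/funext.
have h3 : \forall y \near (0 : 'rV[C]_m), Q (i2 R *: y) (DM (phC Fp) ((i2 R)^-1 *: (i2 R *: y))).
  apply: (An_near_map (G := fun y : 'rV[C]_m => i2 R *: y)
    (P := fun x => Q x (DM (phC Fp) ((i2 R)^-1 *: x)))); first exact: AnM_scl.
  by rewrite scaler0.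
by apply: filterS h3 => y; rewrite scalerK ?i2_neq0.
Qed.

Variables (beta : 'I_m -> {ffun 'I_m -> nat}) (kappa : 'I_m -> 'I_d).
Hypothesis beta_pos : forall j, (0 < \sum_i beta j i)%N.

Definition psC (y : 'rV[C]_m) : 'rV[C]_m := \row_j dCs (mlist (beta j)) (Fp (kappa j)) y.

Lemma AnM_psC : AnM psC 0.
Proof. by move=> j; under eq_fun do rewrite mxE; apply: An_dCs; exact: Fp_An. Qed.

Lemma psC_ext j : ext (fun y => psi_map phi beta kappa y 0 j) (fun x => psC x 0 j) 0.
Proof.
have e1 : (fun y => psi_map phi beta kappa y 0 j) = pderiv_multi (beta j) (phi (kappa j)).
  by apply/funext => y; rewrite mxE.
have e2 : (fun x => psC x 0 j) = dCs (mlist (beta j)) (Fp (kappa j)).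
  by apply/funext => y; rewrite mxE.
by rewrite e1 e2; exact: ext_pderiv_multi.
Qed.

Lemma DM_psC_inj : \rank ('J (psi_map phi beta kappa) 0) = m ->
  forall w, DM psC 0 w = 0 -> w = 0.
Proof.
move=> rk w; rewrite DM_mx.
have -> : Dmx psC 0 = map_mx (real_complex R) ('J (psi_map phi beta kappa) 0).
  rewrite (ext_jacobian psC_ext); apply/matrixP => i j; rewrite !mxE.
  by have := ext_Dd_real (delta_mx 0 i) (psC_ext j); rewrite cv0 cv_delta.
have u : map_mx (real_complex R) ('J (psi_map phi beta kappa) 0) \in unitmx.
  by rewrite map_unitmx -row_free_unit /row_free rk.
by move=> h; rewrite -[w](mulmxK u) h mul0mx.
Qed.

(** The derivative of each [Fp k] along [lsubmx v] is constant, so its derivatives of the positive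
    orders [beta j] vanish at 0; these are the components of the differential of [psC] along
    [lsubmx v]. *)
Lemma tube_levi : (forall w, DM psC 0 w = 0 -> w = 0) -> levi_nondeg (phH Fp).
Proof.
move=> inj v hv.
have h1 : \forall y \near (0 : 'rV[C]_m), rsubmx v = DM (phC Fp) y (lsubmx v).
  exact: (near_DM_phH (Q := fun _ D => rsubmx v = D (lsubmx v))).
have h2 k : \forall y \near (0 : 'rV[C]_m), Dd (Fp k) y (lsubmx v) = rsubmx v 0 k.
  apply: filterS h1 => y /rowP/(_ k); rewrite [RHS]mxE => ->.
  by congr Dd; apply/funext => x; rewrite mxE.
have l0 : lsubmx v = 0.
  apply: inj; apply/rowP => j; rewrite !mxE.
  have -> : (fun x => psC x 0 j) = dCs (mlist (beta j)) (Fp (kappa j)).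
    by apply/funext => x; rewrite mxE.
  have h3 := dCs_near (mlist (beta j)) (h2 (kappa j)).
  have h4 := dCs_Dd (mlist (beta j)) (lsubmx v) (Fp_An (kappa j)).
  rewrite -(nbhs_singleton h4) (nbhs_singleton h3) dCs_cst //.
  by rewrite size_mlist.
rewrite -[v]hsubmxK l0 (nbhs_singleton h1) l0 DM_0.
exact: row_mx0.
Qed.

(** [G] has zero differential near 0 and [G 0 = 0], so it vanishes near 0; at real points this is
    the relation that [gfun_re_im] excludes. *)
Lemma tube_no_affine : minimal (tube phi) -> (forall k, phi k 0 = 0) -> no_affine (phH Fp).
Proof.
move=> mi phi0 p c h.
have h1 : \forall y \near (0 : 'rV[C]_m), forall v : 'rV[C]_m, v *m p + DM (phC Fp) y v *m c = 0.
  exact: (near_DM_phH (Q := fun _ D => forall v : 'rV[C]_m, v *m p + D v *m c = 0)).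
pose G (y : 'rV[C]_m) : 'rV[C]_1 := y *m p + phC Fp y *m c.
have idA (y : 'rV[C]_m) : AnM id y by apply: NashM_An; exact: NashM_id.
have PA := AnM_phC FE.
have GA : AnM G 0 by apply: AnM_add; apply: AnM_mulmx.
have h2 : \forall y \near (0 : 'rV[C]_m), forall v, DM G y v = 0.
  apply: filterS2 h1 (AnM_nbhs PA) => y e hA v.
  rewrite /G DM_add; [|exact: AnM_mulmx|exact: AnM_mulmx].
  by rewrite !DM_mulmx // DM_id.
have h3 i : \forall y \near (0 : 'rV[C]_m), dC i (fun y => G y 0 0) y = 0.
  apply: filterS h2 => y e; rewrite dC_Dd; have /rowP/(_ 0) := e (delta_mx 0 i).
  by rewrite !mxE.
have h4 : \forall y \near (0 : 'rV[C]_m), G y 0 0 = 0.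
  apply: An_taylor_zero; first exact: GA.
  case/lastP => [|I i].
    by rewrite /= /G mul0mx (phC0 FE) // mul0mx addr0 mxE.
  rewrite dCs_rcons; have := dCs_near I (h3 i) => /nbhs_singleton ->.
  case: I => [|j I] //; by rewrite dCs_cst.
have h5 : \forall y \near (0 : 'rV[R]_m),
    \sum_k c k 0 * cofr (phi k y) + \sum_i p i 0 * cofr (y 0 i) = 0.
  have h6 : \forall y \near (0 : 'rV[R]_m), G (cv y) 0 0 = 0.
    by apply: (near_cv (a := 0) (P := fun x => G x 0 0 = 0)); rewrite cv0.
  have h7 : \forall y \near (0 : 'rV[R]_m), forall k, Fp k (cv y) = cofr (phi k y).
    have h8 k := (FE k).2; exact: filter_forall h8.
  apply: filterS2 h6 h7 => y e f; rewrite -[RHS]e /G !mxE addrC; congr (_ + _).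
    by apply: eq_bigr => k _; rewrite mxE f mulrC.
  by apply: eq_bigr => i _; rewrite cvE mulrC.
have [p0 c0] := gfun_re_im (p := fun i => p i 0) (c := fun k => c k 0) h5 mi phi0.
by split; apply/colP => i; rewrite mxE.
Qed.

End TubeConditions.

(** * The complex inverse at real points *)

Section RealInverse.
Variable R : realType.
Local Notation C := (Cx R).
Variable m : nat.
Variables (f g : 'rV[R]_m -> 'rV[R]_m) (F S : 'rV[C]_m -> 'rV[C]_m).
Hypothesis FE : forall j, ext (fun y => f y 0 j) (fun x => F x 0 j) 0.
Hypothesis gf : local_inverse f g 0.
Hypotheses (SA : AnM S (cv (f 0))) (S0 : S (cv (f 0)) = 0).
Hypothesis FS : \forall y \near cv (f 0), F (S y) = y.
Hypothesis SF : \forall x \near (0 : 'rV[C]_m), S (F x) = x.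

Lemma cv_inj n : injective (@cv R n).
Proof. by move=> v w /rowP h; apply/rowP => i; have := h i; rewrite !cvE => /(@cofr_inj R). Qed.

Lemma cj_cv n (v : 'rV[R]_n) : cj (cv v) = cv v.
Proof. by apply/rowP => i; rewrite cjE cvE conj_cofr. Qed.

Lemma cj_fix n (x : 'rV[C]_n) : cj x = x -> x = cv (map_mx (@re R) x).
Proof.
move=> /rowP h; apply/rowP => i; rewrite cvE mxE [LHS]cE.
have := im_conj (x 0 i); have := h i; rewrite cjE => -> h1.
have -> : im (x 0 i) = 0 by lra.
by rewrite cofr0 mulr0 addr0.
Qed.

Lemma ext_conj : \forall x \near (0 : 'rV[C]_m), F (cj x) = cj (F x).
Proof.
have h j : \forall x \near (0 : 'rV[C]_m), F x 0 j = (F (cj x) 0 j)^*.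
  have h1 : ext (fun y => f y 0 j) (fun x => (F (cj x) 0 j)^*) 0.
    split; first by have := An_conj (FE j).1; rewrite cj_cv.
    by apply: filterS (FE j).2 => y; rewrite cj_cv => ->; rewrite conj_cofr.
  by have := ext_unique (FE j) h1; rewrite cv0.
have h2 : \forall x \near (0 : 'rV[C]_m), forall j, F x 0 j = (F (cj x) 0 j)^* by exact: filter_forall h.
apply: filterS h2 => x h2; apply/rowP => j; rewrite cjE h2; exact: (esym (conjCK _)).
Qed.

(** [F] is real at real points and so commutes with conjugation; hence [S] does too at real points,
    its values there are real, and [g (f w) = w] identifies them with those of [g]. *)
Lemma ext_inverse j : ext (fun y => g y 0 j) (fun x => S x 0 j) (f 0).
Proof.
split; first exact: SA.
have pull (P : 'rV[C]_m -> Prop) : (\forall x \near (0 : 'rV[C]_m), P x) ->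
    \forall y \near f 0, P (S (cv y)).
  move=> h; apply: (near_cv (P := fun y => P (S y))).
  by apply: (An_near_map SA); rewrite S0.
have Fcv : \forall y \near (0 : 'rV[R]_m), F (cv y) = cv (f y).
  have h1 : \forall y \near (0 : 'rV[R]_m), forall j, F (cv y) 0 j = cofr (f y 0 j).
    have h2 j' := (FE j').2; exact: filter_forall h2.
  by apply: filterS h1 => y e; apply/rowP => i; rewrite cvE.
have toC (P : 'rV[R]_m -> Prop) : (\forall y \near (0 : 'rV[R]_m), P y) ->
    \forall x \near (0 : 'rV[C]_m), forall y, x = cv y -> P y.
  by move=> /near_real; rewrite cv0.
have k1 := pull _ ext_conj.
have k2 : \forall y \near f 0, S (F (cj (S (cv y)))) = cj (S (cv y)).
  apply: (pull (fun x => S (F (cj x)) = cj x)).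
  by have := near_cj SF; rewrite cj0.
have k3 := near_cv FS.
have k4 := pull _ (toC _ Fcv).
have k5 := pull _ (toC _ gf.1).
near=> y.
have e1 : F (cj (S (cv y))) = cj (F (S (cv y))) by near: y.
have e2 : S (F (cj (S (cv y)))) = cj (S (cv y)) by near: y.
have e3 : F (S (cv y)) = cv y by near: y.
have e4 : forall w, S (cv y) = cv w -> F (cv w) = cv (f w) by near: y.
have e5 : forall w, S (cv y) = cv w -> g (f w) = w by near: y.
have e6 : S (cv y) = cv (map_mx (@re R) (S (cv y))).
  by apply: cj_fix; rewrite -[LHS]e2 e1 e3 cj_cv.
have e7 := e4 _ e6; rewrite -e6 e3 in e7; have {}e7 := cv_inj e7.
by rewrite [in LHS]e6 -[in LHS](e5 _ e6) -e7 cvE.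
Unshelve. all: by end_near. Qed.

End RealInverse.

(** * The map [eta] of a tube *)

Section Reduction.
Variable R : realType.
Local Notation C := (Cx R).
Variables m d : nat.
Local Notation N := (m + d)%N.
Variables (phi : 'I_d -> 'rV[R]_m -> R) (Fp : 'I_d -> 'rV[C]_m -> C).
Hypothesis FE : forall k, ext (phi k) (Fp k) 0.
Variables (E : 'rV[C]_m -> 'rV[C]_N).
Hypotheses (EA : AnM E 0) (E0 : E 0 = 0).
Hypothesis Egraph : \forall z \near (0 : 'rV[C]_m), rsubmx (E z) = phH Fp (lsubmx (E z)).
Hypothesis ED : forall v, lsubmx (DM E 0 v) = v.
Hypothesis EN : forall v, NashM (fun z => DM E z v) 0.

(** The factor [1 / 2i] undoes the rescaling in [phH], so that [phC] can be evaluated along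
    [eta]. *)
Definition eta (z : 'rV[C]_m) : 'rV[C]_m := (i2 R)^-1 *: lsubmx (E z).

Lemma AnM_eta : AnM eta 0.
Proof. by apply: AnM_scale; exact: AnM_lsub. Qed.

Lemma eta0 : eta 0 = 0.
Proof.
have l0 : lsubmx (0 : 'rV[C]_N) = 0 :> 'rV[C]_m by exact: linear0.
by rewrite /eta E0 l0 scaler0.
Qed.

Lemma DM_eta0 v : DM eta 0 v = (i2 R)^-1 *: v.
Proof. by rewrite DM_scale ?DM_lsub ?ED //; exact: AnM_lsub. Qed.

Lemma DM_eta_inj v : DM eta 0 v = 0 -> v = 0.
Proof. by rewrite DM_eta0 => /eqP; rewrite scaler_eq0 invr_eq0 (negPf (i2_neq0 R)) => /eqP. Qed.

Lemma Dmx_eta_unit : Dmx eta 0 \in unitmx.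
Proof.
have -> : Dmx eta 0 = (i2 R)^-1%:M.
  by apply/row_matrixP => i; rewrite !rowE -DM_mx DM_eta0 mul_mx_scalar.
by rewrite unitmxE det_scalar unitfE expf_neq0 // invr_eq0 i2_neq0.
Qed.

Lemma NashM_DM_eta v : NashM (fun z => DM eta z v) 0.
Proof.
have h := AnM_nbhs (AnM_lsub EA).
apply: (@NashM_near R _ _ (fun z => (i2 R)^-1 *: lsubmx (DM E z v))).
  by apply: filterS h => z h; rewrite DM_scale // DM_lsub.
by apply: NashM_scale; exact: NashM_lsub.
Qed.

(** [E] runs in the graph of [phH], so [phC] along [eta] is the second block of [E] divided by
    [2i]. *)
Lemma Nash_Dd_phi_eta k v : Nash (fun z => Dd (fun z => Fp k (eta z)) z v) 0.
Proof.
have h : \forall z \near (0 : 'rV[C]_m), (i2 R)^-1 *: rsubmx (E z) = phC Fp (eta z).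
  apply: filterS Egraph => z ->; rewrite /phH scalerK //; exact: i2_neq0.
have h1 := near_near h; have h2 := AnM_nbhs (AnM_rsub EA).
apply: (@Nash_near R _ (fun z => ((i2 R)^-1 *: rsubmx (DM E z v)) 0 k)); last first.
  by have := NashM_scale (i2 R)^-1 (NashM_rsub (EN v)) => /(_ k).
near=> z.
have e1 : \forall z \near z, (i2 R)^-1 *: rsubmx (E z) = phC Fp (eta z) by near: z.
have e2 : AnM (fun z => rsubmx (E z)) z by near: z.
have := DM_near v e1; rewrite DM_scale // DM_rsub => ->; rewrite mxE.
by congr Dd; apply/funext => x; rewrite mxE.
Unshelve. all: by end_near. Qed.

Variables (beta : 'I_m -> {ffun 'I_m -> nat}) (kappa : 'I_m -> 'I_d).
Hypothesis beta_pos : forall j, (0 < \sum_i beta j i)%N.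

Lemma NashM_psC_eta : NashM (fun z => psC Fp beta kappa (eta z)) 0.
Proof.
move=> j; under eq_fun do rewrite mxE.
apply: Nash_pull_dCs; rewrite ?size_mlist //.
- exact: (Fp_An FE).
- exact: AnM_eta.
- exact: eta0.
- exact: Dmx_eta_unit.
- exact: NashM_DM_eta.
- exact: Nash_Dd_phi_eta.
Qed.

End Reduction.

Theorem mainTheorem2 (R : realType) (n d : nat) (hd : (1 <= d)%N) (hdn : (d < n)%N)
    (phi : 'I_d -> 'rV[R]_(n - d) -> R)
    (phi_analytic : forall k, analytic_at (phi k) 0)
    (phi0 : forall k, phi k 0 = 0)
    (hM : family_T (tube phi))
    (beta : 'I_(n - d) -> {ffun 'I_(n - d) -> nat})
    (kappa : 'I_(n - d) -> 'I_d)
    (beta_pos : forall j, (0 < \sum_i beta j i)%N)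
    (psi_rank : \rank ('J (psi_map phi beta kappa) 0) = (n - d)%N)
    (psi' : 'rV[R]_(n - d) -> 'rV[R]_(n - d))
    (psi'_inv : local_inverse (psi_map phi beta kappa) psi' 0)
    (halg : locally_algebraizable (tube phi)) :
  forall j l : 'I_(n - d),
    algebraic_at (pderiv l (fun y' => psi' y' 0 j)) (psi_map phi beta kappa 0).
Proof.
have [Fp FE] := choice (fun k => analytic_ext (phi_analytic k)).
have [_ _ mi _ _] := hM.
have inj := DM_psC_inj FE psi_rank.
have FN := tube_levi FE beta_pos inj.
have MI := tube_no_affine FE mi phi0.
have [Phi [r' [[PhiA Phi0 [Psi [PsiA PhiK PsiK]]] [_ _ Rind] rA Rzero]]] := halg.
have rA' k : exists F, ext (r' k \o @of_real R _) F 0 /\ Nash F 0.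
  by have [F] := algebraic_ext (rA k); rewrite to_real0 cv0; exists F.
have [Rp RE] := choice rA'.
have S := setup_tube FE phi0 (fun j => analytic_An (PhiA j)) (fun j => analytic_An (PsiA j))
  Phi0 PhiK PsiK (fun k => (RE k).1) (fun k => (RE k).2) Rind Rzero.
have [E [EA E0 Eg ED EN]] := eta_exists S FN MI.
pose P := psC Fp beta kappa.
have PA : AnM P 0 := AnM_psC FE beta kappa.
have P0 : P 0 = cv (psi_map phi beta kappa 0).
  apply/rowP => j; have := nbhs_singleton (psC_ext FE beta kappa j).2.
  by rewrite cv0 cvE => ->.
have [s [sA s0 PK sK]] := AnM_inverse PA P0 inj.
(* The complex inverse [s] of [psC] extends [psi'], so its derivatives extend those of [psi']. *)
move=> j l; apply: (@Nash_algebraic R _ _ (dC l (fun x => s x 0 j))).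
  apply: ext_pderiv; apply: (ext_inverse (F := P)) => //.
  exact: psC_ext.
apply: (Nash_inverse_dC (P := P) (eta := eta E)) => //.
- exact: AnM_eta.
- exact: eta0.
- exact: DM_eta_inj.
- exact: NashM_DM_eta.
- exact: (NashM_psC_eta FE).
Qed.
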